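(* For every $u\in H_\lambda$ there is a sequence $\{u_m\}\subset H_\lambda$ of continuous functions on $\mathbb{C}^n$ such that $u(z)=\lim_{m\to\infty}u_m(z)$ for each $z\in\mathbb{C}^n$, and for each $m$ and each $z\in\mathbb{C}^n$, $$u_m(z)=\sup\big\{|q_k(z)|^{1/\rho_k}:k\ge0,\ q_k\in\mathcal{H}_\lambda\text{ of bidegree }(\rho_k,0),\ |q_k|^{1/\rho_k}\le u_m\text{ on }\mathbb{C}^n\big\}.$$
   Context: Fix $\lambda=(\lambda_1,\dots,\lambda_n)$ with $\lambda_1=1$, $\lambda_k>0$. $\Phi^X(z,t)=(z_1e^{-\lambda_1t},\dots,z_ne^{-\lambda_nt})$; $\mathbb{H}=\{\operatorname{Re}t>0\}$. $\{\rho_m\}_{m\ge0}$ is the strictly increasing enumeration of $\{\lambda_1k_1+\dots+\lambda_nk_n:k\in\mathbb{Z}^n_{\ge0}\}$. A polynomial $q\in\mathbb{C}[z,\bar z]$ is quasi-homogeneous of type $\lambda$ with bidegree $(d_1,d_2)$ if $q(\Phi^X(z,t))=e^{-d_1t}e^{-d_2\bar t}q(z)$ for all $t\in\mathbb{H}$, $z\in\mathbb{C}^n$; $\mathcal{H}_\lambda$ is the set of such polynomials. $H_\lambda$ is the set of nonconstant plurisubharmonic functions $u\ge0$ on $\mathbb{C}^n$ with $u(\Phi^X(z,t))=e^{-\operatorname{Re}t}u(z)$ for all $z\in\mathbb{C}^n$, $t\in\mathbb{C}$. *)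

(* Defs.v *)
From HB Require Import structures.
From mathcomp Require Import all_boot all_order all_algebra.
From mathcomp Require Import all_classical all_reals all_analysis.
From mathcomp Require Import complex.

Set Implicit Arguments.
Unset Strict Implicit.
Unset Printing Implicit Defensive.
Import Order.TTheory GRing.Theory Num.Theory.
Local Open Scope ring_scope.
Local Open Scope classical_set_scope.

Definition cabs (R : realType) (x : R[i]) : R := Normc.normc x.

Definition cnorm (R : realType) (n : nat) (z : 'I_n -> R[i]) : R :=
  \sum_(i < n) cabs (z i).

(* e^{-d t} for d real, t complex:  e^{-d Re t} (cos (d Im t) - i sin (d Im t)) *)
Definition cexpm (R : realType) (d : R) (t : R[i]) : R[i] :=
  Complex (expR (- (d * complex.Re t)) * cos (d * complex.Im t))
          (- (expR (- (d * complex.Re t)) * sin (d * complex.Im t))).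

Definition cis (R : realType) (th : R) : R[i] := Complex (cos th) (sin th).

Definition PhiX (R : realType) (n : nat) (lam : 'I_n -> R)
    (z : 'I_n -> R[i]) (t : R[i]) : 'I_n -> R[i] :=
  fun k => z k * cexpm (lam k) t.

Definition usc (R : realType) (n : nat) (u : ('I_n -> R[i]) -> R) : Prop :=
  forall z (e : R), 0 < e -> exists d : R, 0 < d /\
    forall w, cnorm (fun k => w k - z k) < d -> u w < u z + e.

Definition cont (R : realType) (n : nat) (u : ('I_n -> R[i]) -> R) : Prop :=
  forall z (e : R), 0 < e -> exists d : R, 0 < d /\
    forall w, cnorm (fun k => w k - z k) < d -> `|u w - u z| < e.

(* plurisubharmonic (real-valued): upper semicontinuous, and subharmonic on
   every complex line, i.e. sub-mean-value inequality on every circle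
   theta |-> a + e^{i theta} b :
      2 pi u(a) <= \int_0^{2 pi} u(a + e^{i theta} b) d theta. *)
Definition psh (R : realType) (n : nat) (u : ('I_n -> R[i]) -> R) : Prop :=
  usc u /\
  forall a b : 'I_n -> R[i],
    ((((2 * pi) * u a)%R)%:E <=
     \int[lebesgue_measure]_(th in `[0%R, (2 * pi)%R])
        (u (fun k => a k + cis th * b k))%:E)%E.

Definition inH (R : realType) (n : nat) (lam : 'I_n -> R)
    (u : ('I_n -> R[i]) -> R) : Prop :=
  [/\ psh u,
      exists z w, u z <> u w,
      forall z, 0 <= u z &
      forall z (t : R[i]), u (PhiX lam z t) = expR (- complex.Re t) * u z].

Definition is_cpoly (R : realType) (n : nat) (q : ('I_n -> R[i]) -> R[i]) :=
  exists s : seq (R[i] * ('I_n -> nat) * ('I_n -> nat)),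
    forall z, q z = \sum_(x <- s)
       x.1.1 * \prod_(i < n) (z i ^+ x.1.2 i * conjc (z i) ^+ x.2 i).

Definition quasi_hom (R : realType) (n : nat) (lam : 'I_n -> R)
    (q : ('I_n -> R[i]) -> R[i]) (d1 d2 : R) : Prop :=
  is_cpoly q /\
  forall (t : R[i]) (z : 'I_n -> R[i]), 0 < complex.Re t ->
    q (PhiX lam z t) = cexpm d1 t * cexpm d2 (conjc t) * q z.

Definition rho_enum (R : realType) (n : nat) (lam : 'I_n -> R)
    (rho : nat -> R) : Prop :=
  (forall m1 m2, (m1 < m2)%N -> rho m1 < rho m2) /\
  (forall x : R, (exists m, rho m = x) <->
      exists k : 'I_n -> nat, x = \sum_(i < n) lam i * (k i)%:R).

(* Main.v *)
Require Import Defs.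
From HB Require Import structures.
From mathcomp Require Import all_boot all_order all_algebra.
From mathcomp Require Import all_classical all_reals all_analysis.
From mathcomp Require Import perm measurable_realfun complex ring lra.
Import Order.TTheory GRing.Theory Num.Theory numFieldNormedType.Exports.
Local Open Scope ring_scope.
Local Open Scope classical_set_scope.
Set Implicit Arguments.
Unset Strict Implicit.
Unset Printing Implicit Defensive.

(** The functions $u_m$ are polynomial envelopes of regularisations of $u$.  With
    the gauge $N(z) = \sum_i |z_i|^{1/\lambda_i}$ put
    $v_m(z) = \sup_x (u(x) - m N(x - z)) + N(z)/m$: it is continuous, homogeneous,
    positive off the origin, dominates $u$ and tends to $u$.  Let $u_m = E(v_m)$ be the
    supremum of all $|q_k|^{1/\rho_k} \le v_m$.  Both $E(v) \ge u$ and the continuity of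
    $E(v)$ follow from one estimate: if a function $w \ge 0$ with the sub-mean value
    property is at most $s$ near $\{v \le r\}$ and $w(z_0) > s$, then $E(v)(z_0) \ge r$.

    For this estimate one needs a polynomial separating $z_0$ from $\{v \le r\}$; the
    homogeneous components of its powers are bounded by $1$ on $\{v \le r\}$, hence are
    admissible after scaling, and a geometric series in the weights gives the bound.

    The separating polynomial is obtained without $\bar\partial$-estimates.  After
    scaling, a Lipschitz regularisation of $w$ is glued to a periodic perturbation of
    $2\pi \sum_i (\mathrm{Im}\, z_i)^2$ and smoothed by a trigonometric kernel, which
    gives a weight $\Phi$ with positive Hessian for which $|f|^2 e^{-N \Phi}$ is periodic
    when $f$ is a theta function of level $N$.  These form a space of dimension $N^n$.
    A Gaussian computation bounds $|f|^2 e^{-N\Phi}$ by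
    $(1 + o(1)) (N/\pi)^n \det H \, \|f\|^2$ pointwise, while the integral of the Bergman
    density is $N^n$ and that of $\det H$ is $\pi^n$; hence there is no loss anywhere, and
    near $z_0$ there are theta functions that nearly attain the bound.  Such a function
    is exponentially small where $\Phi$ is smaller than near $z_0$, and it is a limit of
    polynomials. *)

(** * Complex moduli and continuity *)

(** Polynomials that separate points are usually produced by weighted existence theorems. On a
    compact torus a count does the same work: a pointwise upper bound for the Bergman density whose
    total barely exceeds the number of sections has to be nearly attained on most of the torus. Both
    totals must then be known exactly, and this dictates the weight. With
    $2\pi\sum(\mathrm{Im}\,z_i)^2$ plus a periodic term, the sections are $N^n$ explicit theta
    functions, and the mean of $\det H$ is a Fourier coefficient on which the perturbation has no
    effect.

    Since $u$ is merely upper semicontinuous, sub-mean values are tested on continuous majorants and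
    finite averages over roots of unity, so that suprema and translates cause no measurability
    problem.

    The central estimate needs bounded sublevel sets with a uniform margin; the term $N/m$ gives
    boundedness and the sup-convolution gives the margin. It is applied to $w=u$, which yields
    $E(v)\ge u$, and to translates of $E(v)$ itself, which yields upper semicontinuity; lower
    semicontinuity is automatic for a supremum of continuous functions. Finally $E(E(v))=E(v)$ turns
    the envelope of $v_m$ into the required self-referential formula for $u_m$. *)

Section ComplexModulus.
Variable R : realType.
Implicit Types x y : R[i].

Lemma cabs_ge0 x : 0 <= cabs x.
Proof. by case: x => a b; exact: sqrtr_ge0. Qed.

Lemma cabs_def x : cabs x = Num.sqrt (complex.Re x ^+ 2 + complex.Im x ^+ 2).
Proof. by case: x. Qed.

Lemma cabsD x y : cabs (x + y) <= cabs x + cabs y.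
Proof. exact: complex.le_normcD. Qed.

Lemma cabsM x y : cabs (x * y) = cabs x * cabs y.
Proof. exact: Normc.normcM. Qed.

Lemma cabsN x : cabs (- x) = cabs x.
Proof. exact: complex.normcN. Qed.

Lemma cabs0 : cabs (0 : R[i]) = 0. Proof. exact: Normc.normc0. Qed.

Lemma cabs1 : cabs (1 : R[i]) = 1. Proof. exact: Normc.normc1. Qed.

Lemma cabsV x : cabs x^-1 = (cabs x)^-1.
Proof. exact: Normc.normcV. Qed.

Lemma cabs_eq0 x : (cabs x == 0) = (x == 0).
Proof.
by apply/eqP/eqP => [/Normc.eq0_normc //|->]; exact: cabs0.
Qed.

Lemma cabs_gt0 x : (0 < cabs x) = (x != 0).
Proof. by rewrite lt_neqAle eq_sym cabs_eq0 cabs_ge0 andbT. Qed.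

Lemma cabsX x k : cabs (x ^+ k) = cabs x ^+ k.
Proof. by elim: k => [|k IH]; rewrite ?expr0 ?cabs1// !exprS cabsM IH. Qed.

Lemma cabsB x y : cabs (x - y) = cabs (y - x).
Proof. by rewrite -cabsN opprB. Qed.

Lemma cabs_sum (I : Type) (s : seq I) (P : pred I) (F : I -> R[i]) :
  cabs (\sum_(i <- s | P i) F i) <= \sum_(i <- s | P i) cabs (F i).
Proof.
elim/big_rec2: _ => [|i a b _ le_ab]; first by rewrite cabs0.
by apply: le_trans (cabsD _ _) _; rewrite lerD2l.
Qed.

Lemma cabs_prod (I : Type) (s : seq I) (P : pred I) (F : I -> R[i]) :
  cabs (\prod_(i <- s | P i) F i) = \prod_(i <- s | P i) cabs (F i).
Proof.
by elim/big_rec2: _ => [|i a b _ <-]; rewrite ?cabs1// cabsM.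
Qed.

Lemma cabs_real (a : R) : cabs a%:C%C = `|a|.
Proof. by rewrite /cabs /= expr0n addr0 sqrtr_sqr. Qed.

Lemma cabs_nat k : cabs (k%:R : R[i]) = k%:R.
Proof.
by rewrite -[k%:R](rmorph_nat (real_complex R)) cabs_real ger0_norm.
Qed.

Lemma sqr_cabs x : cabs x ^+ 2 = complex.Re x ^+ 2 + complex.Im x ^+ 2.
Proof. by rewrite cabs_def sqr_sqrtr// addr_ge0// sqr_ge0. Qed.

Lemma Re_le_cabs x : `|complex.Re x| <= cabs x.
Proof.
by rewrite cabs_def -sqrtr_sqr ler_wsqrtr// lerDl sqr_ge0.
Qed.

Lemma Im_le_cabs x : `|complex.Im x| <= cabs x.
Proof.
by rewrite cabs_def -sqrtr_sqr ler_wsqrtr// lerDr sqr_ge0.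
Qed.

Lemma cabs_le_ReIm x : cabs x <= `|complex.Re x| + `|complex.Im x|.
Proof.
rewrite -(@ler_pXn2r _ 2) ?nnegrE ?cabs_ge0 ?addr_ge0//.
rewrite sqr_cabs sqrrD -(real_normK (num_real (complex.Re x))).
rewrite -(real_normK (num_real (complex.Im x))).
have := mulr_ge0 (normr_ge0 (complex.Re x)) (normr_ge0 (complex.Im x)); lra.
Qed.

Lemma cabsJ x : cabs (conjc x) = cabs x.
Proof. by case: x => a b; rewrite !cabs_def /= sqrrN. Qed.

Lemma cabs_cis (t : R) : cabs (cis t) = 1.
Proof. by rewrite cabs_def /= cos2Dsin2 sqrtr1. Qed.

Lemma cabs_cexpm (d : R) (t : R[i]) :
  cabs (cexpm d t) = expR (- (d * complex.Re t)).
Proof.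
rewrite cabs_def /= sqrrN !exprMn -mulrDr cos2Dsin2 mulr1 sqrtr_sqr.
by rewrite ger0_norm// expR_ge0.
Qed.

Lemma mulJc x : x * conjc x = (cabs x ^+ 2)%:C%C.
Proof.
rewrite sqr_cabs; case: x => a b /=; apply/eqP; rewrite eq_complex /=.
by apply/andP; split; apply/eqP; ring.
Qed.

Lemma cReD x y : complex.Re (x + y) = complex.Re x + complex.Re y.
Proof. by case: x y => [? ?] [? ?]. Qed.
Lemma cImD x y : complex.Im (x + y) = complex.Im x + complex.Im y.
Proof. by case: x y => [? ?] [? ?]. Qed.
Lemma cReN x : complex.Re (- x) = - complex.Re x.
Proof. by case: x. Qed.
Lemma cImN x : complex.Im (- x) = - complex.Im x.
Proof. by case: x. Qed.
Lemma cReM x y : complex.Re (x * y) =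
  complex.Re x * complex.Re y - complex.Im x * complex.Im y.
Proof. by case: x y => [? ?] [? ?]. Qed.
Lemma cImM x y : complex.Im (x * y) =
  complex.Re x * complex.Im y + complex.Im x * complex.Re y.
Proof. by case: x y => [? ?] [? ?]. Qed.

Lemma cRe_sum (I : Type) (s : seq I) (P : pred I) (F : I -> R[i]) :
  complex.Re (\sum_(i <- s | P i) F i) = \sum_(i <- s | P i) complex.Re (F i).
Proof. by elim/big_rec2: _ => // i a b _ <-; rewrite cReD. Qed.

Lemma cIm_sum (I : Type) (s : seq I) (P : pred I) (F : I -> R[i]) :
  complex.Im (\sum_(i <- s | P i) F i) = \sum_(i <- s | P i) complex.Im (F i).
Proof. by elim/big_rec2: _ => // i a b _ <-; rewrite cImD. Qed.

Lemma cplx_eqP x y :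
  complex.Re x = complex.Re y -> complex.Im x = complex.Im y -> x = y.
Proof. by case: x y => [? ?] [? ?] /= -> ->. Qed.

Lemma cisD (s t : R) : cis (s + t) = cis s * cis t.
Proof. by apply: cplx_eqP; rewrite ?(cReM, cImM) /= ?cosD ?sinD//; ring. Qed.

Lemma cis0 : cis (0 : R) = 1.
Proof. by rewrite /cis cos0 sin0. Qed.

Lemma cisX (t : R) k : cis t ^+ k = cis (t *+ k).
Proof.
by elim: k => [|k IH]; rewrite ?expr0 ?mulr0n ?cis0// exprS mulrS cisD IH.
Qed.

Lemma cis2pi : cis (2 * pi : R) = 1.
Proof. by rewrite /cis mulrC mulr_natr cos2pi sin2pi. Qed.

End ComplexModulus.

(** * The l1 norm on $\mathbb{C}^n$ and compactness of its balls *)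

Section VectorNorm.
Variables (R : realType) (n : nat).
Local Notation E := ('I_n -> R[i]).
Implicit Types z w : E.

Definition cscale (c : R[i]) z : E := fun k => c * z k.

Lemma cnorm_ge0 z : 0 <= cnorm z.
Proof. by apply: sumr_ge0 => i _; exact: cabs_ge0. Qed.

Lemma cnormD z w : cnorm (z + w) <= cnorm z + cnorm w.
Proof. by rewrite /cnorm -big_split ler_sum// => i _; exact: cabsD. Qed.

Lemma cnormN z : cnorm (- z) = cnorm z.
Proof. by apply: eq_bigr => i _; exact: cabsN. Qed.

Lemma cnormB z w : cnorm (z - w) = cnorm (w - z).
Proof. by rewrite -cnormN opprB. Qed.

Lemma cnorm0 : cnorm (0 : E) = 0.
Proof. by rewrite /cnorm big1// => i _; exact: cabs0. Qed.

Lemma cnormZ c z : cnorm (cscale c z) = cabs c * cnorm z.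
Proof. by rewrite /cnorm mulr_sumr; apply: eq_bigr => i _; exact: cabsM. Qed.

Lemma cabs_le_cnorm z i : cabs (z i) <= cnorm z.
Proof.
by rewrite /cnorm (bigD1 i)//= lerDl sumr_ge0// => j _; exact: cabs_ge0.
Qed.

Lemma cnorm_le_const z (c : R) :
  (forall i, cabs (z i) <= c) -> cnorm z <= n%:R * c.
Proof.
move=> le_zc; apply: (@le_trans _ _ (\sum_(i < n) c)).
  by apply: ler_sum => i _.
by rewrite big_const_ord iter_addr_0 mulr_natl.
Qed.

Lemma cnorm_dist z w v : cnorm (z - v) <= cnorm (z - w) + cnorm (w - v).
Proof.
have -> : z - v = (z - w) + (w - v) by rewrite subrKA.
exact: cnormD.
Qed.

Lemma cscaleDr c z w : cscale c (z + w) = cscale c z + cscale c w.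
Proof. by apply/funext => i; exact: mulrDr. Qed.

Lemma cscaleA c d z : cscale c (cscale d z) = cscale (c * d) z.
Proof. by apply/funext => i; exact: mulrA. Qed.

Lemma cscale1 z : cscale 1 z = z.
Proof. by apply/funext => i; exact: mul1r. Qed.

(** Compactness of closed balls, with a radius [D] that may vary with the centre; boundedness and
    uniform continuity are read off from it. It is transported from boxes in real row vectors of
    length [n + n]. *)
Lemma box_cover (rho : R) (D : E -> R) : (forall z, 0 < D z) ->
  exists (k : nat) (s : nat -> E), forall w, cnorm w <= rho ->
    exists2 i, (i < k)%N & cnorm (w - s i) < D (s i).
Proof.
move=> D_gt0; pose T := 'rV[R]_(n + n).
pose toE (v : T) : E := fun k => Complex (v 0 (lshift n k)) (v 0 (rshift n k)).
pose B := [set v : T | forall i, `[- rho, rho]%classic (v ord0 i)].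
have : compact B by apply: (@rV_compact R _ (fun=> `[- rho, rho])) => i; exact: segment_compact.
rewrite compact_cover => cB.
have dpos : 0 < (2 * n%:R + 1 : R) by rewrite ltr_wpDl// mulr_ge0.
(* The norm is at most [2 * n] times the largest real coordinate difference; the extra 1 makes the
   final inequality strict, also for [n = 0]. *)
pose F (v : T) := ball v (D (toE v) / (2 * n%:R + 1)).
have F_gt0 v : 0 < D (toE v) / (2 * n%:R + 1) by exact: divr_gt0.
have [|v _|S _ cS] := cB _ setT F.
- by move=> v _; exact: ball_open.
- by exists v => //; exact: ballxx.
have rvE v : cnorm v <= rho -> exists2 t : T, B t & toE t = v.
  move=> vrho; exists (\row_(i < n + n) match fintype.split i with
    | inl k => complex.Re (v k) | inr k => complex.Im (v k) end).
    move=> i; rewrite mxE /= in_itv /= -ler_norml.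
    case: (fintype.split i) => k; apply: le_trans vrho.
      by apply: le_trans (cabs_le_cnorm v k); exact: Re_le_cabs.
    by apply: le_trans (cabs_le_cnorm v k); exact: Im_le_cabs.
  apply/funext => k; rewrite /toE !mxE.
  have -> : fintype.split (lshift n k) = inl k by exact: (unsplitK (inl k)).
  have -> : fintype.split (rshift n k) = inr k by exact: (unsplitK (inr k)).
  by case: (v k).
pose l := finmap.enum_fset S.
exists (size l), (fun i => toE (nth 0 l i)) => w /rvE[t Bt <-].
have [v /= vS] := cS _ Bt; rewrite /F.
set e := D _ / _ => tv.
have tvj j : `|v 0 j - t 0 j| < e by have := tv.2 ord0 j; rewrite -ball_normE.
exists (index v l); first by rewrite index_mem.
rewrite nth_index//; apply: (@le_lt_trans _ _ (2 * n%:R * e)).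
  rewrite -mulrA mulrCA; apply: cnorm_le_const => i.
  apply: le_trans (cabs_le_ReIm _) _; rewrite mulr_natl mulr2n.
  have := tvj (lshift n i); have := tvj (rshift n i).
  rewrite ![`|v _ _ - _|]distrC => /ltW h1 /ltW h2.
  by rewrite addrC; apply: lerD.
apply: (@lt_le_trans _ _ ((2 * n%:R + 1) * e)).
  by rewrite ltr_pM2r ?F_gt0// ltrDl.
by rewrite /e mulrC divfK// gt_eqF.
Qed.

Lemma usc_bounded (u : E -> R) (rho : R) : usc u ->
  exists2 M, 0 <= M & forall z, cnorm z <= rho -> u z <= M.
Proof.
move=> usc_u; pose D z := xget 1 [set d : R | 0 < d /\
  forall w, cnorm (w - z) < d -> u w < u z + 1].
have DP z : 0 < D z /\ forall w, cnorm (w - z) < D z -> u w < u z + 1.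
  by rewrite /D; case: xgetP => [d _ //|] /= none; case: (usc_u z 1 ltr01) => d /none.
have [k [s cov]] := box_cover rho (fun z => (DP z).1).
exists (\sum_(i < k) (`|u (s i)| + 1)) => [|z /cov[i ik /(DP _).2 uz]].
  by apply: sumr_ge0 => i _; exact: addr_ge0.
apply: (le_trans (ltW uz)); rewrite (bigD1 (Ordinal ik))//=.
apply: (@le_trans _ _ (`|u (s i)| + 1)); first by rewrite lerD2r ler_norm.
by rewrite lerDl; apply: sumr_ge0 => j _; exact: addr_ge0.
Qed.

Lemma cont_usc (u : E -> R) : cont u -> usc u.
Proof.
move=> cu z e /(cu z)[d [d0 dP]]; exists d; split=> // w /dP.
by rewrite ltr_norml => /andP[_]; rewrite ltrBlDl.
Qed.

Lemma contN (u : E -> R) : cont u -> cont (fun z => - u z).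
Proof.
move=> cu z e /(cu z)[d [d0 dP]]; exists d; split=> // w /dP.
by rewrite -opprD normrN.
Qed.

Lemma cont_bounded (u : E -> R) (rho : R) : cont u ->
  exists2 M, 0 <= M & forall z, cnorm z <= rho -> `|u z| <= M.
Proof.
move=> cu; have [M M0 MP] := usc_bounded rho (cont_usc cu).
have [M' M'0 M'P] := usc_bounded rho (cont_usc (contN cu)).
exists (M + M') => [|z zr]; first exact: addr_ge0.
rewrite ler_norml lerNl; apply/andP; split.
  by apply: (le_trans (M'P _ zr)); rewrite lerDr.
by apply: (le_trans (MP _ zr)); rewrite lerDl.
Qed.

Lemma cont_unif (u : E -> R) (rho e : R) : cont u -> 0 < e ->
  exists2 d, 0 < d & forall z w, cnorm z <= rho -> cnorm (w - z) < d ->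
    `|u w - u z| < e.
Proof.
move=> cu e0; have e20 : 0 < e / 2 by rewrite divr_gt0.
pose D z := xget 1 [set d : R | 0 < d /\
  forall w, cnorm (w - z) < d -> `|u w - u z| < e / 2].
have DP z : 0 < D z /\ forall w, cnorm (w - z) < D z -> `|u w - u z| < e / 2.
  by rewrite /D; case: xgetP => [d _ //|] /= none; case: (cu z _ e20) => d /none.
have D2 z : 0 < D z / 2 by rewrite divr_gt0// (DP z).1.
have [k [s cov]] := box_cover rho D2.
pose d := \big[Num.min/1]_(i < k) (D (s i) / 2).
have d0 : 0 < d.
  by rewrite /d; elim/big_ind: _ => // x y x0 y0; rewrite lt_min x0 y0.
exists d => // z w zrho wz; have [i ik zi] := cov _ zrho.
have dle : d <= D (s i) / 2 by exact: (bigmin_le _ (Ordinal ik)).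
have wi : cnorm (w - s i) < D (s i).
  rewrite [ltRHS]splitr; apply: le_lt_trans (cnorm_dist w z _) _.
  by apply: ltrD => //; exact: lt_le_trans dle.
have zi' : cnorm (z - s i) < D (s i).
  by apply: lt_trans zi _; rewrite ltr_pdivrMr// mulr_natr mulr2n ltrDl (DP _).1.
have := (DP (s i)).2 _ wi; have := (DP (s i)).2 _ zi'.
rewrite [e in _ -> _ -> _ < e]splitr distrC => h1 h2.
have -> : u w - u z = (u w - u (s i)) + (u (s i) - u z) by rewrite subrKA.
apply: le_lt_trans (ler_normD _ _) _; rewrite addrC; exact: ltrD.
Qed.

End VectorNorm.

(** * Taylor bounds for sine and cosine *)

Section TrigonometricBounds.
Variable R : realType.
Implicit Types s t : R.

Lemma mvt_total (f df : R -> R) s t :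
  (forall x : R, is_derive x (1 : R) f (df x)) ->
  exists2 c, (Num.min s t <= c <= Num.max s t) & f t - f s = df c * (t - s).
Proof.
move=> fdf.
have cf : continuous f.
  move=> x; apply: differentiable_continuous; apply/derivable1_diffP.
  by have [] := fdf x.
have [st|ts] := leP s t.
  have [//|] := @MVT_segment _ f df s t st.
    by apply: continuous_subspaceT.
  by move=> c; rewrite in_itv /= => ? ?; exists c.
have [//|] := @MVT_segment _ f df t s (ltW ts).
  by apply: continuous_subspaceT.
move=> c; rewrite in_itv /= => ct fst; exists c => //.
by rewrite -opprB fst -mulrN opprB.
Qed.

Lemma mvt_origin (f df : R -> R) t :
  (forall x : R, is_derive x (1 : R) f (df x)) ->
  exists2 c, `|c| <= `|t| & f t - f 0 = df c * t.
Proof.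
move=> /(@mvt_total f df 0 t)[c /andP[c1 c2] ->]; exists c; rewrite ?subr0//.
rewrite ler_norml; apply/andP; split.
  by apply: le_trans c1; rewrite le_min lerNl oppr0 normr_ge0 lerNl -normrN ler_norm.
by apply: le_trans c2 _; rewrite ge_max normr_ge0 ler_norm.
Qed.

Lemma sin_lip s t : `|sin s - sin t| <= `|s - t|.
Proof.
have [c _ ->] := @mvt_total sin cos t s (@is_derive_sin R).
by rewrite normrM ler_piMl// cos_max.
Qed.

Lemma cos_lip s t : `|cos s - cos t| <= `|s - t|.
Proof.
have [c _ ->] := @mvt_total cos (fun x => - sin x) t s (@is_derive_cos R).
by rewrite normrM normrN ler_piMl// sin_max.
Qed.

Lemma cis_lip s t : cabs (cis s - cis t) <= 2 * `|s - t|.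
Proof.
apply: le_trans (cabs_le_ReIm _) _; rewrite mulr_natl mulr2n /=.
by apply: lerD; [exact: cos_lip | exact: sin_lip].
Qed.

Lemma sin_norm_le t : `|sin t| <= `|t|.
Proof. by have := sin_lip t 0; rewrite sin0 !subr0. Qed.

(** Each Taylor bound of this section follows from the previous one by the mean value theorem. The
    constants are not sharp, only the orders of vanishing matter. *)
Lemma cos_taylor1 t : `|cos t - 1| <= t ^+ 2.
Proof.
have [c ct] := @mvt_origin cos (fun x => - sin x) t (@is_derive_cos R).
rewrite cos0 => ->; rewrite normrM normrN -[t ^+ 2]ger0_norm ?sqr_ge0// normrX.
by rewrite expr2 ler_wpM2r// (le_trans (sin_norm_le c)).
Qed.

Lemma sin_taylor1 t : `|sin t - t| <= `|t| ^+ 3.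
Proof.
have d (x : R) : is_derive x (1 : R) (fun y => sin y - y) (cos x - 1).
  by apply: is_deriveB.
have [c ct /=] := mvt_origin t d.
rewrite sin0 subrr subr0 => ->; rewrite normrM exprSr ler_wpM2r//.
apply: le_trans (cos_taylor1 c) _.
by rewrite -real_normK ?num_real// ler_pXn2r ?nnegrE.
Qed.

Lemma cos_taylor2 t : `|cos t - 1 + t ^+ 2 / 2| <= t ^+ 4.
Proof.
have d (x : R) : is_derive x (1 : R) (fun y => cos y + y ^+ 2 / 2) (x - sin x).
  have h : is_derive x (1 : R) (fun y => y ^+ 2 / 2) x.
    have -> : (fun y : R => y ^+ 2 / 2) = ((2^-1 : R) \*: (fun y : R => y ^+ 2)).
      by apply/funext => y /=; rewrite mulrC.
    apply: is_derive_eq.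
    by rewrite /GRing.scale /=; lra.
  by rewrite addrC; apply: is_deriveD.
have [c ct /=] := mvt_origin t d.
rewrite cos0 expr0n /= mul0r addr0 => dE.
have -> : cos t - 1 + t ^+ 2 / 2 = (c - sin c) * t by rewrite -dE; ring.
rewrite normrM distrC -[t ^+ 4]ger0_norm ?exprn_even_ge0// normrX exprSr.
rewrite ler_wpM2r//; apply: le_trans (sin_taylor1 c) _.
by rewrite ler_pXn2r ?nnegrE.
Qed.

End TrigonometricBounds.

(** * Sub-mean values on circles *)

Section CircleAverages.
Variables (R : realType) (n : nat).
Local Notation E := ('I_n -> R[i]).
Implicit Types (a b z w : E) (G : E -> R).

Definition circ a b (t : R) : E := a + cscale (cis t) b.

Definition rootang (M k : nat) : R := 2 * pi * k%:R / M%:R.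

Definition avg (M : nat) G a b : R :=
  M%:R^-1 * \sum_(k < M) G (circ a b (rootang M k)).

(** The sub-mean value property, tested only against continuous majorants and finite averages. No
    measurability of [w] enters, so the property passes to arbitrary suprema and to translates. *)
Definition smv (w : E -> R) := forall a b G, cont G ->
  (forall t, w (circ a b t) <= G (circ a b t)) ->
  forall e : R, 0 < e ->
  exists M0, forall M, (M0 <= M)%N -> (0 < M)%N -> w a - e <= avg M G a b.

Lemma circ_lip a b s t :
  cnorm (circ a b s - circ a b t) <= 2 * `|s - t| * cnorm b.
Proof.
have -> : circ a b s - circ a b t = cscale (cis s - cis t) b.
  apply/funext => i.
  change (a i + cis s * b i - (a i + cis t * b i) = (cis s - cis t) * b i).
  by ring.
by rewrite cnormZ ler_wpM2r ?cnorm_ge0 ?cis_lip.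
Qed.

Lemma cnorm_circ a b t : cnorm (circ a b t) <= cnorm a + cnorm b.
Proof. by apply: le_trans (cnormD _ _) _; rewrite cnormZ cabs_cis mul1r. Qed.

Lemma circ_shift a b w t : circ a b t + w = circ (a + w) b t.
Proof. by rewrite /circ addrAC. Qed.

Lemma avg_shift M G a b w : avg M (fun z => G (z + w)) a b = avg M G (a + w) b.
Proof. by congr (_ * _); apply: eq_bigr => k _; rewrite circ_shift. Qed.

Lemma avg_cst M c a b : (0 < M)%N -> avg M (fun=> c) a b = c.
Proof.
move=> M0; rewrite /avg sumr_const card_ord -[c *+ M]mulr_natl mulrA mulVf ?mul1r//.
by rewrite pnatr_eq0 -lt0n.
Qed.

Lemma avgD M G G' a b :
  avg M (fun z => G z + G' z) a b = avg M G a b + avg M G' a b.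
Proof. by rewrite /avg big_split mulrDr. Qed.

Lemma avgZ M c G a b : avg M (fun z => c * G z) a b = c * avg M G a b.
Proof. by rewrite /avg -mulr_sumr mulrCA. Qed.

Lemma avg_le M G G' a b :
  (forall k, (k < M)%N -> G (circ a b (rootang M k)) <= G' (circ a b (rootang M k))) ->
  avg M G a b <= avg M G' a b.
Proof.
move=> le_GG'; rewrite /avg ler_wpM2l ?invr_ge0//.
by apply: ler_sum => k _; exact: le_GG'.
Qed.

Lemma avg_dist M G G' a b a' b' (e : R) : (0 < M)%N ->
  (forall k, (k < M)%N ->
    `|G (circ a b (rootang M k)) - G' (circ a' b' (rootang M k))| <= e) ->
  `|avg M G a b - avg M G' a' b'| <= e.
Proof.
move=> M0 le_e; rewrite /avg -mulrBr -sumrB normrM ger0_norm ?invr_ge0//.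
rewrite mulrC ler_pdivrMr ?ltr0n//; apply: le_trans (ler_norm_sum _ _ _) _.
apply: (@le_trans _ _ (\sum_(k < M) e)).
  by apply: ler_sum => k _; exact: le_e.
by rewrite sumr_const card_ord mulr_natr.
Qed.

Lemma rootang_refine M M' (k j : nat) : (0 < M)%N -> (0 < M')%N -> (j < M')%N ->
  `|rootang (M * M') (k * M' + j) - rootang M k| <= 2 * pi / M%:R.
Proof.
move=> M0 M'0 jM'; have hM : (M%:R : R) != 0 by rewrite pnatr_eq0 -lt0n.
have hM' : (M'%:R : R) != 0 by rewrite pnatr_eq0 -lt0n.
have -> : rootang (M * M') (k * M' + j) - rootang M k =
    2 * pi / M%:R * (j%:R / M'%:R).
  by rewrite /rootang natrD !natrM; field; rewrite hM hM'.
rewrite normrM ger0_norm ?divr_ge0 ?mulr_ge0 ?pi_ge0//.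
rewrite ler_piMr ?divr_ge0 ?mulr_ge0 ?pi_ge0//.
by rewrite ger0_norm ?divr_ge0// ler_pdivrMr ?ltr0n// mul1r ler_nat ltnW.
Qed.

(** Every angle of the coarse subdivision starts a block of [M'] finer angles, so the two averages
    differ by at most the oscillation of [G] over one coarse step. *)
Lemma avg_refine M M' G a b (e : R) : (0 < M)%N -> (0 < M')%N ->
  (forall s t, `|s - t| <= 2 * pi / M%:R ->
    `|G (circ a b s) - G (circ a b t)| <= e) ->
  `|avg (M * M') G a b - avg M G a b| <= e.
Proof.
move=> M0 M'0 le_e; have hM : (0 : R) < M%:R by rewrite ltr0n.
have hM' : (0 : R) < M'%:R by rewrite ltr0n.
pose g (m k : nat) := G (circ a b (rootang m k)).
have -> : avg (M * M') G a b = M%:R^-1 * \sum_(k < M)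
    (M'%:R^-1 * \sum_(j < M') g (M * M')%N (k * M' + j)%N).
  rewrite /avg -mulr_sumr mulrA natrM invfM; congr (_ * _).
  rewrite -(big_mkord xpredT (g (M * M')%N)).
  rewrite -(big_mkord xpredT (fun k => \sum_(j < M') g (M * M')%N (k * M' + j)%N)).
  rewrite big_nat_mul; apply: eq_bigr => k _.
  by rewrite -{1}[(k * M')%N]add0n big_addn mulSn addnK big_mkord;
     apply: eq_bigr => j _; rewrite addnC.
rewrite /avg -mulrBr -sumrB normrM ger0_norm ?invr_ge0 ?(ltW hM)//.
rewrite mulrC ler_pdivrMr//; apply: le_trans (ler_norm_sum _ _ _) _.
apply: (@le_trans _ _ (\sum_(k < M) e)); last first.
  by rewrite sumr_const card_ord mulr_natr.
apply: ler_sum => k _.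
have -> : M'%:R^-1 * (\sum_(j < M') g (M * M')%N (k * M' + j)%N) -
    G (circ a b (rootang M k)) =
    M'%:R^-1 * \sum_(j < M') (g (M * M')%N (k * M' + j)%N - g M k).
  rewrite sumrB sumr_const card_ord -[g M k *+ _]mulr_natl mulrBr mulrA.
  by rewrite mulVf ?mul1r ?gt_eqF.
rewrite normrM ger0_norm ?invr_ge0 ?(ltW hM')// mulrC ler_pdivrMr//.
apply: le_trans (ler_norm_sum _ _ _) _.
apply: (@le_trans _ _ (\sum_(j < M') e)); last first.
  by rewrite sumr_const card_ord mulr_natr.
by apply: ler_sum => j _; apply: le_e; exact: rootang_refine.
Qed.

Lemma cont_circ_unif G a b (e : R) : cont G -> 0 < e ->
  exists2 d, 0 < d & forall s t, `|s - t| <= d ->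
    `|G (circ a b s) - G (circ a b t)| <= e.
Proof.
move=> cG e0; have [d d0 dP] := cont_unif (cnorm a + cnorm b) cG e0.
have K0 : 0 < 2 * cnorm b + 1 by rewrite ltr_wpDl// mulr_ge0// cnorm_ge0.
exists (d / 2 / (2 * cnorm b + 1)) => [|s t]; first by rewrite !divr_gt0.
rewrite ler_pdivlMr// => st; apply/ltW/dP; first exact: cnorm_circ.
apply: le_lt_trans (circ_lip _ _ _ _) _.
apply: (@le_lt_trans _ _ (d / 2)).
  apply: le_trans st; rewrite mulrAC [leRHS]mulrC ler_wpM2r//.
  by rewrite lerDl.
by rewrite ltr_pdivrMr// mulr_natr mulr2n ltrDl.
Qed.

Lemma angle_small (d : R) : 0 < d ->
  exists M0 : nat, forall M, (M0 <= M)%N -> (0 < M)%N -> 2 * pi / M%:R <= d.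
Proof.
move=> d0; exists (Num.truncn (2 * pi / d)).+1 => M M0M M0.
rewrite ler_pdivrMr ?ltr0n// -ler_pdivrMl// [X in X <= _]mulrC.
by apply: ltW; apply: lt_le_trans (truncnS_gt _) _; rewrite ler_nat.
Qed.

(* For a continuous function the averages over roots of unity are uniformly
   close to their limit, so finitely many points already detect [smv]. *)
Lemma smv_avg G a b (e : R) (M : nat) : smv G -> cont G -> (0 < M)%N ->
  (forall s t, `|s - t| <= 2 * pi / M%:R ->
    `|G (circ a b s) - G (circ a b t)| <= e) ->
  G a - e <= avg M G a b.
Proof.
move=> smvG cG M0 le_e; apply/ler_addgt0Pr => d d0.
have [M' M'P] := smvG a b G cG (fun t => lexx _) d d0.
have /ler_normlP[_] := avg_refine M0 (ltn0Sn M') le_e.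
have := M'P (M * M'.+1)%N; rewrite muln_gt0 M0 /=.
move=> /(_ _ isT) h; have {h} := h (leq_trans (leqnSn _) (leq_pmull _ M0)).
lra.
Qed.

Lemma smv_of_avg G :
  (forall a b (e : R), 0 < e ->
    exists M0, forall M, (M0 <= M)%N -> (0 < M)%N -> G a - e <= avg M G a b) ->
  smv G.
Proof.
move=> avgG a b G' cG' GG' e /(avgG a b)[M0 M0P].
exists M0 => M /M0P h /h{}h; apply: le_trans h _.
by apply: avg_le => k _; exact: GG'.
Qed.

(** At the centre choose a member that nearly attains the supremum; a majorant of [w] on the circle
    is also a majorant of that member. *)
Lemma smv_sup (I : Type) (P : I -> Prop) (F : I -> E -> R) (w : E -> R) :
  (forall i, P i -> smv (F i)) ->
  (forall i, P i -> forall z, F i z <= w z) ->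
  (forall z (e : R), 0 < e -> exists2 i, P i & w z - e < F i z) ->
  smv w.
Proof.
move=> smvF Fw wF a b G cG wG e e0; have e20 : 0 < e / 2 by rewrite divr_gt0.
have [i Pi Fi] := wF a _ e20.
have [|M0 M0P] := smvF i Pi a b G cG _ _ e20.
  by move=> t; apply: le_trans (wG t); exact: Fw.
by exists M0 => M /M0P h /h; lra.
Qed.

Lemma smv_translate (w : E -> R) (h : E) : smv w -> smv (fun z => w (z + h)).
Proof.
move=> smvw a b G cG wG e e0.
have cG' : cont (fun z => G (z - h)).
  move=> z d /(cG (z - h))[r [r0 rP]]; exists r; split=> // x xz; apply: rP.
  by rewrite -[X in cnorm X](_ : x - z = _)//; apply/funext => i; rewrite !fctE; ring.
have [|M0 M0P] := smvw (a + h) b _ cG' _ e e0.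
  by move=> t; rewrite -circ_shift addrK.
exists M0 => M M0M M_gt0; have := M0P M M0M M_gt0.
rewrite -avg_shift; congr (_ <= avg M _ a b); apply/funext => z.
by rewrite addrK.
Qed.

End CircleAverages.

(** * Riemann sums and the passage between [psh] and [smv] *)

Section RiemannSums.
Variables (R : realType) (n : nat).
Local Notation E := ('I_n -> R[i]).
Local Notation mu := (@lebesgue_measure R).

(** Neither function has to be measurable, because the integral of a nonnegative function is a
    supremum over simple functions below it. This allows comparing an upper semicontinuous [u] with
    a continuous majorant along a circle. *)
Lemma nonneg_integral_mono d (T : measurableType d)
    (nu : {measure set T -> \bar R}) (D : set T) (f g : T -> \bar R) :
  (forall x, D x -> 0 <= f x)%E -> (forall x, D x -> f x <= g x)%E ->
  (\int[nu]_(x in D) f x <= \int[nu]_(x in D) g x)%E.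
Proof.
move=> f0 fg; rewrite !ge0_integralE//; last first.
  by move=> x Dx; apply: le_trans (fg x Dx); exact: f0.
apply: le_ereal_sup => _ [h hf <-]; exists h => // x.
apply: le_trans (hf x) _; rewrite /patch; case: ifPn => // /set_mem.
exact: fg.
Qed.

Lemma riemann_sum (h : R -> R) (a d eta : R) (m : nat) : 0 <= d ->
  continuous h ->
  (forall s t, `|s - t| <= d -> `|h s - h t| <= eta) ->
  `|\int[mu]_(x in `[a, a + m%:R * d]) h x - d * \sum_(k < m) h (a + k%:R * d)|
    <= m%:R * d * eta.
Proof.
move=> d0 ch le_eta.
have ih x y : mu.-integrable `[x, y] (EFin \o h).
  apply: continuous_compact_integrable; first exact: segment_compact.
  exact: continuous_subspaceT.
elim: m => [|m IH].
  by rewrite !mul0r addr0 big_ord0 mulr0 subr0 set_itv1 Rintegral_set1 normr0.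
set x := a + m%:R * d in IH *; set y := a + m.+1%:R * d.
have yE : y = x + d by rewrite /y /x -natr1 mulrDl mul1r addrA.
have ax : a <= x by rewrite lerDl mulr_ge0.
have xy : x <= y by rewrite yE lerDl.
have split := @Rintegral_itvB R h (BLeft a) (BRight y) x (ih _ _).
have {}split : \int[mu]_(t in `[a, y]) h t =
    \int[mu]_(t in `[a, x]) h t + \int[mu]_(t in `]x, y]) h t.
  by rewrite -split ?bnd_simp// addrC subrK.
have ih' : mu.-integrable `]x, y] (EFin \o h).
  by apply: integrableS (ih x y) => //; exact: subset_itv_oc_cc.
have ic c : mu.-integrable `]x, y] (EFin \o cst c).
  apply: (@integrableS _ _ _ mu `[x, y]) => //; first exact: subset_itv_oc_cc.
  apply: continuous_compact_integrable; first exact: segment_compact.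
  by apply: continuous_subspaceT => z; exact: cst_continuous.
have muxy : fine (mu `]x, y]) = d.
  rewrite lebesgue_measure_itv /= lte_fin.
  case: ltP => [_|yx]; first by rewrite -EFinD /= yE addrC addKr.
  by move: yx; rewrite yE gerDl => d_le0; apply/le_anti; rewrite d0 d_le0.
have hx t : `]x, y]%classic t -> `|h t - h x| <= eta.
  rewrite /= in_itv /= => /andP[xt ty]; apply: le_eta.
  by rewrite ger0_norm ?subr_ge0 ?(ltW xt)// lerBlDl -yE.
have up : \int[mu]_(t in `]x, y]) h t <= (h x + eta) * d.
  rewrite -[X in _ <= _ * X]muxy -Rintegral_cst//; apply: le_Rintegral => //; first exact: (ic (h x + eta)).
  by move=> t /hx; rewrite ler_distl => /andP[].
have lo : (h x - eta) * d <= \int[mu]_(t in `]x, y]) h t.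
  rewrite -[X in _ * X <= _]muxy -Rintegral_cst//; apply: le_Rintegral => //; first exact: (ic (h x - eta)).
  by move=> t /hx; rewrite ler_distl => /andP[].
have step : `|\int[mu]_(t in `]x, y]) h t - d * h x| <= d * eta.
  by rewrite ler_distl -mulrBr -mulrDr ![d * _]mulrC lo up.
rewrite split big_ord_recr /= mulrDr -natr1 !mulrDl mul1r.
have -> : forall p q r s : R, p + q - (r + s) = (p - r) + (q - s).
  by move=> p q r s; ring.
by apply: le_trans (ler_normD _ _) _; exact: lerD.
Qed.

Lemma circ_continuous (G : E -> R) a b : cont G ->
  continuous (fun t : R => G (circ a b t)).
Proof.
move=> cG t; apply/cvgrPdist_le => e e0.
have [d d0 dP] := cont_circ_unif a b cG e0.
near=> s; apply: dP; near: s.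
by exists d => //= s /ltW.
Unshelve. all: by end_near. Qed.

Lemma integral_circ (G : E -> R) a b : cont G ->
  (\int[mu]_(t in `[0%R, (2 * pi)%R]) (G (circ a b t))%:E =
   (\int[mu]_(t in `[0%R, (2 * pi)%R]) G (circ a b t))%R%:E)%E.
Proof.
move=> cG; rewrite /Rintegral fineK//; apply: integrable_fin_num => //.
apply: continuous_compact_integrable; first exact: segment_compact.
by apply: continuous_subspaceT; exact: circ_continuous.
Qed.

Lemma avg_integral (G : E -> R) a b (e : R) : cont G -> 0 < e ->
  exists M0, forall M, (M0 <= M)%N -> (0 < M)%N ->
  `|\int[mu]_(t in `[0, 2 * pi]) G (circ a b t) - 2 * pi * avg M G a b| <= e.
Proof.
move=> cG e0.
have pi2 : 0 < 2 * pi :> R by rewrite mulr_gt0 ?pi_gt0.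
have [d d0 dP] := cont_circ_unif a b cG (divr_gt0 e0 pi2).
have [M0 M0P] := angle_small d0.
exists M0 => M M0M M_gt0; have M_neq0 : (M%:R : R) != 0 by rewrite pnatr_eq0 -lt0n.
have := @riemann_sum (fun t => G (circ a b t)) 0 (2 * pi / M%:R) (e / (2 * pi)) M.
rewrite [M%:R * _]mulrC divfK// add0r [2 * pi * (e / _)]mulrC divfK ?gt_eqF//.
move=> h; apply: le_trans (h _ _ _).
- rewrite /avg mulrA le_eqVlt; apply/orP; left; apply/eqP.
  congr (`| _ - _ * _|); apply: eq_bigr => k _.
  by rewrite add0r /rootang; congr (G (circ a b _)); ring.
- by rewrite divr_ge0// ltW.
- exact: circ_continuous.
- by move=> s t st; apply: dP; apply: le_trans st _; exact: M0P.
Qed.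

Lemma psh_smv (u : E -> R) : (forall z, 0 <= u z) -> psh u -> smv u.
Proof.
move=> u0 [_ pshu] a b G cG uG e e0.
have pi2 : 0 < 2 * pi :> R by rewrite mulr_gt0 ?pi_gt0.
have [M0 M0P] := avg_integral a b cG (mulr_gt0 pi2 e0).
exists M0 => M M0M M_gt0; have := M0P M M0M M_gt0.
have : ((2 * pi * u a)%:E <= (\int[mu]_(t in `[0, 2 * pi]) G (circ a b t))%R%:E)%E.
  rewrite -integral_circ//; apply: le_trans (pshu a b) _.
  by apply: nonneg_integral_mono => t _; rewrite lee_fin; [exact: u0 | exact: uG].
rewrite lee_fin => h1 /ler_normlP[_ h2].
rewrite -(ler_pM2l pi2); lra.
Qed.

Lemma cont_smv_psh (u : E -> R) : cont u -> smv u -> psh u.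
Proof.
move=> cu smvu; split; first exact: cont_usc.
move=> a b; rewrite [leRHS](_ : _ =
  (\int[mu]_(t in `[0, (2 * pi)%R]) u (circ a b t))%R%:E); last first.
  by rewrite -integral_circ.
have pi2 : 0 < 2 * pi :> R by rewrite mulr_gt0 ?pi_gt0.
rewrite lee_fin; apply/ler_addgt0Pr => e e0; have e20 : 0 < e / 2 by rewrite divr_gt0.
have [M0 M0P] := avg_integral a b cu e20.
have [M1 M1P] := smvu a b u cu (fun t => lexx _) _ (divr_gt0 e20 pi2).
have /ler_normlP[h1 _] := M0P (maxn M0 M1).+1 (leqW (leq_maxl _ _)) isT.
have := M1P (maxn M0 M1).+1 (leqW (leq_maxr _ _)) isT.
rewrite -(ler_pM2l pi2) mulrBr [2 * pi * (_ / _)]mulrC divfK ?gt_eqF//; lra.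
Qed.

End RiemannSums.

(** * Continuity of real and complex functions on $\mathbb{C}^n$ *)

Section Continuity.
Variables (R : realType) (n : nat).
Local Notation E := ('I_n -> R[i]).
Implicit Types (u v : E -> R) (f g : E -> R[i]).

Lemma cont_cst (c : R) : cont (fun=> c : R) (n := n).
Proof. by move=> z e e0; exists 1; split=> // w _; rewrite subrr normr0. Qed.

Lemma cont_comp (phi : R -> R) u : cont u ->
  (forall z, {for u z, continuous phi}) -> cont (fun z => phi (u z)).
Proof.
move=> cu cphi z e e0; have /cvgrPdist_lt/(_ e e0) := cphi z.
move=> /nbhs_ballP[d /= d0 dP].
have [r [r0 rP]] := cu z d d0; exists r; split=> // w wz.
by rewrite distrC; apply: dP; rewrite -ball_normE /= distrC; exact: rP.
Qed.

Lemma contD u v : cont u -> cont v -> cont (fun z => u z + v z).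
Proof.
move=> cu cv z e e0; have e20 : 0 < e / 2 by rewrite divr_gt0.
have [d [d0 dP]] := cu z _ e20; have [d' [d'0 d'P]] := cv z _ e20.
exists (Num.min d d'); split=> [|w]; first by rewrite lt_min d0.
rewrite lt_min => /andP[/dP h /d'P h'].
rewrite opprD addrACA [e]splitr; apply: le_lt_trans (ler_normD _ _) _.
exact: ltrD.
Qed.

Lemma contM u v : cont u -> cont v -> cont (fun z => u z * v z).
Proof.
move=> cu cv z e e0.
pose K := `|u z| + `|v z| + 1.
have K0 : 0 < K by rewrite ltr_wpDl// addr_ge0.
have d0 : 0 < Num.min 1 (e / (2 * K)) by rewrite lt_min ltr01 divr_gt0// mulr_gt0.
have [d [dp dP]] := cu z _ d0; have [d' [d'p d'P]] := cv z _ d0.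
exists (Num.min d d'); split=> [|w]; first by rewrite lt_min dp.
rewrite lt_min => /andP[/dP + /d'P]; rewrite !lt_min => /andP[h1 h2] /andP[h3 h4].
have -> : u w * v w - u z * v z = (u w - u z) * v w + u z * (v w - v z) by ring.
apply: le_lt_trans (ler_normD _ _) _; rewrite !normrM.
have vw : `|v w| <= K.
  have -> : v w = (v w - v z) + v z by rewrite subrK.
  by apply: le_trans (ler_normD _ _) _; have := normr_ge0 (u z); rewrite /K; lra.
have uz : `|u z| <= K by have := normr_ge0 (v z); rewrite /K; lra.
have e2 : e = e / (2 * K) * K + e / (2 * K) * K.
  by field; exact: lt0r_neq0.
rewrite [ltRHS]e2; apply: ltr_leD.
  apply: (@le_lt_trans _ _ (`|u w - u z| * K)); first by rewrite ler_wpM2l.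
  by rewrite ltr_pM2r.
by rewrite mulrC ler_pM// ltW.
Qed.

Lemma contZ (c : R) u : cont u -> cont (fun z => c * u z).
Proof. by move=> cu; apply: contM => //; exact: cont_cst. Qed.

Lemma cont_sum (I : Type) (s : seq I) (P : pred I) (F : I -> E -> R) :
  (forall i, cont (F i)) -> cont (fun z => \sum_(i <- s | P i) F i z).
Proof.
move=> cF; elim: s => [|i s IH].
  by under [X in cont X]eq_fun do rewrite big_nil; exact: cont_cst.
case Pi : (P i); under [X in cont X]eq_fun do rewrite big_cons Pi; last exact: IH.
by apply: contD => //; exact: cF.
Qed.

Lemma cont_max u v : cont u -> cont v -> cont (fun z => Num.max (u z) (v z)).
Proof.
move=> cu cv.
have -> : (fun z => Num.max (u z) (v z)) =
    (fun z => 2^-1 * (u z + v z + `|u z + (-1) * v z|)).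
  by apply/funext => z; rewrite mulN1r maxr_absE mulrC.
apply: contZ; apply: contD; first exact: contD.
apply: (@cont_comp (fun x => `|x|)); last by move=> z; exact: norm_continuous.
by apply: contD => //; exact: contZ.
Qed.

Definition ccont f := cont (fun z => complex.Re (f z)) /\
                      cont (fun z => complex.Im (f z)).

Lemma ccont_cst (c : R[i]) : ccont (fun=> c).
Proof. by split; exact: cont_cst. Qed.

Lemma ccont_coord i : ccont (fun z => z i).
Proof.
split=> z e e0; exists e; split=> // w wz.
- apply: le_lt_trans wz; rewrite -cReN -cReD.
  exact: le_trans (Re_le_cabs _) (cabs_le_cnorm (w - z) i).
- apply: le_lt_trans wz; rewrite -cImN -cImD.
  exact: le_trans (Im_le_cabs _) (cabs_le_cnorm (w - z) i).
Qed.

Lemma ccontD f g : ccont f -> ccont g -> ccont (fun z => f z + g z).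
Proof.
move=> [cf1 cf2] [cg1 cg2]; split.
  by under [X in cont X]eq_fun do rewrite cReD; exact: contD.
by under [X in cont X]eq_fun do rewrite cImD; exact: contD.
Qed.

Lemma ccontM f g : ccont f -> ccont g -> ccont (fun z => f z * g z).
Proof.
move=> [cf1 cf2] [cg1 cg2]; split.
  under [X in cont X]eq_fun do rewrite cReM.
  by apply: contD; [exact: contM | apply: contN; exact: contM].
by under [X in cont X]eq_fun do rewrite cImM; apply: contD; exact: contM.
Qed.

Lemma cont_sqr_cabs f : ccont f -> cont (fun z => cabs (f z) ^+ 2).
Proof.
move=> [cf1 cf2]; under [X in cont X]eq_fun do rewrite sqr_cabs !expr2.
by apply: contD; exact: contM.
Qed.

Lemma cont_cabs f : ccont f -> cont (fun z => cabs (f z)).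
Proof.
move=> cf; have -> : (fun z => cabs (f z)) = (fun z => Num.sqrt (cabs (f z) ^+ 2)).
  by apply/funext => z; rewrite sqrtr_sqr ger0_norm// cabs_ge0.
apply: (@cont_comp Num.sqrt); first exact: cont_sqr_cabs.
by move=> z; exact: sqrt_continuous.
Qed.

Lemma ccontP f : (forall z (e : R), 0 < e -> exists d : R, 0 < d /\
    forall w, cnorm (w - z) < d -> cabs (f w - f z) <= e) -> ccont f.
Proof.
move=> cf; split=> z e e0; have [d [d0 dP]] := cf z _ (divr_gt0 e0 (ltr0Sn _ 1));
  exists d; split=> // w /dP h; (apply: (@le_lt_trans _ _ (e / 2));
  last by rewrite ltr_pdivrMr// mulr_natr mulr2n ltrDl).
  by rewrite -cReN -cReD; exact: le_trans (Re_le_cabs _) _.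
by rewrite -cImN -cImD; exact: le_trans (Im_le_cabs _) _.
Qed.

Lemma powR_cont_at (al y e : R) : 0 < al -> 0 <= y -> 0 < e ->
  exists2 d, 0 < d & forall x, 0 <= x -> `|x - y| < d ->
    `|powR x al - powR y al| < e.
Proof.
move=> al0 y0 e0.
have inv x : 0 <= x -> powR (powR x al^-1) al = x.
  by move=> x0; rewrite -powRrM mulVf ?gt_eqF// powRr1.
have mono x x' : 0 <= x -> 0 <= x' -> x < x' -> powR x al < powR x' al.
  by move=> ? ? ?; apply: gt0_ltr_powR; rewrite ?nnegrE.
have imono x x' : 0 <= x -> 0 <= x' -> powR x al < powR x' al -> x < x'.
  move=> x0 x'0; rewrite !ltNge; apply: contra => xx'.
  by apply: ge0_ler_powR => //; rewrite ltW.
have ya0 := powR_ge0 y al.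
pose A := powR (powR y al + e) al^-1.
have AE : powR A al = powR y al + e by rewrite inv// addr_ge0// ltW.
have yA : y < A by apply: imono; rewrite ?powR_ge0// AE ltrDl.
(* [A] and [B] are the preimages of [powR y al + e] and [powR y al - e]. When the latter is negative
   there is no lower constraint, and any negative number can serve as [B]. *)
pose B := if powR y al - e >= 0 then powR (powR y al - e) al^-1 else -1.
have By : B < y.
  rewrite /B; case: ifP => [h|_]; last by rewrite (lt_le_trans _ y0)// ltrN10.
  by apply: imono; rewrite ?powR_ge0// inv// gtrBl.
exists (Num.min (A - y) (y - B)) => [|x x0].
  by rewrite lt_min !subr_gt0 yA By.
rewrite lt_min => /andP[]; rewrite !ltr_norml => /andP[_ h1] /andP[h2 _].
have xA : x < A by move: h1; rewrite ltrBlDr subrK.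
have Bx : B < x by move: h2; rewrite opprB ltrBrDr subrK.
have hA : powR x al < powR y al + e by rewrite -AE; apply: mono; rewrite ?powR_ge0.
apply/andP; split; last by rewrite ltrBlDl.
rewrite ltrBrDr addrC; move: Bx; rewrite /B addrC; case: ifP => h Bx.
  by rewrite -[X in X < _]inv//; apply: mono => //; exact: powR_ge0.
by move/negbT: h; rewrite -ltNge => /lt_le_trans; apply; exact: powR_ge0.
Qed.

Lemma cont_powR (al : R) u : 0 < al -> (forall z, 0 <= u z) -> cont u ->
  cont (fun z => powR (u z) al).
Proof.
move=> al0 u0 cu z e e0; have [d d0 dP] := powR_cont_at al0 (u0 z) e0.
by have [r [r0 rP]] := cu z d d0; exists r; split=> // w /rP; exact: dP.
Qed.

End Continuity.

(** * Holomorphic polynomials and entire functions *)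

Section DiscreteJensen.
Variable R : realType.
Local Notation C := R[i].

Lemma cos_neq1 (x : R) : 0 < x < 2 * pi -> cos x != 1.
Proof.
move=> /andP[x0 x2]; have xE : x = (x / 2) *+ 2 by rewrite -mulr_natr divfK.
have : 0 < sin (x / 2).
  by apply: sin_gt0_pi; rewrite divr_gt0//= ltr_pdivrMr// mulrC.
rewrite {2}xE cos_mulr2n cos2sin2 => s0.
have := exprn_gt0 2 s0; case: eqP => //; rewrite -[_ *+ 2]mulr_natr; lra.
Qed.

Lemma cis_primitive (M : nat) : (0 < M)%N ->
  M.-primitive_root (cis (2 * pi / M%:R) : C).
Proof.
move=> M0; have hM : (M%:R : R) != 0 by rewrite pnatr_eq0 -lt0n.
apply/andP; split => //; apply/forallP => /= k.
rewrite unity_rootE cisX; apply/eqP.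
have [kM|kM] := eqVneq k.+1 M.
  by rewrite kM -[(2 * pi / M%:R) *+ M]mulr_natr divfK// cis2pi eqxx.
have {}kM : (k.+1 < M)%N by rewrite ltn_neqAle kM ltn_ord.
apply/negbTE; rewrite eq_complex /= negb_and.
apply/orP; left; apply: cos_neq1; rewrite -[_ *+ k.+1]mulr_natr.
have pi2 : 0 < 2 * pi :> R by rewrite mulr_gt0 ?pi_gt0.
rewrite mulr_gt0 ?divr_gt0 ?ltr0n//= mulrAC ltr_pdivrMr ?ltr0n//.
by rewrite ltr_pM2l// ltr_nat.
Qed.

(** This is the factorisation of $X^M-1$ over the roots of unity, evaluated at $r/t$. *)
Lemma prod_root_unity (M : nat) (r : C) (t : R) : (0 < M)%N -> 0 < t ->
  \prod_(k < M) cabs (t%:C%C * cis (rootang R M k) - r) = cabs (r ^+ M - t%:C%C ^+ M).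
Proof.
move=> M0 t0; have t_neq0 : t%:C%C != 0 :> C.
  by apply/eqP => -[t_eq0]; rewrite t_eq0 ltxx in t0.
rewrite -cabs_prod.
have prodE : \prod_(k < M) (r / t%:C%C - cis (2 * pi / M%:R) ^+ k) =
    (r / t%:C%C) ^+ M - 1.
  have hX (x : C) : ('X^M - 1 : {poly C}).[x] = x ^+ M - 1 by rewrite !hornerE.
  rewrite -hX -(factor_Xn_sub_1 (cis_primitive M0)) horner_prod.
  rewrite (big_mkord xpredT (fun k => ('X - (cis (2 * pi / M%:R) ^+ k)%:P).[r / t%:C%C])).
  by apply: eq_bigr => k _; rewrite hornerXsubC.
have -> : \prod_(k < M) (t%:C%C * cis (rootang R M k) - r) =
    (- t%:C%C) ^+ M * ((r / t%:C%C) ^+ M - 1).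
  rewrite -prodE -[X in _ = _ ^+ X * _]card_ord -prodr_const -big_split /=.
  apply: eq_bigr => k _; rewrite cisX /rootang.
  have -> : (2 * pi / M%:R) *+ k = 2 * pi * k%:R / M%:R :> R.
    by rewrite -mulr_natr; ring.
  by field.
rewrite exprNn -mulrA cabsM cabsX cabsN cabs1 expr1n mul1r mulrBr mulr1.
by rewrite -exprMn mulrC divfK.
Qed.

Lemma eventually_expr_le (x c : R) : 0 <= x < 1 -> 0 < c ->
  exists M0 : nat, forall M, (M0 <= M)%N -> x ^+ M <= c.
Proof.
move=> /andP[x0 x1] c0.
have /cvgrPdist_le/(_ c c0)[M0 _ M0P] : (fun k : nat => x ^+ k : R) @ \oo --> 0.
  by apply: cvg_expr; rewrite ger0_norm.
exists M0 => M /M0P; rewrite /= sub0r normrN ger0_norm// exprn_ge0//.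
Qed.

(** The larger of $|r|$ and $t$ dominates the other after raising to the power [M]; only equality of
    the two moduli would permit cancellation. *)
Lemma root_gap (r : C) (t : R) : 0 < t -> cabs r != t ->
  exists M0 : nat, forall M, (M0 <= M)%N ->
    cabs r ^+ M / 2 <= cabs (r ^+ M - t%:C%C ^+ M).
Proof.
move=> t0 rt; have r0 := cabs_ge0 r.
have t_norm M : cabs (t%:C%C ^+ M) = t ^+ M by rewrite cabsX cabs_real ger0_norm// ltW.
have [lt_tr|le_rt] := ltP t (cabs r).
  have rp : 0 < cabs r by exact: lt_trans lt_tr.
  have [|M0 M0P] := @eventually_expr_le (t / cabs r) 2^-1 _ ltac:(by []).
    by rewrite divr_ge0 ?(ltW t0)//= ltr_pdivrMr// mul1r.
  exists M0 => M /M0P; rewrite expr_div_n ler_pdivrMr ?exprn_gt0// => h.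
  have := cabsD (r ^+ M - t%:C%C ^+ M) (t%:C%C ^+ M).
  by rewrite subrK t_norm cabsX; lra.
have lt_rt : cabs r < t by rewrite lt_neqAle rt.
have [|M0 M0P] := @eventually_expr_le (cabs r / t) 2^-1 _ ltac:(by []).
  by rewrite divr_ge0 ?(ltW t0)//= ltr_pdivrMr// mul1r.
exists M0 => M /M0P; rewrite expr_div_n ler_pdivrMr ?exprn_gt0// => h.
have := cabsD (t%:C%C ^+ M - r ^+ M) (r ^+ M).
have := exprn_ge0 M (ltW t0).
by rewrite subrK t_norm cabsX (cabsB (r ^+ M)); lra.
Qed.

Lemma avoid_radii (s : seq C) (u : R) : u < 1 ->
  exists2 t, u < t < 1 & all (fun r => cabs r != t) s.
Proof.
move=> u1; have [v /andP[uv v1] vP] : exists2 v, u <= v < 1 &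
    all (fun r => (cabs r <= v) || (1 <= cabs r)) s.
  elim: s => [|r s [v /andP[uv v1] vP]]; first by exists u; rewrite ?lexx.
  have [r1|r1] := leP 1 (cabs r).
    by exists v; rewrite ?uv //= r1 orbT.
  exists (Num.max v (cabs r)); first by rewrite le_max uv gt_max v1.
  rewrite /= le_max lexx orbT /=; apply: sub_all vP => x /orP[xv|->]; last by rewrite orbT.
  by rewrite le_max xv.
exists ((1 + v) / 2); first by apply/andP; split; lra.
apply: sub_all vP => r /orP[|] h; apply/eqP => rE; move: h; rewrite rE; lra.
Qed.

Lemma powR_prod (I : Type) (s : seq I) (F : I -> R) (al : R) :
  (forall i, 0 <= F i) ->
  \prod_(i <- s) powR (F i) al = powR (\prod_(i <- s) F i) al.
Proof.
move=> F0; elim: s => [|i s IH]; first by rewrite !big_nil powR1.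
by rewrite !big_cons IH -powRM// prodr_ge0.
Qed.

(** A discrete Jensen inequality. The product of $|P|$ over the [M] points splits over the roots,
    and each root costs at most a factor 2 whatever [M] is. The arithmetic mean dominates the
    geometric mean, and the [M]-th root makes the total cost $2^{\deg P}$ tend to 1. *)
Lemma poly_jensen (P : {poly C}) (al t e : R) : 0 < al -> 0 < t -> 0 < e ->
  (forall r, root P r -> cabs r != t) ->
  exists M0, forall M, (M0 <= M)%N -> (0 < M)%N ->
    powR (cabs P.[0]) al - e <=
    M%:R^-1 * \sum_(k < M) powR (cabs P.[t%:C%C * cis (rootang R M k)]) al.
Proof.
move=> al0 t0 e0 rootP; have [P0|Pneq0] := eqVneq P 0.
  exists 0%N => M _ M0; rewrite P0.
  have -> : powR (cabs (0 : {poly C}).[0]) al = 0.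
    by rewrite horner0 cabs0 powR0// gt_eqF.
  apply: (@le_trans _ _ 0); first by rewrite sub0r oppr_le0 ltW.
  by rewrite mulr_ge0 ?invr_ge0// sumr_ge0// => k _; exact: powR_ge0.
have [s Ps] := closed_field_poly_normal P.
set c := lead_coef P in Ps.
have rs r : r \in s -> cabs r != t.
  move=> rs; apply: rootP; rewrite Ps rootZ ?lead_coef_eq0//.
  by rewrite root_prod_XsubC.
have [M1 M1P] : exists M0 : nat, forall M, (M0 <= M)%N -> (0 < M)%N ->
    cabs P.[0] ^+ M / 2 ^+ size s <=
    \prod_(k < M) cabs P.[t%:C%C * cis (rootang R M k)].
  have evalP x : cabs P.[x] = cabs c * \prod_(r <- s) cabs (x - r).
    rewrite {1}Ps hornerZ cabsM horner_prod cabs_prod; congr (_ * _).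
    by apply: eq_bigr => r _; rewrite hornerXsubC.
  have prodP M : (0 < M)%N -> \prod_(k < M) cabs P.[t%:C%C * cis (rootang R M k)] =
      cabs c ^+ M * \prod_(r <- s) cabs (r ^+ M - t%:C%C ^+ M).
    move=> M0; rewrite (eq_bigr _ (fun k _ => evalP _)).
    rewrite big_split /= prodr_const card_ord exchange_big /=; congr (_ * _).
    by apply: eq_bigr => r _; rewrite -prod_root_unity.
  have [M0 M0P] : exists M0 : nat, forall M, (M0 <= M)%N ->
      \prod_(r <- s) (cabs r ^+ M / 2) <= \prod_(r <- s) cabs (r ^+ M - t%:C%C ^+ M).
    elim: s rs {Ps evalP prodP} => [|r s IH] rs; first by exists 0%N => M _; rewrite !big_nil.
    have [M0 M0P] := IH (fun x xs => rs x (mem_behead (s := r :: s) xs)).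
    have [M1 M1P] := root_gap t0 (rs r (mem_head _ _)).
    exists (maxn M0 M1) => M; rewrite geq_max => /andP[/M0P h0 /M1P h1].
    rewrite !big_cons ler_pM ?divr_ge0 ?exprn_ge0 ?cabs_ge0//.
    by rewrite prodr_ge0// => x _; rewrite divr_ge0// exprn_ge0// cabs_ge0.
  exists M0 => M /M0P h M_gt0; rewrite prodP//; apply: le_trans (ler_wpM2l _ h); last first.
    by rewrite exprn_ge0// cabs_ge0.
  rewrite evalP exprMn -mulrA; apply: ler_wpM2l; first by rewrite exprn_ge0// cabs_ge0.
  rewrite big_split /= prodrXl; under eq_bigr do rewrite sub0r cabsN.
  rewrite ler_wpM2l//; first by rewrite exprn_ge0// prodr_ge0// => r _; exact: cabs_ge0.
  by rewrite big_const_seq count_predT iter_mulr_1 exprVn.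
set p0 := powR (cabs P.[0]) al.
have p00 : 0 <= p0 by exact: powR_ge0.
(* This factor is below 1 and satisfies [q * p0 >= p0 - e]; its powers eventually fall below the
   loss caused by the roots. *)
pose q := 1 - e / (p0 + e).
have pe0 : 0 < p0 + e by rewrite ltr_wpDl.
have q01 : 0 <= q < 1.
  by rewrite subr_ge0 ler_pdivrMr// mul1r lerDr p00 gtrBl divr_gt0.
have [|M2 M2P] := eventually_expr_le q01 (_ : 0 < powR (2 ^+ size s)^-1 al).
  by rewrite powR_gt0// invr_gt0 exprn_gt0.
exists (maxn M1 M2) => M; rewrite geq_max => /andP[/M1P h1 /M2P h2] M_gt0.
have {}h1 := h1 M_gt0.
pose x (k : 'I_M) := powR (cabs P.[t%:C%C * cis (rootang R M k)]) al.
set A := M%:R^-1 * _.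
have A0 : 0 <= A.
  by rewrite mulr_ge0 ?invr_ge0// sumr_ge0// => k _; exact: powR_ge0.
have agm : \prod_(k < M) x k <= A ^+ M.
  have := @leif_AGM R 'I_M predT x; rewrite card_ord => /(_ _)[k _|+ _].
    by rewrite /x powR_ge0.
  by rewrite /A mulrC; apply.
have prodE : \prod_(k < M) x k =
    powR (\prod_(k < M) cabs P.[t%:C%C * cis (rootang R M k)]) al.
  by apply: powR_prod => k; exact: cabs_ge0.
have q0 : 0 <= q by case/andP: q01.
have p0M : p0 ^+ M = powR (cabs P.[0] ^+ M) al.
  by rewrite -(powR_mulrn M p00) -(powR_mulrn M (cabs_ge0 _)) powRAC.
have qp : q * p0 <= A.
  rewrite -(@ler_pXn2r _ M) ?nnegrE ?(mulr_ge0 q0 p00)//.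
  apply: le_trans agm; rewrite prodE exprMn p0M.
  apply: (@le_trans _ _ (powR (cabs P.[0] ^+ M / 2 ^+ size s) al)).
    rewrite powRM ?exprn_ge0 ?cabs_ge0 ?invr_ge0 ?exprn_ge0// mulrC.
    by rewrite ler_wpM2l// powR_ge0.
  apply: ge0_ler_powR; rewrite ?nnegrE ?(ltW al0)//.
    by rewrite divr_ge0 ?exprn_ge0 ?cabs_ge0.
  by rewrite prodr_ge0// => k _; exact: cabs_ge0.
apply: le_trans qp; rewrite /q mulrBl mul1r lerD2l lerN2 mulrAC ler_pdivrMr//.
by rewrite ler_pM2l// lerDl ltW.
Qed.

End DiscreteJensen.

(** * Holomorphic polynomials and the sub-mean value property of their powers *)

Section HolomorphicPolynomials.
Variables (R : realType) (n : nat).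
Local Notation E := ('I_n -> R[i]).

Inductive hpoly : (E -> R[i]) -> Prop :=
| hpoly_cst c : hpoly (fun=> c)
| hpoly_coord i : hpoly (fun z => z i)
| hpolyD p q : hpoly p -> hpoly q -> hpoly (fun z => p z + q z)
| hpolyM p q : hpoly p -> hpoly q -> hpoly (fun z => p z * q z).

Lemma hpoly_ext p q : hpoly p -> p =1 q -> hpoly q.
Proof. by move=> hp /funext <-. Qed.

Lemma hpolyX p k : hpoly p -> hpoly (fun z => p z ^+ k).
Proof.
move=> hp; elim: k => [|k IH]; first exact: (hpoly_ext (hpoly_cst 1)).
by apply: (hpoly_ext (hpolyM hp IH)) => z; rewrite exprS.
Qed.

Lemma hpoly_sum (I : Type) (s : seq I) (P : pred I) (F : I -> E -> R[i]) :
  (forall i, hpoly (F i)) -> hpoly (fun z => \sum_(i <- s | P i) F i z).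
Proof.
move=> hF; elim: s => [|i s IH].
  by apply: (hpoly_ext (hpoly_cst 0)) => z; rewrite big_nil.
case Pi : (P i); last by apply: (hpoly_ext IH) => z; rewrite big_cons Pi.
by apply: (hpoly_ext (hpolyD (hF i) IH)) => z; rewrite big_cons Pi.
Qed.

Lemma hpoly_prod (I : Type) (s : seq I) (P : pred I) (F : I -> E -> R[i]) :
  (forall i, hpoly (F i)) -> hpoly (fun z => \prod_(i <- s | P i) F i z).
Proof.
move=> hF; elim: s => [|i s IH].
  by apply: (hpoly_ext (hpoly_cst 1)) => z; rewrite big_nil.
case Pi : (P i); last by apply: (hpoly_ext IH) => z; rewrite big_cons Pi.
by apply: (hpoly_ext (hpolyM (hF i) IH)) => z; rewrite big_cons Pi.
Qed.

Lemma hpoly_affine p (c : R[i]) (h : E) : hpoly p ->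
  hpoly (fun z => p (cscale c z + h)).
Proof.
elim=> [d|i|p1 p2 _ h1 _ h2|p1 p2 _ h1 _ h2].
- exact: hpoly_cst.
- exact: (hpolyD (hpolyM (hpoly_cst c) (hpoly_coord i)) (hpoly_cst (h i))).
- exact: hpolyD.
- exact: hpolyM.
Qed.

Lemma hpoly_ccont p : hpoly p -> ccont p.
Proof.
elim=> [d|i|p1 p2 _ h1 _ h2|p1 p2 _ h1 _ h2].
- exact: ccont_cst.
- exact: ccont_coord.
- exact: ccontD.
- exact: ccontM.
Qed.

Lemma hpoly_line p (a b : E) : hpoly p ->
  exists P : {poly R[i]}, forall x, p (a + cscale x b) = P.[x].
Proof.
elim=> [d|i|p1 p2 _ [P1 h1] _ [P2 h2]|p1 p2 _ [P1 h1] _ [P2 h2]].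
- by exists d%:P => x; rewrite hornerC.
- exists ((a i)%:P + (b i)%:P * 'X) => x.
  by rewrite hornerD hornerM hornerX !hornerC mulrC.
- by exists (P1 + P2) => x; rewrite hornerD h1 h2.
- by exists (P1 * P2) => x; rewrite hornerM h1 h2.
Qed.

(* The radius is perturbed to [t < 1] so that no zero lies on the circle. *)
Lemma hpoly_powR_smv p (al : R) : 0 < al -> hpoly p ->
  smv (fun z => powR (cabs (p z)) al).
Proof.
move=> al0 hp; set F := fun z => _.
have cF : cont F.
  apply: cont_powR => // [z|]; first exact: cabs_ge0.
  exact: cont_cabs (hpoly_ccont hp).
apply: smv_of_avg => a b e e0; have e20 : 0 < e / 2 by rewrite divr_gt0.
have [d d0 dP] := cont_unif (cnorm a + cnorm b) cF e20.
have [P PE] := hpoly_line a b hp.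
have b1 : 0 < cnorm b + 1 by rewrite ltr_wpDl// cnorm_ge0.
pose u := Num.max 0 (1 - d / (cnorm b + 1)).
have u1 : u < 1 by rewrite gt_max ltr01 gtrBl divr_gt0.
pose s := if P == 0 then [::] else sval (closed_field_poly_normal P).
have [t /andP[ut t1] tP] := avoid_radii s u1.
have t0 : 0 < t by apply: le_lt_trans ut; rewrite le_max lexx.
have [Pz|Pnz] := eqVneq P 0.
  exists 0%N => M _ M0.
  have -> : F a = 0.
    have := PE 0; rewrite Pz horner0 => pa0.
    rewrite /F -[a in p a](_ : a + cscale 0 b = a) ?pa0 ?cabs0 ?powR0 ?gt_eqF//.
    by apply/funext => i; change (a i + 0 * b i = a i); rewrite mul0r addr0.
  apply: (@le_trans _ _ 0); first by rewrite sub0r oppr_le0 ltW.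
  by rewrite mulr_ge0 ?invr_ge0// sumr_ge0// => k _; exact: powR_ge0.
have rootP r : root P r -> cabs r != t.
  move=> rP; apply: (allP tP); rewrite /s (negbTE Pnz).
  case: closed_field_poly_normal => /= l lE; move: rP; rewrite lE.
  by rewrite rootZ ?lead_coef_eq0// root_prod_XsubC.
have [M0 M0P] := poly_jensen al0 t0 e20 rootP.
exists M0 => M M0M M_gt0; have := M0P M M0M M_gt0.
rewrite -!PE.
have -> : a + cscale 0 b = a.
  by apply/funext => i; change (a i + 0 * b i = a i); rewrite mul0r addr0.
set A := M%:R^-1 * _ => h.
have AE : A = avg M F a (cscale t%:C%C b).
  rewrite /A /avg; congr (_ * _); apply: eq_bigr => k _.
  by rewrite /F /circ cscaleA -PE [t%:C%C * _]mulrC.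
suff : `|avg M F a (cscale t%:C%C b) - avg M F a b| <= e / 2.
  by rewrite -AE => /ler_normlP[_]; move: h; rewrite -/(F a); lra.
apply: avg_dist => // k _; apply/ltW/dP; first exact: cnorm_circ.
have -> : circ a (cscale t%:C%C b) (rootang R M k) - circ a b (rootang R M k) =
    cscale (cis (rootang R M k)) (cscale (t - 1)%:C%C b).
  apply/funext => i; rewrite !cscaleA.
  change (a i + cis (rootang R M k) * (t%:C%C * b i) - (a i + cis (rootang R M k) * b i) =
     cis (rootang R M k) * (t - 1)%:C%C * b i).
  by rewrite rmorphB rmorph1; ring.
rewrite !cnormZ cabs_cis mul1r cabs_real distrC ger0_norm ?subr_ge0 ?(ltW t1)//.
apply: (@le_lt_trans _ _ ((1 - t) * (cnorm b + 1))).
  by rewrite ler_wpM2l ?subr_ge0 ?(ltW t1)// lerDl.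
rewrite -ltr_pdivlMr// ltrBlDr -ltrBlDl.
by apply: le_lt_trans ut; rewrite le_max lexx orbT.
Qed.

End HolomorphicPolynomials.

(** * The complex exponential as a limit of polynomials *)

Section ComplexExponential.
Variable R : realType.
Local Notation C := R[i].
Implicit Types x y : C.

Definition cexp x : C := (expR (complex.Re x))%:C%C * cis (complex.Im x).

Lemma cabs_cexp x : cabs (cexp x) = expR (complex.Re x).
Proof. by rewrite cabsM cabs_cis mulr1 cabs_real ger0_norm// expR_ge0. Qed.

Lemma cexpD x y : cexp (x + y) = cexp x * cexp y.
Proof. by rewrite /cexp cReD cImD expRD rmorphM cisD; ring. Qed.

Lemma cexp0 : cexp 0 = 1.
Proof. by rewrite /cexp expR0 cis0 mulr1. Qed.

Lemma cexpX x k : cexp x ^+ k = cexp (x *+ k).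
Proof.
by elim: k => [|k IH]; rewrite ?mulr0n ?cexp0// exprS mulrS cexpD IH.
Qed.

Lemma expR_taylor1 (t : R) : `|t| <= 1 -> `|expR t - 1 - t| <= expR 1 * t ^+ 2.
Proof.
move=> t1.
have d (s : R) : is_derive s (1 : R) (fun r : R => expR r - r) (expR s - 1).
  by apply: is_deriveB.
have [c ct /=] := mvt_origin t d; rewrite expR0 subr0 => dE.
have -> : expR t - 1 - t = (expR c - 1) * t by rewrite -dE; ring.
have [c' c'c] := mvt_origin c (@is_derive_expR R); rewrite expR0 => ->.
rewrite !normrM -mulrA ler_pM ?mulr_ge0//.
  rewrite ger0_norm ?expR_ge0// ler_expR; apply: le_trans (ler_norm _) _.
  by apply: le_trans c'c _; exact: le_trans ct t1.
by rewrite -[t ^+ 2]ger0_norm ?sqr_ge0// normrX expr2 ler_wpM2r.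
Qed.

Lemma cexp_taylor1 x : cabs x <= 1 ->
  cabs (cexp x - 1 - x) <= (expR 1 + 5) * cabs x ^+ 2.
Proof.
move=> x1; set s := complex.Re x; set t := complex.Im x.
have sx : `|s| <= cabs x by exact: Re_le_cabs.
have tx : `|t| <= cabs x by exact: Im_le_cabs.
have x0 := cabs_ge0 x.
have -> : cexp x - 1 - x = (expR s - 1 - s)%:C%C * cis t +
    (1 + s)%:C%C * (cis t - 1 - Complex 0 t) + Complex 0 (s * t).
  by rewrite /cexp -/s -/t; apply: cplx_eqP; rewrite ?(cReD, cReN, cReM, cImD, cImN, cImM) /=;
     rewrite -/s -/t; ring.
apply: le_trans (cabsD _ _) _.
have sq (r : R) : `|r| <= cabs x -> r ^+ 2 <= cabs x ^+ 2.
  by move=> rx; rewrite -real_normK ?num_real// ler_pXn2r ?nnegrE.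
have -> : (expR 1 + 5) * cabs x ^+ 2 =
   (expR 1 * cabs x ^+ 2 + 4 * cabs x ^+ 2) + cabs x ^+ 2 by ring.
apply: lerD; last first.
  rewrite cabs_def /= expr0n add0r sqrtr_sqr normrM expr2.
  by apply: ler_pM.
apply: le_trans (cabsD _ _) _; apply: lerD.
  rewrite cabsM cabs_cis mulr1 cabs_real; apply: le_trans (expR_taylor1 _) _.
    exact: le_trans sx x1.
  by rewrite ler_wpM2l ?expR_ge0// sq.
rewrite cabsM cabs_real.
have h1 : `|1 + s| <= 2.
  by apply: le_trans (ler_normD _ _) _; rewrite normr1; have := le_trans sx x1; lra.
have h2 : cabs (cis t - 1 - Complex 0 t) <= 2 * cabs x ^+ 2.
  apply: le_trans (cabs_le_ReIm _) _; rewrite !(cReD, cReN, cImD, cImN) /= oppr0 !addr0.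
  rewrite mulr_natl mulr2n; apply: lerD.
    by apply: le_trans (cos_taylor1 t) _; exact: sq.
  apply: le_trans (sin_taylor1 t) _; rewrite exprS.
  rewrite -[X in _ <= X]mul1r; apply: ler_pM => //.
    exact: le_trans tx x1.
  by rewrite real_normK ?num_real// sq.
by rewrite (_ : 4 = 2 * 2 :> R) -?mulrA ?ler_pM ?cabs_ge0//; lra.
Qed.

Lemma cabs_exprB_le x y (K : R) k : cabs x <= K -> cabs y <= K ->
  cabs (x ^+ k.+1 - y ^+ k.+1) <= k.+1%:R * K ^+ k * cabs (x - y).
Proof.
move=> xK yK; have K0 : 0 <= K by apply: le_trans xK; exact: cabs_ge0.
rewrite subrXX cabsM mulrC ler_wpM2r ?cabs_ge0//.
apply: le_trans (cabs_sum _ _ _) _.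
apply: (@le_trans _ _ (\sum_(i < k.+1) K ^+ k)); last first.
  by rewrite sumr_const card_ord mulr_natl.
apply: ler_sum => i _; rewrite cabsM !cabsX /=.
have -> : K ^+ k = K ^+ (k - i) * K ^+ i by rewrite -exprD subnK// -ltnS.
by apply: ler_pM; rewrite ?exprn_ge0 ?cabs_ge0//; apply: lerXn2r;
   rewrite ?nnegrE ?cabs_ge0.
Qed.

(** With [y] the quotient of [x] by [k.+1], the bases [cexp y] and [1 + y] differ by a multiple of
    the inverse square of [k.+1]. Raising to the power [k.+1] multiplies the difference by at most
    [k.+1] times a constant. *)
Lemma cexp_limit (rho e : R) : 0 < e -> exists k : nat, forall x, cabs x <= rho ->
  cabs (cexp x - (1 + x / k.+1%:R) ^+ k.+1) <= e.
Proof.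
move=> e0; pose r := Num.max rho 1.
have r0 : 0 < r by rewrite lt_max ltr01 orbT.
pose K := (expR 1 + 5) * r ^+ 2 * expR r.
have K0 : 0 < K.
  by rewrite !mulr_gt0 ?expR_gt0 ?exprn_gt0// addr_gt0 ?expR_gt0.
exists (maxn (Num.truncn r) (Num.truncn (K / e))) => x xrho.
set k := maxn _ _.
have k0 : (0 : R) < k.+1%:R by [].
have kr : r <= k.+1%:R.
  by apply/ltW/(lt_le_trans (truncnS_gt r)); rewrite ler_nat ltnS leq_maxl.
have kK : K / e <= k.+1%:R.
  by apply/ltW/(lt_le_trans (truncnS_gt (K / e))); rewrite ler_nat ltnS leq_maxr.
have xr : cabs x <= r by rewrite le_max xrho.
pose y := x / k.+1%:R.
have yE : cabs y = cabs x / k.+1%:R by rewrite cabsM cabsV cabs_nat.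
have y1 : cabs y <= 1 by rewrite yE ler_pdivrMr// mul1r (le_trans xr).
have -> : cexp x = cexp y ^+ k.+1.
  by rewrite cexpX /y -mulrnAl -[x *+ _]mulr_natr mulfK// pnatr_eq0.
have ay : cabs (cexp y) <= expR (cabs y).
  by rewrite cabs_cexp ler_expR; apply: le_trans (ler_norm _) (Re_le_cabs _).
have by1 : cabs (1 + y) <= expR (cabs y).
  by apply: le_trans (cabsD _ _) _; rewrite cabs1; exact: expR_ge1Dx.
apply: le_trans (cabs_exprB_le _ ay by1) _.
have eK : expR (cabs y) ^+ k <= expR r.
  rewrite -expRM_natl ler_expR yE; apply: (@le_trans _ _ (k.+1%:R * (cabs x / k.+1%:R))).
    by rewrite ler_wpM2r ?divr_ge0 ?cabs_ge0// ler_nat.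
  by rewrite mulrC divfK ?gt_eqF.
have dy : cabs (cexp y - (1 + y)) <= (expR 1 + 5) * r ^+ 2 / k.+1%:R ^+ 2.
  rewrite opprD addrA; apply: le_trans (cexp_taylor1 y1) _.
  rewrite -mulrA ler_wpM2l ?addr_ge0 ?expR_ge0// yE expr_div_n ler_wpM2r//.
  by rewrite ler_pXn2r ?nnegrE ?cabs_ge0 ?(ltW r0).
apply: (@le_trans _ _ (k.+1%:R * expR r * ((expR 1 + 5) * r ^+ 2 / k.+1%:R ^+ 2))).
  apply: ler_pM => //; rewrite ?cabs_ge0 ?mulr_ge0 ?exprn_ge0 ?expR_ge0//.
  by rewrite ler_wpM2l.
have -> : k.+1%:R * expR r * ((expR 1 + 5) * r ^+ 2 / k.+1%:R ^+ 2) = K / k.+1%:R.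
  by rewrite /K; move: (k.+1%:R) k0 => m m0; field; exact: lt0r_neq0.
by rewrite ler_pdivrMr// mulrC -ler_pdivrMr.
Qed.

End ComplexExponential.

(** * Entire functions *)

Section Entire.
Variables (R : realType) (n : nat).
Local Notation E := ('I_n -> R[i]).
Implicit Types f g : E -> R[i].

(* Entire functions, encoded as locally uniform limits of holomorphic
   polynomials. *)
Definition entire f := forall rho e : R, 0 < e ->
  exists p, hpoly p /\ forall z, cnorm z <= rho -> cabs (f z - p z) <= e.

Lemma entire_hpoly (p : E -> R[i]) : hpoly p -> entire p.
Proof. by move=> hp rho e e0; exists p; split=> // z _; rewrite subrr cabs0 ltW. Qed.

Lemma entire_lim f : (forall rho e : R, 0 < e ->
    exists2 g, entire g & forall z, cnorm z <= rho -> cabs (f z - g z) <= e) ->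
  entire f.
Proof.
move=> lim rho e e0; have e20 : 0 < e / 2 by rewrite divr_gt0.
have [g eg fg] := lim rho _ e20; have [p [hp gp]] := eg rho _ e20.
exists p; split=> // z zr; have -> : f z - p z = (f z - g z) + (g z - p z).
  by rewrite subrKA.
by rewrite [e]splitr; apply: le_trans (cabsD _ _) _; apply: lerD; [exact: fg|exact: gp].
Qed.

Lemma entire_ext f g : entire f -> f =1 g -> entire g.
Proof. by move=> ef /funext <-. Qed.

Lemma entireD f g : entire f -> entire g -> entire (fun z => f z + g z).
Proof.
move=> ef eg rho e e0; have e20 : 0 < e / 2 by rewrite divr_gt0.
have [p [hp fp]] := ef rho _ e20; have [q [hq gq]] := eg rho _ e20.
exists (fun z => p z + q z); split; first exact: hpolyD.
move=> z zr; rewrite opprD addrACA [e]splitr.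
by apply: le_trans (cabsD _ _) _; apply: lerD; [exact: fp|exact: gq].
Qed.

Lemma hpoly_bounded (p : E -> R[i]) (rho : R) : hpoly p ->
  exists2 M, 0 <= M & forall z, cnorm z <= rho -> cabs (p z) <= M.
Proof.
move=> hp; have [M M0 MP] := cont_bounded rho (cont_cabs (hpoly_ccont hp)).
by exists M => // z /MP; rewrite ger0_norm// cabs_ge0.
Qed.

Lemma entireM f g : entire f -> entire g -> entire (fun z => f z * g z).
Proof.
move=> ef eg rho e e0.
have [p1 [hp1 fp1]] := ef rho 1 ltr01.
have [K1 K10 p1K] := hpoly_bounded rho hp1.
pose d := e / (2 * (K1 + 1)).
have d0 : 0 < d by rewrite divr_gt0// mulr_gt0// ltr_wpDl.
have [q [hq gq]] := eg rho d d0.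
have [K2 K20 qK] := hpoly_bounded rho hq.
pose d' := e / (2 * (K2 + 1)).
have d'0 : 0 < d' by rewrite divr_gt0// mulr_gt0// ltr_wpDl.
have [p [hp fp]] := ef rho d' d'0.
exists (fun z => p z * q z); split; first exact: hpolyM.
move=> z zr.
have -> : f z * g z - p z * q z = f z * (g z - q z) + (f z - p z) * q z by ring.
have fz : cabs (f z) <= K1 + 1.
  have -> : f z = (f z - p1 z) + p1 z by rewrite subrK.
  by apply: le_trans (cabsD _ _) _; rewrite addrC lerD ?p1K ?fp1.
apply: le_trans (cabsD _ _) _; rewrite !cabsM.
have eE : e = (K1 + 1) * d + d' * (K2 + 1).
  by rewrite /d /d'; field; rewrite !lt0r_neq0 ?ltr_wpDl.
rewrite [leRHS]eE; apply: lerD; apply: ler_pM; rewrite ?cabs_ge0 ?fz ?gq ?fp//.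
by apply: le_trans (qK z zr) _; rewrite lerDl.
Qed.

Lemma entire_cst (c : R[i]) : entire (fun=> c).
Proof. by apply: entire_hpoly; exact: hpoly_cst. Qed.

Lemma entire_sum (I : Type) (s : seq I) (P : pred I) (F : I -> E -> R[i]) :
  (forall i, entire (F i)) -> entire (fun z => \sum_(i <- s | P i) F i z).
Proof.
move=> hF; elim: s => [|i s IH].
  by apply: (entire_ext (entire_cst 0)) => z; rewrite big_nil.
case Pi : (P i); last by apply: (entire_ext IH) => z; rewrite big_cons Pi.
by apply: (entire_ext (entireD (hF i) IH)) => z; rewrite big_cons Pi.
Qed.

Lemma entire_prod (I : Type) (s : seq I) (P : pred I) (F : I -> E -> R[i]) :
  (forall i, entire (F i)) -> entire (fun z => \prod_(i <- s | P i) F i z).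
Proof.
move=> hF; elim: s => [|i s IH].
  by apply: (entire_ext (entire_cst 1)) => z; rewrite big_nil.
case Pi : (P i); last by apply: (entire_ext IH) => z; rewrite big_cons Pi.
by apply: (entire_ext (entireM (hF i) IH)) => z; rewrite big_cons Pi.
Qed.

Lemma entire_cexp (p : E -> R[i]) : hpoly p -> entire (fun z => cexp (p z)).
Proof.
move=> hp rho e e0; have [M M0 pM] := hpoly_bounded rho hp.
have [k kP] := cexp_limit M e0.
exists (fun z => (1 + p z / k.+1%:R) ^+ k.+1); split.
  apply: (@hpolyX _ _ (fun z => 1 + p z / k.+1%:R)).
  pose c : R[i] := k.+1%:R^-1.
  have h1 := @hpoly_cst R n (1 : R[i]); have h2 := @hpoly_cst R n c.
  exact: (hpolyD h1 (hpolyM hp h2)).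
by move=> z /pM; exact: kP.
Qed.

Lemma entire_affine f (c : R[i]) (h : E) : entire f ->
  entire (fun z => f (cscale c z + h)).
Proof.
move=> ef rho e e0; have [p [hp fp]] := ef (cabs c * rho + cnorm h) e e0.
exists (fun z => p (cscale c z + h)); split; first exact: hpoly_affine.
move=> z zr; apply: fp; apply: le_trans (cnormD _ _) _; rewrite lerD2r cnormZ.
by rewrite ler_wpM2l// cabs_ge0.
Qed.

Lemma entire_ccont f : entire f -> ccont f.
Proof.
move=> ef; apply: ccontP => z e e0; have e30 : 0 < e / 3 by rewrite divr_gt0.
have [p [hp fp]] := ef (cnorm z + 1) _ e30.
have [cp1 cp2] := hpoly_ccont hp.
have e60 : 0 < e / 6 by rewrite divr_gt0.
have [d1 [d10 d1P]] := cp1 z _ e60; have [d2 [d20 d2P]] := cp2 z _ e60.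
exists (Num.min 1 (Num.min d1 d2)); split; first by rewrite !lt_min ltr01 d10.
move=> w; rewrite !lt_min => /and3P[w1 /d1P h1 /d2P h2].
have wr : cnorm w <= cnorm z + 1.
  rewrite -[w](subrK z) addrC; apply: le_trans (cnormD _ _) _.
  by rewrite lerD2l ltW.
have -> : f w - f z = (f w - p w) + (p w - p z) - (f z - p z) by ring.
apply: le_trans (cabsD _ _) _; rewrite cabsN.
have -> : e = e / 3 + (e / 6 + e / 6) + e / 3 by field.
apply: lerD; last by apply: fp; rewrite lerDl.
apply: le_trans (cabsD _ _) _; apply: lerD; first exact: fp.
apply: le_trans (cabs_le_ReIm _) _; rewrite cReD cImD cReN cImN.
by apply: lerD; exact: ltW.
Qed.

Lemma smv_lim (F : E -> R) : (forall rho e : R, 0 < e ->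
    exists2 G, smv G /\ cont G & forall z, cnorm z <= rho -> `|F z - G z| <= e) ->
  smv F.
Proof.
move=> lim; apply: smv_of_avg => a b e e0; have e30 : 0 < e / 3 by rewrite divr_gt0.
have [G [smvG cG] FG] := lim (cnorm a + cnorm b) _ e30.
have [M0 M0P] := smvG a b G cG (fun t => lexx _) _ e30.
exists M0 => M /M0P h M_gt0; have {}h := h M_gt0.
have /ler_normlP[h1 h2] := @avg_dist R n M F G a b a b (e / 3) M_gt0
  (fun k _ => FG _ (cnorm_circ _ _ _)).
have /ler_normlP[h3 h4] : `|F a - G a| <= e / 3 by apply: FG; rewrite lerDl cnorm_ge0.
have : e = e / 3 + e / 3 + e / 3 by field.
lra.
Qed.

Lemma entire_sqr_smv f : entire f -> smv (fun z => cabs (f z) ^+ 2).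
Proof.
move=> ef; apply: smv_lim => rho e e0.
have [p1 [hp1 fp1]] := ef rho 1 ltr01.
have [K K0 pK] := hpoly_bounded rho hp1.
pose d := Num.min 1 (e / (2 * (K + 1) + 1)).
have K2 : 0 < 2 * (K + 1) + 1 by rewrite ltr_wpDl// mulr_ge0// addr_ge0.
have d0 : 0 < d by rewrite lt_min ltr01 divr_gt0.
have [p [hp fp]] := ef rho d d0.
exists (fun z => cabs (p z) ^+ 2).
  split; last exact: cont_sqr_cabs (hpoly_ccont hp).
  have := @hpoly_powR_smv R n p 2 ltac:(by []) hp.
  congr smv; apply/funext => z.
  by rewrite powR_mulrn ?cabs_ge0.
move=> z zr.
have fz : cabs (f z) <= K + 1.
  have -> : f z = (f z - p1 z) + p1 z by rewrite subrK.
  by apply: le_trans (cabsD _ _) _; rewrite addrC lerD ?pK ?fp1.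
have dfp : `|cabs (f z) - cabs (p z)| <= d.
  apply: le_trans (fp z zr); rewrite ler_norml; apply/andP; split.
    have := cabsD (f z) (p z - f z); rewrite addrC subrK cabsB; lra.
  by have := cabsD (f z - p z) (p z); rewrite subrK; lra.
rewrite subr_sqr normrM.
have d1 : d <= 1 by rewrite ge_min lexx.
have sum_le : `|cabs (f z) + cabs (p z)| <= 2 * (K + 1) + 1.
  rewrite ger0_norm ?addr_ge0 ?cabs_ge0//.
  by move: dfp => /ler_normlP[+ _]; lra.
apply: (@le_trans _ _ (d * (2 * (K + 1) + 1))); first exact: ler_pM.
by rewrite -ler_pdivlMr// ge_min lexx orbT.
Qed.

End Entire.

(** * Iterated Lebesgue integrals *)

Section LebesgueInvariance.
Variable R : realType.
Local Notation mu := (@lebesgue_measure R).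

Lemma measurable_affine (s a : R) :
  measurable_fun (setT : set (measurableTypeR R))
    (fun x => s * x + a : measurableTypeR R).
Proof.
apply: (@measurable_funD _ (measurableTypeR R) R setT); last exact: measurable_cst.
apply: (@measurable_funM _ (measurableTypeR R) R setT); first exact: measurable_cst.
exact: measurable_id.
Qed.

Definition affine_map (s a : R) (x : measurableTypeR R) : measurableTypeR R :=
  s * x + a.

HB.instance Definition _ (s a : R) :=
  isMeasurableFun.Build _ _ _ _ (affine_map s a) (measurable_affine s a).

(** The rescaled image of Lebesgue measure under the affine map has the right value on half-open
    intervals, so it is Lebesgue measure by uniqueness. *)
Lemma lebesgue_affine (f : R -> \bar R) (s a : R) : 0 < s ->
  measurable_fun setT f -> (forall x, 0 <= f x)%E ->
  (\int[mu]_x f (s * x + a)%R = (s^-1)%R%:E * \int[mu]_x f x)%E.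
Proof.
move=> s0 mf f0.
have push : (\int[mu]_x f (s * x + a)%R = \int[pushforward mu (affine_map s a)]_x f x)%E.
  by rewrite (ge0_integral_pushforward (measurable_affine s a))// preimage_setT.
pose c : {nonneg R} := NngNum (ltW s0).
pose m : {measure set (measurableTypeR R) -> \bar R} :=
  mscale c (pushforward mu (affine_map s a)).
have leb A : measurable A -> mu A = m (measurable_affine s a) A.
  apply: lebesgue_measure_unique => X [[x y] _ <-] /=.
  rewrite /mscale /= /pushforward.
  have -> : affine_map s a @^-1` `]x, y] = `](x - a) / s, (y - a) / s]%classic.
    apply/seteqP; split => t /=; rewrite !in_itv /= /affine_map => /andP[h1 h2].
      by rewrite ltr_pdivrMr// ler_pdivlMr// mulrC ltrBlDr lerBrDr h1.
    by move: h1 h2; rewrite ltr_pdivrMr// ler_pdivlMr// mulrC ltrBlDr lerBrDr => -> ->.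
  rewrite !lebesgue_measure_itv /= !lte_fin.
  have -> : ((x - a) / s < (y - a) / s) = (x < y).
    by rewrite ltr_pM2r ?invr_gt0// ltrD2r.
  case: ifP => _; last by rewrite mule0.
  rewrite -!EFinD -EFinM; congr _%:E.
  by rewrite /c /=; field; exact: lt0r_neq0.
rewrite push.
have -> : (\int[mu]_x f x = \int[m (measurable_affine s a)]_x f x)%E.
  by apply: eq_measure_integral => A mA _; exact: leb.
rewrite ge0_integral_mscale//= muleA -EFinM mulVf ?mul1e//.
exact: lt0r_neq0.
Qed.

Lemma lebesgue_translate (f : R -> \bar R) (a : R) :
  measurable_fun setT f -> (forall x, 0 <= f x)%E ->
  (\int[mu]_x f (x + a)%R = \int[mu]_x f x)%E.
Proof.
move=> mf f0; have := lebesgue_affine a ltr01 mf f0.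
by under eq_integral do rewrite mul1r; rewrite invr1 mul1e.
Qed.

End LebesgueInvariance.

(** * Integration over the complex plane *)

Section PlaneIntegral.
Variable R : realType.
Local Notation C := R[i].
Local Notation mu := (@lebesgue_measure R).
Local Open Scope ereal_scope.

Definition JC (F : C -> \bar R) : \bar R :=
  \int[mu]_x \int[mu]_y F (Complex x y).

(* Measurability of [F] tested against all measurable parametrisations; this
   makes composition and the use of Tonelli's theorem immediate. *)
Definition ucm (F : C -> \bar R) := forall d (T : measurableType d) (x y : T -> R),
  measurable_fun setT x -> measurable_fun setT y ->
  measurable_fun setT (fun t => F (Complex (x t) (y t))).

Lemma ucm_pair F : ucm F ->
  measurable_fun (setT : set (R * R)) (fun p => F (Complex p.1 p.2)).
Proof. by move=> mF; apply: mF; [exact: measurable_fst|exact: measurable_snd]. Qed.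

Lemma ucm_snd F x : ucm F -> measurable_fun setT (fun y : R => F (Complex x y)).
Proof. by move=> mF; apply: mF; [exact: measurable_cst|exact: measurable_id]. Qed.

Lemma ucm_fst F y : ucm F -> measurable_fun setT (fun x : R => F (Complex x y)).
Proof. by move=> mF; apply: mF; [exact: measurable_id|exact: measurable_cst]. Qed.

Lemma ucm_inner F : ucm F -> (forall c, 0 <= F c) ->
  measurable_fun setT (fun x : R => \int[mu]_y F (Complex x y)).
Proof.
move=> mF F0.
by apply: (@measurable_fun_fubini_tonelli_F _ _ _ _ _ mu (fun p : R * R => F (Complex p.1 p.2)));
  [exact: ucm_pair|].
Qed.

Lemma JC_swap F : ucm F -> (forall c, 0 <= F c) ->
  JC F = \int[mu]_y \int[mu]_x F (Complex x y).
Proof.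
move=> mF F0.
by apply: (@fubini_tonelli _ _ _ _ _ mu mu (fun p : R * R => F (Complex p.1 p.2)));
  [exact: ucm_pair|].
Qed.

Lemma JC_ge0 F : (forall c, 0 <= F c) -> 0 <= JC F.
Proof. by move=> F0; apply: integral_ge0 => x _; exact: integral_ge0. Qed.

Lemma JC_mono F G : (forall c, 0 <= F c) -> (forall c, F c <= G c) -> JC F <= JC G.
Proof.
move=> F0 FG; apply: nonneg_integral_mono => x _; first exact: integral_ge0.
exact: nonneg_integral_mono.
Qed.

Lemma JC_add F G : ucm F -> ucm G -> (forall c, 0 <= F c) -> (forall c, 0 <= G c) ->
  JC (fun c => F c + G c) = JC F + JC G.
Proof.
move=> mF mG F0 G0; rewrite /JC.
under eq_integral => x _.
  rewrite ge0_integralD//; [|exact: ucm_snd|exact: ucm_snd].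
  over.
rewrite ge0_integralD//; [|exact: ucm_inner| |exact: ucm_inner].
- by move=> x _; exact: integral_ge0.
- by move=> x _; exact: integral_ge0.
Qed.

Lemma JC_scale (k : R) F : (0 <= k)%R -> ucm F -> (forall c, 0 <= F c) ->
  JC (fun c => k%:E * F c) = k%:E * JC F.
Proof.
move=> k0 mF F0; rewrite /JC.
under eq_integral => x _.
  rewrite ge0_integralZl_EFin//; last exact: ucm_snd.
  over.
rewrite ge0_integralZl_EFin//; last exact: ucm_inner.
by move=> x _; exact: integral_ge0.
Qed.

(* [T] multiplies planar Lebesgue measure by [k^-1]. *)
Definition scales_area (T : C -> C) (k : R) := [/\ (0 <= k)%R,
  forall d (S : measurableType d) (x y : S -> R),
    measurable_fun setT x -> measurable_fun setT y ->
    measurable_fun setT (fun s => complex.Re (T (Complex (x s) (y s)))) /\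
    measurable_fun setT (fun s => complex.Im (T (Complex (x s) (y s)))) &
  forall F, ucm F -> (forall c, 0 <= F c) -> JC (fun c => F (T c)) = k%:E * JC F].

Lemma scales_area_ucm T k F : scales_area T k -> ucm F -> ucm (fun c => F (T c)).
Proof.
move=> [_ mT _] mF d S x y mx my; have [m1 m2] := mT d S x y mx my.
apply: eq_measurable_fun (mF d S _ _ m1 m2) => s _.
by case: (T _).
Qed.

Lemma scales_area_comp T k T' k' : scales_area T k -> scales_area T' k' ->
  scales_area (fun c => T (T' c)) (k * k').
Proof.
move=> sT sT'; have [k0 mT JT] := sT; have [k'0 mT' JT'] := sT'.
split; first exact: mulr_ge0.
  move=> d S x y mx my; have [m1 m2] := mT' d S x y mx my.
  have [m3 m4] := mT d S _ _ m1 m2; split.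
    by apply: eq_measurable_fun m3 => s _; case: (T' _).
  by apply: eq_measurable_fun m4 => s _; case: (T' _).
move=> F mF F0; have uFT := scales_area_ucm sT mF.
rewrite (JT' _ uFT (fun c => F0 (T c))) (JT F mF F0) muleA -EFinM.
by rewrite [(k' * k)%R]mulrC.
Qed.

Lemma scales_area_translate (a : C) : scales_area (fun c => c + a)%R 1.
Proof.
case: a => a b; split => //.
  by move=> d S x y mx my; split; apply: measurable_funD => //; exact: measurable_cst.
move=> F mF F0; rewrite mul1e /JC.
transitivity (\int[mu]_x \int[mu]_y F (Complex (x + a)%R y)).
  by apply: eq_integral => x _; rewrite -(lebesgue_translate b (ucm_snd (x + a)%R mF)).
rewrite (lebesgue_translate a (f := fun x => \int[mu]_y F (Complex x y)))//.
- exact: ucm_inner.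
- by move=> x; exact: integral_ge0.
Qed.

Lemma scales_area_scale (s : R) : (0 < s)%R ->
  scales_area (fun c => s%:C%C * c)%R (s^-1 ^+ 2)%R.
Proof.
move=> s0; split; first by rewrite exprn_ge0// invr_ge0 ltW.
  move=> d S x y mx my; split => /=.
    by under eq_fun do rewrite mul0r subr0; apply: measurable_funM.
  by under eq_fun do rewrite mul0r addr0; apply: measurable_funM.
move=> F mF F0; rewrite /JC.
transitivity (\int[mu]_x ((s^-1)%R%:E * \int[mu]_y F (Complex (s * x + 0)%R y))).
  apply: eq_integral => x _.
  rewrite -(lebesgue_affine 0%R s0 (ucm_snd _ mF))//; apply: eq_integral => y _.
  by congr F; apply: cplx_eqP; rewrite ?(cReM, cImM) /=; ring.
have I0 (x : R) : 0 <= \int[mu]_y F (Complex x y).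
  by apply: integral_ge0 => y _; exact: F0.
have mI := ucm_inner mF F0.
have mI' : measurable_fun setT (fun x : R => \int[mu]_y F (Complex (s * x + 0)%R y)).
  exact: (measurableT_comp mI (measurable_affine s 0%R)).
rewrite (ge0_integralZl_EFin mu measurableT (fun x _ => I0 _) mI'); last first.
  by rewrite invr_ge0 ltW.
rewrite (lebesgue_affine 0%R s0 mI I0).
by rewrite muleA -EFinM expr2.
Qed.

Lemma scales_area_shearX (t : R) :
  scales_area (fun c => c + (t * complex.Im c)%:C%C)%R 1.
Proof.
split => //.
  move=> d S x y mx my; split => /=; last first.
    by under eq_fun do rewrite addr0.
  by apply: measurable_funD => //; apply: measurable_funM => //; exact: measurable_cst.
have mT F : ucm F -> ucm (fun c => F (c + (t * complex.Im c)%:C%C)%R).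
  move=> mF d S x y mx my.
  apply: (mF d S (fun s => x s + t * y s)%R (fun s => y s + 0)%R).
    by apply: measurable_funD => //; apply: measurable_funM => //; exact: measurable_cst.
  by apply: measurable_funD => //; exact: measurable_cst.
move=> F mF F0; rewrite mul1e (JC_swap (mT F mF) (fun c => F0 _)) (JC_swap mF F0).
apply: eq_integral => y _.
rewrite -(lebesgue_translate (t * y)%R (ucm_fst y mF) (fun x => F0 _)).
by apply: eq_integral => x _; congr F; apply: cplx_eqP; rewrite ?(cReD, cImD) /= ?addr0.
Qed.

Lemma scales_area_shearY (t : R) :
  scales_area (fun c => c + Complex 0 (t * complex.Re c))%R 1.
Proof.
split => //.
  move=> d S x y mx my; split => /=.
    by under eq_fun do rewrite addr0.
  by apply: measurable_funD => //; apply: measurable_funM => //; exact: measurable_cst.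
move=> F mF F0; rewrite mul1e; apply: eq_integral => x _.
rewrite -(lebesgue_translate (t * x)%R (ucm_snd x mF))//.
by apply: eq_integral => y _; congr F; apply: cplx_eqP; rewrite ?(cReD, cImD) /= ?addr0.
Qed.

(* A rotation is a product of three shears. *)
Lemma scales_area_rotation (th : R) : (cos th != -1)%R ->
  scales_area (fun c => cis th * c)%R 1.
Proof.
(* The shear parameter is minus the tangent of half the angle, hence the exclusion of cosine -1. *)
move=> c1; pose t := (- (sin th / (1 + cos th)))%R.
have c1' : (1 + cos th != 0)%R by rewrite addrC addr_eq0.
have := scales_area_comp (scales_area_shearX t)
  (scales_area_comp (scales_area_shearY (sin th)) (scales_area_shearX t)).
rewrite !mulr1; congr (scales_area _ 1).
have tE : ((1 + cos th) * t = - sin th)%R by rewrite /t mulrN mulrC divfK.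
have st : (sin th * t = cos th - 1)%R.
  by apply: (mulfI c1'); rewrite mulrCA tE mulrN -expr2 sin2cos2; ring.
apply/funext => -[x y]; apply: cplx_eqP; rewrite ?(cReD, cImD, cReM, cImM) /= ?addr0.
  have -> : (x + t * y + t * (y + sin th * (x + t * y)) =
     x * (1 + sin th * t) + t * y * (2 + sin th * t))%R by ring.
  rewrite st (_ : t * y * (2 + (cos th - 1)) = (1 + cos th) * t * y)%R; last by ring.
  by rewrite tE; ring.
rewrite (_ : y + sin th * (x + t * y) = y * (1 + sin th * t) + sin th * x)%R; last by ring.
by rewrite st; ring.
Qed.

Lemma ucm_gauss (s : R) : ucm (fun c => (expR (- (s * cabs c ^+ 2)))%:E).
Proof.
move=> d T x y mx my; apply/measurable_EFinP.
apply: measurableT_comp; first exact: measurable_expR.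
under eq_fun do rewrite sqr_cabs /=.
apply: measurable_funN; apply: measurable_funM; first exact: measurable_cst.
by apply: measurable_funD; exact: measurable_funX.
Qed.

Lemma JC_gauss (s : R) : (0 < s)%R ->
  JC (fun c => (expR (- (s * cabs c ^+ 2)))%:E) = (pi / s)%:E.
Proof.
have sqrt_pi2 : ((Num.sqrt pi : R) * Num.sqrt pi = pi)%R.
  by rewrite -expr2 sqr_sqrtr// pi_ge0.
have J1 : JC (fun c => (expR (- (cabs c ^+ 2)))%:E) = pi%:E.
  have mg : measurable_fun setT (fun x : R => (gauss_fun x)%:E).
    by apply/measurable_EFinP; exact: measurable_gauss_fun.
  have g0 (x : R) : 0 <= (gauss_fun x)%:E by rewrite lee_fin gauss_fun_ge0.
  transitivity (\int[mu]_x ((Num.sqrt pi)%:E * (gauss_fun x)%:E)); last first.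
    rewrite (ge0_integralZl_EFin mu measurableT (fun x _ => g0 x) mg (sqrtr_ge0 _)).
    by rewrite integralT_gauss -EFinM sqrt_pi2.
  apply: eq_integral => x _.
  transitivity (\int[mu]_y ((gauss_fun x)%:E * (gauss_fun y)%:E)); last first.
    rewrite (ge0_integralZl_EFin mu measurableT (fun x _ => g0 x) mg (gauss_fun_ge0 x)).
    by rewrite integralT_gauss muleC.
  apply: eq_integral => y _; rewrite -EFinM sqr_cabs /gauss_fun -expRD /=.
  by congr (expR _)%:E; rewrite opprD.
move=> s0; have r0 : (0 < Num.sqrt s)%R by rewrite sqrtr_gt0.
have [_ _ JT] := scales_area_scale r0.
have m1 : ucm (fun c => (expR (- (cabs c ^+ 2)))%:E).
  by have := ucm_gauss 1; under eq_fun do rewrite mul1r.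
have {JT} := JT _ m1 (fun c => expR_ge0 _); rewrite J1 -EFinM => JE.
transitivity ((Num.sqrt s)^-1 ^+ 2 * pi)%:E.
  rewrite -JE; congr JC; apply/funext => c.
  by rewrite cabsM cabs_real exprMn real_normK ?num_real// sqr_sqrtr// ltW.
by rewrite exprVn sqr_sqrtr ?(ltW s0)// mulrC.
Qed.

End PlaneIntegral.

(** * Iterated integrals over $\mathbb{C}^n$ *)

Section IteratedIntegral.
Variable R : realType.
Local Notation C := R[i].
Local Notation mu := (@lebesgue_measure R).
Local Open Scope ereal_scope.

Definition vcons n (c : C) (w : 'I_n -> C) : 'I_n.+1 -> C :=
  fun i => oapp w c (unlift ord0 i).

Lemma vcons0 n c (w : 'I_n -> C) : vcons c w ord0 = c.
Proof. by rewrite /vcons unlift_none. Qed.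

Lemma vconsS n c (w : 'I_n -> C) i : vcons c w (lift ord0 i) = w i.
Proof. by rewrite /vcons liftK. Qed.

Lemma vcons_ext n (z : 'I_n.+1 -> C) c (w : 'I_n -> C) :
  z ord0 = c -> (forall i, z (lift ord0 i) = w i) -> z = vcons c w.
Proof.
move=> z0 zS; apply/funext => i; case: (unliftP ord0 i) => [j ->|->].
  by rewrite vconsS zS.
by rewrite vcons0.
Qed.

Fixpoint J n : (('I_n -> C) -> \bar R) -> \bar R :=
  match n with
  | 0 => fun G => G (fun=> 0%R)
  | n'.+1 => fun G => JC (fun c => J (fun w => G (vcons c w)))
  end.

Definition mpt d (T : measurableType d) n (h : T -> 'I_n -> C) := forall i,
  measurable_fun setT (fun t => complex.Re (h t i)) /\
  measurable_fun setT (fun t => complex.Im (h t i)).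

Definition ume n (G : ('I_n -> C) -> \bar R) :=
  forall d (T : measurableType d) (h : T -> 'I_n -> C), mpt h ->
  measurable_fun setT (fun t => G (h t)).

Definition pume dA (A : measurableType dA) n (G : A -> ('I_n -> C) -> \bar R) :=
  forall d (T : measurableType d) (a : T -> A) (h : T -> 'I_n -> C),
  measurable_fun setT a -> mpt h -> measurable_fun setT (fun t => G (a t) (h t)).

Lemma mpt_vcons d (T : measurableType d) n (x y : T -> R) (h : T -> 'I_n -> C) :
  measurable_fun setT x -> measurable_fun setT y -> mpt h ->
  mpt (fun t => vcons (Complex (x t) (y t)) (h t)).
Proof.
move=> mx my mh i; case: (unliftP ord0 i) => [j ->|->].
  by have [m1 m2] := mh j; split;
    [apply: eq_measurable_fun m1|apply: eq_measurable_fun m2] => t _; rewrite vconsS.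
by split; [apply: eq_measurable_fun mx|apply: eq_measurable_fun my] => t _; rewrite vcons0.
Qed.

Lemma J_ge0 n (G : ('I_n -> C) -> \bar R) : (forall w, 0 <= G w) -> 0 <= J G.
Proof.
elim: n G => [|n IH] G G0 /=; first exact: G0.
by apply: JC_ge0 => c; apply: IH => w.
Qed.

Lemma J_mono n (F G : ('I_n -> C) -> \bar R) : (forall w, 0 <= F w) ->
  (forall w, F w <= G w) -> J F <= J G.
Proof.
elim: n F G => [|n IH] F G F0 FG /=; first exact: FG.
apply: JC_mono => c; first by apply: J_ge0 => w.
by apply: IH => w.
Qed.

(** The induction moves the first coordinate into the parameter space; for this reason the statement
    quantifies over every measurable parameter type [A]. *)
Lemma J_measurable n dA (A : measurableType dA) (G : A -> ('I_n -> C) -> \bar R) :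
  (forall a w, 0 <= G a w) -> pume G -> measurable_fun setT (fun a => J (G a)).
Proof.
elim: n dA A G => [|n IH] dA A G G0 mG /=.
  apply: (mG _ A id (fun=> fun=> 0%R)); first exact: measurable_id.
  by case.
pose G' (p : A * R * R) (w : 'I_n -> C) := G p.1.1 (vcons (Complex p.1.2 p.2) w).
have G'0 p w : 0 <= G' p w by exact: G0.
have mG' : pume G'.
  move=> d T a h ma mh.
  have m1 : measurable_fun setT (fun t => (a t).1).
    by apply: measurableT_comp; [exact: measurable_fst|].
  apply: (mG _ T (fun t => (a t).1.1)).
    by apply: measurableT_comp; [exact: measurable_fst|].
  apply: mpt_vcons => //.
    by apply: measurableT_comp m1; exact: measurable_snd.
  by apply: measurableT_comp ma; exact: measurable_snd.
have mJ := IH _ _ G' G'0 mG'.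
have J0 p : 0 <= J (G' p) by apply: J_ge0 => w; exact: G'0.
have mJ1 := @measurable_fun_fubini_tonelli_F _ _ _ _ R mu (fun p => J (G' p)) mJ J0.
apply: (@measurable_fun_fubini_tonelli_F _ _ _ _ R mu
   (fun p : A * R => \int[mu]_y J (G' (p, y))) mJ1) => p.
by apply: integral_ge0 => y _; exact: J0.
Qed.

Lemma J_slice_ucm n (G : ('I_n.+1 -> C) -> \bar R) : (forall w, 0 <= G w) ->
  ume G -> ucm (fun c => J (fun w => G (vcons c w))).
Proof.
move=> G0 mG d T x y mx my.
apply: (@J_measurable n _ T (fun t w => G (vcons (Complex (x t) (y t)) w))) => //.
move=> d' T' a h ma mh; apply: mG; apply: mpt_vcons => //.
  exact: measurableT_comp ma.
exact: measurableT_comp ma.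
Qed.

Lemma slice_ume n (G : ('I_n.+1 -> C) -> \bar R) c : ume G ->
  ume (fun w => G (vcons c w)).
Proof.
move=> mG d T h mh.
have := @mpt_vcons _ T n (cst (complex.Re c)) (cst (complex.Im c)) h.
move=> /(_ (measurable_cst _) (measurable_cst _) mh) /mG.
by case: c.
Qed.

Lemma J_add n (F G : ('I_n -> C) -> \bar R) : ume F -> ume G ->
  (forall w, 0 <= F w) -> (forall w, 0 <= G w) ->
  J (fun w => F w + G w) = J F + J G.
Proof.
elim: n F G => [//|n IH] F G mF mG F0 G0 /=.
rewrite -JC_add; [|exact: J_slice_ucm|exact: J_slice_ucm| |].
- congr JC; apply/funext => c; rewrite -IH//; exact: slice_ume.
- by move=> c; apply: J_ge0 => w.
- by move=> c; apply: J_ge0 => w.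
Qed.

Lemma J_scale n (k : R) (F : ('I_n -> C) -> \bar R) : (0 <= k)%R -> ume F ->
  (forall w, 0 <= F w) -> J (fun w => k%:E * F w) = k%:E * J F.
Proof.
elim: n F => [//|n IH] F k0 mF F0 /=.
rewrite -(JC_scale k0 (J_slice_ucm F0 mF) (fun c => J_ge0 (fun w => F0 _))).
by congr JC; apply/funext => c; rewrite -IH//; exact: slice_ume.
Qed.

Lemma mpt_cscale d (S : measurableType d) n (h : S -> 'I_n -> C) (c : C) :
  mpt h -> mpt (fun s => cscale c (h s)).
Proof.
move=> mh i; have [m1 m2] := mh i; split.
  apply: (@eq_measurable_fun _ _ _ _ _ (fun s =>
    complex.Re c * complex.Re (h s i) - complex.Im c * complex.Im (h s i))%R).
    by move=> s _; rewrite cReM.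
  by apply: measurable_funB; apply: measurable_funM => //; exact: measurable_cst.
apply: (@eq_measurable_fun _ _ _ _ _ (fun s =>
  complex.Re c * complex.Im (h s i) + complex.Im c * complex.Re (h s i))%R).
  by move=> s _; rewrite cImM.
by apply: measurable_funD; apply: measurable_funM => //; exact: measurable_cst.
Qed.

Lemma J_map n (T : 'I_n -> C -> C) (k : R) (G : ('I_n -> C) -> \bar R) :
  (forall i, scales_area (T i) k) -> ume G -> (forall w, 0 <= G w) ->
  J (fun w => G (fun i => T i (w i))) = (k ^+ n)%:E * J G.
Proof.
elim: n T G => [|n IH] T G sT mG G0 /=.
  by rewrite expr0 mul1e; congr G; apply/funext => -[].
have [k0 _ JT] := sT ord0.
transitivity (JC (fun c => (k ^+ n)%:E * J (fun w => G (vcons (T ord0 c) w)))).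
  congr JC; apply/funext => c.
  rewrite -(IH (fun i => T (lift ord0 i)) (fun w => G (vcons (T ord0 c) w))) => //.
    congr J; apply/funext => w; congr G; apply: vcons_ext; first by rewrite vcons0.
    by move=> i; rewrite vconsS.
  exact: slice_ume.
have uG := J_slice_ucm G0 mG.
have G1 c : 0 <= J (fun w => G (vcons c w)) by apply: J_ge0 => w; exact: G0.
rewrite (JC_scale (exprn_ge0 n k0) (scales_area_ucm (sT ord0) uG) (fun c => G1 _)).
by rewrite (JT _ uG G1) muleA -EFinM exprSr.
Qed.

Lemma J_translate n (a : 'I_n -> C) (G : ('I_n -> C) -> \bar R) : ume G ->
  (forall w, 0 <= G w) -> J (fun w => G (w + a)%R) = J G.
Proof.
move=> mG G0.
have := J_map (fun i => scales_area_translate (a i)) mG G0.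
by rewrite expr1n mul1e.
Qed.

Lemma J_dilate n (s : R) (G : ('I_n -> C) -> \bar R) : (0 < s)%R -> ume G ->
  (forall w, 0 <= G w) ->
  J (fun w => G (cscale s%:C%C w)) = ((s^-1 ^+ 2) ^+ n)%:E * J G.
Proof. by move=> s0 mG G0; exact: (J_map (fun i => scales_area_scale s0) mG G0). Qed.

Lemma J_rotate n (th : R) (G : ('I_n -> C) -> \bar R) : (cos th != -1)%R -> ume G ->
  (forall w, 0 <= G w) -> J (fun w => G (cscale (cis th) w)) = J G.
Proof.
move=> th1 mG G0.
have := J_map (fun i => scales_area_rotation th1) mG G0.
by rewrite expr1n mul1e.
Qed.

(** [J_rotate] excludes the half turn, so the rotation is decomposed into [k] steps of angle
    $2\pi/M$, none of which is a half turn when [M] exceeds 2. *)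
Lemma J_rotate_unity n (M k : nat) (G : ('I_n -> C) -> \bar R) : (2 < M)%N ->
  ume G -> (forall w, 0 <= G w) ->
  J (fun w => G (cscale (cis (rootang R M k)) w)) = J G.
Proof.
move=> M2 mG G0; have M0 : (0 < M)%N by apply: leq_trans M2.
have hM : (M%:R != 0 :> R)%R by rewrite pnatr_eq0 -lt0n.
have step : (cos (2 * pi / M%:R) != -1 :> R)%R.
  rewrite -cospi; apply/eqP => /cos_inj.
  rewrite !in_itv /= pi_ge0 lexx divr_ge0 ?mulr_ge0 ?pi_ge0//=.
  rewrite ler_pdivrMr ?ltr0n// mulrC ler_pM2l ?pi_gt0// ler_nat (ltnW M2).
  move=> /(_ isT isT) e; have : (pi * 2 = pi * M%:R :> R)%R.
    by rewrite -{2}e divfK// mulrC.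
  have pi0 : (pi != 0 :> R)%R by rewrite gt_eqF// pi_gt0.
  by move=> /(mulfI pi0)/eqP; rewrite eqr_nat => /eqP M2'; rewrite -M2' in M2.
elim: k => [|k IH].
  rewrite /rootang mulr0 mul0r; congr J; apply/funext => w.
  by rewrite cis0 cscale1.
rewrite -IH.
pose G' w := G (cscale (cis (rootang R M k)) w).
have mG' : ume G' by move=> d T h mh; apply: mG; exact: mpt_cscale.
rewrite -[RHS](J_rotate step mG' (fun w => G0 _)); congr J; apply/funext => w.
rewrite /G' cscaleA -cisD; congr (G (cscale (cis _) w)).
by rewrite /rootang -natr1; ring.
Qed.

End IteratedIntegral.

(** * Measurability of continuous functions *)

Section ContinuousMeasurable.
Variable R : realType.
Local Notation C := R[i].

Lemma measurable_countable_comp d (T : measurableType d) (K : countType)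
    (g : T -> K) (phi : K -> R) :
  (forall c, measurable (g @^-1` [set c])) -> measurable_fun setT (phi \o g).
Proof.
move=> mg _ B mB; rewrite setTI.
have -> : (phi \o g) @^-1` B =
    \bigcup_(c in [set c : K | B (phi c)]) (g @^-1` [set c]).
  apply/seteqP; split => [t Bt|t [c /= Bc gt]]; first by exists (g t).
  by rewrite /= gt.
rewrite bigcup_mkcond; apply: countable_bigcupT_measurable => [|c].
  exact: countableP.
by case: ifP => _; [exact: mg|exact: measurable0].
Qed.

Definition grid (k : nat) (x : R) : int := Num.floor (x * k.+1%:R).

Lemma grid_dist k (x : R) : `|(grid k x)%:~R / k.+1%:R - x| <= k.+1%:R^-1.
Proof.
have k0 : (0 : R) < k.+1%:R by [].
have /andP[h1 h2] := floor_itv (x * k.+1%:R).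
have -> : (grid k x)%:~R / k.+1%:R - x = ((grid k x)%:~R - x * k.+1%:R) / k.+1%:R.
  by rewrite mulrBl mulfK// gt_eqF.
rewrite -[leRHS]mul1r normrM [X in _ * X]ger0_norm ?invr_ge0// ler_wpM2r ?invr_ge0//.
rewrite distrC ger0_norm ?subr_ge0// lerBlDl; move: h2; rewrite intrD => /ltW.
by rewrite /grid.
Qed.

Lemma measurable_grid d (T : measurableType d) (x : T -> R) k (m : int) :
  measurable_fun setT x -> measurable [set t | grid k (x t) = m].
Proof.
move=> mx.
have -> : [set t | grid k (x t) = m] =
    setT `&` (fun t => x t * k.+1%:R) @^-1` `[m%:~R, (m + 1)%:~R[%classic.
  rewrite setTI; apply/seteqP; split => t /=; rewrite in_itv /=.
    by move=> <-; exact: floor_itv.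
  by move=> h; exact: floor_def.
have mxk : measurable_fun setT (fun t => x t * k.+1%:R).
  by apply: measurable_funM => //; exact: measurable_cst.
by apply: mxk => //; exact: measurable_itv.
Qed.

(** A continuous function is the pointwise limit of its values at nearby grid points, and each of
    these approximations factors through a countable type. *)
Lemma cont_ume n (G : ('I_n -> C) -> R) : cont G -> ume (fun z => (G z)%:E).
Proof.
move=> cG d T h mh; apply/measurable_EFinP.
pose K := {ffun 'I_n -> int * int}.
pose code k t : K := [ffun i => (grid k (complex.Re (h t i)), grid k (complex.Im (h t i)))].
pose pt k (c : K) : 'I_n -> C := fun i =>
  Complex ((c i).1%:~R / k.+1%:R) ((c i).2%:~R / k.+1%:R).
have mk k : measurable_fun setT ((fun c => G (pt k c)) \o code k).
  apply: measurable_countable_comp => c.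
  have -> : code k @^-1` [set c] = \bigcap_(i in [set: 'I_n])
    ([set t | grid k (complex.Re (h t i)) = (c i).1] `&`
     [set t | grid k (complex.Im (h t i)) = (c i).2]).
    apply/seteqP; split => [t /= <- i _|t ct] /=; first by rewrite ffunE.
    apply/ffunP => i; rewrite ffunE; have [/= -> ->] := ct i I.
    by case: (c i).
  apply: fin_bigcap_measurable => [|i _]; first exact: finite_finset.
  by have [m1 m2] := mh i; apply: measurableI; exact: measurable_grid.
apply: (measurable_fun_cvg mk) => t _.
apply/cvgrPdist_lt => e e0; have [r [r0 rP]] := cG (h t) e e0.
have nr0 : 0 < r / (2 * n%:R + 1) by rewrite divr_gt0// ltr_wpDl// mulr_ge0.
exists (Num.truncn (r / (2 * n%:R + 1))^-1) => // k /= kP.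
rewrite distrC; apply: rP.
apply: (@le_lt_trans _ _ (n%:R * (2 * k.+1%:R^-1))).
  apply: cnorm_le_const => i; apply: le_trans (cabs_le_ReIm _) _.
  rewrite cReD cReN cImD cImN /pt ffunE /= mulr_natl mulr2n.
  by apply: lerD; exact: grid_dist.
have kr : k.+1%:R^-1 < r / (2 * n%:R + 1).
  rewrite -[ltRHS]invrK ltf_pV2 ?posrE ?invr_gt0//.
  by apply: lt_le_trans (truncnS_gt _) _; rewrite ler_nat ltnS.
apply: (@le_lt_trans _ _ ((2 * n%:R + 1) * k.+1%:R^-1)).
  by rewrite mulrA ler_wpM2r ?invr_ge0// mulrC lerDl.
by rewrite mulrC -ltr_pdivlMr// ltr_wpDl// mulr_ge0.
Qed.

End ContinuousMeasurable.

(** * Gaussian integrals of Hermitian forms *)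

Section GaussianIntegral.
Variable R : realType.
Local Notation C := R[i].

Definition adj m n (A : 'M[C]_(m, n)) : 'M[C]_(n, m) := map_mx conjc A^T.

Lemma adjM m n p (A : 'M[C]_(m, n)) (B : 'M[C]_(n, p)) :
  adj (A *m B) = adj B *m adj A.
Proof. by rewrite /adj trmx_mul map_mxM. Qed.

Lemma adjD m n (A B : 'M[C]_(m, n)) : adj (A + B) = adj A + adj B.
Proof. by rewrite /adj linearD map_mxD. Qed.

Lemma adjN m n (A : 'M[C]_(m, n)) : adj (- A) = - adj A.
Proof. by rewrite /adj linearN map_mxN. Qed.

Lemma adjK m n (A : 'M[C]_(m, n)) : adj (adj A) = A.
Proof. by apply/matrixP => i j; rewrite !mxE conjcK. Qed.

Lemma adj1 n : adj (1%:M : 'M[C]_n) = 1%:M.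
Proof. by rewrite /adj trmx1 map_mx1. Qed.

Definition colv n (w : 'I_n -> C) : 'cV[C]_n := \col_i w i.

Definition sqn n (w : 'I_n -> C) : R := \sum_i cabs (w i) ^+ 2.

Definition qf n (H : 'M[C]_n) (w : 'I_n -> C) : R :=
  complex.Re ((adj (colv w) *m H *m colv w) 0 0).

Lemma qfE n (H : 'M[C]_n) w :
  qf H w = complex.Re (\sum_j \sum_k conjc (w j) * H j k * w k).
Proof.
rewrite /qf mxE exchange_big /=; congr complex.Re; apply: eq_bigr => k _.
rewrite !mxE mulr_suml; apply: eq_bigr => j _.
by rewrite !mxE.
Qed.

Lemma ccont_conj n (f : ('I_n -> C) -> C) : ccont f -> ccont (fun z => conjc (f z)).
Proof.
move=> [cf1 cf2]; split.
  have -> : (fun z => complex.Re (conjc (f z))) = (fun z => complex.Re (f z)).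
    by apply/funext => z; case: (f z).
  exact: cf1.
have -> : (fun z => complex.Im (conjc (f z))) = (fun z => - complex.Im (f z)).
  by apply/funext => z; case: (f z).
exact: contN.
Qed.

Lemma cont_qf n (H : 'M[C]_n) : cont (qf H).
Proof.
have -> : qf H = (fun w => \sum_j \sum_k complex.Re (conjc (w j) * H j k * w k)).
  by apply/funext => w; rewrite qfE cRe_sum; apply: eq_bigr => j _; rewrite cRe_sum.
apply: cont_sum => j; apply: cont_sum => k.
have cj := ccont_conj (@ccont_coord R n j).
by have [] := ccontM (ccontM cj (@ccont_cst R n (H j k))) (@ccont_coord R n k).
Qed.

Lemma cont_exp_qf n (H : 'M[C]_n) (s : R) : cont (fun w => expR (- (s * qf H w))).
Proof.
apply: (@cont_comp _ _ expR); last by move=> z; exact: continuous_expR.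
by apply: contN; apply: contZ; exact: cont_qf.
Qed.

Lemma colv_vcons n c (w : 'I_n -> C) :
  colv (vcons c w) = col_mx c%:M (colv w) :> 'cV_(1 + n).
Proof.
apply/matrixP => i j; rewrite !mxE; case: splitP => k ik.
  by rewrite ord1 in ik *; rewrite !mxE ord1 eqxx (_ : i = ord0) ?vcons0//; exact: val_inj.
by rewrite mxE (_ : i = lift ord0 k) ?vconsS//; exact: val_inj.
Qed.

Lemma det_schur n (a : 'M[C]_1) (b : 'rV[C]_n) (c : 'cV[C]_n) (D : 'M[C]_n) :
  D \in unitmx ->
  \det (block_mx a b c D) = \det D * (a - b *m invmx D *m c) 0 0.
Proof.
move=> uD; pose L : 'M[C]_(1 + n) := block_mx 1%:M 0 (- (invmx D *m c)) 1%:M.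
have detL : \det L = 1 by rewrite det_lblock !det1 mulr1.
rewrite -[LHS]mulr1 -detL -det_mulmx mulmx_block !mulmx1 !mulmx0 add0r.
rewrite !mulmxN [D *m (_ *m _)]mulmxA mulmxV// mul1mx subrr add0r mulmxA.
by rewrite det_ublock mulrC det_mx11.
Qed.

Lemma qf_block0 n (a : 'M[C]_1) (b : 'rV[C]_n) (c : 'cV[C]_n) (D : 'M[C]_n) w :
  qf (block_mx a b c D) (vcons 0 w) = qf D w.
Proof.
rewrite /qf colv_vcons.
have -> : adj (col_mx 0%:M (colv w)) = row_mx (adj 0%:M) (adj (colv w)).
  by rewrite /adj tr_col_mx map_row_mx.
rewrite mul_row_block mul_row_col raddf0 /adj trmx0 map_mx0.
by rewrite !mul0mx mulmx0 !add0r.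
Qed.

(** Completing the square in the last coordinates: the first coordinate enters through the Schur
    complement and through a shift of the argument of [D]. *)
Lemma qf_schur n (a : 'M[C]_1) (b : 'rV[C]_n) (D : 'M[C]_n) z (w : 'I_n -> C) :
  D \in unitmx -> adj D = D ->
  qf (block_mx a b (adj b) D) (vcons z w) =
  complex.Re (conjc z * (a - b *m invmx D *m adj b) 0 0 * z) +
  qf D (w + (fun i => (invmx D *m adj b) i 0 * z)).
Proof.
move=> uD hD; rewrite /qf colv_vcons.
set W := colv w; set k := invmx D *m adj b.
have -> : colv (w + (fun i => k i 0 * z)) = W + k *m z%:M.
  apply/matrixP => i j; rewrite [LHS]mxE [RHS]mxE [X in _ = X + _]mxE.
  congr (_ + _); rewrite [RHS]mxE big_ord1 [X in _ = _ * X]mxE !ord1 eqxx.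
  by rewrite mulr1n.
have Dk : D *m k = adj b by rewrite /k mulmxA mulmxV// mul1mx.
have ak : adj k *m D = b.
  by rewrite adjM adjK -{2}hD -mulmxA -adjM mulmxV// adj1 mulmx1.
set Z : 'M[C]_1 := z%:M.
have sandwich (S : 'M[C]_1) : conjc z * S 0 0 * z = (adj Z *m S *m Z) 0 0.
  by rewrite mxE big_ord1 mxE big_ord1 !mxE eqxx mulr1n.
rewrite sandwich.
rewrite -cReD; congr complex.Re.
have -> (X Y : 'M[C]_1) : X 0 0 + Y 0 0 = (X + Y) 0 0 by rewrite mxE.
congr (fun_of_matrix _ 0 0).
have -> : adj (col_mx Z W) = row_mx (adj Z) (adj W) by rewrite /adj tr_col_mx map_row_mx.
rewrite mul_row_block mul_row_col adjD adjM !mulmxDl !mulmxDr.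
rewrite -[adj Z *m adj k *m D]mulmxA ak.
have -> : adj W *m D *m (k *m Z) = adj W *m adj b *m Z.
  by rewrite -[adj W *m D *m _]mulmxA [D *m (k *m Z)]mulmxA Dk mulmxA.
rewrite !mulmxN mulmxBl.
have -> : adj Z *m (b *m invmx D *m adj b) *m Z = adj Z *m b *m (k *m Z).
  by rewrite /k !mulmxA.
move: (adj Z *m a *m Z) (adj W *m adj b *m Z) (adj Z *m b *m W)
  (adj W *m D *m W) (adj Z *m b *m (k *m Z)) => m1 m2 m3 m4 m5.
by apply/matrixP => i j; rewrite !mxE; ring.
Qed.

Lemma sqn_ge0 n (w : 'I_n -> C) : 0 <= sqn w.
Proof. by apply: sumr_ge0 => i _; exact: sqr_ge0. Qed.

Lemma sqn_vcons n c (w : 'I_n -> C) : sqn (vcons c w) = cabs c ^+ 2 + sqn w.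
Proof.
rewrite /sqn big_ord_recl vcons0; congr (_ + _); apply: eq_bigr => i _.
by rewrite vconsS.
Qed.

Lemma adj_entry n (H : 'M[C]_n) : adj H = H -> forall i, complex.Im (H i i) = 0.
Proof.
move=> hH i; have : (adj H) i i = H i i by rewrite hH.
by rewrite !mxE; case: (H i i) => x y /= [] /eqP; rewrite eqNr => /eqP.
Qed.

Lemma Re_conjM (s z : C) : complex.Im s = 0 ->
  complex.Re (conjc z * s * z) = complex.Re s * cabs z ^+ 2.
Proof.
rewrite sqr_cabs; case: s z => [s1 s2] [x y] /= ->.
by ring.
Qed.

(** Induction on the dimension. Completing the square splits off a planar Gaussian whose coefficient
    is the Schur complement, and translation invariance removes the shift. The determinant acquires
    the same Schur complement as a factor. *)
Lemma gauss_det n (H : 'M[C]_n) (eta : R) : adj H = H -> 0 < eta ->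
  (forall w, eta * sqn w <= qf H w) ->
  exists d, [/\ 0 < d, \det H = d%:C%C &
    J (fun w => (expR (- qf H w))%:E) = (pi ^+ n / d)%:E].
Proof.
move=> + eta0; elim: n H => [|n IH] H hH posH.
  exists 1; split => //; first by rewrite det_mx00.
  by rewrite /= qfE big_ord0 oppr0 expR0 expr0 divr1.
pose H1 : 'M[C]_(1 + n) := H.
set a := ulsubmx H1; set b := ursubmx H1; set D := drsubmx H1.
have hH1 j k : H1 j k = conjc (H1 k j).
  have e : adj H j k = H j k by rewrite hH.
  by rewrite /H1 -[LHS]e !mxE.
have HE : H = block_mx a b (adj b) D.
  have <- : dlsubmx H1 = adj b.
    by apply/matrixP => j k; rewrite !mxE hH1.
  exact: (esym (submxK H1)).
have hD : adj D = D by apply/matrixP => i j; rewrite !mxE [RHS]hH1.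
have ha : adj a = a by apply/matrixP => i j; rewrite !mxE [RHS]hH1.
have posD w : eta * sqn w <= qf D w.
  have := posH (vcons 0 w); rewrite sqn_vcons cabs0 expr0n add0r.
  suff -> : qf H (vcons 0 w) = qf D w by [].
  by rewrite HE; exact: qf_block0.
have [d' [d'0 detD JD]] := IH D hD posD.
have uD : D \in unitmx.
  by rewrite unitmxE detD unitfE; apply/eqP => -[d'E]; rewrite d'E ltxx in d'0.
set S := a - b *m invmx D *m adj b.
have hS : adj S = S.
  have hinv : adj (invmx D) = invmx D.
    rewrite -[LHS]mulmx1 -(mulmxV uD) mulmxA -{2}hD -adjM mulmxV//.
    by rewrite adj1 mul1mx.
  by rewrite /S adjD adjN !adjM adjK hinv ha mulmxA.
have ImS : complex.Im (S 0 0) = 0 by exact: adj_entry.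
have qfH z w : qf H (vcons z w) = complex.Re (conjc z * S 0 0 * z) +
    qf D (w + (fun i => (invmx D *m adj b) i 0 * z)).
  by rewrite HE; exact: qf_schur.
set s := complex.Re (S 0 0).
have s0 : 0 < s.
  (* This vector makes the shifted argument of [D] vanish, so positivity of [H] reduces to
     positivity of the Schur complement. *)
  have := posH (vcons 1 (fun i => - ((invmx D *m adj b) i 0 * 1))).
  rewrite qfH Re_conjM// -/s cabs1 expr1n mulr1 sqn_vcons cabs1 expr1n.
  rewrite (_ : _ + _ = 0 :> ('I_n -> C)); last first.
    by apply/funext => i; exact: addNr.
  rewrite (_ : qf D 0 = 0) ?addr0; last first.
    rewrite qfE big1// => j _; rewrite big1// => k _.
    exact: mulr0.
  apply: lt_le_trans; rewrite mulrDr mulr1 ltr_wpDr// mulr_ge0 ?sqn_ge0//.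
  exact: ltW.
exists (d' * s); split; first exact: mulr_gt0.
  by rewrite HE det_schur// detD -/S rmorphM; congr (_ * _); apply: cplx_eqP.
rewrite /=.
have eqf z w : (expR (- qf H (vcons z w)))%:E =
    ((expR (- (s * cabs z ^+ 2)))%:E *
     (expR (- qf D (w + (fun i => (invmx D *m adj b) i 0 * z))))%:E)%E.
  by rewrite qfH Re_conjM// -EFinM -expRD opprD.
have uexp : ume (fun w => (expR (- qf D w))%:E).
  by have := cont_ume (cont_exp_qf D 1); under eq_fun do rewrite mul1r.
transitivity (JC (fun z => ((pi ^+ n / d')%:E * (expR (- (s * cabs z ^+ 2)))%:E)%E)).
  congr JC; apply/funext => z.
  under [X in J X]eq_fun do rewrite eqf.
  set t := (fun i => (invmx D *m adj b) i 0 * z) : 'I_n -> C.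
  have e0 (w : 'I_n -> C) : (0 <= (expR (- qf D w))%:E)%E by rewrite lee_fin expR_ge0.
  have ut : ume (fun w => (expR (- qf D (w + t)))%:E).
    move=> dd T h mh; apply: (uexp dd T (fun x => h x + t)).
    move=> i; have [m1 m2] := mh i; split.
      apply: (@eq_measurable_fun _ _ _ _ _ (fun x => complex.Re (h x i) + complex.Re (t i))).
        by move=> x _; rewrite -cReD.
      by apply: measurable_funD => //; exact: measurable_cst.
    apply: (@eq_measurable_fun _ _ _ _ _ (fun x => complex.Im (h x i) + complex.Im (t i))).
      by move=> x _; rewrite -cImD.
    by apply: measurable_funD => //; exact: measurable_cst.
  rewrite (J_scale (expR_ge0 _) ut (fun w => e0 _)).
  by rewrite (J_translate t uexp e0) JD muleC.
rewrite (JC_scale _ (ucm_gauss s)); last 2 first.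
- by rewrite divr_ge0 ?exprn_ge0 ?pi_ge0// ltW.
- by move=> c; rewrite lee_fin expR_ge0.
rewrite JC_gauss// -EFinM exprSr; congr _%:E.
by field; rewrite !lt0r_neq0.
Qed.

End GaussianIntegral.

(** * Periodic means and trigonometric polynomials *)

Section UnitCell.
Variable R : realType.
Local Notation C := R[i].
Local Notation mu := (@lebesgue_measure R).

Definition ivl (a b x : R) : R := ((a <= x) && (x < b))%:R.

Lemma ivl_ge0 a b x : 0 <= ivl a b x.
Proof. exact: ler0n. Qed.

Lemma measurable_ivl d (T : measurableType d) (x : T -> R) a b :
  measurable_fun setT x -> measurable_fun setT (fun t => ivl a b (x t)).
Proof.
move=> mx.
have -> : (fun t => ivl a b (x t)) = (\1_(`[a, b[%classic : set R) : R -> R) \o x.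
  by apply/funext => t /=; rewrite indicE mem_setE in_itv.
by apply: measurableT_comp mx; apply: measurable_indic.
Qed.

Lemma ivl_split a b c x : a <= b -> b <= c -> ivl a c x = ivl a b x + ivl b c x.
Proof.
move=> ab bc; rewrite /ivl -natrD (leNgt b x); congr _%:R.
have [ax|xa] := leP a x; have [xb|bx] := ltP x b => //=.
  by rewrite (lt_le_trans xb bc).
by have := le_lt_trans bx xa; rewrite ltNge ab.
Qed.

Lemma periodic_int (f : R -> \bar R) : (forall x, f (x + 1) = f x) ->
  forall (m : int) x, f (x + m%:~R) = f x.
Proof.
move=> f1; have fn (k : nat) x : f (x + k%:R) = f x.
  by elim: k => [|k IH]; rewrite ?addr0// -natr1 addrA f1 IH.
case=> k x; first exact: fn.
by rewrite NegzE mulrNz -(fn k.+1 (x - _)) subrK.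
Qed.

(** Only the fractional part [r] of [a] matters. The shifted cell sticks out by [r] on the right;
    moved back by one period, this piece fills the gap of length [r] on the left. *)
Lemma periodic_integral (f : R -> \bar R) (a : R) : (forall x, f (x + 1) = f x) ->
  measurable_fun setT f -> (forall x, 0 <= f x)%E ->
  (\int[mu]_x ((ivl (- 2^-1) 2^-1 x)%:E * f (x + a)%R) =
   \int[mu]_x ((ivl (- 2^-1) 2^-1 x)%:E * f x))%E.
Proof.
move=> f1 mf f0; have [h hE0] : exists h : R, h = 2^-1 by exists 2^-1.
rewrite -hE0.
have [r r01 rE] : exists2 r, 0 <= r < 1 & r = a - (Num.floor a)%:~R.
  eexists; last reflexivity; have /andP[h1 h2] := floor_itv a.
  by rewrite subr_ge0 h1 ltrBlDl -(intrD _ _ 1).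
have /andP[r0 r1] := r01.
have fa x : f (x + a) = f (x + r) by rewrite -[RHS](periodic_int f1 (Num.floor a)) -addrA rE subrK.
have mi b c (g : R -> \bar R) : measurable_fun setT g ->
    measurable_fun setT (fun x => (ivl b c x)%:E * g x)%E.
  move=> mg; apply: emeasurable_funM => //; apply/measurable_EFinP.
  by apply: measurable_ivl; exact: measurable_id.
have i0 b c x : (0 <= (ivl b c x)%:E * f x)%E by rewrite mule_ge0// lee_fin ivl_ge0.
have hE : h - 1 = - h by rewrite hE0; lra.
have h0 : 0 < h by rewrite hE0 invr_gt0.
pose F b c := (\int[mu]_x ((ivl b c x)%:E * f x))%E.
have shift b c t : (\int[mu]_x ((ivl b c x)%:E * f (x + t)%R))%E = F (b + t) (c + t).
  rewrite /F -[RHS](lebesgue_translate t (mi _ _ _ mf) (i0 _ _)).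
  by apply: eq_integral => x _; rewrite /ivl lerD2r ltrD2r.
have sum a' b c : a' <= b -> b <= c -> F a' c = (F a' b + F b c)%E.
  move=> ab bc; rewrite /F.
  rewrite -(ge0_integralD mu measurableT (fun x _ => i0 a' b x) (mi a' b f mf)
    (fun x _ => i0 b c x) (mi b c f mf)).
  apply: eq_integral => x _; rewrite (ivl_split x ab bc) EFinD ge0_muleDl//.
    by rewrite lee_fin ivl_ge0.
  by rewrite lee_fin ivl_ge0.
have -> : (\int[mu]_x ((ivl (- h) h x)%:E * f (x + a)%R))%E =
    (\int[mu]_x ((ivl (- h) h x)%:E * f (x + r)%R))%E.
  by apply: eq_integral => x _; rewrite fa.
rewrite shift -/(F (- h) h) (sum (- h + r) h (h + r)); [|lra|lra].
rewrite (sum (- h) (- h + r) h) ?lerDl//; last lra.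
rewrite [RHS]addeC.
congr (_ + _)%E.
have := shift (- h) (- h + r) 1.
have -> : - h + 1 = h by lra.
have -> : - h + r + 1 = h + r by lra.
by move=> <-; apply: eq_integral => x _; rewrite f1.
Qed.

Lemma integral_ivl (a b : R) : a <= b -> (\int[mu]_x (ivl a b x)%:E = (b - a)%:E)%E.
Proof.
move=> ab.
transitivity (\int[mu]_x (\1_(`[a, b[%classic : set R) x)%:E)%E.
  by apply: eq_integral => x _; rewrite indicE mem_setE in_itv.
rewrite integral_indic//= setIT lebesgue_measure_itv /= lte_fin.
move: ab; rewrite le_eqVlt => /predU1P[->|ab]; first by rewrite ltxx subrr.
by rewrite ab -EFinB.
Qed.

Definition cell1 (c : C) : R :=
  ivl (- 2^-1) 2^-1 (complex.Re c) * ivl (- 2^-1) 2^-1 (complex.Im c).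

Definition cell n (z : 'I_n -> C) : R := \prod_i cell1 (z i).

Lemma cell1_ge0 c : 0 <= cell1 c.
Proof. by rewrite mulr_ge0 ?ivl_ge0. Qed.

Lemma cell_ge0 n (z : 'I_n -> C) : 0 <= cell z.
Proof. by apply: prodr_ge0 => i _; exact: cell1_ge0. Qed.

Lemma cell_vcons n c (w : 'I_n -> C) : cell (vcons c w) = cell1 c * cell w.
Proof.
rewrite /cell big_ord_recl vcons0; congr (_ * _); apply: eq_bigr => i _.
by rewrite vconsS.
Qed.

Lemma ume_cell n : ume (fun z : 'I_n -> C => (cell z)%:E).
Proof.
move=> d T h mh; apply/measurable_EFinP.
apply: (@measurable_prod _ _ _ _ _ _ (fun i t => cell1 (h t i))) => i _.
by have [m1 m2] := mh i; apply: measurable_funM; exact: measurable_ivl.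
Qed.

Lemma JC_cell_translate (K : C -> \bar R) (a : C) : ucm K -> (forall c, 0 <= K c)%E ->
  (forall c (k l : int), K (c + Complex k%:~R l%:~R) = K c) ->
  (JC (fun c => (cell1 c)%:E * K (c + a)%R) = JC (fun c => (cell1 c)%:E * K c))%E.
Proof.
move=> mK K0 perK; case: a => a b.
have perx x y : K (Complex (x + 1) y) = K (Complex x y).
  rewrite -(perK (Complex x y) 1 0); congr K.
  by apply: cplx_eqP; rewrite ?(cReD, cImD) /= ?addr0.
have pery x y : K (Complex x (y + 1)) = K (Complex x y).
  rewrite -(perK (Complex x y) 0 1); congr K.
  by apply: cplx_eqP; rewrite ?(cReD, cImD) /= ?addr0.
have ivlM x y t : ((ivl (- 2^-1) 2^-1 x * ivl (- 2^-1) 2^-1 y)%R%:E * t =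
    (ivl (- 2^-1) 2^-1 x)%:E * ((ivl (- 2^-1) 2^-1 y)%:E * t))%E.
  by rewrite EFinM muleA.
pose L (x : R) := (\int[mu]_y ((ivl (- 2^-1) 2^-1 y)%:E * K (Complex x y)))%E.
have mi (x : R) : measurable_fun setT (fun y : R => (ivl (- 2^-1) 2^-1 y)%:E * K (Complex x y))%E.
  apply: emeasurable_funM; last exact: ucm_snd.
  by apply/measurable_EFinP; apply: measurable_ivl; exact: measurable_id.
have i0 x y : (0 <= (ivl (- 2^-1) 2^-1 y)%:E * K (Complex x y))%E.
  by rewrite mule_ge0// lee_fin ivl_ge0.
have inner (s t : R) : (\int[mu]_y ((cell1 (Complex t y))%:E * K (Complex s (y + b)%R)) =
    (ivl (- 2^-1) 2^-1 t)%:E * L s)%E.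
  transitivity (\int[mu]_y ((ivl (- 2^-1) 2^-1 t)%:E *
     ((ivl (- 2^-1) 2^-1 y)%:E * K (Complex s (y + b)%R))))%E.
    by apply: eq_integral => y _; rewrite /cell1 /= ivlM.
  rewrite (ge0_integralZl_EFin mu measurableT _ _ (ivl_ge0 _ _ _)); last 2 first.
  - by move=> y _; rewrite mule_ge0// lee_fin ivl_ge0.
  - apply: emeasurable_funM.
      by apply/measurable_EFinP; apply: measurable_ivl; exact: measurable_id.
    apply: (measurableT_comp (ucm_snd s mK)).
    by apply: measurable_funD => //; exact: measurable_cst.
  by rewrite (@periodic_integral (fun y => K (Complex s y)) b (pery s) (ucm_snd s mK) (fun y => K0 _)).
have inner0 (s : R) : (\int[mu]_y ((cell1 (Complex s y))%:E * K (Complex s y)) =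
    (ivl (- 2^-1) 2^-1 s)%:E * L s)%E.
  rewrite -(ge0_integralZl_EFin mu measurableT (fun y _ => i0 s y) (mi s) (ivl_ge0 _ _ _)).
  by apply: eq_integral => y _; rewrite /cell1 /= ivlM.
rewrite /JC.
under eq_integral => x _ do rewrite inner.
under [RHS]eq_integral => x _ do rewrite inner0.
apply: (@periodic_integral L a).
- by move=> x; apply: eq_integral => y _; rewrite perx.
- apply: (@ucm_inner R (fun c => (ivl (- 2^-1) 2^-1 (complex.Im c))%:E * K c)%E) => [|c].
    move=> d T x y mx my; apply: emeasurable_funM; last exact: mK.
    by apply/measurable_EFinP; exact: measurable_ivl.
  by rewrite mule_ge0// lee_fin ivl_ge0.
- by move=> x; apply: integral_ge0 => y _; exact: i0.
Qed.

Lemma JC_cell1 : JC (fun c => (cell1 c)%:E) = 1%E.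
Proof.
have h2 : - 2^-1 <= 2^-1 :> R by lra.
have hE : 2^-1 - - 2^-1 = 1 :> R by lra.
rewrite /JC; transitivity (\int[mu]_x (ivl (- 2^-1) 2^-1 x)%:E)%E; last first.
  by rewrite integral_ivl// hE.
apply: eq_integral => x _; rewrite /cell1 /=.
under eq_integral do rewrite EFinM.
rewrite ge0_integralZl_EFin ?ivl_ge0//.
- by rewrite integral_ivl// hE mule1.
- by move=> y _; rewrite lee_fin ivl_ge0.
- by apply/measurable_EFinP; apply: measurable_ivl; exact: measurable_id.
Qed.

Definition lat n (k l : 'I_n -> int) : 'I_n -> C := fun i => Complex (k i)%:~R (l i)%:~R.

Lemma ume_translate n (G : ('I_n -> C) -> \bar R) (t : 'I_n -> C) : ume G ->
  ume (fun w => G (w + t)).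
Proof.
move=> mG d T h mh; apply: (mG d T (fun x => h x + t)) => i.
have [m1 m2] := mh i; split.
  apply: (@eq_measurable_fun _ _ _ _ _ (fun x => complex.Re (h x i) + complex.Re (t i))).
    by move=> x _; rewrite -cReD.
  by apply: measurable_funD => //; exact: measurable_cst.
apply: (@eq_measurable_fun _ _ _ _ _ (fun x => complex.Im (h x i) + complex.Im (t i))).
  by move=> x _; rewrite -cImD.
by apply: measurable_funD => //; exact: measurable_cst.
Qed.

Lemma umeM n (F G : ('I_n -> C) -> \bar R) : ume F -> ume G -> ume (fun w => F w * G w)%E.
Proof. by move=> mF mG d T h mh; apply: emeasurable_funM; [exact: mF|exact: mG]. Qed.

Lemma J_cell_translate n (G : ('I_n -> C) -> \bar R) (a : 'I_n -> C) : ume G ->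
  (forall w, 0 <= G w)%E -> (forall w k l, G (w + lat k l) = G w) ->
  (J (fun w => (cell w)%:E * G (w + a)%R) = J (fun w => (cell w)%:E * G w))%E.
Proof.
elim: n G a => [|n IH] G a mG G0 perG /=.
  by congr (_ * G _)%E; apply/funext => -[].
pose a' := fun i => a (lift ord0 i).
pose K c := J (fun w => ((cell w)%:E * G (vcons c w))%E).
have cG0 c w : (0 <= (cell w)%:E * G (vcons c w))%E.
  by rewrite mule_ge0// lee_fin cell_ge0.
have K0 c : (0 <= K c)%E by apply: J_ge0 => w; exact: cG0.
have mK : ucm K.
  move=> d T x y mx my.
  apply: (@J_measurable R n _ T (fun t w => ((cell w)%:E * G (vcons (Complex (x t) (y t)) w))%E)) => //.
  move=> d' T' b h mb mh; apply: emeasurable_funM; first exact: ume_cell.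
  by apply: mG; apply: mpt_vcons => //; exact: measurableT_comp mb.
have perK c (k l : int) : K (c + Complex k%:~R l%:~R) = K c.
  congr J; apply/funext => w; congr (_ * _)%E.
  rewrite -(perG (vcons c w) (fun i => if i == ord0 then k else 0)
     (fun i => if i == ord0 then l else 0)); congr G.
  apply/esym/vcons_ext; first by rewrite -[LHS]/(vcons c w ord0 + _) vcons0.
  by move=> i; rewrite -[LHS]/(vcons c w _ + _) vconsS; apply: cplx_eqP;
     rewrite ?(cReD, cImD) /= addr0.
have inner c b : (J (fun w => (cell (vcons c w))%:E * G (vcons b w)) = (cell1 c)%:E * K b)%E.
  rewrite -(J_scale (cell1_ge0 c)); last 2 first.
  - by apply: umeM; [exact: ume_cell|exact: slice_ume].
  - by move=> w; exact: cG0.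
  by congr J; apply/funext => w; rewrite cell_vcons EFinM muleA.
transitivity (JC (fun c => (cell1 c)%:E * K (c + a ord0)%R)%E).
  congr JC; apply/funext => c; rewrite -inner.
  have eG w : G (vcons c w + a) = G (vcons (c + a ord0) (w + a')).
    congr G; apply: vcons_ext; first by rewrite -[LHS]/(vcons c w ord0 + _) vcons0.
    by move=> i; rewrite -[LHS]/(vcons c w _ + _) vconsS.
  under [X in J X = _]eq_fun do rewrite eG cell_vcons EFinM -muleA.
  under [X in _ = J X]eq_fun do rewrite cell_vcons EFinM -muleA.
  have ub b : ume (fun w => (cell w)%:E * G (vcons b w))%E.
    by apply: umeM; [exact: ume_cell|exact: slice_ume].
  rewrite (J_scale (cell1_ge0 c) (ub _) (cG0 _)).
  rewrite (J_scale (cell1_ge0 c)); last 2 first.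
  - apply: umeM; first exact: ume_cell.
    exact: (@ume_translate n (fun w => G (vcons (c + a ord0) w)) a' (slice_ume _ mG)).
  - by move=> w; rewrite mule_ge0// lee_fin cell_ge0.
  congr (_ * _)%E; apply: (IH (fun w => G (vcons (c + a ord0) w))) => //.
    exact: slice_ume.
  move=> w k l; rewrite -(perG (vcons (c + a ord0) w) (fun i => oapp k 0 (unlift ord0 i))
    (fun i => oapp l 0 (unlift ord0 i))); congr G; apply/esym/vcons_ext.
    rewrite -[LHS]/(vcons _ w ord0 + _) vcons0 /lat unlift_none /=.
    by apply: cplx_eqP; rewrite ?(cReD, cImD) /= addr0.
  by move=> i; rewrite -[LHS]/(vcons _ w _ + _) vconsS /lat liftK.
rewrite (JC_cell_translate (a ord0) mK K0 perK); congr JC; apply/funext => c.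
by rewrite -inner.
Qed.

Lemma J_cell n : J (fun w : 'I_n -> C => (cell w)%:E) = 1%E.
Proof.
elim: n => [|n IH] /=; first by rewrite /cell big_ord0.
rewrite -[RHS]JC_cell1; congr JC; apply/funext => c.
under [X in J X]eq_fun do rewrite cell_vcons EFinM.
rewrite J_scale ?cell1_ge0//; [|exact: ume_cell|by move=> w; rewrite lee_fin cell_ge0].
by rewrite IH mule1.
Qed.

End UnitCell.

(** * Means over the unit cell *)

Section CellMean.
Variables (R : realType) (n : nat).
Local Notation C := R[i].
Local Notation E := ('I_n -> C).
Implicit Types G F : E -> R.

Definition tame G := ume (fun z => (G z)%:E) /\
  exists2 K, 0 <= K & forall z, `|G z| <= K.

Lemma tame_cst c : tame (fun=> c).
Proof.
split; last by exists `|c|.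
by move=> d T h mh; exact: measurable_cst.
Qed.

Lemma tameD F G : tame F -> tame G -> tame (fun z => F z + G z).
Proof.
move=> [mF [K K0 FK]] [mG [L L0 GL]]; split.
  move=> d T h mh; apply/measurable_EFinP; apply: measurable_funD.
    by apply/measurable_EFinP; exact: mF.
  by apply/measurable_EFinP; exact: mG.
exists (K + L) => [|z]; first exact: addr_ge0.
by apply: le_trans (ler_normD _ _) _; exact: lerD.
Qed.

Lemma tameM F G : tame F -> tame G -> tame (fun z => F z * G z).
Proof.
move=> [mF [K K0 FK]] [mG [L L0 GL]]; split.
  move=> d T h mh; apply/measurable_EFinP; apply: measurable_funM.
    by apply/measurable_EFinP; exact: mF.
  by apply/measurable_EFinP; exact: mG.
exists (K * L) => [|z]; first exact: mulr_ge0.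
by rewrite normrM; exact: ler_pM.
Qed.

Lemma tameZ c F : tame F -> tame (fun z => c * F z).
Proof. by apply: tameM; exact: tame_cst. Qed.

Lemma tame_translate F a : tame F -> tame (fun z => F (z + a)).
Proof.
move=> [mF [K K0 FK]]; split; last by exists K.
exact: (@ume_translate R n (fun z => (F z)%:E) a mF).
Qed.

Definition periodic G := forall z k l, G (z + lat R k l) = G z.

Lemma periodic_reduce (z : E) : exists k l, cnorm (z + lat R k l) <= n%:R * 2.
Proof.
exists (fun i => - Num.floor (complex.Re (z i))), (fun i => - Num.floor (complex.Im (z i))).
apply: cnorm_le_const => i; apply: le_trans (cabs_le_ReIm _) _.
rewrite -[(z + _) i]/(z i + lat R _ _ i) cReD cImD /= !intrN mulr2n.
have frac (x : R) : `|x - (Num.floor x)%:~R| <= 1.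
  have /andP[h1 h2] := floor_itv x; rewrite ger0_norm ?subr_ge0// lerBlDl.
  by move: h2; rewrite intrD => /ltW.
by apply: lerD; exact: frac.
Qed.

Lemma cont_periodic_tame G : cont G -> periodic G -> tame G.
Proof.
move=> cG pG; split; first exact: cont_ume.
have [M M0 MP] := cont_bounded (n%:R * 2) cG.
exists M => // z; have [k [l kl]] := periodic_reduce z.
by rewrite -(pG z k l); exact: MP.
Qed.

Definition Jc (P : E -> R) : R := fine (J (fun z => (cell z * P z)%:E)).

Lemma ume_cellM P : tame P -> ume (fun z => (cell z * P z)%:E).
Proof.
move=> [mP _]; under [X in ume X]eq_fun do rewrite EFinM.
exact: (umeM (@ume_cell R n) mP).
Qed.

Lemma JcE P : tame P -> (forall z, 0 <= P z) ->
  J (fun z => (cell z * P z)%:E) = (Jc P)%:E.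
Proof.
move=> tP P0; rewrite fineK// ge0_fin_numE; last first.
  by apply: J_ge0 => w; rewrite lee_fin mulr_ge0// cell_ge0.
have [_ [K K0 PK]] := tP.
apply: (@le_lt_trans _ _ (J (fun z : E => K%:E * (cell z)%:E)%E)).
  apply: J_mono => w; first by rewrite lee_fin mulr_ge0// cell_ge0.
  rewrite -EFinM lee_fin mulrC ler_wpM2r ?cell_ge0//.
  by apply: le_trans (ler_norm _) (PK w).
rewrite J_scale//; [|exact: ume_cell|by move=> w; rewrite lee_fin cell_ge0].
by rewrite J_cell mule1 ltry.
Qed.

Lemma Jc_add P Q : tame P -> tame Q -> (forall z, 0 <= P z) -> (forall z, 0 <= Q z) ->
  Jc (fun z => P z + Q z) = Jc P + Jc Q.
Proof.
move=> tP tQ P0 Q0; apply: EFin_inj; rewrite EFinD -!JcE//; last 2 first.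
- exact: tameD.
- by move=> z; exact: addr_ge0.
rewrite -J_add; [|exact: ume_cellM|exact: ume_cellM| |].
- by congr J; apply/funext => z; rewrite mulrDr.
- by move=> z; rewrite lee_fin mulr_ge0// cell_ge0.
- by move=> z; rewrite lee_fin mulr_ge0// cell_ge0.
Qed.

Lemma Jc_scale c P : 0 <= c -> tame P -> (forall z, 0 <= P z) ->
  Jc (fun z => c * P z) = c * Jc P.
Proof.
move=> c0 tP P0; apply: EFin_inj; rewrite EFinM -!JcE//; last 2 first.
- exact: tameZ.
- by move=> z; exact: mulr_ge0.
rewrite -J_scale//; [|exact: ume_cellM|].
- by congr J; apply/funext => z; rewrite mulrCA.
- by move=> z; rewrite lee_fin mulr_ge0// cell_ge0.
Qed.

Lemma Jc_cst c : 0 <= c -> Jc (fun=> c) = c.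
Proof.
move=> c0; rewrite /Jc; under [X in J X]eq_fun do rewrite mulrC EFinM.
rewrite J_scale//; [|exact: ume_cell|by move=> w; rewrite lee_fin cell_ge0].
by rewrite J_cell mule1.
Qed.

Lemma Jc_mono P Q : tame P -> tame Q -> (forall z, 0 <= P z) ->
  (forall z, P z <= Q z) -> Jc P <= Jc Q.
Proof.
move=> tP tQ P0 PQ; rewrite -lee_fin -!JcE//; last first.
  by move=> z; apply: le_trans (PQ z).
apply: J_mono => w; first by rewrite lee_fin mulr_ge0// cell_ge0.
by rewrite lee_fin ler_wpM2l// cell_ge0.
Qed.

Lemma Jc_translate P a : tame P -> (forall z, 0 <= P z) -> periodic P ->
  Jc (fun z => P (z + a)) = Jc P.
Proof.
move=> [mP _] P0 pP; rewrite /Jc; congr fine.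
transitivity (J (fun z : E => (cell z)%:E * (P (z + a))%:E)%E).
  by congr J.
rewrite (J_cell_translate (G := fun z => (P z)%:E))//.
by move=> w k l; rewrite pP.
Qed.

(* The mean of a bounded function over the unit cell, reduced to the integral of
   nonnegative functions by adding a constant. *)
Definition bnd G : R := xget 0 [set K | 0 <= K /\ forall z, `|G z| <= K].

Definition cmean G : R := Jc (fun z => G z + bnd G) - bnd G.

Lemma bndP G : tame G -> 0 <= bnd G /\ forall z, `|G z| <= bnd G.
Proof.
move=> [_ [K K0 GK]]; rewrite /bnd; case: xgetP => [d _ //|].
by move=> /(_ K) [].
Qed.

Lemma add_bound_ge0 G K : (forall z, `|G z| <= K) -> forall z, 0 <= G z + K.
Proof. by move=> GK z; have := GK z; rewrite ler_norml => /andP[]; lra. Qed.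

Lemma cmeanE G K : tame G -> (forall z, `|G z| <= K) -> cmean G = Jc (fun z => G z + K) - K.
Proof.
move=> tG GK; have [b0 bP] := bndP tG; rewrite /cmean.
have K0 : 0 <= K by apply: le_trans (GK 0).
have tGK c : tame (fun z => G z + c) by apply: tameD => //; exact: tame_cst.
have h1 := Jc_add (tGK K) (tame_cst (bnd G)) (add_bound_ge0 GK) (fun=> b0).
have h2 := Jc_add (tGK (bnd G)) (tame_cst K) (add_bound_ge0 bP) (fun=> K0).
rewrite Jc_cst// in h1; rewrite Jc_cst// in h2.
have : Jc (fun z => G z + K + bnd G) = Jc (fun z => G z + bnd G + K).
  by congr Jc; apply/funext => z; rewrite addrAC.
by rewrite h1 h2; lra.
Qed.

Lemma cmean_pos P : tame P -> (forall z, 0 <= P z) -> cmean P = Jc P.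
Proof.
move=> tP P0; have [b0 bP] := bndP tP.
by rewrite /cmean Jc_add ?Jc_cst ?addrK//; exact: tame_cst.
Qed.

Lemma cmeanD F G : tame F -> tame G -> cmean (fun z => F z + G z) = cmean F + cmean G.
Proof.
move=> tF tG; have [bF FP] := bndP tF; have [bG GP] := bndP tG.
rewrite (@cmeanE _ (bnd F + bnd G)); [|exact: tameD|]; last first.
  by move=> z; apply: le_trans (ler_normD _ _) _; exact: lerD.
rewrite /cmean -addrACA -opprD -Jc_add; last 4 first.
- by apply: tameD => //; exact: tame_cst.
- by apply: tameD => //; exact: tame_cst.
- exact: add_bound_ge0.
- exact: add_bound_ge0.
by congr (Jc _ - _); apply/funext => z; rewrite addrACA.
Qed.

Lemma cmeanN G : tame G -> cmean (fun z => - G z) = - cmean G.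
Proof.
move=> tG; have tNG : tame (fun z => - G z).
  by have := tameZ (-1) tG; congr tame; apply/funext => z; rewrite mulN1r.
have := cmeanD tG tNG; under [X in cmean X = _ -> _]eq_fun do rewrite subrr.
rewrite cmean_pos ?Jc_cst//; last exact: tame_cst.
by move=> h; lra.
Qed.

Lemma cmeanZ c G : tame G -> cmean (fun z => c * G z) = c * cmean G.
Proof.
move=> tG; have pos k : 0 <= k -> cmean (fun z => k * G z) = k * cmean G.
  move=> k0; have [b0 bP] := bndP tG.
  rewrite (@cmeanE _ (k * bnd G)); [|exact: tameZ|]; last first.
    by move=> z; rewrite normrM ger0_norm// ler_wpM2l.
  rewrite /cmean mulrBr -Jc_scale//; last 2 first.
  - by apply: tameD => //; exact: tame_cst.
  - exact: add_bound_ge0.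
  by congr (Jc _ - _); apply/funext => z; rewrite mulrDr.
have [c0|c0] := leP 0 c; first exact: pos.
rewrite -[c]opprK; under [X in cmean X]eq_fun do rewrite mulNr.
by rewrite cmeanN ?pos ?mulNr// ?oppr_ge0 ?ltW//; exact: tameZ.
Qed.

Lemma cmean_mono F G : tame F -> tame G -> (forall z, F z <= G z) -> cmean F <= cmean G.
Proof.
move=> tF tG FG; have [bF FP] := bndP tF; have [bG GP] := bndP tG.
pose K := bnd F + bnd G.
have FK z : `|F z| <= K by apply: le_trans (FP z) _; rewrite lerDl.
have GK z : `|G z| <= K by apply: le_trans (GP z) _; rewrite lerDr.
rewrite (cmeanE tF FK) (cmeanE tG GK) lerD2r; apply: Jc_mono.
- by apply: tameD => //; exact: tame_cst.
- by apply: tameD => //; exact: tame_cst.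
- exact: add_bound_ge0.
- by move=> z; rewrite lerD2r.
Qed.

Lemma cmean_cst c : cmean (fun=> c) = c.
Proof.
have [c0|c0] := leP 0 c; first by rewrite cmean_pos ?Jc_cst//; exact: tame_cst.
rewrite -[in LHS](opprK c) cmeanN; last exact: tame_cst.
by rewrite cmean_pos ?Jc_cst ?opprK// ?oppr_ge0 ?ltW//; exact: tame_cst.
Qed.

Lemma cmean_translate G a : tame G -> periodic G -> cmean (fun z => G (z + a)) = cmean G.
Proof.
move=> tG pG; have [bG GP] := bndP tG.
rewrite (@cmeanE _ (bnd G)) => [|//|z]; [|exact: tame_translate|exact: GP].
rewrite /cmean (@Jc_translate (fun z => G z + bnd G))//.
- by apply: tameD => //; exact: tame_cst.
- exact: add_bound_ge0.
- by move=> z k l; rewrite pG.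
Qed.

Lemma tame_sum (I : Type) (s : seq I) (F : I -> E -> R) :
  (forall i, tame (F i)) -> tame (fun z => \sum_(i <- s) F i z).
Proof.
move=> tF; elim: s => [|i s IH].
  by under [X in tame X]eq_fun do rewrite big_nil; exact: tame_cst.
by under [X in tame X]eq_fun do rewrite big_cons; exact: tameD.
Qed.

Lemma cmean_sum (I : Type) (s : seq I) (F : I -> E -> R) :
  (forall i, tame (F i)) ->
  cmean (fun z => \sum_(i <- s) F i z) = \sum_(i <- s) cmean (F i).
Proof.
move=> tF; elim: s => [|i s IH].
  by under [X in cmean X]eq_fun do rewrite big_nil; rewrite cmean_cst big_nil.
under [X in cmean X]eq_fun do rewrite big_cons.
by rewrite cmeanD ?IH ?big_cons//; exact: tame_sum.
Qed.

Definition ctame (f : E -> C) := tame (fun z => complex.Re (f z)) /\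
                                 tame (fun z => complex.Im (f z)).

Definition ccmean (f : E -> C) : C :=
  Complex (cmean (fun z => complex.Re (f z))) (cmean (fun z => complex.Im (f z))).

Lemma ctameD f g : ctame f -> ctame g -> ctame (fun z => f z + g z).
Proof.
move=> [f1 f2] [g1 g2]; split.
  by under [X in tame X]eq_fun do rewrite cReD; exact: tameD.
by under [X in tame X]eq_fun do rewrite cImD; exact: tameD.
Qed.

Lemma ctameM f g : ctame f -> ctame g -> ctame (fun z => f z * g z).
Proof.
move=> [f1 f2] [g1 g2]; split.
  under [X in tame X]eq_fun do rewrite cReM -[X in _ - X]mul1r -mulNr.
  by apply: tameD; [exact: tameM|apply: tameZ; exact: tameM].
by under [X in tame X]eq_fun do rewrite cImM; apply: tameD; exact: tameM.
Qed.

Lemma ctame_cst c : ctame (fun=> c).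
Proof. by split; exact: tame_cst. Qed.

Lemma ccmeanD f g : ctame f -> ctame g ->
  ccmean (fun z => f z + g z) = ccmean f + ccmean g.
Proof.
move=> [f1 f2] [g1 g2]; apply: cplx_eqP; rewrite ?(cReD, cImD) /=.
  by under [X in cmean X]eq_fun do rewrite cReD; exact: cmeanD.
by under [X in cmean X]eq_fun do rewrite cImD; exact: cmeanD.
Qed.

Lemma ccmeanZ c f : ctame f -> ccmean (fun z => c * f z) = c * ccmean f.
Proof.
move=> [f1 f2]; apply: cplx_eqP; rewrite ?(cReM, cImM) /=.
  under [X in cmean X]eq_fun do rewrite cReM -mulNr.
  by rewrite cmeanD ?cmeanZ ?mulNr//; exact: tameZ.
under [X in cmean X]eq_fun do rewrite cImM.
by rewrite cmeanD ?cmeanZ//; exact: tameZ.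
Qed.

Lemma ctame_sum (I : Type) (s : seq I) (F : I -> E -> C) :
  (forall i, ctame (F i)) -> ctame (fun z => \sum_(i <- s) F i z).
Proof.
move=> tF; elim: s => [|i s IH].
  by under [X in ctame X]eq_fun do rewrite big_nil; exact: ctame_cst.
by under [X in ctame X]eq_fun do rewrite big_cons; exact: ctameD.
Qed.

Lemma ccmean_cst c : ccmean (fun=> c) = c.
Proof. by apply: cplx_eqP; rewrite /= cmean_cst. Qed.

Lemma ccmean_sum (I : Type) (s : seq I) (F : I -> E -> C) :
  (forall i, ctame (F i)) ->
  ccmean (fun z => \sum_(i <- s) F i z) = \sum_(i <- s) ccmean (F i).
Proof.
move=> tF; elim: s => [|i s IH].
  by under [X in ccmean X]eq_fun do rewrite big_nil; rewrite ccmean_cst big_nil.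
under [X in ccmean X]eq_fun do rewrite big_cons.
by rewrite ccmeanD ?IH ?big_cons//; exact: ctame_sum.
Qed.

End CellMean.

(** * Trigonometric polynomials and the mean of the Hessian determinant *)

Section TrigonometricPolynomials.
Variables (R : realType) (n : nat).
Local Notation C := R[i].
Local Notation E := ('I_n -> C).
Definition mode := (('I_n -> int) * ('I_n -> int))%type.
Implicit Types (m : mode) (z w : E).

Definition phase m z : R :=
  \sum_i ((m.1 i)%:~R * complex.Re (z i) + (m.2 i)%:~R * complex.Im (z i)).

Definition emode m z : C := cis (2 * pi * phase m z).

Lemma phaseD m z w : phase m (z + w) = phase m z + phase m w.
Proof.
rewrite /phase -big_split; apply: eq_bigr => i _ /=.
by rewrite -[(z + w) i]/(z i + w i) cReD cImD; ring.
Qed.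

Lemma emodeD m z w : emode m (z + w) = emode m z * emode m w.
Proof. by rewrite /emode phaseD mulrDr cisD. Qed.

Lemma cis_2pi_int (k : int) : cis (2 * pi * k%:~R : R) = 1.
Proof.
have nat_case (j : nat) : cis (2 * pi * j%:R : R) = 1.
  by rewrite mulr_natr -cisX cis2pi expr1n.
case: k => j; first exact: nat_case.
have := nat_case j.+1; rewrite NegzE mulrNz mulrN => h.
have := cisD (2 * pi * j.+1%:R : R) (- (2 * pi * j.+1%:R)).
by rewrite subrr cis0 h mul1r.
Qed.

Lemma emode_lat m z k l : emode m (z + lat R k l) = emode m z.
Proof.
rewrite emodeD [X in _ * X]/emode.
rewrite (_ : phase m (lat R k l) = (\sum_i (m.1 i * k i + m.2 i * l i))%:~R).
  by rewrite cis_2pi_int mulr1.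
rewrite /phase /lat rmorph_sum; apply: eq_bigr => i _ /=.
by rewrite intrD !intrM.
Qed.

Lemma cont_phase m : cont (phase m).
Proof.
apply: cont_sum => i; have [c1 c2] := @ccont_coord R n i.
by apply: contD; exact: contZ.
Qed.

Lemma ccont_emode m : ccont (emode m).
Proof.
split.
  apply: (@cont_comp _ _ (fun x => cos (2 * pi * x))); first exact: cont_phase.
  move=> z; apply: (@continuous_comp _ _ _ (fun x : R => 2 * pi * x) cos).
    exact: mulrl_continuous.
  exact: continuous_cos.
apply: (@cont_comp _ _ (fun x => sin (2 * pi * x))); first exact: cont_phase.
move=> z; apply: (@continuous_comp _ _ _ (fun x : R => 2 * pi * x) sin).
  exact: mulrl_continuous.
exact: continuous_sin.
Qed.

Lemma ccont_ctame (f : E -> C) : ccont f -> (forall z k l, f (z + lat R k l) = f z) ->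
  ctame f.
Proof.
move=> [c1 c2] pf; split; apply: cont_periodic_tame => // z k l; by rewrite pf.
Qed.

Lemma ctame_emode m : ctame (emode m).
Proof. by apply: ccont_ctame; [exact: ccont_emode|exact: emode_lat]. Qed.

Definition zero_mode m := forall i, m.1 i = 0 /\ m.2 i = 0.

Lemma ccmean_emode0 m : zero_mode m -> ccmean (emode m) = 1.
Proof.
move=> m0; rewrite -[RHS](@ccmean_cst R n); congr ccmean; apply/funext => z.
rewrite /emode /phase big1 ?mulr0 ?cis0// => i _.
by have [-> ->] := m0 i; rewrite !mul0r addr0.
Qed.

(** A translation by a suitable half period changes the sign of the mode but not its mean. *)
Lemma ccmean_emode m : ~ zero_mode m -> ccmean (emode m) = 0.
Proof.
move=> mN0; have [a a1] : exists a, emode m a = -1.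
  have [i mi] : exists i, ~ (m.1 i = 0 /\ m.2 i = 0) by exact/existsNP.
  have half (k : int) : k != 0 -> k%:~R * (2 * k%:~R)^-1 = 2^-1 :> R.
    by move=> k0; rewrite invfM mulrCA mulfV ?mulr1// intr_eq0.
  have cispi : cis (2 * pi * 2^-1 : R) = -1.
    rewrite mulrAC mulfV// mul1r /cis cospi sinpi.
    by apply: cplx_eqP; rewrite ?(cReN, cImN) /= ?oppr0.
  have [m1|m1] := eqVneq (m.1 i) 0.
    have m2 : m.2 i != 0 by apply/eqP => m2; apply: mi.
    exists (fun j => if j == i then Complex 0 (2 * (m.2 i)%:~R)^-1 else 0).
    rewrite /emode -cispi; congr (cis (_ * _)).
    rewrite /phase (bigD1 i)//= eqxx big1 /= ?addr0 ?mulr0 ?add0r; first exact: half.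
    by move=> j /negbTE ->; rewrite /= !mulr0 addr0.
  exists (fun j => if j == i then Complex (2 * (m.1 i)%:~R)^-1 0 else 0).
  rewrite /emode -cispi; congr (cis (_ * _)).
  rewrite /phase (bigD1 i)//= eqxx big1 /= ?addr0 ?mulr0 ?addr0; first exact: half.
  by move=> j /negbTE ->; rewrite /= !mulr0 addr0.
have [t1 t2] := ctame_emode m.
have e : ccmean (emode m) = ccmean (fun z => (-1) * emode m z).
  have -> : (fun z => -1 * emode m z) = (fun z => emode m (z + a)).
    by apply/funext => z; rewrite emodeD a1 mulrC.
  have pRe : periodic (fun z => complex.Re (emode m z)).
    by move=> z k l; rewrite emode_lat.
  have pIm : periodic (fun z => complex.Im (emode m z)).
    by move=> z k l; rewrite emode_lat.
  apply: cplx_eqP; first exact: esym (cmean_translate a t1 pRe).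
  exact: esym (cmean_translate a t2 pIm).
move: e; rewrite ccmeanZ; last exact: ctame_emode.
move/eqP; rewrite mulN1r -subr_eq0 opprK -mulr2n mulrn_eq0 /= => /eqP.
by [].
Qed.

Definition mu m : E := fun i => Complex (m.1 i)%:~R (m.2 i)%:~R.
Arguments mu : simpl never.

Definition lin m w : C := \sum_i conjc (mu m i) * w i.

Lemma phase_lin m w : phase m w = complex.Re (lin m w).
Proof.
rewrite /phase /lin cRe_sum; apply: eq_bigr => i _; rewrite cReM /mu /=; ring.
Qed.

Definition tcoef := seq (C * mode).
Implicit Types s : tcoef.

Definition tpoly s z : R := \sum_(x <- s) complex.Re (x.1 * emode x.2 z).

(** Entry [(j, k)] is $\partial^2\Phi/\partial\bar z_j\partial z_k$ for the weight [Phi] below: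
    [Qim] contributes [pi] on the diagonal, and the mode with frequency vector [mu] contributes
    $-\pi^2\mu_j\bar\mu_k$ times its value. *)
Definition hess s z : 'M[C]_n := \matrix_(j, k)
  ((pi *+ (j == k))%:C%C -
   \sum_(x <- s) (pi ^+ 2 * complex.Re (x.1 * emode x.2 z))%:C%C * (mu x.2 j * conjc (mu x.2 k))).

Lemma hess_hermitian s z : adj (hess s z) = hess s z.
Proof.
apply/matrixP => j k; rewrite !mxE rmorphB rmorph_sum eq_sym; congr (_ - _); first exact: conjc_real.
apply: eq_bigr => x _; rewrite [mu _ j * _]mulrC [LHS]rmorphM.
congr (_ * _); first exact: conjc_real.
by rewrite rmorphM; congr (_ * _); exact: conjcK.
Qed.

Lemma qf_hess s z w : qf (hess s z) w = pi * sqn w -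
  \sum_(x <- s) pi ^+ 2 * complex.Re (x.1 * emode x.2 z) * cabs (lin x.2 w) ^+ 2.
Proof.
rewrite qfE.
have -> : \sum_j \sum_k conjc (w j) * hess s z j k * w k =
    \sum_j \sum_k (conjc (w j) * (pi *+ (j == k))%:C%C * w k) -
    \sum_(x <- s) (pi ^+ 2 * complex.Re (x.1 * emode x.2 z))%:C%C *
      (\sum_j \sum_k (conjc (w j) * (mu x.2 j * conjc (mu x.2 k)) * w k)).
  under [X in _ - X]eq_bigr do rewrite mulr_sumr.
  rewrite [X in _ - X]exchange_big /= -sumrB; apply: eq_bigr => j _.
  under [X in _ - X]eq_bigr do rewrite mulr_sumr.
  rewrite [X in _ - X]exchange_big /= -sumrB; apply: eq_bigr => k _.
  rewrite !mxE mulrBr mulrBl; congr (_ - _).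
  rewrite mulr_sumr mulr_suml; apply: eq_bigr => x _.
  have ac (a b c d e : C) : a * (b * (c * d)) * e = b * (a * (c * d) * e) by ring.
  exact: ac.
rewrite cReD cReN; congr (_ - _).
  rewrite cRe_sum /sqn mulr_sumr; apply: eq_bigr => j _.
  rewrite (bigD1 j)//= big1 ?addr0 => [|k kj]; last first.
    by rewrite eq_sym (negbTE kj) mulr0n mulr0 mul0r.
  by rewrite eqxx mulr1n Re_conjM.
rewrite cRe_sum; apply: eq_bigr => x _.
have -> : \sum_j \sum_k (conjc (w j) * (mu x.2 j * conjc (mu x.2 k)) * w k) =
    (cabs (lin x.2 w) ^+ 2)%:C%C.
  rewrite -mulJc mulrC /lin rmorph_sum mulr_suml; apply: eq_bigr => j _.
  rewrite mulr_sumr; apply: eq_bigr => k _.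
  have ac (a b c d : C) : a * (b * c) * d = b * a * (c * d) by ring.
  rewrite ac; congr (_ * _).
  by rewrite [RHS]rmorphM; congr (_ * _); exact: esym (conjcK _).
by rewrite -rmorphM.
Qed.

Definition mode_opp m : mode := (fun i => - m.1 i, fun i => - m.2 i).

Lemma emode_opp m z : emode (mode_opp m) z = conjc (emode m z).
Proof.
rewrite /emode (_ : phase (mode_opp m) z = - phase m z).
  by rewrite mulrN /cis cosN sinN.
by rewrite /phase -sumrN; apply: eq_bigr => i _; rewrite /= !intrN; ring.
Qed.

(* Each entry of the Hessian as a genuine trigonometric polynomial: the real
   coefficient is split into a mode and its conjugate. *)
Definition doubled s : tcoef :=
  [seq (- (pi ^+ 2 / 2)%:C%C * x.1, x.2) | x <- s] ++
  [seq (- (pi ^+ 2 / 2)%:C%C * conjc x.1, mode_opp x.2) | x <- s].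

Lemma hess_doubled s z j k : hess s z j k = (pi *+ (j == k))%:C%C +
  \sum_(x <- doubled s) x.1 * emode x.2 z * (mu x.2 j * conjc (mu x.2 k)).
Proof.
pose F (c : C) m := c * emode m z * (mu m j * conjc (mu m k)).
have FN c m : F c (mode_opp m) = c * conjc (emode m z) * (mu m j * conjc (mu m k)).
  rewrite /F emode_opp.
  have mN i : mu (mode_opp m) i = - mu m i.
    by apply: cplx_eqP; rewrite /mu ?(cReN, cImN) /= intrN.
  by rewrite !mN rmorphN mulrNN.
rewrite -[\sum_(x <- doubled s) _]/(\sum_(x <- doubled s) F x.1 x.2).
rewrite mxE -sumrN; congr (_ + _).
transitivity (\sum_(x <- s) (F (- (pi ^+ 2 / 2)%:C%C * x.1) x.2 +
    F (- (pi ^+ 2 / 2)%:C%C * conjc x.1) (mode_opp x.2))); last first.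
  by rewrite big_split /doubled big_cat !big_map.
apply: eq_bigr => x _; rewrite FN /F.
have -> : (pi ^+ 2 * complex.Re (x.1 * emode x.2 z))%:C%C =
    (pi ^+ 2 / 2)%:C%C * (x.1 * emode x.2 z + conjc x.1 * conjc (emode x.2 z)).
  rewrite -rmorphM /= addcJ mulrA -(rmorph_nat (real_complex R)) -!rmorphM.
  by congr (_%:C%C); field.
have ac (a b c d e f : C) : - (a * (b * c + d * e) * f) = - a * b * c * f + - a * d * e * f by ring.
exact: ac.
Qed.

Section DeterminantMean.
Variable s : tcoef.
Let N := size s.
Let o0 : C * mode := (0, (fun=> 0, fun=> 0)).
(** Row [j] of the matrix is a sum indexed by [option 'I_N]: [None] stands for the diagonal entry
    [pi], and [Some y] for the mode [y]. Each summand is a scalar, times a mode, times a constant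
    row [vec]. *)
Let term (o : option 'I_N) : C * mode := if o is Some y then nth o0 s y else (pi%:C%C, o0.2).
Let coef (o : option 'I_N) (j : 'I_n) : C :=
  if o is Some y then (term o).1 * mu (term o).2 j else pi%:C%C.
Let vec (o : option 'I_N) (j k : 'I_n) : C :=
  if o is Some y then conjc (mu (term o).2 k) else (j == k)%:R.
Let msum (f : {ffun 'I_n -> option 'I_N}) : mode :=
  (fun i => \sum_j (term (f j)).2.1 i, fun i => \sum_j (term (f j)).2.2 i).

Lemma entry_option z j k :
  (pi *+ (j == k))%:C%C + \sum_(x <- s) x.1 * emode x.2 z * (mu x.2 j * conjc (mu x.2 k)) =
  \sum_(o : option 'I_N) coef o j * emode (term o).2 z * vec o j k.
Proof.
rewrite (bigD1 None)//=; congr (_ + _).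
  rewrite /emode /phase big1 ?mulr0 ?cis0 ?mulr1 => [|i _]; last by rewrite !mul0r addr0.
  by case: (j == k); rewrite ?mulr1 ?mulr0.
rewrite (big_nth o0) big_mkord.
rewrite [RHS](reindex_omap Some (fun o => o))/=; last by case.
apply: eq_big => [y|y _]; first by rewrite /= eqxx.
rewrite /coef /vec /=; have ac (a b c d : C) : a * b * (c * d) = a * c * b * d by ring.
exact: ac.
Qed.

Lemma prod_emode (f : {ffun 'I_n -> option 'I_N}) z :
  \prod_j emode (term (f j)).2 z = emode (msum f) z.
Proof.
have prod_cis (t : 'I_n -> R) : \prod_j cis (t j) = cis (\sum_j t j).
  by elim/big_rec2: _ => [|j x y _ ->]; rewrite ?cis0// cisD.
rewrite /emode prod_cis -mulr_sumr; congr (cis (_ * _)).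
rewrite /phase exchange_big /=; apply: eq_bigr => i _.
by rewrite big_split /= -!mulr_suml !rmorph_sum.
Qed.

(** Multilinearity in the rows: the function [f] records which summand is chosen in each row, and
    the modes chosen multiply to the single mode [msum f]. *)
Lemma det_option z (H : 'M[C]_n) :
  (forall j k, H j k = \sum_(o : option 'I_N) coef o j * emode (term o).2 z * vec o j k) ->
  \det H = \sum_(f : {ffun 'I_n -> option 'I_N})
    (\prod_j coef (f j) j * \det (\matrix_(j, k) vec (f j) j k)) * emode (msum f) z.
Proof.
move=> HE; rewrite /determinant.
transitivity (\sum_(t : 'S_n) \sum_(f : {ffun 'I_n -> option 'I_N})
    (-1) ^+ t * \prod_j (coef (f j) j * emode (term (f j)).2 z * vec (f j) j (t j))).
  apply: eq_bigr => t _; rewrite -mulr_sumr; congr (_ * _).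
  rewrite -(bigA_distr_bigA (fun j o => coef o j * emode (term o).2 z * vec o j (t j))).
  by apply: eq_bigr => j _; rewrite HE.
rewrite exchange_big /=; apply: eq_bigr => f _.
rewrite mulr_sumr mulr_suml; apply: eq_bigr => t _.
rewrite !big_split /= prod_emode.
have -> : \prod_i (\matrix_(j, k) vec (f j) j k) i (t i) = \prod_j vec (f j) j (t j).
  by apply: eq_bigr => j _; rewrite mxE.
have ac (a b c d : C) : a * (b * c * d) = b * (a * d) * c by ring.
exact: ac.
Qed.

(** The rows for which [f] selects a genuine mode are conjugated frequency vectors. If the chosen
    frequencies add up to zero, so do these rows, and their indicator vector lies in the left
    kernel. Hence among the terms with nonzero mean only the choice [None] everywhere survives. *)
Lemma det_vec_msum (f : {ffun 'I_n -> option 'I_N}) : zero_mode (msum f) ->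
  f != [ffun=> None] -> \det (\matrix_(j, k) vec (f j) j k) = 0.
Proof.
move=> m0 fN; apply/eqP/det0P.
exists (\row_j (f j != None)%:R).
  apply/eqP => v0; move/eqP: fN; apply; apply/ffunP => j; rewrite ffunE.
  have /matrixP/(_ 0 j) := v0; rewrite !mxE.
  by case: (f j) => //= y /eqP; rewrite oner_eq0.
apply/matrixP => i k; rewrite !mxE.
transitivity (\sum_j conjc (mu (term (f j)).2 k)).
  apply: eq_bigr => j _; rewrite !mxE; case: (f j) => [y|] /=; first by rewrite mul1r.
  by rewrite mul0r; apply: cplx_eqP; rewrite /= ?oppr0.
rewrite -rmorph_sum -[RHS]conjc0; congr conjc.
have [m1 m2] := m0 k; apply: cplx_eqP.
  by rewrite cRe_sum /= -rmorph_sum -[LHS]/((msum f).1 k)%:~R m1.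
by rewrite cIm_sum /= -rmorph_sum -[LHS]/((msum f).2 k)%:~R m2.
Qed.

Lemma ccmean_det_option (H : E -> 'M[C]_n) :
  (forall z j k, H z j k =
     \sum_(o : option 'I_N) coef o j * emode (term o).2 z * vec o j k) ->
  ccmean (fun z => \det (H z)) = (pi ^+ n)%:C%C.
Proof.
move=> HE; under [X in ccmean X]eq_fun do rewrite (det_option (HE _)).
rewrite ccmean_sum; last first.
  by move=> f; apply: ctameM; [exact: ctame_cst|exact: ctame_emode].
rewrite (bigD1 [ffun=> None])//= [X in _ + X]big1 => [|f fN].
  rewrite ccmeanZ; last exact: ctame_emode.
  rewrite ccmean_emode0 ?mulr1; last first.
    by move=> i; split; rewrite /= big1// => j _; rewrite ffunE.
  rewrite addr0 (_ : \matrix_(j, k) _ = 1%:M) ?det1 ?mulr1; last first.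
    by apply/matrixP => j k; rewrite !mxE ffunE /=.
  rewrite (eq_bigr (fun=> pi%:C%C)) => [|j _]; last by rewrite ffunE.
  by rewrite prodr_const card_ord rmorphXn.
rewrite ccmeanZ; last exact: ctame_emode.
have [m0|m0] := pselect (zero_mode (msum f)).
  by rewrite det_vec_msum// mulr0 mul0r.
by rewrite ccmean_emode// mulr0.
Qed.

End DeterminantMean.

(* The total Monge-Ampere mass does not depend on the perturbation. *)
Lemma ccmean_det_hess s : ccmean (fun z => \det (hess s z)) = (pi ^+ n)%:C%C.
Proof.
apply: (@ccmean_det_option (doubled s)) => z j k.
by rewrite hess_doubled entry_option.
Qed.

End TrigonometricPolynomials.

(** * Second-order expansion of the weight *)

Section QuadraticApproximation.
Variables (R : realType) (n : nat).
Local Notation C := R[i].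
Local Notation E := ('I_n -> C).
Implicit Types (z w : E) (s : tcoef R n) (m : mode n).

Lemma Re_conj_cabs (L : C) : complex.Re (L ^+ 2) = 2 * complex.Re L ^+ 2 - cabs L ^+ 2.
Proof. by rewrite sqr_cabs expr2 cReM; ring. Qed.

Lemma Re_realM (a : R) (x : C) : complex.Re (a%:C%C * x) = a * complex.Re x.
Proof. by rewrite cReM /= mul0r subr0. Qed.

(** The quadratic term of the cosine is split by $2(\mathrm{Re}\,L)^2=\mathrm{Re}(L^2)+|L|^2$ into
    the real part of a holomorphic polynomial and a Hermitian term. *)
Lemma Re_cis_taylor (g L : C) (tau : R) : tau = 2 * pi * complex.Re L ->
  `|complex.Re (g * cis tau) - (complex.Re g -
     complex.Re ((2 * pi * complex.Im g)%:C%C * L + (pi ^+ 2 * complex.Re g)%:C%C * L ^+ 2) -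
     pi ^+ 2 * complex.Re g * cabs L ^+ 2)| <= cabs g * (tau ^+ 4 + `|tau| ^+ 3).
Proof.
move=> tauE; have -> : complex.Re (g * cis tau) - (complex.Re g -
     complex.Re ((2 * pi * complex.Im g)%:C%C * L + (pi ^+ 2 * complex.Re g)%:C%C * L ^+ 2) -
     pi ^+ 2 * complex.Re g * cabs L ^+ 2) =
   complex.Re g * (cos tau - 1 + tau ^+ 2 / 2) - complex.Im g * (sin tau - tau).
  by rewrite cReM cReD !Re_realM Re_conj_cabs /= tauE; field.
rewrite [leRHS]mulrDr; apply: le_trans (ler_normB _ _) _; rewrite !normrM; apply: lerD.
  by apply: ler_pM => //; [exact: Re_le_cabs|exact: cos_taylor2].
by apply: ler_pM => //; [exact: Im_le_cabs|exact: sin_taylor1].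
Qed.

Definition mode_size m : R := \sum_i cabs (mu R m i).

Lemma mode_size_ge0 m : 0 <= mode_size m.
Proof. by apply: sumr_ge0 => i _; exact: cabs_ge0. Qed.

Lemma cabs_lin m w : cabs (lin m w) <= mode_size m * cnorm w.
Proof.
apply: le_trans (cabs_sum _ _ _) _; rewrite mulr_suml; apply: ler_sum => i _.
by rewrite cabsM cabsJ ler_wpM2l ?cabs_ge0// cabs_le_cnorm.
Qed.

(** The holomorphic polynomial in [w] whose real part is the pluriharmonic part of the expansion of
    [tpoly] at [z]; [qlin] plays this role for [Qim]. Multiplying a section by an exponential of
    such a polynomial removes this part from the weight. *)
Definition tlin s z w : C := - \sum_(x <- s)
  ((2 * pi * complex.Im (x.1 * emode x.2 z))%:C%C * lin x.2 w +
   (pi ^+ 2 * complex.Re (x.1 * emode x.2 z))%:C%C * lin x.2 w ^+ 2).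

Definition qlin z w : C :=
  \sum_i (Complex 0 (- (4 * pi * complex.Im (z i))) * w i - pi%:C%C * w i ^+ 2).

Definition Qim z : R := 2 * pi * \sum_i complex.Im (z i) ^+ 2.

Definition Phi s z : R := Qim z + tpoly s z.

Lemma emode_cabs m z : cabs (emode m z : C) = 1.
Proof. exact: cabs_cis. Qed.

Lemma tpoly_taylor s : exists2 K, 0 <= K & forall z w, cnorm w <= 1 ->
  `|tpoly s (z + w) - (tpoly s z + complex.Re (tlin s z w) +
     (qf (hess s z) w - pi * sqn w))| <= K * cnorm w ^+ 3.
Proof.
pose c m : R := 2 * pi * mode_size m.
have c0 m : 0 <= c m by rewrite !mulr_ge0 ?pi_ge0 ?mode_size_ge0.
exists (\sum_(x <- s) cabs x.1 * (c x.2 ^+ 4 + c x.2 ^+ 3)).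
  by apply: sumr_ge0 => x _; rewrite mulr_ge0 ?cabs_ge0 ?addr_ge0 ?exprn_ge0.
move=> z w w1.
have -> : tpoly s (z + w) - (tpoly s z + complex.Re (tlin s z w) +
     (qf (hess s z) w - pi * sqn w)) =
   \sum_(x <- s) (complex.Re (x.1 * emode x.2 z * cis (2 * pi * complex.Re (lin x.2 w))) -
     (complex.Re (x.1 * emode x.2 z) -
     complex.Re ((2 * pi * complex.Im (x.1 * emode x.2 z))%:C%C * lin x.2 w +
       (pi ^+ 2 * complex.Re (x.1 * emode x.2 z))%:C%C * lin x.2 w ^+ 2) -
     pi ^+ 2 * complex.Re (x.1 * emode x.2 z) * cabs (lin x.2 w) ^+ 2)).
  rewrite qf_hess /tlin cReN cRe_sum /tpoly [RHS]sumrB [X in _ = _ - X]sumrB.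
  rewrite [X in _ = _ - (X - _)]sumrB.
  congr (_ - _); last by ring.
  by apply: eq_bigr => x _; rewrite emodeD -phase_lin mulrA.
apply: le_trans (ler_norm_sum _ _ _) _; rewrite mulr_suml; apply: ler_sum => x _.
apply: le_trans (Re_cis_taylor _ erefl) _; set t := 2 * pi * _.
rewrite cabsM emode_cabs mulr1 -[leRHS]mulrA ler_wpM2l ?cabs_ge0// mulrDl.
have tb : `|t| <= c x.2 * cnorm w.
  rewrite /t /c normrM ger0_norm ?mulr_ge0 ?pi_ge0// -[leRHS]mulrA ler_wpM2l ?mulr_ge0 ?pi_ge0//.
  by apply: le_trans (Re_le_cabs _) (cabs_lin _ _).
have cw : 0 <= c x.2 * cnorm w by rewrite mulr_ge0// cnorm_ge0.
apply: lerD; last by rewrite -exprMn lerXn2r ?nnegrE.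
have -> : t ^+ 4 = `|t| ^+ 4 by rewrite -normrX ger0_norm// exprn_even_ge0.
apply: (@le_trans _ _ ((c x.2 * cnorm w) ^+ 4)); first by rewrite lerXn2r ?nnegrE.
by rewrite exprMn ler_wpM2l ?exprn_ge0// exprS ler_piMl ?exprn_ge0 ?cnorm_ge0.
Qed.

Lemma Qim_expand z w : Qim (z + w) = Qim z + complex.Re (qlin z w) + pi * sqn w.
Proof.
rewrite /Qim /qlin /sqn cRe_sum !mulr_sumr -!big_split /=; apply: eq_bigr => i _.
rewrite -[(z + w) i]/(z i + w i) cImD cReD cReN Re_realM Re_conj_cabs cReM /= sqr_cabs.
ring.
Qed.

Definition plin s z w : C := qlin z w + tlin s z w.

Lemma Phi_taylor s : exists2 K, 0 <= K & forall z w, cnorm w <= 1 ->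
  `|Phi s (z + w) - (Phi s z + complex.Re (plin s z w) + qf (hess s z) w)| <=
  K * cnorm w ^+ 3.
Proof.
have [K K0 KP] := tpoly_taylor s; exists K => // z w w1; rewrite /Phi /plin Qim_expand cReD.
have := KP z w w1; congr (`|_| <= _); ring.
Qed.

Lemma hpoly_lin m : hpoly (lin m : E -> C).
Proof.
apply: hpoly_sum => i; apply: hpolyM; [exact: hpoly_cst|exact: hpoly_coord].
Qed.

Lemma hpolyZ (c : C) (p : E -> C) : hpoly p -> hpoly (fun w => c * p w).
Proof. by apply: hpolyM; exact: hpoly_cst. Qed.

Lemma hpoly_plin s z : hpoly (plin s z).
Proof.
apply: hpolyD.
  apply: hpoly_sum => i; apply: hpolyD; first by apply: hpolyZ; exact: hpoly_coord.
  apply: (@hpoly_ext _ _ (fun w : E => (- pi%:C%C) * w i ^+ 2)); last by move=> w; rewrite mulNr.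
  by apply: hpolyZ; apply: (@hpolyX _ _ (fun w : E => w i)); exact: hpoly_coord.
apply: (@hpoly_ext _ _ (fun w => (-1) * (- tlin s z w))); last by move=> w; rewrite mulN1r opprK.
apply: hpolyZ; rewrite /tlin; under [X in hpoly X]eq_fun do rewrite opprK.
apply: hpoly_sum => x; apply: hpolyD; apply: hpolyZ; first exact: hpoly_lin.
exact: (@hpolyX _ _ (fun w : E => lin x.2 w) 2 (hpoly_lin _)).
Qed.

Lemma lin0 m : lin m (0 : E) = 0.
Proof. by rewrite /lin big1 // => i _; rewrite mulr0. Qed.

Lemma plin0 s z : plin s z 0 = 0.
Proof.
rewrite /plin /qlin /tlin !big1 ?oppr0 ?addr0// => [x _|i _].
  by rewrite lin0 expr0n /= !mulr0 addr0.
by rewrite -[(0 : E) i]/(0 : C) expr0n /= !mulr0 subr0.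
Qed.

Lemma tpoly_lat s z k l : tpoly s (z + lat R k l) = tpoly s z.
Proof. by apply: eq_bigr => x _; rewrite emode_lat. Qed.

Lemma cont_tpoly s : cont (tpoly s).
Proof.
apply: cont_sum => x.
exact: (ccontM (@ccont_cst R n x.1) (@ccont_emode R n x.2)).1.
Qed.

Lemma cont_Qim : cont (@Qim : E -> R).
Proof.
apply: contZ; apply: cont_sum => i; have [_ c2] := @ccont_coord R n i.
exact: contM.
Qed.

Lemma cont_Phi s : cont (Phi s).
Proof. by apply: contD; [exact: cont_Qim|exact: cont_tpoly]. Qed.

Lemma hess_lat s z k l : hess s (z + lat R k l) = hess s z.
Proof.
by apply/matrixP => i j; rewrite !mxE; congr (_ - _); apply: eq_bigr => x _; rewrite emode_lat.
Qed.

Lemma sqn_cscale (c : C) w : sqn (cscale c w) = cabs c ^+ 2 * sqn w.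
Proof.
by rewrite /sqn mulr_sumr; apply: eq_bigr => i _; rewrite /cscale cabsM exprMn.
Qed.

Lemma qf_cscale (H : 'M[C]_n) (c : C) w : qf H (cscale c w) = cabs c ^+ 2 * qf H w.
Proof.
rewrite !qfE -Re_realM; congr complex.Re; rewrite mulr_sumr; apply: eq_bigr => j _.
rewrite mulr_sumr; apply: eq_bigr => k _; rewrite /cscale -mulJc.
have -> : conjc (c * w j) = conjc c * conjc (w j) by rewrite rmorphM.
have ac (a b e f g : C) : a * b * e * (f * g) = f * a * (b * e * g) by ring.
exact: ac.
Qed.

Lemma cnorm_le_sqn w (r : R) : 0 <= r -> sqn w <= r ^+ 2 -> cnorm w <= n%:R * r.
Proof.
move=> r0 h; apply: cnorm_le_const => i; rewrite -(@ler_pXn2r _ 2) ?nnegrE ?cabs_ge0//.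
apply: le_trans h; rewrite /sqn (bigD1 i)//= lerDl; apply: sumr_ge0 => j _.
exact: sqr_ge0.
Qed.

Lemma sum_cis_eq0 (M j : nat) : (0 < j < M)%N ->
  \sum_(k < M) cis (rootang R M k) ^+ j = 0 :> C.
Proof.
move=> /andP[j0 jM]; have M0 : (0 < M)%N by exact: leq_trans jM.
have prim := @cis_primitive R M M0; set x := cis _ in prim.
have cx k : cis (rootang R M k) = x ^+ k.
  by rewrite /x cisX /rootang -mulr_natr; congr cis; ring.
have : (x ^+ j - 1) * \sum_(k < M) cis (rootang R M k) ^+ j = 0.
  under eq_bigr do rewrite cx -exprM mulnC exprM.
  by rewrite -subrX1 -exprM mulnC exprM (prim_expr_order prim) expr1n subrr.
move/eqP; rewrite mulf_eq0 subr_eq0 => /orP[|/eqP //].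
by rewrite -(prim_order_dvd prim) => /(dvdn_leq j0); rewrite leqNgt jM.
Qed.

End QuadraticApproximation.

(** * A lower bound for means of nonnegative periodic functions *)

Section TrigonometricApproximation.
Variables (R : realType) (n : nat).
Local Notation C := R[i].
Local Notation E := ('I_n -> C).
Implicit Types (a b z w : E) (s : tcoef R n) (m : mode n) (psi G : E -> R).

Lemma grid_point (L : nat) (x : R) : (0 < L)%N ->
  exists (j : 'I_L) (k : int), `|x + j%:R / L%:R + k%:~R| <= L%:R^-1.
Proof.
move=> L0; pose t := Num.floor (- (x * L%:R)).
have Lz : (L%:Z != 0)%R by rewrite eqz_nat -lt0n.
have LR : (0 : R) < L%:R by rewrite ltr0n.
have tm : (0 <= (t %% L)%Z)%R by rewrite modz_ge0.
have tl : (`|(t %% L)%Z| < L)%N.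
  by have := ltz_pmod t (L0 : (0 < L%:Z)%R); rewrite -{1}(gez0_abs tm) ltz_nat.
exists (Ordinal tl), ((t %/ L)%Z).
have tE : (t%:~R : R) = (t %/ L)%Z%:~R * L%:R + (`|(t %% L)%Z|%N)%:R.
  by rewrite {1}(divz_eq t L) intrD intrM -{1}(gez0_abs tm).
have /andP[h1 h2] := floor_itv (- (x * L%:R) : R); rewrite -/t intrD in h1 h2.
have -> : x + (Ordinal tl : nat)%:R / L%:R + (t %/ L)%Z%:~R =
    (x * L%:R + t%:~R) / L%:R.
  by rewrite tE /=; field; rewrite gt_eqF.
rewrite normrM [`|L%:R^-1|]ger0_norm ?invr_ge0 ?ler0n// ler_piMl ?invr_ge0 ?ler0n//.
by rewrite ler_norml; apply/andP; split; move: h1 h2; rewrite /=; lra.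
Qed.

(** For every [z], one of finitely many grid translates lies within [eta] of [z0] modulo the
    lattice. The sum of the translates of [G] is therefore at least [m0] everywhere, and [c] is the
    inverse of their number. *)
Lemma cmean_lower (eta : R) : 0 < eta -> exists2 c, 0 < c &
  forall G z0 (m0 : R), tame G -> periodic G -> (forall z, 0 <= G z) ->
    (forall z, cnorm (z - z0) <= eta -> m0 <= G z) -> c * m0 <= cmean G.
Proof.
move=> eta0; pose L := (Num.truncn (n%:R * 2 / eta)).+1.
have LR : (0 : R) < L%:R by rewrite ltr0n.
have Leta : n%:R * (L%:R^-1 + L%:R^-1) <= eta.
  have -> : n%:R * (L%:R^-1 + L%:R^-1) = n%:R * 2 / L%:R :> R by ring.
  by rewrite ler_pdivrMr// [eta * _]mulrC -ler_pdivrMr//; apply/ltW/truncnS_gt.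
pose I := {ffun 'I_n -> 'I_L * 'I_L}.
pose sh (f : I) : E := fun i => Complex ((f i).1%:R / L%:R) ((f i).2%:R / L%:R).
have I0 : (0 < #|I|)%N.
  by rewrite card_ffun card_prod !card_ord expn_gt0 muln_gt0.
exists (#|I|%:R^-1); first by rewrite invr_gt0 ltr0n.
move=> G z0 m0 tG pG G0 Gm.
rewrite ler_pdivrMl ?ltr0n//.
have -> : #|I|%:R * cmean G = cmean (fun z => \sum_(f : I) G (z + sh f)).
  rewrite cmean_sum => [|f]; last exact: tame_translate.
  rewrite (eq_bigr (fun=> cmean G)) => [|f _]; last exact: cmean_translate.
  by rewrite sumr_const mulr_natl.
rewrite -[leLHS](@cmean_cst R n); apply: cmean_mono.
- exact: tame_cst.
- by apply: tame_sum => f; exact: tame_translate.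
move=> z.
have /choice[j1 /choice[k1 h1]] := fun i => @grid_point L (complex.Re (z i - z0 i)) isT.
have /choice[j2 /choice[k2 h2]] := fun i => @grid_point L (complex.Im (z i - z0 i)) isT.
have near : cnorm (z + sh [ffun i => (j1 i, j2 i)] + lat R k1 k2 - z0) <= eta.
  apply: le_trans Leta; apply: cnorm_le_const => i; apply: le_trans (cabs_le_ReIm _) _.
  have -> : (z + sh [ffun i => (j1 i, j2 i)] + lat R k1 k2 - z0) i =
     z i - z0 i + sh [ffun i => (j1 i, j2 i)] i + lat R k1 k2 i.
    by rewrite -[LHS]/(z i + sh _ i + lat R k1 k2 i - z0 i); ring.
  rewrite !(cReD, cImD) /sh /= ffunE /=; apply: lerD.
    by have := h1 i; rewrite /= cReD.
  by have := h2 i; rewrite /= cImD.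
apply: le_trans (Gm _ near) _; rewrite pG (bigD1 [ffun i => (j1 i, j2 i)])//= lerDl.
by apply: sumr_ge0.
Qed.

(** The constant 256 fits a crude split at 1/2. Beyond it [t ^+ 2] is at most 16, and 16/256 equals
    the bound 1/16 already reached at 1/2. *)
Lemma one_sub_cos_ge (t : R) : `|t| <= pi -> t ^+ 2 / 256 <= 1 - cos t.
Proof.
have small (v : R) : 0 <= v -> v <= 2^-1 -> v ^+ 2 / 4 <= 1 - cos v.
  move=> v0 v1; have := cos_taylor2 v; rewrite ler_norml => /andP[_ h].
  have v2 : v ^+ 2 <= 4^-1.
    have <- : (2^-1 : R) ^+ 2 = 4^-1 by field.
    by rewrite lerXn2r ?nnegrE ?invr_ge0.
  have v4 : v ^+ 4 <= v ^+ 2 * 4^-1.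
    have -> : v ^+ 4 = v ^+ 2 * v ^+ 2 by rewrite -exprD.
    by rewrite ler_wpM2l ?sqr_ge0.
  by move: (v ^+ 4) (v ^+ 2) (cos v) h v4 => *; lra.
have gen (u : R) : 0 <= u -> u <= pi -> u ^+ 2 / 256 <= 1 - cos u.
  move=> u0 upi; have [u1|u1] := leP u 2^-1.
    apply: le_trans (small u u0 u1); rewrite ler_wpM2l ?sqr_ge0//; lra.
  have pi4 : pi <= 4 :> R by have := @pihalf_lt2 R; lra.
  have h : cos u < cos 2^-1.
    have i1 : u \in `[0, pi]%R by rewrite in_itv /= u0 upi.
    have i2 : 2^-1 \in `[0, pi : R]%R.
      by rewrite in_itv /=; apply/andP; have := @pi_ge2 R; split; lra.
    by rewrite ltr_cos.
  have h2 : (2^-1 : R) ^+ 2 / 4 <= 1 - cos 2^-1 by apply: small; lra.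
  have u16 : u ^+ 2 <= 16.
    have <- : (4 : R) ^+ 2 = 16 by rewrite -natrX.
    by rewrite lerXn2r ?nnegrE// (le_trans upi).
  have e4 : (2^-1 : R) ^+ 2 = 4^-1 by field.
  by rewrite e4 in h2; move: (u ^+ 2) (cos u) (cos _) h h2 u16 => *; lra.
move=> tpi; have -> : t ^+ 2 = `|t| ^+ 2 by rewrite real_normK ?num_real.
have -> : cos t = cos `|t| by case: (ger0P t) => //; rewrite cosN.
exact: gen.
Qed.

End TrigonometricApproximation.

(** * A trigonometric polynomial peaking on the lattice *)

Section TrigonometricKernel.
Variables (R : realType) (n : nat).
Local Notation C := R[i].
Local Notation E := ('I_n -> C).
Implicit Types (a b z w : E) (s : tcoef R n) (m : mode n) (psi G f g : E -> R).

Definition trigonometric f := exists s, forall z, f z = tpoly s z.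

Lemma trigonometric_ext f g : trigonometric f -> f =1 g -> trigonometric g.
Proof. by move=> [s sP] fg; exists s => z; rewrite -fg. Qed.

Lemma trigonometric_mode (c : C) m : trigonometric (fun z => complex.Re (c * emode m z)).
Proof. by exists [:: (c, m)] => z; rewrite /tpoly big_seq1. Qed.

Lemma trigonometric_cst (c : R) : trigonometric (fun=> c).
Proof.
apply: trigonometric_ext (trigonometric_mode c%:C%C (fun=> 0, fun=> 0)) _ => z.
rewrite /emode /phase big1 ?mulr0 ?cis0 ?mulr1// => i _.
by rewrite !mul0r addr0.
Qed.

Lemma trigonometricD f g : trigonometric f -> trigonometric g ->
  trigonometric (fun z => f z + g z).
Proof.
by move=> [s sP] [t tP]; exists (s ++ t) => z; rewrite sP tP /tpoly big_cat.
Qed.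

Lemma trigonometric_sum (I : Type) (r : seq I) (F : I -> E -> R) :
  (forall i, trigonometric (F i)) -> trigonometric (fun z => \sum_(i <- r) F i z).
Proof.
move=> tF; elim: r => [|i r IH].
  by apply: trigonometric_ext (trigonometric_cst 0) _ => z; rewrite big_nil.
by apply: trigonometric_ext (trigonometricD (tF i) IH) _ => z; rewrite big_cons.
Qed.

Definition mode_add m m' : mode n := (fun i => m.1 i + m'.1 i, fun i => m.2 i + m'.2 i).

Lemma emode_add m m' z : emode (mode_add m m') z = emode m z * emode m' z :> C.
Proof.
rewrite /emode -cisD -mulrDr; congr (cis (_ * _)); rewrite /phase -big_split.
by apply: eq_bigr => i _; rewrite /= !intrD; ring.
Qed.

(** Product-to-sum formula: $2\,\mathrm{Re}\,a\,\mathrm{Re}\,b=\mathrm{Re}(ab)+\mathrm{Re}(a\bar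
    b)$. *)
Lemma trigonometric_modeM (c d : C) m m' :
  trigonometric (fun z => complex.Re (c * emode m z) * complex.Re (d * emode m' z)).
Proof.
have t1 := trigonometric_mode (2^-1%:C%C * (c * d)) (mode_add m m').
have t2 := trigonometric_mode (2^-1%:C%C * (c * conjc d)) (mode_add m (mode_opp m')).
apply: trigonometric_ext (trigonometricD t1 t2) _ => z.
rewrite !emode_add emode_opp -!mulrA !Re_realM.
move: (emode m z) (emode m' z) => [x1 x2] [y1 y2].
by case: c d {t1 t2} => [c1 c2] [d1 d2]; rewrite !(cReM, cImM) /=; field.
Qed.

Lemma trigonometricM f g : trigonometric f -> trigonometric g ->
  trigonometric (fun z => f z * g z).
Proof.
move=> [s sP] [t tP].
have h : trigonometric (fun z => \sum_(x <- s) \sum_(y <- t)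
    complex.Re (x.1 * emode x.2 z) * complex.Re (y.1 * emode y.2 z)).
  apply: trigonometric_sum => x; apply: trigonometric_sum => y.
  exact: trigonometric_modeM.
apply: trigonometric_ext h _ => z; rewrite sP tP /tpoly mulr_suml.
by apply: eq_bigr => x _; rewrite mulr_sumr.
Qed.

Lemma trigonometricX f k : trigonometric f -> trigonometric (fun z => f z ^+ k).
Proof.
move=> tf; elim: k => [|k IH].
  by apply: trigonometric_ext (trigonometric_cst 1) _ => z; rewrite expr0.
by apply: trigonometric_ext (trigonometricM tf IH) _ => z; rewrite exprS.
Qed.

Lemma trigonometricZ (c : R) f : trigonometric f -> trigonometric (fun z => c * f z).
Proof. exact: trigonometricM (trigonometric_cst c). Qed.

Lemma trigonometric_cont f : trigonometric f -> cont f.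
Proof.
move=> [s sP]; have -> : f = tpoly s by apply/funext.
exact: cont_tpoly.
Qed.

Lemma trigonometric_periodic f : trigonometric f -> periodic f.
Proof. by move=> [s sP] z k l; rewrite !sP tpoly_lat. Qed.

Lemma trigonometric_tame f : trigonometric f -> tame f.
Proof.
move=> tf; apply: cont_periodic_tame; [exact: trigonometric_cont|].
exact: trigonometric_periodic.
Qed.

Lemma trigonometric_cos_Re i : trigonometric (fun z => cos (2 * pi * complex.Re (z i))).
Proof.
apply: trigonometric_ext (trigonometric_mode 1 (fun j => (j == i)%:Z, fun=> 0)) _ => z.
rewrite mul1r /emode /phase (bigD1 i)//= eqxx big1 => [|j /negbTE ->].
  by rewrite mul1r mul0r !addr0.
by rewrite !mul0r addr0.
Qed.

Lemma trigonometric_cos_Im i : trigonometric (fun z => cos (2 * pi * complex.Im (z i))).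
Proof.
apply: trigonometric_ext (trigonometric_mode 1 (fun=> 0, fun j => (j == i)%:Z)) _ => z.
rewrite mul1r /emode /phase (bigD1 i)//= eqxx big1 => [|j /negbTE ->].
  by rewrite mul1r mul0r add0r addr0.
by rewrite !mul0r addr0.
Qed.

(** It equals 1 exactly on the lattice, so its high powers concentrate there. Each summand is at
    most 4, which the normalisation uses to keep the values in $[0,1]$. *)
Definition peak z : R := 1 - (4 * n.+1%:R)^-1 *
  \sum_i ((1 - cos (2 * pi * complex.Re (z i))) + (1 - cos (2 * pi * complex.Im (z i)))).

Lemma trigonometric_peak : trigonometric peak.
Proof.
have tB f : trigonometric f -> trigonometric (fun z => 1 - f z).
  move=> tf; apply: trigonometric_ext
    (trigonometricD (trigonometric_cst 1) (trigonometricZ (-1) tf)) _ => z.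
  by rewrite mulN1r.
apply: (tB); apply: trigonometricZ; apply: trigonometric_sum => i.
apply: trigonometricD; apply: (tB); first exact: trigonometric_cos_Re.
exact: trigonometric_cos_Im.
Qed.

Lemma peak_ge0 z : 0 <= peak z.
Proof.
rewrite subr_ge0 ler_pdivrMl ?mulr_gt0 ?ltr0n// mulr1.
apply: (@le_trans _ _ (\sum_(i < n) 4)).
  apply: ler_sum => i _.
  by have := cos_geN1 (2 * pi * complex.Re (z i)); have := cos_geN1 (2 * pi * complex.Im (z i)); lra.
by rewrite sumr_const card_ord -[_ *+ n]mulr_natr ler_wpM2l// ler_nat.
Qed.

Lemma peak_le1 z : peak z <= 1.
Proof.
rewrite gerBl mulr_ge0 ?invr_ge0 ?mulr_ge0//; apply: sumr_ge0 => i _.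
by rewrite addr_ge0 ?subr_ge0 ?cos_le1.
Qed.

Lemma peak0 : peak 0 = 1.
Proof.
by rewrite /peak big1 ?mulr0 ?subr0// => i _ /=; rewrite mulr0 cos0 !subrr addr0.
Qed.

Lemma one_sub_cos_lattice (x : R) : exists k : int,
  (x + k%:~R) ^+ 2 / 16 <= 1 - cos (2 * pi * x).
Proof.
exists (- Num.floor (x + 2^-1)); set k := - _.
have c : cos (2 * pi * (x + k%:~R)) = cos (2 * pi * x).
  have := cisD (2 * pi * x) (2 * pi * k%:~R); rewrite cis_2pi_int mulr1 -mulrDr.
  by move=> /(congr1 (@complex.Re R)).
have /andP[h1 h2] := floor_itv (x + 2^-1); rewrite intrD in h2.
have kx : `|x + k%:~R| <= 2^-1.
  by rewrite ler_norml /k intrN; apply/andP; move: h1 h2; rewrite /=; split; lra.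
rewrite -c; apply: le_trans (one_sub_cos_ge _); last first.
  rewrite normrM ger0_norm ?mulr_ge0 ?pi_ge0//.
  apply: (@le_trans _ _ (2 * pi * 2^-1)); first by rewrite ler_wpM2l ?mulr_ge0 ?pi_ge0.
  by rewrite mulrAC mulfV ?mul1r.
have pi2 : 4 <= pi ^+ 2 :> R.
  have <- : (2 : R) ^+ 2 = 4 by rewrite -natrX.
  by rewrite lerXn2r ?nnegrE ?pi_ge0 ?pi_ge2.
rewrite [(2 * pi * _) ^+ 2]exprMn [(2 * pi) ^+ 2]exprMn.
have := sqr_ge0 (x + k%:~R); move: ((x + k%:~R) ^+ 2) (pi ^+ 2) pi2 => u v v4 u0.
have -> : 2 ^+ 2 * v * u / 256 = v * u / 64 by field.
have : 4 * u <= v * u by rewrite ler_wpM2r.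
by lra.
Qed.

Lemma peak_far (d : R) : 0 < d -> exists2 q, 0 < q < 1 & forall z, peak z <= q \/
  exists k l, cnorm (z + lat R k l) < d.
Proof.
move=> d0; pose r := Num.min d 1 / n.+1%:R; pose c : R := 16 * (4 * n.+1%:R).
have r0 : 0 < r by rewrite divr_gt0// lt_min d0 ltr01.
have r1 : r <= 1.
  rewrite ler_pdivrMr// mul1r (@le_trans _ _ 1)// ?ler1n//.
  by rewrite ge_min lexx orbT.
have c2 : 2 <= c by rewrite /c mulrA -[2]mulr1 ler_pM// ?ler1n//; lra.
have r21 : 0 < r ^+ 2 <= 1 by rewrite exprn_gt0//= expr_le1// ltW.
exists (1 - r ^+ 2 / c).
  have c0 : 0 < c by lra.
  rewrite gtrBl divr_gt0 ?andbT; [|by case/andP: r21|by []].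
  by rewrite subr_gt0 ltr_pdivrMr// mul1r; case/andP: r21 => _ h; lra.
move=> z.
have /choice[k kP] := fun i => one_sub_cos_lattice (complex.Re (z i)).
have /choice[l lP] := fun i => one_sub_cos_lattice (complex.Im (z i)).
have [far|near] := ltP (r ^+ 2) (sqn (z + lat R k l)); [left|right; exists k, l]; last first.
  apply: le_lt_trans (cnorm_le_sqn (ltW r0) near) _; rewrite /r mulrCA.
  apply: (@lt_le_trans _ _ (Num.min d 1)); last by rewrite ge_min lexx.
  rewrite -[ltRHS]mulr1 ltr_pM2l ?lt_min ?d0 ?ltr01//.
  by rewrite ltr_pdivrMr// mul1r ltr_nat.
rewrite lerD2l lerN2 /c invfM mulrA [leLHS]mulrC ler_wpM2l ?invr_ge0 ?mulr_ge0//.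
apply: (@le_trans _ _ (sqn (z + lat R k l) / 16)).
  by rewrite ler_wpM2r ?invr_ge0// ltW.
rewrite /sqn mulr_suml; apply: ler_sum => i _.
rewrite -[(z + _) i]/(z i + lat R k l i) sqr_cabs cReD cImD mulrDl.
by apply: lerD; [exact: kP|exact: lP].
Qed.

End TrigonometricKernel.

(** * Smoothing by trigonometric convolution *)

Section Smoothing.
Variables (R : realType) (n : nat).
Local Notation C := R[i].
Local Notation E := ('I_n -> C).
Implicit Types (a b z w y : E) (s : tcoef R n) (m : mode n) (psi G f g : E -> R).

Definition convol psi f z : R := cmean (fun y => psi (z + y) * f y).

Lemma cmean_Re_mulr (h : E -> C) (c : C) : ctame h ->
  cmean (fun y => complex.Re (h y * c)) = complex.Re (ccmean h * c).
Proof.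
move=> th; have := ccmeanZ c th => /(congr1 (@complex.Re R)) /=.
by rewrite mulrC => <-; congr cmean; apply/funext => y; rewrite mulrC.
Qed.

Lemma tame_convol psi f z : tame psi -> tame f -> tame (fun y => psi (z + y) * f y).
Proof.
move=> tp tf; apply: tameM => //; under [X in tame X]eq_fun do rewrite addrC.
exact: tame_translate.
Qed.

(** A translation under the mean moves [z] into the kernel, where $e(y-z)=e(y)\overline{e(z)}$
    separates the variables. The coefficients are the Fourier coefficients of [psi] times those of
    [f]. *)
Lemma trigonometric_convol psi f : tame psi -> periodic psi -> trigonometric f ->
  trigonometric (convol psi f).
Proof.
move=> tp pp tf; have [s sP] := tf.
pose h (x : C * mode n) y : C := (psi y)%:C%C * (conjc x.1 * emode (mode_opp x.2) y).
have th x : ctame (h x).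
  apply: ctameM; first by split; [exact: tp|exact: tame_cst].
  by apply: ctameM; [exact: ctame_cst|exact: ctame_emode].
have hs : trigonometric (fun z => \sum_(x <- s) complex.Re (ccmean (h x) * emode x.2 z)).
  by apply: trigonometric_sum => x; exact: trigonometric_mode.
apply: trigonometric_ext hs _ => z.
have pz : cmean (fun y => psi y * f (y - z)) = convol psi f z.
  rewrite -(@cmean_translate _ _ (fun y => psi y * f (y - z)) z).
  - by congr cmean; apply/funext => y; rewrite addrK addrC.
  - by apply: tameM => //; apply: (@tame_translate _ _ f (- z)); exact: trigonometric_tame.
  - by move=> y k l; rewrite pp addrAC (trigonometric_periodic tf).
rewrite -pz.
transitivity (cmean (fun y => \sum_(x <- s) complex.Re (h x y * emode x.2 z))).
  rewrite cmean_sum => [|x]; first by apply: eq_bigr => x _; rewrite cmean_Re_mulr.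
  by have [] := ctameM (th x) (@ctame_cst R n (emode x.2 z)).
congr cmean; apply/funext => y; rewrite sP /tpoly mulr_sumr; apply: eq_bigr => x _.
rewrite /h -mulrA Re_realM; congr (_ * _).
have -> : emode x.2 (y - z) = emode x.2 y * conjc (emode x.2 z).
  rewrite emodeD -emode_opp; congr (_ * _); rewrite /emode; congr (cis (_ * _)).
  rewrite /phase; apply: eq_bigr => i _; rewrite -[(- z) i]/(- z i) cReN cImN /= !intrN.
  ring.
rewrite emode_opp.
case: (x.1) (emode x.2 y) (emode x.2 z) => [c1 c2] [y1 y2] [z1 z2].
by rewrite !(cReM, cImM) /=; ring.
Qed.

(* The sub-mean value property of [Qim + psi], expressed in the periodic function
   [psi] alone: [Qim] exceeds its value at the centre by [pi * sqn b]. *)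
Definition quasi_smv psi := exists2 r : R, 0 < r & forall e : R, 0 < e ->
  exists M0, forall M, (M0 <= M)%N -> (0 < M)%N -> forall a b, cnorm b <= r ->
  psi a - pi * sqn b - e <= avg M psi a b.

(** Averaging over circles commutes with the convolution. The threshold of [quasi_smv] is uniform in
    the centre, so the inequality can be integrated over all translates [a + y]. *)
Lemma quasi_smv_convol psi f : tame psi -> tame f -> (forall y, 0 <= f y) ->
  cmean f = 1 -> quasi_smv psi -> quasi_smv (convol psi f).
Proof.
move=> tp tf f0 f1 [r r0 rP]; exists r => // e e0; have [M0 MP] := rP e e0.
exists M0 => M MM M1 a b br.
have -> : avg M (convol psi f) a b = cmean (fun y => avg M psi (a + y) b * f y).
  rewrite /avg -cmean_sum => [|k]; last exact: tame_convol.
  rewrite -cmeanZ; last by apply: tame_sum => k; exact: tame_convol.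
  congr cmean; apply/funext => y; rewrite -mulrA mulr_suml; congr (_ * _).
  by apply: eq_bigr => k _; rewrite circ_shift.
have tpf := tame_convol a tp tf.
have -> : convol psi f a - pi * sqn b - e =
    cmean (fun y => psi (a + y) * f y + (- (pi * sqn b + e)) * f y).
  by rewrite cmeanD ?cmeanZ//; [rewrite f1 /convol; ring|exact: tameZ].
apply: cmean_mono; first by apply: tameD => //; exact: tameZ.
  apply: tameM => //; rewrite /avg; apply: tameZ; apply: tame_sum => k.
  under [X in tame X]eq_fun do rewrite -circ_shift addrC; exact: tame_translate.
move=> y; rewrite -mulrDl ler_wpM2r//; have := MP M MM M1 (a + y) b br; lra.
Qed.

Lemma periodic_unif psi (e : R) : cont psi -> periodic psi -> 0 < e ->
  exists2 d, 0 < d & forall z w, cnorm w < d -> `|psi (z + w) - psi z| < e.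
Proof.
move=> cp pp e0; have [d d0 dP] := cont_unif (n%:R * 2) cp e0.
exists d => // z w wd; have [k [l zkl]] := periodic_reduce z.
have := dP (z + lat R k l) (z + lat R k l + w) zkl.
have -> : z + lat R k l + w - (z + lat R k l) = w by rewrite addrAC subrr add0r.
by move=> /(_ wd); rewrite addrAC !pp.
Qed.

(** The kernel is a normalised high power of [peak]. Away from the lattice the power is at most
    [q ^+ M], while by [cmean_lower] its mean is at least a constant times the [M]-th power of
    [(1 + q) / 2]; the ratio tends to 0. *)
Lemma convol_close psi (e : R) : cont psi -> periodic psi -> 0 < e ->
  exists f, [/\ trigonometric f, forall y, 0 <= f y, cmean f = 1 &
    forall z, `|convol psi f z - psi z| <= e].
Proof.
move=> cp pp e0; have tp := cont_periodic_tame cp pp.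
have e2 : 0 < e / 2 by lra.
have [d d0 dP] := periodic_unif cp pp e2.
have [q /andP[q0 q1] qP] := @peak_far R n d d0.
have [K K0 KP] : exists2 K, 0 <= K & forall z, `|psi z| <= K by case: tp.
have [eta eta0 etaP] : exists2 eta, 0 < eta & forall z, cnorm z <= eta -> (1 + q) / 2 <= peak z.
  have q2 : 0 < (1 - q) / 2 by lra.
  have [d' [d'0 dP']] := trigonometric_cont (@trigonometric_peak R n) 0 q2.
  exists (d' / 2) => [|z zd]; first exact: divr_gt0.
  have : cnorm (z - 0) < d' by rewrite subr0; apply: le_lt_trans zd _; lra.
  by move=> /dP'; rewrite peak0 ltr_norml => /andP[h _]; lra.
have [c c0 cP] := @cmean_lower R n eta eta0.
have q'0 : 0 < (1 + q) / 2 by lra.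
have qq : 0 <= q / ((1 + q) / 2) < 1.
  by rewrite divr_ge0 ?ltW//= ltr_pdivrMr// mul1r; lra.
have [M MP] : exists M, 2 * K * (q / ((1 + q) / 2)) ^+ M <= c * (e / 2).
  have [M0 M0P] := @eventually_expr_le R _ (c * (e / 2) / (2 * K + 1)) qq
    (divr_gt0 (mulr_gt0 c0 e2) (ltr_wpDl (mulr_ge0 (ler0n _ 2) K0) ltr01)).
  exists M0; have := M0P M0 (leqnn _); rewrite ler_pdivlMr; last lra.
  apply: le_trans; rewrite mulrC ler_wpM2l ?exprn_ge0 ?lerDl//; lra.
pose g y := peak y ^+ M.
have tg : trigonometric g by apply: trigonometricX; exact: trigonometric_peak.
have gt := trigonometric_tame tg.
have g0 y : 0 <= g y by rewrite exprn_ge0 ?peak_ge0.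
pose A := cmean g.
have cA : c * ((1 + q) / 2) ^+ M <= A.
  apply: (cP g 0) => //; first exact: trigonometric_periodic.
  by move=> z; rewrite subr0 => /etaP h; rewrite lerXn2r ?nnegrE ?peak_ge0// ltW.
have A0 : 0 < A by apply: lt_le_trans cA; rewrite mulr_gt0 ?exprn_gt0.
pose f y := A^-1 * g y.
have tf : trigonometric f by exact: trigonometricZ.
have f0 y : 0 <= f y by rewrite mulr_ge0 ?invr_ge0 ?(ltW A0).
have ft := trigonometric_tame tf.
have f1 : cmean f = 1 by rewrite cmeanZ// mulVf ?gt_eqF.
exists f; split=> // z.
have pointwise y : `|(psi (z + y) - psi z) * f y| <= e / 2 * f y + e / 2.
  rewrite normrM [`|f y|]ger0_norm//.
  have [far|[k [l near]]] := qP y; last first.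
    have -> : psi (z + y) = psi (z + (y + lat R k l)) by rewrite addrA pp.
    apply: (@le_trans _ _ (e / 2 * f y)); last by rewrite lerDl; lra.
    by rewrite ler_wpM2r// ltW// dP.
  apply: (@le_trans _ _ (e / 2)); last by rewrite lerDr mulr_ge0//; lra.
  have fb : f y <= q ^+ M / (c * ((1 + q) / 2) ^+ M).
    rewrite /f mulrC; apply: ler_pM => //; first by rewrite invr_ge0 ltW.
      by rewrite lerXn2r ?nnegrE ?peak_ge0// ltW.
    by rewrite lef_pV2 ?posrE// mulr_gt0 ?exprn_gt0.
  have pb : `|psi (z + y) - psi z| <= 2 * K.
    by apply: le_trans (ler_normB _ _) _; rewrite mulr_natl mulr2n; exact: lerD.
  apply: le_trans (ler_pM _ _ pb fb) _ => //.
  rewrite invfM [_^-1 * _]mulrC mulrA mulrA ler_pdivrMr// [_ * c]mulrC.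
  by apply: le_trans MP; rewrite [(q / _) ^+ M]expr_div_n mulrA.
clearbody f.
have tz : tame (fun y => psi (z + y) * f y) by exact: tame_convol.
have -> : convol psi f z - psi z = cmean (fun y => (psi (z + y) - psi z) * f y).
  under [X in cmean X]eq_fun do rewrite mulrBl -mulNr.
  by rewrite cmeanD ?cmeanZ ?f1 ?mulr1//; exact: tameZ.
have tz2 : tame (fun y => (psi (z + y) - psi z) * f y).
  under [X in tame X]eq_fun do rewrite mulrBl -mulNr.
  by apply: tameD => //; exact: tameZ.
have te : tame (fun y => e / 2 * f y + e / 2).
  by apply: tameD; [exact: tameZ|exact: tame_cst].
have me : cmean (fun y => e / 2 * f y + e / 2) = e.
  rewrite cmeanD; [|exact: tameZ|exact: tame_cst].
  by rewrite cmeanZ// cmean_cst f1; lra.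
rewrite ler_norml -me; apply/andP; split.
  rewrite lerNl -cmeanN//; apply: cmean_mono => //.
    by have := tameZ (-1) tz2; congr tame; apply/funext => y; rewrite mulN1r.
  by move=> y; have := pointwise y; rewrite ler_norml => /andP[h _]; rewrite lerNl.
apply: cmean_mono => // y; have := pointwise y; rewrite ler_norml => /andP[_ h] //.
Qed.

(** Averaging over at least three roots of unity kills the holomorphic linear and quadratic terms of
    the expansion. The inequality becomes a lower bound for the Hermitian form with a cubic error,
    which disappears when [w] is scaled to 0 and the square of the scale is divided out. *)
Lemma hess_ge0 s : quasi_smv (tpoly s) -> forall z w, 0 <= qf (hess s z) w.
Proof.
move=> [r r0 rP] z.
have [K K0 KP] := tpoly_taylor s.
have small w : cnorm w <= Num.min r 1 -> - (K * cnorm w ^+ 3) <= qf (hess s z) w.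
  rewrite le_min => /andP[wr w1]; apply/ler_addgt0Pr => e e0.
  have [M0 MP] := rP e e0; pose M := maxn M0 3.
  have M3 : (3 <= M)%N by exact: leq_maxr.
  have Mp : (0 < M)%N by exact: leq_trans M3.
  have h := MP M (leq_maxl _ _) Mp z w wr.
  pose L (c : C) : R := complex.Re (tlin s z (cscale c w)).
  have sumL : \sum_(k < M) L (cis (rootang R M k)) = 0.
    pose A := \sum_(x <- s) ((2 * pi * complex.Im (x.1 * emode x.2 z))%:C%C * lin x.2 w).
    pose B := \sum_(x <- s) ((pi ^+ 2 * complex.Re (x.1 * emode x.2 z))%:C%C * lin x.2 w ^+ 2).
    have LE c : L c = - complex.Re (c ^+ 1 * A + c ^+ 2 * B).
      rewrite /L /tlin cReN; congr (- complex.Re _); rewrite /A /B !mulr_sumr -big_split.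
      apply: eq_bigr => x _.
      have -> : lin x.2 (cscale c w) = c * lin x.2 w.
        rewrite /lin mulr_sumr; apply: eq_bigr => i _; rewrite /cscale mulrCA //.
      have ac (f g l : C) : f * (c * l) + g * (c * l) ^+ 2 = c ^+ 1 * (f * l) + c ^+ 2 * (g * l ^+ 2).
        by ring.
      exact: ac.
    under eq_bigr do rewrite LE.
    have s1 := @sum_cis_eq0 R M 1 (ltnW M3); have s2 := @sum_cis_eq0 R M 2 M3.
    by rewrite sumrN -cRe_sum big_split -!mulr_suml s1 s2 !mul0r /= addr0 oppr0.
  have up : avg M (tpoly s) z w <= tpoly s z + (qf (hess s z) w - pi * sqn w) + K * cnorm w ^+ 3.
    rewrite /avg ler_pdivrMl ?ltr0n//.
    have -> : M%:R * (tpoly s z + (qf (hess s z) w - pi * sqn w) + K * cnorm w ^+ 3) =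
       \sum_(k < M) (L (cis (rootang R M k)) +
         (tpoly s z + (qf (hess s z) w - pi * sqn w) + K * cnorm w ^+ 3)).
      by rewrite big_split /= sumL add0r sumr_const card_ord mulr_natl.
    apply: ler_sum => k _.
    have := KP z (cscale (cis (rootang R M k)) w).
    rewrite cnormZ cabs_cis mul1r qf_cscale sqn_cscale cabs_cis expr1n !mul1r => /(_ w1).
    rewrite ler_norml -[z + _]/(circ z w _) => /andP[_]; rewrite /L; lra.
  lra.
move=> w; rewrite leNgt; apply/negP => neg.
have w0 : 0 <= cnorm w := cnorm_ge0 w.
pose D := K * cnorm w ^+ 3 + 1; have D1 : 0 < D by rewrite /D ltr_wpDl ?mulr_ge0 ?exprn_ge0.
pose t := Num.min (Num.min r 1 / (cnorm w + 1)) (- qf (hess s z) w / (2 * D)).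
have m0 : 0 < Num.min r 1 by rewrite lt_min r0 ltr01.
have t0 : 0 < t by rewrite lt_min !divr_gt0 ?oppr_gt0//; lra.
have t1 : t * cnorm w <= Num.min r 1.
  apply: (@le_trans _ _ (Num.min r 1 / (cnorm w + 1) * cnorm w)).
    by rewrite ler_wpM2r// ge_min lexx.
  by rewrite mulrAC ler_pdivrMr; [rewrite ler_wpM2l ?(ltW m0)//; lra|lra].
have t2 : t * (2 * D) <= - qf (hess s z) w.
  by rewrite -ler_pdivlMr ?mulr_gt0// ge_min lexx orbT.
have := small (cscale t%:C%C w); rewrite cnormZ cabs_real (ger0_norm (ltW t0)) => /(_ t1).
rewrite qf_cscale cabs_real (ger0_norm (ltW t0)) exprMn.
have -> : - (K * (t ^+ 3 * cnorm w ^+ 3)) = t ^+ 2 * - (t * (K * cnorm w ^+ 3)).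
  by ring.
rewrite ler_pM2l ?exprn_gt0// => h.
have : t * (K * cnorm w ^+ 3) <= t * D by rewrite ler_wpM2l ?(ltW t0)// /D lerDl.
have : 0 < t * D by rewrite mulr_gt0.
rewrite mulrCA in t2; lra.
Qed.

Lemma trigonometric_approx psi (e : R) : cont psi -> periodic psi -> quasi_smv psi ->
  0 < e -> exists s, (forall z, `|tpoly s z - psi z| <= e) /\
    exists2 eta, 0 < eta & forall z w, eta * sqn w <= qf (hess s z) w.
Proof.
move=> cp pp qp e0; have tp := cont_periodic_tame cp pp.
have e4 : 0 < e / 2 by lra.
have [f [tf f0 f1 close]] := convol_close cp pp e4.
have [s sP] := trigonometric_convol tp pp tf.
have qs : quasi_smv (tpoly s).
  have <- : convol psi f = tpoly s by apply/funext.
  by apply: quasi_smv_convol => //; exact: trigonometric_tame.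
have hs := hess_ge0 qs.
have [K K0 KP] : exists2 K, 0 <= K & forall z, `|psi z| <= K by case: tp.
(* Multiplying the trigonometric part by [1 - kap] moves it by at most [e / 2]. The Hessian keeps
   the share [kap * pi] of the form contributed by [Qim], so semipositivity becomes uniform
   positivity. *)
pose kap : R := Num.min (2^-1) (e / 2 / (K + e)).
have kap0 : 0 < kap by rewrite lt_min invr_gt0 ltr0n/= divr_gt0//; lra.
have kap1 : kap <= 2^-1 by rewrite ge_min lexx.
have kap2 : kap * (K + e) <= e / 2.
  by rewrite -ler_pdivlMr ?ge_min ?lexx ?orbT//; lra.
clearbody kap.
exists [seq ((1 - kap)%:C%C * x.1, x.2) | x <- s]; split.
  move=> z; have -> : tpoly [seq ((1 - kap)%:C%C * x.1, x.2) | x <- s] z = (1 - kap) * tpoly s z.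
    rewrite /tpoly big_map mulr_sumr; apply: eq_bigr => x _.
    by rewrite -Re_realM /= mulrA.
  have := close z; rewrite sP => h.
  have -> : (1 - kap) * tpoly s z - psi z = (tpoly s z - psi z) - kap * tpoly s z by ring.
  apply: le_trans (ler_normB _ _) _; rewrite normrM (ger0_norm (ltW kap0)).
  have : `|tpoly s z| <= K + e.
    have -> : tpoly s z = psi z + (tpoly s z - psi z) by ring.
    by apply: le_trans (ler_normD _ _) _; apply: lerD => //; lra.
  move=> /(ler_wpM2l (ltW kap0)); lra.
exists (kap * pi) => [|z w]; first by rewrite mulr_gt0 ?pi_gt0.
have -> : qf (hess [seq ((1 - kap)%:C%C * x.1, x.2) | x <- s] z) w =
   (1 - kap) * qf (hess s z) w + kap * pi * sqn w.
  rewrite !qf_hess big_map.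
  rewrite (eq_bigr (fun x => (1 - kap) * (pi ^+ 2 * complex.Re (x.1 * emode x.2 z) * cabs (lin x.2 w) ^+ 2))); last first.
    by move=> x _; rewrite -[_ * _ * emode _ _]mulrA Re_realM; ring.
  by rewrite -mulr_sumr; ring.
have k1 : 0 <= 1 - kap by lra.
by rewrite lerDr mulr_ge0.
Qed.

End Smoothing.

(** * Theta functions *)

Section EntireLimits.
Variables (R : realType) (n : nat).
Local Notation C := R[i].
Local Notation E := ('I_n -> C).

(** The limit is the supremum of the lower bounds [a k] minus the geometric tail, so it comes with
    an explicit rate. *)
Lemma geometric_cauchy (a : nat -> R) (c : R) (K0 : nat) :
  (forall K, (K0 <= K)%N -> `|a K.+1 - a K| <= c * 2^-1 ^+ K) ->
  exists l, forall K, (K0 <= K)%N -> `|l - a K| <= 2 * c * 2^-1 ^+ K.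
Proof.
move=> aP.
have c0 : 0 <= c.
  by have := le_trans (normr_ge0 _) (aP K0 (leqnn _)); rewrite pmulr_lge0 ?exprn_gt0 ?invr_gt0.
have pos K : 0 <= c * 2^-1 ^+ K by rewrite mulr_ge0 ?exprn_ge0 ?invr_ge0.
have tel K d : (K0 <= K)%N -> `|a (K + d)%N - a K| <= 2 * c * 2^-1 ^+ K - 2 * c * 2^-1 ^+ (K + d).
  move=> KK; elim: d => [|d IH]; first by rewrite addn0 !subrr normr0.
  have h := aP (K + d)%N (leq_trans KK (leq_addr _ _)).
  have -> : a (K + d.+1)%N - a K = (a (K + d).+1 - a (K + d)%N) + (a (K + d)%N - a K).
    by rewrite addnS; ring.
  apply: le_trans (ler_normD _ _) _; apply: le_trans (lerD h IH) _.
  rewrite addnS [in leRHS]exprS; lra.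
have bnd K k : (K0 <= K)%N -> (K0 <= k)%N -> a k <= a K + 2 * c * 2^-1 ^+ K + 2 * c * 2^-1 ^+ k.
  move=> KK kk; have [Kk|kK] := leqP K k.
    have := tel K (k - K)%N KK; rewrite subnKC// ler_norml => /andP[_ h].
    have := pos k; lra.
  have := tel k (K - k)%N kk; rewrite subnKC ?(ltnW kK)// ler_norml => /andP[h _].
  have := pos K; have := pos k; lra.
pose A := [set a k - 2 * c * 2^-1 ^+ k | k in [set k | (K0 <= k)%N]].
have ub K : (K0 <= K)%N -> ubound A (a K + 2 * c * 2^-1 ^+ K).
  by move=> KK _ [k /= kk <-]; rewrite lerBlDr; exact: bnd.
have A0 : A !=set0 by exists (a K0 - 2 * c * 2^-1 ^+ K0); exists K0 => //=.
exists (sup A) => K KK; rewrite ler_norml; apply/andP; split.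
  rewrite lerNl opprB lerBlDr -lerBlDl; apply: ub_le_sup; last by exists K.
  by exists (a K + 2 * c * 2^-1 ^+ K); exact: ub.
by rewrite lerBlDl; apply: ge_sup => //; exact: ub.
Qed.

Lemma complex_geometric_cauchy (a : nat -> C) (c : R) (K0 : nat) :
  (forall K, (K0 <= K)%N -> cabs (a K.+1 - a K) <= c * 2^-1 ^+ K) ->
  exists l, forall K, (K0 <= K)%N -> cabs (l - a K) <= 4 * c * 2^-1 ^+ K.
Proof.
move=> aP.
have [lr lrP] : exists l, forall K, (K0 <= K)%N ->
    `|l - complex.Re (a K)| <= 2 * c * 2^-1 ^+ K.
  apply: geometric_cauchy => K KK; apply: le_trans (aP K KK).
  by rewrite -cReN -cReD Re_le_cabs.
have [li liP] : exists l, forall K, (K0 <= K)%N ->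
    `|l - complex.Im (a K)| <= 2 * c * 2^-1 ^+ K.
  apply: geometric_cauchy => K KK; apply: le_trans (aP K KK).
  by rewrite -cImN -cImD Im_le_cabs.
exists (Complex lr li) => K KK; apply: le_trans (cabs_le_ReIm _) _.
rewrite cReD cImD cReN cImN /=; have := lrP K KK; have := liP K KK; lra.
Qed.

End EntireLimits.

(** * Theta functions of one variable *)

Section Theta.
Variable R : realType.
Local Notation C := R[i].
Variable N : nat.
Hypothesis N0 : (0 < N)%N.

Lemma NR0 : (0 : R) < N%:R. Proof. by rewrite ltr0n. Qed.

Definition freq (j : nat) (m : int) : int := j%:Z + N%:Z * m.

(** The term $\exp(-\pi k^2/N+2\pi i k x)$ with $k=j+Nm$. For fixed [j] the sum over [m] is the
    level [N] theta function of the lattice $\mathbb{Z}+i\mathbb{Z}$ attached to the residue class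
    of [j]. *)
Definition thterm (j : nat) (m : int) (x : C) : C :=
  cexp ((- (pi * (freq j m)%:~R ^+ 2 / N%:R))%:C%C + Complex 0 (2 * pi * (freq j m)%:~R) * x).

Definition thsum (j K : nat) (x : C) : C := thterm j 0 x +
  \sum_(m < K) (thterm j m.+1 x + thterm j (- m.+1%:Z) x).

Lemma thsumS j K x :
  thsum j K.+1 x = thsum j K x + (thterm j K.+1 x + thterm j (- K.+1%:Z) x).
Proof. by rewrite /thsum big_ord_recr /= addrA. Qed.

Lemma expRN_le_half (t : R) (K : nat) : K%:R <= t -> expR (- t) <= 2^-1 ^+ K.
Proof.
move=> Kt; apply: (@le_trans _ _ (expR (- K%:R))); first by rewrite ler_expR lerN2.
have -> : - K%:R = K%:R * (- 1) :> R by rewrite mulrN1.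
rewrite expRM_natl lerXn2r ?nnegrE ?expR_ge0 ?invr_ge0//.
rewrite expRN lef_pV2 ?posrE ?expR_gt0//.
by have := @expR_ge1Dx R 1; lra.
Qed.

(** Once [absz m] passes [2 * rho + 2], the Gaussian decay in the frequency outweighs the
    exponential growth on the disc of radius [rho], with enough left for a geometric rate. *)
Lemma cabs_thterm j m x (rho : R) : (j < N)%N -> cabs x <= rho ->
  2 * rho + 1 <= (absz m)%:R - 1 -> cabs (thterm j m x) <= 2^-1 ^+ (absz m).-1.
Proof.
move=> jN xr mr; have Np := NR0; have pi2 := @pi_ge2 R.
have rho0 : 0 <= rho := le_trans (cabs_ge0 x) xr.
have m1 : (0 < absz m)%N by case: (absz m) mr => // h; lra.
rewrite cabs_cexp cReD cReM /= mul0r sub0r.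
set k : R := (freq j m)%:~R.
have kE : k = j%:R + N%:R * m%:~R by rewrite /k /freq intrD intrM.
have kabs : N%:R * ((absz m)%:R - 1) <= `|k|.
  have jN' : j%:R <= N%:R :> R by rewrite ler_nat ltnW.
  have mE : `|m%:~R : R| = (absz m)%:R by rewrite -intr_norm natr_absz.
  have h : `|N%:R * m%:~R : R| <= `|k| + j%:R.
    have -> : N%:R * m%:~R = k - j%:R by rewrite kE; ring.
    by apply: le_trans (ler_normB _ _) _; rewrite normr_nat.
  rewrite normrM mE normr_nat in h; lra.
have mm : (absz m).-1%:R = (absz m)%:R - 1 :> R by rewrite -{2}(prednK m1) -natr1 addrK.
have k1 : (absz m).-1%:R <= `|k|.
  by apply: le_trans kabs; rewrite mm ler_peMl ?ler1n//; lra.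
rewrite -opprD; apply: expRN_le_half; apply: le_trans k1 _.
have ky : - (2 * pi * `|k| * rho) <= 2 * pi * k * complex.Im x.
  have h : `|k * complex.Im x| <= `|k| * rho.
    by rewrite normrM ler_wpM2l//; apply: le_trans (Im_le_cabs _) xr.
  have h2 : - (`|k| * rho) <= k * complex.Im x by move: h; rewrite ler_norml => /andP[].
  have -> : 2 * pi * k * complex.Im x = 2 * pi * (k * complex.Im x) by ring.
  have -> : - (2 * pi * `|k| * rho) = 2 * pi * (- (`|k| * rho)) by ring.
  by rewrite ler_wpM2l ?mulr_ge0 ?pi_ge0.
have kk : (2 * rho + 1) * `|k| <= k ^+ 2 / N%:R.
  rewrite -[k ^+ 2]real_normK ?num_real// ler_pdivlMr// expr2 mulrAC ler_wpM2r//.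
  by apply: le_trans kabs; rewrite mulrC; apply: ler_wpM2l mr; exact: ltW.
have : pi * ((2 * rho + 1) * `|k|) <= pi * (k ^+ 2 / N%:R) by rewrite ler_wpM2l ?pi_ge0.
have : `|k| <= pi * `|k| by rewrite ler_peMl//; lra.
have -> : pi * ((2 * rho + 1) * `|k|) = 2 * pi * `|k| * rho + pi * `|k| by ring.
rewrite mulrA; lra.
Qed.

Lemma thsum_step j (rho : R) : (j < N)%N -> exists K0, forall K, (K0 <= K)%N ->
  forall x, cabs x <= rho ->
  cabs (thterm j K.+1 x) <= 2^-1 ^+ K /\ cabs (thterm j (- K.+1%:Z) x) <= 2^-1 ^+ K.
Proof.
move=> jN; exists (Num.truncn (2 * rho + 1)).+1 => K KK x xr.
have h : 2 * rho + 1 <= K.+1%:R - 1.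
  rewrite (_ : K.+1%:R - 1 = K%:R :> R); last by rewrite -[K.+1%:R]natr1 addrK.
  apply/ltW; apply: lt_le_trans (truncnS_gt _) _.
  by rewrite ler_nat.
split; first exact: (@cabs_thterm j K.+1 x rho).
by have := @cabs_thterm j (- K.+1%:Z) x rho jN xr; rewrite abszN; apply.
Qed.

Lemma thsum_cauchy j (rho : R) : (j < N)%N -> exists K0, forall K, (K0 <= K)%N ->
  forall x, cabs x <= rho -> cabs (thsum j K.+1 x - thsum j K x) <= 2 * 2^-1 ^+ K.
Proof.
move=> jN; have [K0 KP] := thsum_step rho jN; exists K0 => K KK x xr.
have [h1 h2] := KP K KK x xr; rewrite thsumS addrAC subrr add0r.
by apply: le_trans (cabsD _ _) _; lra.
Qed.

Definition theta (j : nat) (x : C) : C :=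
  xget 0 [set l | exists K0, forall K, (K0 <= K)%N -> cabs (l - thsum j K x) <= 8 * 2^-1 ^+ K].

Lemma theta_lim j (x : C) : (j < N)%N ->
  exists K0, forall K, (K0 <= K)%N -> cabs (theta j x - thsum j K x) <= 8 * 2^-1 ^+ K.
Proof.
move=> jN; rewrite /theta; case: xgetP => [l _ //|nl].
have [K0 KP] := thsum_cauchy (cabs x) jN.
have [l lP] := complex_geometric_cauchy (fun K KK => KP K KK x (lexx _)).
exfalso; apply: (nl l); exists K0 => K KK; have := lP K KK; lra.
Qed.

Lemma half_pow_small (e : R) : 0 < e ->
  exists K0, forall K, (K0 <= K)%N -> 2^-1 ^+ K <= e.
Proof. by move=> e0; apply: eventually_expr_le => //; apply/andP; split; lra. Qed.

Lemma theta_unique j (x l : C) (c : R) : (j < N)%N -> 0 <= c ->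
  (exists K0, forall K, (K0 <= K)%N -> cabs (l - thsum j K x) <= c * 2^-1 ^+ K) ->
  theta j x = l.
Proof.
move=> jN c0 [K1 P1]; have [K2 P2] := theta_lim x jN.
apply/eqP; rewrite -subr_eq0 -cabs_eq0 eq_le cabs_ge0 andbT.
apply/ler_addgt0Pr => e e0; rewrite add0r.
have e1 : 0 < e / (8 + c) by rewrite divr_gt0//; lra.
have [K3 P3] := half_pow_small e1.
pose K := maxn K1 (maxn K2 K3).
have h1 := P1 K (leq_maxl _ _).
have h2 := P2 K (leq_trans (leq_maxl _ _) (leq_maxr _ _)).
have := P3 K (leq_trans (leq_maxr _ _) (leq_maxr _ _)).
rewrite ler_pdivlMr; last lra; move=> h3.
have -> : theta j x - l = (theta j x - thsum j K x) - (l - thsum j K x) by ring.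
apply: le_trans (cabsD _ _) _; rewrite cabsN; move: h1 h2 h3; move: (2^-1 ^+ K) => u; lra.
Qed.

Lemma theta_unif j (rho e : R) : (j < N)%N -> 0 < e ->
  exists K, forall x, cabs x <= rho -> cabs (theta j x - thsum j K x) <= e.
Proof.
move=> jN e0; have [K0 KP] := thsum_cauchy rho jN.
have e8 : 0 < e / 8 by lra.
have [K1 P1] := half_pow_small e8.
pose K := maxn K0 K1; exists K => x xr.
have [l lP] := complex_geometric_cauchy (fun K KK => KP K KK x xr).
have -> : theta j x = l by apply: (theta_unique (c := 4 * 2)) => //; exists K0.
have := lP K (leq_maxl _ _); have := P1 K (leq_maxr _ _); lra.
Qed.

(** At 0 all terms are positive reals, so the partial sums stay above the first term. *)
Lemma theta0_neq0 j : (j < N)%N -> theta j 0 != 0.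
Proof.
move=> jN; have tr m : exists2 r : R, 0 < r & thterm j m 0 = r%:C%C.
  exists (expR (- (pi * (freq j m)%:~R ^+ 2 / N%:R))); first exact: expR_gt0.
  by rewrite /thterm mulr0 addr0 /cexp /= cis0 mulr1.
have sr K : complex.Re (thterm j 0 0) <= complex.Re (thsum j K 0).
  elim: K => [|K IH]; first by rewrite /thsum big_ord0 addr0.
  rewrite thsumS [leRHS]cReD [X in _ <= _ + X]cReD; have [r1 r10 ->] := tr K.+1; have [r2 r20 ->] := tr (- K.+1%:Z).
  by apply: le_trans IH _; rewrite lerDl; apply: addr_ge0; apply: ltW.
have [r r0 rE] := tr 0; rewrite rE /= in sr.
apply/negP => /eqP th0; have [K0 KP] := theta_lim 0 jN.
have r9 : 0 < r / 16 by lra.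
have [K1 P1] := half_pow_small r9.
have h1 := KP _ (leq_maxl K0 K1); have h2 := P1 _ (leq_maxr K0 K1).
rewrite th0 sub0r cabsN in h1.
have := sr (maxn K0 K1); have := le_trans (ler_norm _) (Re_le_cabs (thsum j (maxn K0 K1) 0)).
lra.
Qed.

Lemma theta_factor j (x y c : C) : (j < N)%N ->
  (forall m, thterm j m y = c * thterm j m x) -> theta j y = c * theta j x.
Proof.
move=> jN tm; have sm K : thsum j K y = c * thsum j K x.
  rewrite /thsum tm mulrDr mulr_sumr; congr (_ + _); apply: eq_bigr => m _.
  by rewrite !tm mulrDr.
have [K0 KP] := theta_lim x jN.
apply: (theta_unique (c := cabs c * 8)) => //; first by rewrite mulr_ge0 ?cabs_ge0.
exists K0 => K KK; rewrite sm -mulrBr cabsM -mulrA ler_wpM2l ?cabs_ge0//; exact: KP.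
Qed.

Lemma cexp_2pi_int (k : int) : cexp (Complex 0 (2 * pi * k%:~R)) = 1 :> C.
Proof. by rewrite /cexp /= expR0 mul1r cis_2pi_int. Qed.

Lemma theta_int j (x : C) (k : int) : (j < N)%N -> theta j (x + k%:~R%:C%C) = theta j x.
Proof.
move=> jN; rewrite (theta_factor (x := x) (c := 1)) ?mul1r// => m.
rewrite mul1r /thterm mulrDr addrA [LHS]cexpD.
have -> : Complex 0 (2 * pi * (freq j m)%:~R) * k%:~R%:C%C =
    Complex 0 (2 * pi * (freq j m * k)%:~R) :> C.
  by apply: cplx_eqP; rewrite ?(cReM, cImM) /= ?intrM; ring.
by rewrite cexp_2pi_int mulr1.
Qed.

Lemma theta_root j (x : C) (a : nat) : (j < N)%N ->
  theta j (x + (a%:R / N%:R)%:C%C) = cis (rootang R N a) ^+ j * theta j x.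
Proof.
move=> jN; apply: theta_factor => // m; have Np := NR0.
rewrite /thterm mulrDr addrA [LHS]cexpD [LHS]mulrC; congr (_ * _).
have -> : Complex 0 (2 * pi * (freq j m)%:~R) * (a%:R / N%:R)%:C%C =
    Complex 0 (2 * pi * (m * a%:Z)%:~R) + Complex 0 (rootang R N a *+ j) :> C.
  apply: cplx_eqP; rewrite ?(cReM, cImM, cReD, cImD) /=; first by ring.
  rewrite /rootang /freq intrD intrM intrM -mulr_natr /=; field.
  by rewrite gt_eqF.
by rewrite cexpD cexp_2pi_int mul1r cisX /cexp /= expR0 mul1r.
Qed.

Lemma thterm_shift j m (x : C) : thterm j m (x + Complex 0 1) =
  cexp ((pi * N%:R)%:C%C - Complex 0 (2 * pi * N%:R) * x) * thterm j (m + 1) x.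
Proof.
have Np := NR0; rewrite /thterm -cexpD; congr cexp.
have -> : (freq j (m + 1))%:~R = (freq j m)%:~R + N%:R :> R.
  by rewrite /freq !intrD !intrM intrD; ring.
apply: cplx_eqP; rewrite ?(cReM, cImM, cReD, cImD, cReN, cImN) /=; field;
  by rewrite ?gt_eqF.
Qed.

(** The shift by [i] moves the summation index by one. A symmetric partial sum gains a term at one
    end and loses one at the other, and both tend to 0. *)
Lemma theta_i j (x : C) : (j < N)%N -> theta j (x + Complex 0 1) =
  cexp ((pi * N%:R)%:C%C - Complex 0 (2 * pi * N%:R) * x) * theta j x.
Proof.
move=> jN; set c := cexp _.
have sm K : thsum j K (x + Complex 0 1) =
    c * (thsum j K x + thterm j K.+1 x - thterm j (- K%:Z) x).
  elim: K => [|K IH].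
    rewrite /thsum !big_ord0 !addr0 thterm_shift -/c; congr (_ * _).
    by rewrite -[- 0%:Z]/(0 : int) addrAC subrr add0r add0r.
  rewrite !thsumS IH !thterm_shift -/c.
  have -> : K.+1%:Z + 1 = K.+2%:Z by rewrite -[K.+2]addn1 PoszD.
  have -> : - K.+1%:Z + 1 = - K%:Z by rewrite -addn1 PoszD opprD addrK.
  by ring.
have [K0 KP] := theta_lim x jN; have [K1 P1] := thsum_step (cabs x) jN.
apply: (theta_unique (c := cabs c * 12)) => //; first by rewrite mulr_ge0 ?cabs_ge0.
exists (maxn K0 K1).+1; case=> [//|K]; rewrite ltnS geq_max => /andP[KK0 KK1].
rewrite sm -mulrBr cabsM -mulrA ler_wpM2l ?cabs_ge0//.
have [h1 _] := P1 K.+1 (leqW KK1) x (lexx _); have [_ h2] := P1 K KK1 x (lexx _).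
have h3 := KP K.+1 (leqW KK0).
have -> : theta j x - (thsum j K.+1 x + thterm j K.+2 x - thterm j (- K.+1%:Z) x) =
  (theta j x - thsum j K.+1 x) - thterm j K.+2 x + thterm j (- K.+1%:Z) x by ring.
apply: le_trans (cabsD _ _) _.
have := cabsD (theta j x - thsum j K.+1 x) (- thterm j K.+2 x); rewrite cabsN.
move: h1 h2 h3; rewrite exprS; have := cabs_ge0 (thterm j (- K.+1%:Z) x).
move: (2^-1 ^+ K) => u; lra.
Qed.

Lemma theta_lattice_nat j (x : C) (l : nat) : (j < N)%N -> theta j (x + Complex 0 l%:R) =
  cexp ((pi * N%:R * l%:R ^+ 2)%:C%C - Complex 0 (2 * pi * N%:R * l%:R) * x) * theta j x.
Proof.
move=> jN; elim: l => [|l IH].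
  have -> : (Complex 0 0%:R : C) = 0 by [].
  by rewrite expr0n /= !mulr0 mul0r subrr addr0 cexp0 mul1r.
have -> : x + Complex 0 l.+1%:R = (x + Complex 0 l%:R) + Complex 0 1 :> C.
  by apply: cplx_eqP; rewrite ?(cReD, cImD) /= ?addr0// -natr1 addrA.
rewrite theta_i// IH mulrA -cexpD; congr (cexp _ * _).
by apply: cplx_eqP; rewrite ?(cReM, cImM, cReD, cImD, cReN, cImN) /= -natr1; ring.
Qed.

Lemma theta_lattice j (x : C) (l : int) : (j < N)%N -> theta j (x + Complex 0 l%:~R) =
  cexp ((pi * N%:R * l%:~R ^+ 2)%:C%C - Complex 0 (2 * pi * N%:R * l%:~R) * x) * theta j x.
Proof.
move=> jN; case: l => l; first exact: theta_lattice_nat.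
set y := x + _; have -> : x = y + Complex 0 l.+1%:R.
  by apply: cplx_eqP; rewrite /y NegzE ?(cReD, cImD) /= ?intrN; ring.
rewrite theta_lattice_nat// mulrA -cexpD.
rewrite [X in cexp X](_ : _ = 0) ?cexp0 ?mul1r// NegzE.
by apply: cplx_eqP; rewrite ?(cReM, cImM, cReD, cImD, cReN, cImN) /= ?intrN; ring.
Qed.

End Theta.

(** * Theta functions on $\mathbb{C}^n$, their weights and independence *)

Section ThetaSections.
Variables (R : realType) (n N : nat).
Hypothesis N0 : (0 < N)%N.
Local Notation C := R[i].
Local Notation E := ('I_n -> C).
Local Notation I := {ffun 'I_n -> 'I_N}.
Implicit Types (z : E) (s : tcoef R n).

Lemma entire_theta (i : 'I_n) j : (j < N)%N -> entire (fun z : E => theta N j (z i)).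
Proof.
move=> jN; apply: entire_lim => rho e e0.
have [K KP] := theta_unif N0 rho jN e0; exists (fun z => thsum N j K (z i)); last first.
  by move=> z zr; apply: KP; apply: le_trans (cabs_le_cnorm _ _) zr.
have et m : entire (fun z : E => thterm N j m (z i)).
  apply: entire_cexp; apply: hpolyD; first exact: (@hpoly_cst R n).
  by apply: hpolyZ; exact: hpoly_coord.
by apply: entireD => //; apply: entire_sum => m; exact: entireD.
Qed.

Definition tsec (J : I) z : C := \prod_i theta N (J i) (z i).

Lemma entire_tsec J : entire (tsec J).
Proof. by apply: entire_prod => i; exact: entire_theta. Qed.

Definition lat_factor (k l : 'I_n -> int) z : C := \prod_i
  cexp ((pi * N%:R * (l i)%:~R ^+ 2)%:C%C - Complex 0 (2 * pi * N%:R * (l i)%:~R) * z i).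

Lemma tsec_lat J z k l : tsec J (z + lat R k l) = lat_factor k l z * tsec J z.
Proof.
rewrite /tsec /lat_factor -big_split; apply: eq_bigr => i _ /=.
rewrite -(theta_lattice N0)// -[RHS](theta_int N0 _ (k i))//; congr (theta _ _ _).
rewrite -[LHS]/(z i + lat R k l i).
by apply: cplx_eqP; rewrite /lat !(cReD, cImD) /=; ring.
Qed.

(** This identity fixes the constant in [Qim]: the growth of a theta function under lattice
    translations is compensated exactly by the weight, whence the periodicity of [density]. *)
Lemma cabs_lat_factor k l z :
  cabs (lat_factor k l z) ^+ 2 = expR (N%:R * (Qim (z + lat R k l) - Qim z)).
Proof.
rewrite /lat_factor cabs_prod -prodrXl /Qim -mulrBr -sumrB !mulr_sumr expR_sum.
apply: eq_bigr => i _; rewrite cabs_cexp -expRM_natl; congr expR.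
rewrite -[(z + _) i]/(z i + lat R k l i) /lat cImD cReD cReN cReM /=; ring.
Qed.

Definition comb (c : I -> C) z : C := \sum_J c J * tsec J z.

Lemma entire_comb c : entire (comb c).
Proof.
by apply: entire_sum => J; apply: entireM; [exact: entire_cst|exact: entire_tsec].
Qed.

Lemma comb_lat c z k l : comb c (z + lat R k l) = lat_factor k l z * comb c z.
Proof.
by rewrite /comb mulr_sumr; apply: eq_bigr => J _; rewrite tsec_lat mulrCA.
Qed.

Definition weight s z : R := expR (- (N%:R * Phi s z)).

Lemma weight_lat s z k l :
  cabs (lat_factor k l z) ^+ 2 * weight s (z + lat R k l) = weight s z.
Proof.
rewrite cabs_lat_factor /weight /Phi tpoly_lat -expRD; congr expR; ring.
Qed.

Lemma weight_gt0 s z : 0 < weight s z.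
Proof. exact: expR_gt0. Qed.

Lemma cont_weight s : cont (weight s).
Proof.
apply: (@cont_comp _ _ (fun x => expR (- (N%:R * x)))); first exact: cont_Phi.
move=> z; apply: (@continuous_comp _ _ _ (fun x : R => - (N%:R * x)) expR).
  by apply: continuousN; exact: mulrl_continuous.
exact: continuous_expR.
Qed.

Definition density s (f : E -> C) z : R := cabs (f z) ^+ 2 * weight s z.

Lemma density_ge0 s f z : 0 <= density s f z.
Proof. by rewrite mulr_ge0 ?sqr_ge0 ?(ltW (weight_gt0 _ _)). Qed.

Lemma density_comb_periodic s c : periodic (density s (comb c)).
Proof.
by move=> z k l; rewrite /density comb_lat cabsM exprMn -(weight_lat s z k l); ring.
Qed.

Definition pairing s (f g : E -> C) z : C := conjc (f z) * g z * (weight s z)%:C%C.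

Lemma pairing_tsec_ctame s J K : ctame (pairing s (tsec J) (tsec K)).
Proof.
apply: ccont_ctame => [|z k l].
  apply: ccontM; last by split; [exact: cont_weight|exact: cont_cst].
  by apply: ccontM; [apply: ccont_conj|]; apply: entire_ccont; exact: entire_tsec.
rewrite /pairing !tsec_lat -(weight_lat s z k l).
have -> : (cabs (lat_factor k l z) ^+ 2 * weight s (z + lat R k l))%:C%C =
    lat_factor k l z * conjc (lat_factor k l z) * (weight s (z + lat R k l))%:C%C.
  by rewrite mulJc -rmorphM.
have -> : conjc (lat_factor k l z * tsec J z) = conjc (lat_factor k l z) * conjc (tsec J z).
  by rewrite rmorphM.
have ac (a b c d e : C) : a * b * (c * d) * e = b * d * (c * a * e) by ring.
exact: ac.
Qed.

(** Orthogonality of characters. The exponent [j + (N - j')] represents [j - j'] modulo [N] within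
    the natural numbers. *)
Lemma sum_character (j j' : nat) : (j < N)%N -> (j' < N)%N ->
  \sum_(a < N) cis (rootang R N a) ^+ (j + (N - j')) = (N%:R * (j == j')%:R : C).
Proof.
move=> jN jN'.
have wN (a : 'I_N) : cis (rootang R N a) ^+ N = 1 :> C.
  rewrite cisX /rootang -[_ *+ N]mulr_natr divfK ?pnatr_eq0 -?lt0n//.
  exact: (cis_2pi_int R a).
case: (ltngtP j j') => [jj|jj|->]; rewrite ?mulr0 ?mulr1.
- apply: sum_cis_eq0; rewrite addn_gt0 subn_gt0 jN' orbT /=.
  by rewrite addnBA ?(ltnW jN')// ltn_subLR ?ltn_add2r// ltnW// (leq_trans jN')// leq_addl.
- under eq_bigr do rewrite addnBA ?(ltnW jN')// addnC -addnBA ?(ltnW jj)// exprD wN mul1r.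
  by apply: sum_cis_eq0; rewrite subn_gt0 jj /= (leq_ltn_trans (leq_subr _ _)).
- under eq_bigr do rewrite subnKC ?(ltnW jN')// wN.
  by rewrite sumr_const card_ord.
Qed.

(** Translation by $1/N$ multiplies the theta functions of different [j] by different characters.
    Evaluating at all [N]-division points and inverting the finite Fourier transform isolates each
    coefficient, up to values [theta N j 0], which do not vanish. *)
Lemma tsec_independent c : (forall z, comb c z = 0) -> forall J, c J = 0.
Proof.
move=> c0 J'; pose w (a : 'I_N) : C := cis (rootang R N a).
pose d (J : I) := c J * \prod_i theta N (J i) (0 : C).
have ev (a : I) : \sum_J d J * \prod_i w (a i) ^+ J i = 0.
  rewrite -[RHS](c0 (fun i => ((a i)%:R / N%:R)%:C%C)); apply: eq_bigr => J _.
  rewrite /d /tsec -mulrA -big_split; congr (_ * _); apply: eq_bigr => i _ /=.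
  by have := theta_root N0 (0 : C) (a i) (ltn_ord (J i)); rewrite add0r => ->; exact: mulrC.
have : \sum_(a : I) (\prod_i w (a i) ^+ (N - J' i)) * (\sum_J d J * \prod_i w (a i) ^+ J i) = 0.
  by rewrite big1// => a _; rewrite ev mulr0.
under eq_bigr do rewrite mulr_sumr.
rewrite exchange_big /=.
have term J : \sum_(a : I) (\prod_i w (a i) ^+ (N - J' i)) * (d J * \prod_i w (a i) ^+ J i) =
    d J * (N%:R ^+ n * (J == J')%:R).
  transitivity (d J * \sum_(a : I) \prod_i w (a i) ^+ (J i + (N - J' i))).
    rewrite mulr_sumr; apply: eq_bigr => a _; rewrite mulrCA; congr (_ * _).
    by rewrite -big_split; apply: eq_bigr => i _; rewrite /= exprD mulrC.
  congr (_ * _); rewrite -(bigA_distr_bigA (fun i b => w b ^+ (J i + (N - J' i)))).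
  under eq_bigr do rewrite sum_character//.
  rewrite big_split prodr_const card_ord; congr (_ * _).
  case: eqVneq => [->|JJ]; first by rewrite big1 => // i _; rewrite eqxx.
  have [i iP] : exists i, J i != J' i.
    apply/existsP; rewrite -negb_forall; apply: contra JJ => /forallP h.
    by apply/eqP/ffunP => i; apply/eqP.
  by rewrite (bigD1 i)//= val_eqE (negbTE iP) mul0r.
under eq_bigr do rewrite term.
rewrite (bigD1 J')//= big1 => [|J /negbTE ->]; last by rewrite !mulr0.
rewrite eqxx mulr1 addr0 => /eqP; rewrite !mulf_eq0 -orbA => /or3P[/eqP //| |].
  rewrite prodf_seq_eq0 => /hasP[i _] /= h; exfalso.
  by have := @theta0_neq0 R N N0 (J' i) (ltn_ord _); rewrite h.
by rewrite expf_eq0 pnatr_eq0 -[N == 0]negbK -lt0n N0 andbF.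
Qed.

End ThetaSections.

(** * Local bound and peak sections *)

Section LocalBound.
Variables (R : realType) (n : nat).
Local Notation C := R[i].
Local Notation E := ('I_n -> C).
Implicit Types (z w : E) (s : tcoef R n) (G k : E -> R).

Lemma J_exp_qf (H : 'M[C]_n) (eta a : R) : adj H = H -> 0 < eta -> 0 < a ->
  (forall w, eta * sqn w <= qf H w) ->
  exists d, [/\ 0 < d, \det H = d%:C%C &
    J (fun w => (expR (- (a * qf H w)))%:E) = (pi ^+ n / (a ^+ n * d))%:E].
Proof.
move=> hH eta0 a0 pos; have [d [d0 dE JE]] := gauss_det hH eta0 pos; exists d; split=> //.
have sa : 0 < Num.sqrt a by rewrite sqrtr_gt0.
transitivity (J (fun w => (fun w => (expR (- qf H w))%:E) (cscale (Num.sqrt a)%:C%C w))).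
  congr J; apply/funext => w; rewrite qf_cscale cabs_real ger0_norm ?sqrtr_ge0//.
  by rewrite sqr_sqrtr// ltW.
rewrite (@J_dilate _ _ _ (fun w => (expR (- qf H w))%:E) sa).
- rewrite JE -EFinM exprVn sqr_sqrtr ?(ltW a0)// exprVn; congr _%:E; field.
  by rewrite !gt_eqF ?exprn_gt0.
- have := cont_exp_qf H 1; under [X in cont X -> _]eq_fun do rewrite mul1r.
  exact: cont_ume.
- by move=> w; rewrite lee_fin expR_ge0.
Qed.

Lemma J_rotation_sum G k (M m : nat) : (2 < M)%N -> cont G -> cont k ->
  (forall w, 0 <= G w) -> (forall w, 0 <= k w) ->
  (forall c w, cabs c = 1 -> k (cscale c w) = k w) ->
  J (fun w => (\sum_(j < m) G (cscale (cis (rootang R M j)) w) * k w)%:E) =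
  ((m%:R)%:E * J (fun w => (G w * k w)%:E))%E.
Proof.
move=> M2 cG ck G0 k0 kr.
have cGk : cont (fun w => G w * k w) by exact: contM.
have rot j : J (fun w => (G (cscale (cis (rootang R M j)) w) * k w)%:E) =
    J (fun w => (G w * k w)%:E).
  rewrite -(@J_rotate_unity R n M j (fun w => (G w * k w)%:E)) //.
  - by congr J; apply/funext => w; rewrite kr// cabs_cis.
  - exact: cont_ume.
  - by move=> w; rewrite lee_fin mulr_ge0.
have ur j : ume (fun w => (G (cscale (cis (rootang R M j)) w) * k w)%:E).
  move=> d T h mh.
  have := cont_ume cGk (mpt_cscale (cis (rootang R M j)) mh).
  by under [X in measurable_fun _ X -> _]eq_fun do rewrite kr ?cabs_cis//.
elim: m => [|m IH].
  rewrite mul0e; under [X in J X]eq_fun do rewrite big_ord0.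
  have : J (fun _ : E => (0%:E * 1)%E) = (0%:E * J (fun _ : E => 1%E : \bar R))%E.
    by apply: (@J_scale R n 0 (fun=> 1%E)) => // d T h mh; exact: measurable_cst.
  by rewrite !mul0e.
under [X in J X]eq_fun do rewrite big_ord_recr EFinD.
rewrite J_add //=.
- rewrite IH rot -[m.+1%:R]natr1 EFinD ge0_muleDl ?lee_fin// mul1e //.
- move=> d T h mh; under [X in measurable_fun _ X]eq_fun do rewrite -sumEFin.
  by apply: emeasurable_sum => j; exact: ur.
- by move=> w; rewrite lee_fin sumr_ge0// => j _; rewrite mulr_ge0.
- by move=> w; rewrite lee_fin mulr_ge0.
Qed.

(* Rotation invariance turns the sub-mean value inequality into a lower bound
   for integrals against radial weights. *)
Lemma J_radial_lower G k (e : R) : smv G -> cont G -> cont k ->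
  (forall w, 0 <= G w) -> (forall w, 0 <= k w) ->
  (forall c w, cabs c = 1 -> k (cscale c w) = k w) ->
  (forall w, 0 < k w -> cnorm w <= 1) -> 0 < e -> e <= G 0 ->
  ((G 0 - e)%:E * J (fun w => (k w)%:E) <= J (fun w => (G w * k w)%:E))%E.
Proof.
move=> sG cG ck G0 k0 kr ks e0 eG.
have [d d0 dP] := cont_unif 1 cG e0.
have d4 : 0 < d / 4 by lra.
have [M0 MP] := angle_small d4; pose M := maxn M0 3.
have M3 : (2 < M)%N by exact: leq_maxr.
have Mp : (0 < M)%N by exact: leq_trans M3.
have MR : (0 : R) < M%:R by rewrite ltr0n.
have low w : 0 < k w -> G 0 - e <= avg M G 0 w.
  move=> /ks w1; apply: smv_avg => // t1 t2 tt; rewrite distrC; apply: ltW; apply: dP.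
    by apply: le_trans (cnorm_circ _ _ _) _; rewrite cnorm0 add0r.
  apply: le_lt_trans (circ_lip _ _ _ _) _; rewrite distrC.
  apply: (@le_lt_trans _ _ (2 * (d / 4) * 1)); last lra.
  apply: ler_pM => //; rewrite ?mulr_ge0 ?cnorm_ge0// ler_wpM2l//.
  exact: le_trans tt (MP M (leq_maxl _ _) Mp).
rewrite -J_scale ?subr_ge0//; last exact: cont_ume.
rewrite -(@lee_pmul2l _ M%:R%:E) ?lte_fin// -(J_rotation_sum M M3 cG ck G0 k0 kr).
have uk : ume (fun w => ((G 0 - e)%:E * (k w)%:E)%E) by exact: (cont_ume (contZ (G 0 - e) ck)).
have k0E w : (0 <= (G 0 - e)%:E * (k w)%:E)%E by rewrite mule_ge0// lee_fin// subr_ge0.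
rewrite -(J_scale (ler0n _ M) uk k0E).
apply: J_mono => w; first by rewrite !mule_ge0// lee_fin// subr_ge0.
rewrite -!EFinM lee_fin; have [kw|kw] := eqVneq (k w) 0.
  by rewrite kw !mulr0 big1// => j _; rewrite mulr0.
have kp : 0 < k w by rewrite lt_def kw k0.
rewrite -mulr_suml mulrA ler_wpM2r// -ler_pdivlMl//; apply: le_trans (low w kp) _.
rewrite /avg; under eq_bigr do rewrite /circ add0r.
exact: lexx.
Qed.

Lemma cell_eq1 w : cnorm w < 2^-1 -> cell w = 1.
Proof.
move=> w2; rewrite /cell big1// => i _; have h : cabs (w i) < 2^-1.
  exact: le_lt_trans (cabs_le_cnorm _ _) w2.
have small (x : R) : `|x| <= cabs (w i) -> ivl (- 2^-1) 2^-1 x = 1.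
  move=> xw; have : `|x| < 2^-1 by exact: le_lt_trans h.
  by rewrite ltr_norml /ivl => /andP[/ltW -> ->].
by rewrite /cell1 !small ?mulr1// ?Re_le_cabs// Im_le_cabs.
Qed.

Lemma sqr_cnorm_le w : cnorm w ^+ 2 <= n%:R ^+ 2 * sqn w.
Proof.
have sq : sqn w = Num.sqrt (sqn w) ^+ 2 by rewrite sqr_sqrtr// sqn_ge0.
rewrite {1}sq -exprMn lerXn2r ?nnegrE ?cnorm_ge0 ?mulr_ge0 ?sqrtr_ge0//.
by apply: cnorm_le_sqn; rewrite ?sqrtr_ge0// -sq.
Qed.

Definition hdet s z : R := complex.Re (\det (hess s z)).

(** Subtracting a wider Gaussian confines the support to [a * qf H w < T] without losing continuity
    or rotation invariance, and reduces the mass of the cutoff to two Gaussian integrals. *)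
Definition cutgauss (H : 'M[C]_n) (a T : R) w : R :=
  Num.max 0 (expR (- (a * qf H w)) - expR (- (T / 2)) * expR (- (a / 2 * qf H w))).

Lemma cutgauss_supp H a T w : 0 < cutgauss H a T w -> a * qf H w < T.
Proof.
rewrite /cutgauss lt_max ltxx /= subr_gt0 -expRD ltr_expR; lra.
Qed.

Lemma cutgauss_le H a T w : cutgauss H a T w <= expR (- (a * qf H w)).
Proof.
by rewrite /cutgauss ge_max expR_ge0 gerBl mulr_ge0 ?expR_ge0.
Qed.

Lemma cont_cutgauss H a T : cont (cutgauss H a T).
Proof.
apply: cont_max; first exact: cont_cst.
have := contD (cont_exp_qf H a) (contZ (- expR (- (T / 2))) (cont_exp_qf H (a / 2))).
by under [X in cont X -> _]eq_fun do rewrite mulNr.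
Qed.

(** Halving [a] multiplies the Gaussian integral by [2 ^+ n], which is the source of the lost
    fraction. *)
Lemma cutgauss_mass (H : 'M[C]_n) (eta a T : R) : adj H = H -> 0 < eta -> 0 < a ->
  (forall w, eta * sqn w <= qf H w) ->
  exists d, [/\ 0 < d, \det H = d%:C%C &
   (((1 - 2 ^+ n * expR (- (T / 2))) * (pi ^+ n / (a ^+ n * d)))%:E <=
    J (fun w => (cutgauss H a T w)%:E))%E].
Proof.
move=> hH eta0 a0 pos; have a2 : 0 < a / 2 by lra.
have [d [d0 dE JE]] := J_exp_qf hH eta0 a0 pos.
have [d' [_ dE' JE']] := J_exp_qf hH eta0 a2 pos.
have dd : d' = d by have := dE; rewrite dE' => /(congr1 (@complex.Re R)).
rewrite {d' dE'}dd in JE'; exists d; split=> //.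
have g0 w : (0 <= (expR (- (a / 2 * qf H w)))%:E)%E by rewrite lee_fin expR_ge0.
have ug : ume (fun w => (expR (- (a / 2 * qf H w)))%:E) by apply: cont_ume; exact: cont_exp_qf.
have c0 w : (0 <= (cutgauss H a T w)%:E)%E by rewrite lee_fin le_max lexx.
have uc : ume (fun w => (cutgauss H a T w)%:E) by apply: cont_ume; exact: cont_cutgauss.
have : (J (fun w => (expR (- (a * qf H w)))%:E) <=
   J (fun w => (cutgauss H a T w)%:E) +
   (expR (- (T / 2)))%:E * J (fun w => (expR (- (a / 2 * qf H w)))%:E))%E.
  have us : ume (fun w => (expR (- (T / 2)))%:E * (expR (- (a / 2 * qf H w)))%:E)%E.
    exact: (cont_ume (contZ (expR (- (T / 2))) (cont_exp_qf H (a / 2)))).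
  have s0 w : (0 <= (expR (- (T / 2)))%:E * (expR (- (a / 2 * qf H w)))%:E)%E.
    by rewrite mule_ge0// lee_fin expR_ge0.
  rewrite -(J_scale (expR_ge0 _) ug g0) -(J_add uc us c0 s0).
  apply: J_mono => w; first by rewrite lee_fin expR_ge0.
  by rewrite -EFinM -EFinD lee_fin -lerBlDr /cutgauss le_max lexx orbT.
rewrite JE JE' -EFinM -leeBlDr// -EFinB => h; apply: le_trans h.
rewrite lee_fin le_eqVlt; apply/orP; left; apply/eqP.
rewrite expr_div_n; field.
by rewrite !gt_eqF ?exprn_gt0.
Qed.

(** Near [z], multiplication by an exponential removes the pluriharmonic part of the weight, and the
    rest is Gaussian up to a cubic error. On the scale $N^{-1/2}$ of the cutoff, [N] times this
    error tends to 0, and the sub-mean value inequality against the radial cutoff compares the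
    centre with the total mass. *)
Lemma local_bound s (eta eps : R) : 0 < eta ->
  (forall z w, eta * sqn w <= qf (hess s z) w) -> 0 < eps < 1 ->
  exists N0 : nat, forall N, (N0 <= N)%N -> (0 < N)%N -> forall f, entire f ->
    periodic (density N s f) -> forall z,
    (1 - eps) * pi ^+ n * density N s f z <= N%:R ^+ n * hdet s z * cmean (density N s f).
Proof.
move=> eta0 pos /andP[eps0 eps1].
have [K K0 KP] := Phi_taylor s.
have [T0 T0P] : exists T0 : nat, 2 ^+ n * expR (- T0%:R) <= eps / 2.
  have e2 : 0 < eps / 2 / 2 ^+ n by rewrite !divr_gt0 ?exprn_gt0.
  have [T0 TP] := @half_pow_small R _ e2; exists T0.
  rewrite -ler_pdivlMl ?exprn_gt0// mulrC; apply: le_trans (TP T0 (leqnn _)).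
  exact: expRN_le_half.
pose T : R := 2 * T0%:R; have TT : T / 2 = T0%:R by rewrite /T; field.
have Tge0 : 0 <= T by rewrite mulr_ge0.
(* The first bound keeps the support of the cutoff inside the unit cell; the second keeps [N] times
   the cubic Taylor error below [eps / 2]. *)
pose r0 : R := Num.min (4 * n.+1%:R)^-1 (eps / 2 / (K * n%:R ^+ 3 * T / eta + 1)).
have D0 : 0 <= K * n%:R ^+ 3 * T / eta by rewrite !mulr_ge0 ?exprn_ge0 ?invr_ge0// ltW.
have r00 : 0 < r0 by rewrite lt_min invr_gt0 mulr_gt0 ?ltr0n//= !divr_gt0//; lra.
have r01 : n%:R * r0 <= 4^-1.
  apply: (@le_trans _ _ (n%:R * (4 * n.+1%:R)^-1)); first by rewrite ler_wpM2l// ge_min lexx.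
  rewrite invfM mulrCA ler_piMr ?invr_ge0// ler_pdivrMr ?ltr0n// mul1r ler_nat.
  exact: leqnSn.
have r02 : K * n%:R ^+ 3 * T / eta * r0 <= eps / 2.
  apply: (@le_trans _ _ ((K * n%:R ^+ 3 * T / eta + 1) * r0)).
    by rewrite mulrDl mul1r lerDl ltW.
  by rewrite mulrC -ler_pdivlMr ?ge_min ?lexx ?orbT//; lra.
clearbody r0; exists (Num.truncn (T / (eta * r0 ^+ 2))).+1 => N NN Np f ef pf z.
have NR : (0 : R) < N%:R by rewrite ltr0n.
have NT : T / (N%:R * eta) <= r0 ^+ 2.
  have : T / (eta * r0 ^+ 2) <= N%:R.
    by apply/ltW; apply: lt_le_trans (truncnS_gt _) _; rewrite ler_nat.
  rewrite !ler_pdivrMr ?mulr_gt0 ?exprn_gt0// => h; apply: le_trans h _.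
  by rewrite le_eqVlt; apply/orP; left; apply/eqP; ring.
set H := hess s z; have hH : adj H = H by exact: hess_hermitian.
have [d [d0 dE mass]] := cutgauss_mass T hH eta0 NR (pos z).
have hd : hdet s z = d by rewrite /hdet -/H dE.
pose g w := f (z + w) * cexp (- (N%:R / 2)%:C%C * plin s z w).
have eg : entire g.
  apply: entireM.
    by apply: entire_ext (entire_affine 1 z ef) _ => w; rewrite cscale1 addrC.
  by apply: entire_cexp; apply: hpolyZ; exact: hpoly_plin.
pose G w := cabs (g w) ^+ 2.
have G0E : G 0 = cabs (f z) ^+ 2.
  by rewrite /G /g addr0 plin0 mulr0 cexp0 mulr1.
pose k := cutgauss H N%:R T.
have ck : cont k by exact: cont_cutgauss.
have k0 w : 0 <= k w by rewrite le_max lexx.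
have supp w : 0 < k w -> [/\ cnorm w <= n%:R * r0, cnorm w <= 4^-1 &
    N%:R * (K * cnorm w ^+ 3) <= eps / 2].
  move=> /cutgauss_supp kw.
  have sT : sqn w <= T / (N%:R * eta).
    rewrite ler_pdivlMr ?mulr_gt0//; apply: le_trans (ltW kw).
    by rewrite mulrC -mulrA ler_wpM2l ?ler0n//; exact: pos.
  have wr : cnorm w <= n%:R * r0 by apply: cnorm_le_sqn (ltW r00) (le_trans sT NT).
  split=> //; first exact: le_trans r01.
  apply: le_trans r02; rewrite exprSr.
  have h1 : cnorm w ^+ 2 <= n%:R ^+ 2 * (T / (N%:R * eta)).
    by apply: le_trans (sqr_cnorm_le w) _; rewrite ler_wpM2l ?exprn_ge0.
  apply: (@le_trans _ _ (N%:R * (K * (n%:R ^+ 2 * (T / (N%:R * eta)) * (n%:R * r0))))).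
    rewrite ler_wpM2l ?ler0n// ler_wpM2l//.
    by apply: ler_pM => //; rewrite ?exprn_ge0 ?cnorm_ge0.
  rewrite le_eqVlt; apply/orP; left; apply/eqP; field.
  by rewrite !gt_eqF.
pose c : R := expR (- (eps / 2)) * weight N s z.
have c0 : 0 < c by rewrite mulr_gt0 ?expR_gt0.
have kr e w : cabs e = 1 -> k (cscale e w) = k w.
  by move=> e1; rewrite /k /cutgauss qf_cscale e1 expr1n mul1r.
have cG : cont G by apply: cont_sqr_cabs; exact: entire_ccont.
have G0 w : 0 <= G w by exact: sqr_ge0.
have lowJ : (c%:E * J (fun w => (G w * k w)%:E) <= (cmean (density N s f))%:E)%E.
  have td : tame (density N s f).
    apply: cont_periodic_tame => //; apply: contM; last exact: cont_weight.
    by apply: cont_sqr_cabs; exact: entire_ccont.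
  rewrite cmean_pos//; last by move=> w; exact: density_ge0.
  rewrite -(Jc_translate z td (@density_ge0 R n N s f) pf).
  rewrite -(JcE (tame_translate z td)); last by move=> w; exact: density_ge0.
  have u0 w : (0 <= (G w * k w)%:E)%E by rewrite lee_fin mulr_ge0.
  rewrite -(J_scale (ltW c0) (cont_ume (contM cG ck)) u0).
  apply: J_mono => w; first by apply: mule_ge0 (u0 w); rewrite lee_fin ltW.
  rewrite -EFinM lee_fin; have [kw|kw] := eqVneq (k w) 0.
    by rewrite kw !mulr0 mulr_ge0 ?cell_ge0 ?density_ge0.
  have kp : 0 < k w by rewrite lt_def kw k0.
  have [_ w4 wd] := supp w kp.
  rewrite cell_eq1; last by apply: le_lt_trans w4 _; lra.
  rewrite mul1r /density /G /g cabsM exprMn cabs_cexp [w + z]addrC.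
  rewrite -[X in c * X]mulrA mulrCA ler_wpM2l ?sqr_ge0//.
  apply: (@le_trans _ _ (c * (expR (complex.Re (- (N%:R / 2)%:C%C * plin s z w)) ^+ 2 *
     expR (- (N%:R * qf H w))))).
    rewrite ler_wpM2l ?(ltW c0)// ler_wpM2l ?exprn_ge0 ?expR_ge0//.
    exact: cutgauss_le.
  rewrite /c /weight mulNr cReN Re_realM -expRM_natl -!expRD ler_expR.
  have := KP z w (le_trans w4 (_ : 4^-1 <= 1)); rewrite ler_norml => /(_ _)/andP[].
    by lra.
  move=> _ h; have := ler_wpM2l (ltW NR) h; rewrite -/H; lra.
have main e : 0 < e -> e <= G 0 ->
    c * ((G 0 - e) * ((1 - 2 ^+ n * expR (- (T / 2))) * (pi ^+ n / (N%:R ^+ n * d)))) <=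
    cmean (density N s f).
  move=> e0 eG; rewrite -lee_fin; apply: le_trans lowJ.
  rewrite EFinM lee_pmul2l ?lte_fin//.
  apply: le_trans (J_radial_lower (entire_sqr_smv eg) cG ck G0 k0 kr _ e0 eG).
    by rewrite EFinM lee_wpmul2l ?lee_fin ?subr_ge0.
  by move=> w /supp[_ h _]; apply: le_trans h _; lra.
have A0 : 0 < pi ^+ n / (N%:R ^+ n * d) :> R.
  by rewrite divr_gt0 ?mulr_gt0 ?exprn_gt0 ?pi_gt0.
set A := pi ^+ n / _ in main A0.
have B1 : 1 - eps / 2 <= 1 - 2 ^+ n * expR (- (T / 2)) by rewrite TT; lra.
set B := 1 - _ * expR _ in main B1.
(* The limit of [main] as [e] tends to 0. A vanishing [G 0] is treated apart, since [main] requires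
   [0 < e <= G 0]. *)
have full : c * (G 0 * (B * A)) <= cmean (density N s f).
  have [g0|g0] := eqVneq (G 0) 0.
    rewrite g0 mul0r mulr0; have [td] : tame (density N s f).
      apply: cont_periodic_tame => //; apply: contM; last exact: cont_weight.
      by apply: cont_sqr_cabs; exact: entire_ccont.
    move=> _; rewrite -lee_fin; apply: le_trans lowJ.
    rewrite mule_ge0 ?lee_fin ?(ltW c0)//; apply: J_ge0 => w.
    by rewrite lee_fin mulr_ge0.
  have gp : 0 < G 0 by rewrite lt_def g0 G0.
  rewrite leNgt; apply/negP => lt.
  have Bp : 0 < B by lra.
  have cBA : 0 < c * (B * A) := mulr_gt0 c0 (mulr_gt0 Bp A0).
  pose e := Num.min (G 0) ((c * (G 0 * (B * A)) - cmean (density N s f)) / 2 / (c * (B * A))).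
  have e0 : 0 < e by rewrite lt_min gp/= !divr_gt0// subr_gt0.
  have e1 : e * (c * (B * A)) <= (c * (G 0 * (B * A)) - cmean (density N s f)) / 2.
    by rewrite -ler_pdivlMr// ge_min lexx orbT.
  have eG : e <= G 0 by rewrite ge_min lexx.
  have := main e e0 eG; clearbody e; lra.
have dens : c * G 0 = expR (- (eps / 2)) * density N s f z.
  by rewrite /c G0E /density; ring.
rewrite mulrA dens in full; rewrite hd.
have ex : 1 - eps / 2 <= expR (- (eps / 2)).
  by have := @expR_ge1Dx R (- (eps / 2)); lra.
have D00 := @density_ge0 R n N s f z.
have step : (1 - eps) * density N s f z * A <= cmean (density N s f).
  apply: le_trans full; move: (density N s f z) D00 => D D00.
  have -> : expR (- (eps / 2)) * D * (B * A) = expR (- (eps / 2)) * B * D * A by ring.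
  rewrite ler_wpM2r ?(ltW A0)// ler_wpM2r//.
  apply: (@le_trans _ _ ((1 - eps / 2) * (1 - eps / 2))); last by apply: ler_pM; lra.
  have := sqr_ge0 eps; rewrite expr2; lra.
have Nd : 0 < N%:R ^+ n * d by rewrite mulr_gt0 ?exprn_gt0.
have := ler_wpM2l (ltW Nd) step; apply: le_trans.
rewrite le_eqVlt; apply/orP; left; apply/eqP; rewrite /A; field.
by rewrite !gt_eqF ?exprn_gt0.
Qed.

End LocalBound.

(** * Gram matrix, Bergman density and peak sections *)

Section PeakSections.
Variables (R : realType) (n : nat).
Local Notation C := R[i].
Local Notation E := ('I_n -> C).
Implicit Types (z w : E) (s : tcoef R n).

Lemma ccont_sum (I : Type) (r : seq I) (P : pred I) (F : I -> E -> C) :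
  (forall i, ccont (F i)) -> ccont (fun z => \sum_(i <- r | P i) F i z).
Proof.
move=> cF; split.
  under [X in cont X]eq_fun do rewrite cRe_sum.
  by apply: cont_sum => i; have [] := cF i.
under [X in cont X]eq_fun do rewrite cIm_sum.
by apply: cont_sum => i; have [] := cF i.
Qed.

Lemma ccont_prod (I : Type) (r : seq I) (F : I -> E -> C) :
  (forall i, ccont (F i)) -> ccont (fun z => \prod_(i <- r) F i z).
Proof.
move=> cF; elim: r => [|i r IH].
  by under [X in ccont X]eq_fun do rewrite big_nil; exact: ccont_cst.
by under [X in ccont X]eq_fun do rewrite big_cons; exact: ccontM.
Qed.

Lemma ccont_hess s i j : ccont (fun z => hess s z i j).
Proof.
under [X in ccont X]eq_fun do rewrite hess_doubled.
apply: ccontD; first exact: ccont_cst.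
apply: ccont_sum => x; apply: ccontM; last exact: ccont_cst.
by apply: ccontM; [exact: ccont_cst|exact: ccont_emode].
Qed.

Lemma ccont_det_hess s : ccont (fun z => \det (hess s z)).
Proof.
rewrite /determinant; apply: ccont_sum => t; apply: ccontM; first exact: ccont_cst.
by apply: ccont_prod => i; exact: ccont_hess.
Qed.

Lemma hdet_periodic s : periodic (hdet s).
Proof. by move=> z k l; rewrite /hdet hess_lat. Qed.

Lemma cont_hdet s : cont (hdet s). Proof. by have [] := ccont_det_hess s. Qed.

Lemma hdet_gt0 s (eta : R) z : 0 < eta ->
  (forall z w, eta * sqn w <= qf (hess s z) w) -> 0 < hdet s z.
Proof.
move=> eta0 pos; have [d [d0 dE _]] := gauss_det (hess_hermitian s z) eta0 (pos z).
by rewrite /hdet dE.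
Qed.

Lemma cmean_hdet s : cmean (hdet s) = pi ^+ n.
Proof. by have := ccmean_det_hess s => /(congr1 (@complex.Re R)). Qed.

Section Gram.
Variables (s : tcoef R n) (N : nat).
Hypothesis N0 : (0 < N)%N.
Local Notation I := {ffun 'I_n -> 'I_N}.

Definition fam (i : 'I_#|I|) : E -> C := tsec (enum_val i).

Definition fcomb (c : 'I_#|I| -> C) z : C := \sum_i c i * fam i z.

Lemma fcombE c : fcomb c = comb (fun J : I => c (enum_rank J)).
Proof.
apply/funext => z; rewrite /fcomb /comb (reindex_onto enum_rank enum_val)/=; last first.
  by move=> i _; exact: enum_valK.
apply: eq_big => [J|J _]; first by rewrite enum_rankK eqxx.
by rewrite /fam enum_rankK.
Qed.

Definition gram : 'M[C]_#|I| := \matrix_(i, j) ccmean (pairing N s (fam i) (fam j)).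

Lemma pairing_fam_ctame i j : ctame (pairing N s (fam i) (fam j)).
Proof. exact: pairing_tsec_ctame. Qed.

Lemma tame_density c : tame (density N s (fcomb c)).
Proof.
rewrite fcombE; apply: cont_periodic_tame; last exact: density_comb_periodic.
apply: contM; last exact: cont_weight.
by apply: cont_sqr_cabs; apply: entire_ccont; exact: entire_comb.
Qed.

Lemma gram_norm c : (cmean (density N s (fcomb c)))%:C%C =
  \sum_i \sum_j conjc (c i) * gram i j * c j.
Proof.
have tp i j : ctame (fun z => conjc (c i) * c j * pairing N s (fam i) (fam j) z).
  by apply: ctameM; [exact: ctame_cst|exact: pairing_fam_ctame].
have -> : \sum_i \sum_j conjc (c i) * gram i j * c j =
    ccmean (fun z => \sum_i \sum_j conjc (c i) * c j * pairing N s (fam i) (fam j) z).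
  rewrite ccmean_sum; last by move=> i; apply: ctame_sum => j.
  apply: eq_bigr => i _; rewrite ccmean_sum//; apply: eq_bigr => j _.
  by rewrite ccmeanZ ?mxE; [rewrite mulrAC|exact: pairing_fam_ctame].
have -> : (fun z => \sum_i \sum_j conjc (c i) * c j * pairing N s (fam i) (fam j) z) =
    (fun z => (density N s (fcomb c) z)%:C%C).
  apply/funext => z; transitivity (fcomb c z * conjc (fcomb c z) * (weight N s z)%:C%C); last first.
    by rewrite mulJc -rmorphM.
  have -> : conjc (fcomb c z) = \sum_i conjc (c i) * conjc (fam i z).
    by rewrite /fcomb rmorph_sum; apply: eq_bigr => i _; rewrite rmorphM.
  rewrite mulrC mulr_sumr mulr_sumr; apply: eq_bigr => i _.
  rewrite /fcomb mulr_suml mulr_sumr; apply: eq_bigr => j _.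
  have ac (a b x y v : C) : a * b * (x * y * v) = v * (b * y * (a * x)) by ring.
  exact: ac.
by apply: cplx_eqP; rewrite //= cmean_cst.
Qed.

Variable eps : R.
Hypothesis bound : forall f, entire f -> periodic (density N s f) -> forall z,
  (1 - eps) * pi ^+ n * density N s f z <= N%:R ^+ n * hdet s z * cmean (density N s f).
Hypothesis eps1 : 0 < eps < 1.
Hypothesis hdet_ge0 : forall z, 0 <= hdet s z.

Lemma bound_fcomb c z : (1 - eps) * pi ^+ n * density N s (fcomb c) z <=
  N%:R ^+ n * hdet s z * cmean (density N s (fcomb c)).
Proof.
rewrite fcombE; apply: bound; first exact: entire_comb.
exact: density_comb_periodic.
Qed.

Lemma eps_pi_gt0 : 0 < (1 - eps) * pi ^+ n.
Proof. by case/andP: eps1 => _ h; rewrite mulr_gt0 ?subr_gt0 ?exprn_gt0 ?pi_gt0. Qed.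

(** A kernel vector gives a combination of norm 0; the local bound forces its density to vanish at
    every point, which contradicts the independence of the theta functions. *)
Lemma gram_unit : gram \in unitmx.
Proof.
rewrite unitmxE unitfE; apply/negP => /det0P [v v0 vG]; move/eqP: v0; apply.
pose c i := conjc (v 0 i).
have m0 : cmean (density N s (fcomb c)) = 0.
  have := gram_norm c; rewrite exchange_big /= big1 => [|j _].
    by move=> /(congr1 (@complex.Re R)).
  rewrite -mulr_suml; have /matrixP/(_ 0 j) := vG; rewrite !mxE => h.
  have -> : \sum_i conjc (c i) * gram i j = \sum_i v 0 i * gram i j.
    by apply: eq_bigr => i _; rewrite /c conjcK.
  by rewrite h mul0r.
have f0 z : fcomb c z = 0.
  have := bound_fcomb c z; rewrite m0 mulr0 pmulr_rle0 ?eps_pi_gt0// => h.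
  have /eqP : density N s (fcomb c) z = 0.
    by apply/eqP; rewrite eq_le h density_ge0.
  by rewrite mulf_eq0 (gt_eqF (weight_gt0 _ _ _)) orbF expf_eq0 /= cabs_eq0 => /eqP.
rewrite fcombE in f0; have c0 := tsec_independent N0 f0.
apply/matrixP => i j; rewrite mxE (ord1 i).
have := c0 (enum_val j); rewrite /c enum_valK => h.
by rewrite -[v 0 j]conjcK h conjc0.
Qed.

(** The coefficients of the reproducing kernel at [z]. By [bergmanE], the value at [z] of the
    resulting function equals its squared norm [bergman z]. *)
Definition peakc z (i : 'I_#|I|) : C := \sum_j invmx gram i j * conjc (fam j z).

Definition bergman z : R := cmean (density N s (fcomb (peakc z))).

Lemma gram_peakc z i : \sum_j gram i j * peakc z j = conjc (fam i z).
Proof.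
transitivity ((gram *m (invmx gram *m \col_j conjc (fam j z))) i 0).
  rewrite [RHS]mxE; apply: eq_bigr => j _; rewrite mxE; congr (_ * _).
  by rewrite [RHS]mxE; apply: eq_bigr => k _; rewrite mxE.
by rewrite mulKVmx ?gram_unit// mxE.
Qed.

Lemma bergmanE z : fcomb (peakc z) z = (bergman z)%:C%C.
Proof.
have : conjc (fcomb (peakc z) z) = (bergman z)%:C%C.
  rewrite /bergman gram_norm /fcomb rmorph_sum; apply: eq_bigr => i _.
  under [RHS]eq_bigr do rewrite -mulrA.
  by rewrite -mulr_sumr gram_peakc [LHS]rmorphM.
case: (fcomb _ _) => a b h; have := congr1 (@complex.Re R) h.
have := congr1 (@complex.Im R) h; rewrite /= => /eqP; rewrite oppr_eq0 => /eqP -> ->.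
by [].
Qed.

Lemma bergman_weightE z : (bergman z * weight N s z)%:C%C =
  \sum_i \sum_j invmx gram i j * pairing N s (fam j) (fam i) z.
Proof.
have -> : (bergman z * weight N s z)%:C%C = (bergman z)%:C%C * (weight N s z)%:C%C.
  by rewrite -rmorphM.
rewrite -bergmanE /fcomb /peakc mulr_suml; apply: eq_bigr => i _.
rewrite !mulr_suml; apply: eq_bigr => j _; rewrite /pairing.
have ac (a b c d : C) : a * b * c * d = a * (b * c * d) by ring.
exact: ac.
Qed.

Lemma tame_bergman : tame (fun z => bergman z * weight N s z).
Proof.
have [] // : ctame (fun z => (bergman z * weight N s z)%:C%C).
under [X in ctame X]eq_fun do rewrite bergman_weightE.
apply: ctame_sum => i; apply: ctame_sum => j.
by apply: ctameM; [exact: ctame_cst|exact: pairing_fam_ctame].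
Qed.

(** Integrating the double sum of [bergman_weightE] gives the trace of the inverse Gram matrix times
    the Gram matrix, that is the number of sections. *)
Lemma cmean_bergman : cmean (fun z => bergman z * weight N s z) = N%:R ^+ n.
Proof.
have cI : #|I| = (N ^ n)%N by rewrite card_ffun !card_ord.
have : ccmean (fun z => (bergman z * weight N s z)%:C%C) = (N%:R ^+ n)%:C%C.
  under [X in ccmean X]eq_fun do rewrite bergman_weightE.
  have tp i j : ctame (fun z => invmx gram i j * pairing N s (fam j) (fam i) z).
    by apply: ctameM; [exact: ctame_cst|exact: pairing_fam_ctame].
  rewrite ccmean_sum; last by move=> i; exact: ctame_sum.
  transitivity (\tr (invmx gram *m gram)).
    apply: eq_bigr => i _; rewrite ccmean_sum// mxE; apply: eq_bigr => j _.
    by rewrite ccmeanZ ?mxE//; exact: pairing_fam_ctame.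
  by rewrite mulVmx ?gram_unit// mxtrace1 cI natrX rmorphXn rmorph_nat.
by move=> /(congr1 (@complex.Re R)).
Qed.

Lemma bergman_ge0 z : 0 <= bergman z.
Proof.
rewrite -[leLHS](@cmean_cst R n); apply: cmean_mono.
- exact: tame_cst.
- exact: tame_density.
- by move=> w; exact: density_ge0.
Qed.

Lemma density_bergman z : density N s (fcomb (peakc z)) z = bergman z * (bergman z * weight N s z).
Proof.
by rewrite /density bergmanE cabs_real ger0_norm ?bergman_ge0// expr2 mulrA.
Qed.

(** The local bound is applied to the kernel function at its own centre, where squared value and
    squared norm share a factor [bergman z] that cancels. *)
Lemma bergman_le z : (1 - eps) * pi ^+ n * (bergman z * weight N s z) <= N%:R ^+ n * hdet s z.
Proof.
have := bound_fcomb (peakc z) z; rewrite density_bergman -/(bergman z) => h.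
have [b0|b0] := eqVneq (bergman z) 0.
  by rewrite b0 mul0r mulr0 mulr_ge0 ?exprn_ge0.
have bp : 0 < bergman z by rewrite lt_def b0 bergman_ge0.
by move: h; rewrite mulrCA [leRHS]mulrC ler_pM2l.
Qed.

End Gram.

(* The mass of the Bergman densities equals the dimension [N ^+ n] while the local
   bound has total mass about [N ^+ n], so the density cannot be small on the
   support of a fixed cutoff. *)
Lemma bergman_mass s (eta : R) (chi : E -> R) : 0 < eta ->
  (forall z w, eta * sqn w <= qf (hess s z) w) ->
  tame chi -> (forall z, 0 <= chi z <= 1) -> 0 < cmean (fun z => chi z * hdet s z) ->
  exists a N0, 0 < a /\ forall N, (N0 <= N)%N -> (0 < N)%N ->
    exists z (f : E -> C), [/\ 0 < chi z, entire f, periodic (density N s f),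
      0 < density N s f z & forall x, density N s f x <= a * density N s f z].
Proof.
move=> eta0 pos tchi chi01 gam0; set gam := cmean _ in gam0.
have h0 z : 0 < hdet s z := hdet_gt0 z eta0 pos.
have th : tame (hdet s) := cont_periodic_tame (@cont_hdet s) (@hdet_periodic s).
have [D D0 DP] : exists2 D, 0 <= D & forall z, `|hdet s z| <= D by case: th.
set P : R := pi ^+ n; have P0 : 0 < P by rewrite exprn_gt0 ?pi_gt0.
have tch : tame (fun z => chi z * hdet s z) by exact: tameM.
have gamP : gam <= P.
  rewrite -[P](cmean_hdet s); apply: cmean_mono => // z.
  by rewrite ler_piMl ?(ltW (h0 z))//; case/andP: (chi01 z).
(* With this [eps] and [zeta] the two losses add up to [3 / 4 * gam], which stays below the mass
   [gam] under the cutoff. *)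
pose eps := gam / (2 * P).
have eps1 : 0 < eps < 1.
  rewrite divr_gt0 ?mulr_gt0//= ltr_pdivrMr ?mulr_gt0// mul1r; lra.
have epsP : eps * P = gam / 2 by rewrite /eps; field; rewrite gt_eqF.
pose zeta := gam / (4 * P).
have zeta0 : 0 < zeta by rewrite divr_gt0 ?mulr_gt0.
have zetaP : zeta * P = gam / 4 by rewrite /zeta; field; rewrite gt_eqF.
clearbody eps zeta; have [N0 NP] := local_bound eta0 pos eps1.
have A0 : 0 < (1 - eps) * P by case/andP: eps1 => _ h; rewrite mulr_gt0 ?subr_gt0.
exists ((D + 1) / ((1 - eps) * P * zeta)), N0; split.
  by rewrite divr_gt0 ?mulr_gt0//; lra.
move=> N NN Np; have bd := NP N NN Np.
have NR : (0 : R) < N%:R ^+ n by rewrite exprn_gt0 ?ltr0n.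
pose B z := bergman s N z * weight N s z.
have tB : tame B := @tame_bergman s N Np eps bd eps1.
have mB : cmean B = N%:R ^+ n := @cmean_bergman s N Np eps bd eps1.
have leB z : (1 - eps) * P * B z <= N%:R ^+ n * hdet s z.
  by apply: bergman_le => // w; exact: ltW.
have [z [cz Bz]] : exists z, 0 < chi z /\ zeta * N%:R ^+ n < B z.
  apply: contrapT => no.
  have small z : chi z * B z <= zeta * N%:R ^+ n.
    have /andP[c0 c1] := chi01 z.
    have [cz|cz] := eqVneq (chi z) 0.
      by rewrite cz mul0r mulr_ge0 ?(ltW zeta0)// ltW.
    have Bz : B z <= zeta * N%:R ^+ n.
      rewrite leNgt; apply/negP => Bz; apply: no; exists z; split=> //.
      by rewrite lt_def cz c0.
    have B0 : 0 <= B z by rewrite mulr_ge0 ?bergman_ge0 ?(ltW (weight_gt0 _ _ _)).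
    by apply: le_trans Bz; rewrite ler_piMl.
  have tcB : tame (fun z => chi z * B z) by exact: tameM.
  have i1 : cmean (fun z => chi z * B z) <= zeta * N%:R ^+ n.
    by rewrite -[leRHS](@cmean_cst R n); apply: cmean_mono => //; exact: tame_cst.
  (* The local bound integrated against [1 - chi]. If the density were small on the support of
     [chi], almost all of its mass [N ^+ n] would have to fit under the remaining share
     [P - gam]. *)
  have i2 : (1 - eps) * P * (N%:R ^+ n - cmean (fun z => chi z * B z)) <= N%:R ^+ n * (P - gam).
    have sub F G : tame F -> tame G -> cmean F - cmean G = cmean (fun z => F z + (-1) * G z).
      by move=> tF tG; rewrite cmeanD ?cmeanZ ?mulN1r//; exact: tameZ.
    have tsub F G : tame F -> tame G -> tame (fun z => F z + (-1) * G z).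
      by move=> tF tG; apply: tameD => //; exact: tameZ.
    have -> : N%:R ^+ n - cmean (fun z => chi z * B z) =
        cmean (fun z => B z + -1 * (chi z * B z)) by rewrite -mB sub.
    have -> : P - gam = cmean (fun z => hdet s z + -1 * (chi z * hdet s z)).
      by rewrite -sub// cmean_hdet.
    rewrite -!cmeanZ; [|exact: tsub|exact: tsub].
    apply: cmean_mono => [||z]; [by apply: tameZ; exact: tsub|by apply: tameZ; exact: tsub|].
    have /andP[c0 c1] := chi01 z; have := leB z.
    have -> : (1 - eps) * P * (B z + -1 * (chi z * B z)) = (1 - chi z) * ((1 - eps) * P * B z).
      by ring.
    have -> : N%:R ^+ n * (hdet s z + -1 * (chi z * hdet s z)) =
      (1 - chi z) * (N%:R ^+ n * hdet s z) by ring.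
    by apply: ler_wpM2l; rewrite subr_ge0.
  have i3 : (1 - eps) * P * ((1 - zeta) * N%:R ^+ n) <= N%:R ^+ n * (P - gam).
    apply: le_trans i2; rewrite ler_wpM2l ?(ltW A0)//; lra.
  rewrite mulrA [leLHS]mulrC ler_pM2l// in i3.
  have zz : 0 < eps * (zeta * P) by rewrite zetaP mulr_gt0//; case/andP: eps1 => //; lra.
  have : (1 - eps) * P * (1 - zeta) = P - eps * P - zeta * P + eps * (zeta * P) by ring.
  rewrite epsP zetaP => h; rewrite h zetaP in i3 zz *; lra.
have b0 : 0 < bergman s N z.
  have := lt_trans (mulr_gt0 zeta0 NR) Bz; rewrite /B pmulr_lgt0 ?weight_gt0//.
exists z, (fcomb (@peakc s N z)); split=> //.
- by rewrite fcombE; exact: entire_comb.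
- by rewrite fcombE; exact: density_comb_periodic.
- by rewrite (density_bergman Np bd eps1) !mulr_gt0 ?weight_gt0.
move=> x; have h := bound_fcomb Np bd (@peakc s N z) x; rewrite -/(bergman s N z) in h.
rewrite (density_bergman Np bd eps1) -/(B z) mulrAC (ler_pdivlMr _ _ (mulr_gt0 A0 zeta0)).
have h1 : (1 - eps) * P * density N s (fcomb (@peakc s N z)) x <=
    N%:R ^+ n * D * bergman s N z.
  apply: le_trans h _; rewrite ler_wpM2r ?(ltW b0)// ler_wpM2l ?(ltW NR)//.
  exact: le_trans (ler_norm _) (DP x).
have h2 : zeta * (N%:R ^+ n * D * bergman s N z) <= (D + 1) * (bergman s N z * B z).
  have -> : zeta * (N%:R ^+ n * D * bergman s N z) = D * (bergman s N z * (zeta * N%:R ^+ n)).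
    by ring.
  apply: ler_pM => //; [|lra|]; first by rewrite !mulr_ge0 ?(ltW b0) ?(ltW zeta0) ?(ltW NR).
  by rewrite ler_wpM2l ?(ltW b0)// ltW.
have := ler_wpM2l (ltW zeta0) h1; lra.
Qed.

(** The cutoff is concentrated near [z0] modulo the lattice, and periodicity of the density moves
    the point found into the ball itself. Since [a] does not depend on [N], the exponential decides
    for large [N]. *)
Lemma peak_section s (eta d : R) z0 : 0 < eta -> 0 < d ->
  (forall z w, eta * sqn w <= qf (hess s z) w) ->
  exists a N0, 0 < a /\ forall N, (N0 <= N)%N -> (0 < N)%N ->
    exists z (f : E -> C), [/\ cnorm (z - z0) < d, entire f, 0 < cabs (f z) &
      forall x, cabs (f x) ^+ 2 <= a * expR (N%:R * (Phi s x - Phi s z)) * cabs (f z) ^+ 2].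
Proof.
move=> eta0 d0 pos; have [q /andP[q0 q1] qP] := @peak_far R n d d0.
pose chi z := Num.max 0 (peak (z - z0) - q).
have cpk : cont (fun z : E => peak (z - z0)).
  have cp := trigonometric_cont (@trigonometric_peak R n).
  move=> z e e0; have [r [r0 rP]] := cp (z - z0) e e0; exists r; split=> // w wz.
  by apply: rP; rewrite -[fun _ => _]/((w - z0) - (z - z0)) opprB addrA subrK.
have cchi : cont chi.
  apply: cont_max; first exact: cont_cst.
  by apply: contD => //; exact: cont_cst.
have pchi : periodic chi.
  move=> z k l; rewrite /chi [z + _ - z0]addrAC.
  by rewrite (trigonometric_periodic (@trigonometric_peak R n)).
have tchi := cont_periodic_tame cchi pchi.
have chi01 z : 0 <= chi z <= 1.
  rewrite le_max lexx /= ge_max ler01 /=.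
  by have := @peak_le1 R n (z - z0); lra.
have chi0 : chi z0 = 1 - q.
  by rewrite /chi subrr peak0; apply/max_idPr; lra.
have gam0 : 0 < cmean (fun z => chi z * hdet s z).
  have ch : cont (fun z => chi z * hdet s z) by apply: contM => //; exact: cont_hdet.
  have v0 : 0 < chi z0 * hdet s z0 by rewrite mulr_gt0 ?chi0 ?subr_gt0 ?(hdet_gt0 _ eta0 pos).
  have v2 : 0 < chi z0 * hdet s z0 / 2 by rewrite divr_gt0.
  have [r [r0 rP]] := ch z0 _ v2.
  have r2 : 0 < r / 2 by rewrite divr_gt0.
  have [c c0 cP] := @cmean_lower R n (r / 2) r2.
  have ph : periodic (fun z => chi z * hdet s z).
    by move=> z k l; rewrite pchi hdet_periodic.
  apply: lt_le_trans (cP _ z0 (chi z0 * hdet s z0 / 2) _ ph _ _).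
  - exact: mulr_gt0.
  - exact: cont_periodic_tame.
  - by move=> z; rewrite mulr_ge0 ?(ltW (hdet_gt0 _ eta0 pos))//; case/andP: (chi01 z).
  move=> z zr; have : cnorm (z - z0) < r by apply: le_lt_trans zr _; lra.
  move=> /rP; move: (chi z * _) (chi z0 * _) => u v; rewrite ltr_norml => /andP[h _]; lra.
have [a [N0 [a0 NP]]] := bergman_mass eta0 pos tchi chi01 gam0.
exists a, N0; split=> // N NN Np; have [z [f [cz ef pf fz fP]]] := NP N NN Np.
have [far|[k [l near]]] := qP (z - z0).
  by move: cz; rewrite /chi lt_max ltxx /= subr_gt0 ltNge far.
exists (z + lat R k l), f; split=> //; first by rewrite addrAC.
  rewrite -(pf z k l) in fz; rewrite lt_def cabs_ge0 andbT; apply/negP => /eqP f0.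
  by rewrite /density f0 expr0n /= mul0r ltxx in fz.
move=> x; have := fP x; rewrite -(pf z k l) /density.
rewrite -ler_pdivlMr ?weight_gt0// => h; apply: le_trans h _.
rewrite le_eqVlt; apply/orP; left; apply/eqP.
rewrite /weight -expRN opprK.
have -> : N%:R * (Phi s x - Phi s (z + lat R k l)) =
  - (N%:R * Phi s (z + lat R k l)) + N%:R * Phi s x by ring.
by rewrite expRD; ring.
Qed.

End PeakSections.

(** * Gluing and separation by polynomials *)

Section LatticeDistance.
Variables (R : realType) (n : nat).
Local Notation C := R[i].
Local Notation E := ('I_n -> C).
Implicit Types (a b z w v : E).

(** The distance to the nearest integer. *)
Definition zdist (y : R) : R := `|y - (Num.floor (y + 2^-1))%:~R|.

Lemma zdist_ge0 y : 0 <= zdist y. Proof. exact: normr_ge0. Qed.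

Lemma int_gap (j k : int) : j < k -> (j%:~R : R) + 1 <= k%:~R.
Proof. by move=> jk; rewrite -[1]/(1%:~R) -intrD ler_int lezD1. Qed.

Lemma zdist_le y (k : int) : zdist y <= `|y - k%:~R|.
Proof.
rewrite /zdist; set f := Num.floor _.
have /andP[h1 h2] := floor_itv (y + 2^-1); rewrite -/f intrD /= in h1 h2.
have hf : `|y - f%:~R| <= 2^-1 by rewrite ler_norml; apply/andP; split; lra.
case: (ltgtP k f) => [kf|kf|-> //]; apply: le_trans hf _.
  by have := int_gap kf; rewrite ler_normr; lra.
by have := int_gap kf; rewrite ler_normr; lra.
Qed.

Lemma zdist_shift y (k : int) : zdist (y + k%:~R) = zdist y.
Proof.
have le x (j : int) : zdist (x + j%:~R) <= zdist x.
  rewrite {2}/zdist; apply: le_trans (zdist_le _ (Num.floor (x + 2^-1) + j)) _.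
  by rewrite intrD opprD addrACA subrr addr0.
apply/eqP; rewrite eq_le le /=; have := le (y + k%:~R) (- k).
by rewrite intrN addrK.
Qed.

Lemma zdist_lip x y : `|zdist x - zdist y| <= `|x - y|.
Proof.
have le u t : zdist u - zdist t <= `|u - t|.
  rewrite lerBlDr; apply: le_trans (zdist_le u (Num.floor (t + 2^-1))) _.
  rewrite /zdist -[X in `|X|](_ : (u - t) + (t - (Num.floor (t + 2^-1))%:~R) = _); last by ring.
  exact: ler_normD.
by rewrite ler_norml le andbT; have := le y x; rewrite distrC; lra.
Qed.

Lemma zdist_small y : `|y| <= 2^-1 -> zdist y = `|y|.
Proof.
move=> y2; apply/eqP; rewrite eq_le; apply/andP; split.
  by have := zdist_le y 0; rewrite subr0.
rewrite /zdist; move: (Num.floor _) => k; move: y2; rewrite ler_norml => /andP[h1 h2].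
have [y0|y0] := leP 0 y.
  rewrite [`|y|]ger0_norm//.
  by case: (ltgtP k 0) => [/int_gap|/int_gap|->]; rewrite ?subr0 ler_normr; lra.
rewrite [`|y|]ltr0_norm//.
by case: (ltgtP k 0) => [/int_gap|/int_gap|->]; rewrite ?subr0 ler_normr; lra.
Qed.

Definition pdist v : R := \sum_i (zdist (complex.Re (v i)) + zdist (complex.Im (v i))).

Lemma pdist_ge0 v : 0 <= pdist v.
Proof. by apply: sumr_ge0 => i _; rewrite addr_ge0 ?zdist_ge0. Qed.

Lemma pdist0 : pdist 0 = 0.
Proof.
by rewrite /pdist big1// => i _; rewrite -[(0 : E) i]/(0 : C) /= zdist_small ?normr0 ?addr0.
Qed.

Lemma pdist_lat v k l : pdist (v + lat R k l) = pdist v.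
Proof.
apply: eq_bigr => i _; rewrite -[(v + _) i]/(v i + lat R k l i) cReD cImD /=.
by rewrite !zdist_shift.
Qed.

Lemma pdist_lip v w : `|pdist v - pdist w| <= 2 * cnorm (v - w).
Proof.
rewrite /pdist -sumrB; apply: le_trans (ler_norm_sum _ _ _) _.
rewrite /cnorm mulr_sumr; apply: ler_sum => i _.
rewrite opprD addrACA; apply: le_trans (ler_normD _ _) _.
have h1 := zdist_lip (complex.Re (v i)) (complex.Re (w i)).
have h2 := zdist_lip (complex.Im (v i)) (complex.Im (w i)).
have := Re_le_cabs (v i - w i); have := Im_le_cabs (v i - w i).
rewrite !(cReD, cImD, cReN, cImN) -[(v - w) i]/(v i - w i); lra.
Qed.

Lemma cnorm_le_pdist v : cnorm v <= 2^-1 -> cnorm v <= pdist v.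
Proof.
move=> v2; apply: ler_sum => i _; apply: le_trans (cabs_le_ReIm _) _.
have vi : cabs (v i) <= 2^-1 by apply: le_trans (cabs_le_cnorm _ _) v2.
rewrite !zdist_small//; first exact: le_trans (Im_le_cabs _) vi.
exact: le_trans (Re_le_cabs _) vi.
Qed.

(** A periodic function agreeing with [Qim] near the origin ([Qper_small]); subtracting it lets a
    function given near the origin be extended periodically. *)
Definition Qper z : R := 2 * pi * \sum_i zdist (complex.Im (z i)) ^+ 2.

Lemma Qper_periodic : periodic Qper.
Proof.
move=> z k l; congr (_ * _); apply: eq_bigr => i _.
by rewrite -[(z + _) i]/(z i + lat R k l i) cImD /= zdist_shift.
Qed.

Lemma cont_Qper : cont Qper.
Proof.
apply: contZ; apply: cont_sum => i.
have cz : cont (fun z : E => zdist (complex.Im (z i))).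
  move=> z e e0; exists e; split=> // w wz; apply: le_lt_trans (zdist_lip _ _) _.
  apply: le_lt_trans wz; rewrite -cImN -cImD.
  by apply: le_trans (Im_le_cabs _) (cabs_le_cnorm (w - z) i).
exact: contM.
Qed.

Lemma Qper_small z : cnorm z <= 2^-1 -> Qper z = Qim z.
Proof.
move=> z2; congr (_ * _); apply: eq_bigr => i _; rewrite zdist_small ?real_normK ?num_real//.
by apply: le_trans (Im_le_cabs _) _; apply: le_trans (cabs_le_cnorm _ _) z2.
Qed.

Lemma Qper_ge0 z : 0 <= Qper z.
Proof.
by rewrite !mulr_ge0 ?pi_ge0//; apply: sumr_ge0 => i _; exact: sqr_ge0.
Qed.

Lemma avg_Qim M a b : (2 < M)%N -> avg M (@Qim R n) a b = Qim a + pi * sqn b.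
Proof.
move=> M3; have Mp : (0 < M)%N by exact: leq_trans M3.
have MR : (M%:R : R) != 0 by rewrite pnatr_eq0 -lt0n.
pose A := \sum_i (Complex 0 (- (4 * pi * complex.Im (a i))) * b i).
pose B := \sum_i (- pi%:C%C * b i ^+ 2).
have e k : Qim (circ a b (rootang R M k)) =
    Qim a + pi * sqn b + complex.Re (cis (rootang R M k) ^+ 1 * A + cis (rootang R M k) ^+ 2 * B).
  rewrite /circ Qim_expand sqn_cscale cabs_cis expr1n mul1r -addrA [_ + pi * _]addrC addrA.
  congr (_ + complex.Re _); rewrite /qlin /A /B !mulr_sumr -big_split.
  apply: eq_bigr => i _; rewrite /cscale.
  have ac (x c y p : C) : x * (c * y) - p * (c * y) ^+ 2 = c ^+ 1 * (x * y) + c ^+ 2 * (- p * y ^+ 2).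
    by ring.
  exact: ac.
have s1 := @sum_cis_eq0 R M 1 (ltnW M3); have s2 := @sum_cis_eq0 R M 2 M3.
rewrite /avg; under eq_bigr do rewrite e.
have s0 : \sum_(k < M) complex.Re (cis (rootang R M k) ^+ 1 * A + cis (rootang R M k) ^+ 2 * B) = 0.
  by rewrite -cRe_sum big_split -!mulr_suml s1 s2 !mul0r /= addr0.
by rewrite big_split s0 /= addr0 sumr_const card_ord -[X in _ * X]mulr_natl mulKf.
Qed.

Lemma cos_lower (t h : R) : `|h| <= 1 -> - cos t + sin t * h - 2 * h ^+ 2 <= - cos (t + h).
Proof.
move=> h1; rewrite cosD.
have c1 : `|cos t * (1 - cos h)| <= h ^+ 2.
  rewrite normrM -[leRHS]mul1r; apply: ler_pM => //.
    by rewrite ler_norml cos_geN1 cos_le1.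
  by rewrite distrC cos_taylor1.
have c2 : `|sin t * (sin h - h)| <= h ^+ 2.
  rewrite normrM -[leRHS]mul1r; apply: ler_pM => //.
    by rewrite ler_norml sin_geN1 sin_le1.
  apply: le_trans (sin_taylor1 h) _; rewrite -[h ^+ 2]real_normK ?num_real//.
  by rewrite exprS ler_piMl ?exprn_ge0.
move: c1 c2; rewrite !ler_norml => /andP[c1 _] /andP[c2 _]; lra.
Qed.

(** The barrier for the gluing: it vanishes on the lattice and is bounded below away from it. The
    factor [(8 * pi)^-1] turns the quadratic loss in [cos_lower], taken at $h=2\pi x$, into $\pi
    x^2$, exactly what [Qim] compensates. *)
Definition psib z : R := (8 * pi)^-1 *
  \sum_i ((1 - cos (2 * pi * complex.Re (z i))) + (1 - cos (2 * pi * complex.Im (z i)))).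

Lemma psib_peak z : psib z = (8 * pi)^-1 * (4 * n.+1%:R) * (1 - peak z).
Proof.
rewrite /psib /peak opprB addrCA subrr addr0 mulrA; congr (_ * _).
by rewrite mulfK// mulf_neq0 ?pnatr_eq0.
Qed.

Lemma trigonometric_psib : trigonometric psib.
Proof.
have t1 := trigonometricZ (-1) (@trigonometric_peak R n).
have := trigonometricZ ((8 * pi)^-1 * (4 * n.+1%:R)) (trigonometricD (trigonometric_cst n 1) t1).
move=> h; apply: trigonometric_ext h _ => z.
by rewrite psib_peak mulN1r.
Qed.

Lemma psib_avg M a b : (1 < M)%N -> cnorm b <= 8^-1 -> psib a - pi * sqn b <= avg M psib a b.
Proof.
move=> M2 b8; have Mp : (0 < M)%N by exact: leq_trans M2.
have MR : (0 : R) < M%:R by rewrite ltr0n.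
have p0 := @pi_gt0 R; have pi4 : pi < 4 :> R by have := @pihalf_lt2 R; lra.
pose B := \sum_i ((8 * pi)^-1)%:C%C * (Complex (sin (2 * pi * complex.Re (a i)) * (2 * pi))
  (- (sin (2 * pi * complex.Im (a i)) * (2 * pi))) * b i).
have low c : cabs c = 1 ->
    psib a - pi * sqn b + complex.Re (c * B) <= psib (a + cscale c b).
  move=> c1; rewrite /psib /B /sqn !mulr_sumr -sumrB cRe_sum -big_split /=.
  apply: ler_sum => i _; rewrite -[(a + _) i]/(a i + c * b i).
  have ac (x y u t : C) : x * (y * (u * t)) = y * (u * (x * t)) by ring.
  rewrite ac Re_realM.
  set cb := c * b i; have cbE : cabs cb = cabs (b i) by rewrite cabsM c1 mul1r.
  clearbody cb; rewrite -cbE.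
  have cb8 : cabs cb <= 8^-1 by rewrite cbE; apply: le_trans (cabs_le_cnorm _ _) b8.
  have h1 : `|2 * pi * complex.Re cb| <= 1.
    rewrite normrM ger0_norm ?mulr_ge0 ?(ltW p0)//.
    have := le_trans (Re_le_cabs cb) cb8; nra.
  have h2 : `|2 * pi * complex.Im cb| <= 1.
    rewrite normrM ger0_norm ?mulr_ge0 ?(ltW p0)//.
    have := le_trans (Im_le_cabs cb) cb8; nra.
  have k1 := cos_lower (2 * pi * complex.Re (a i)) h1.
  have k2 := cos_lower (2 * pi * complex.Im (a i)) h2.
  have -> : pi * cabs cb ^+ 2 = (8 * pi)^-1 * (8 * pi ^+ 2 * (complex.Re cb ^+ 2 + complex.Im cb ^+ 2)).
    have p8 : 8 * pi != 0 :> R by rewrite mulf_neq0 ?gt_eqF// pnatr_eq0.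
    rewrite sqr_cabs (_ : 8 * pi ^+ 2 * _ = (8 * pi) * (pi * (complex.Re cb ^+ 2 + complex.Im cb ^+ 2))).
      by rewrite mulKf.
    by ring.
  rewrite -mulrBr -mulrDr ler_wpM2l ?invr_ge0 ?mulr_ge0 ?(ltW p0)//.
  have e1 : 2 * pi * complex.Re (a i + cb) = 2 * pi * complex.Re (a i) + 2 * pi * complex.Re cb.
    by rewrite cReD; ring.
  have e2 : 2 * pi * complex.Im (a i + cb) = 2 * pi * complex.Im (a i) + 2 * pi * complex.Im cb.
    by rewrite cImD; ring.
  rewrite e1 e2 cReM /=; lra.
have s1 := @sum_cis_eq0 R M 1 M2.
rewrite /avg ler_pdivlMl//.
have -> : M%:R * (psib a - pi * sqn b) =
    \sum_(k < M) (psib a - pi * sqn b + complex.Re (cis (rootang R M k) ^+ 1 * B)).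
  rewrite big_split /= sumr_const card_ord -cRe_sum -mulr_suml s1 mul0r addr0.
  by rewrite -[RHS]mulr_natl.
by apply: ler_sum => k _; apply: low; rewrite cabs_cis.
Qed.

End LatticeDistance.

(** * Lipschitz regularisation and gluing to the periodic barrier *)

Section SupConvolution.
Variables (R : realType) (n : nat).
Local Notation C := R[i].
Local Notation E := ('I_n -> C).
Variables (w : E -> R) (W c : R).
Hypothesis sw : smv w.
Hypothesis w0 : forall x, 0 <= w x.
Hypothesis wW : forall x, cnorm x <= 4^-1 -> w x <= W.
Hypothesis cW : 32 * (W + 1) <= c.
Implicit Types (a b x z : E).

(** The sup-convolution of [w], restricted to a small ball, with the lattice-periodic distance; this
    makes [supconv] Lipschitz and periodic at once. *)
Let vals z : set R := [set w x - c * pdist (z - x) | x in [set x | cnorm x <= 4^-1]].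

Definition supconv z : R := sup (vals z).

Let W0 : 0 <= W.
Proof. by apply: le_trans (w0 0) (wW _); rewrite cnorm0 invr_ge0. Qed.

Let c0 : 0 < c. Proof. by apply: lt_le_trans cW; have := W0; lra. Qed.

Let vals_ub z : ubound (vals z) W.
Proof.
move=> _ [x /= xr <-]; apply: le_trans (wW xr).
by rewrite gerBl mulr_ge0 ?pdist_ge0// ltW.
Qed.

Lemma supconv_ge z x : cnorm x <= 4^-1 -> w x - c * pdist (z - x) <= supconv z.
Proof.
by move=> xr; apply: ub_le_sup; [exists W; exact: vals_ub|exists x].
Qed.

Let vals_neq0 z : vals z !=set0.
Proof. by exists (w 0 - c * pdist (z - 0)); exists 0 => //=; rewrite cnorm0 invr_ge0. Qed.

Lemma supconv_le z t : (forall x, cnorm x <= 4^-1 -> w x - c * pdist (z - x) <= t) ->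
  supconv z <= t.
Proof. by move=> h; apply: ge_sup => // _ [x /= xr <-]; exact: h. Qed.

Lemma supconv_leW z : supconv z <= W.
Proof. by apply: ge_sup => //; exact: vals_ub. Qed.

Lemma supconv_approx z (e : R) : 0 < e ->
  exists2 x, cnorm x <= 4^-1 & supconv z - e < w x - c * pdist (z - x).
Proof.
move=> e0; have hs : has_sup (vals z) by split => //; exists W; exact: vals_ub.
by have [_ [x /= xr <-] h] := sup_adherent e0 hs; exists x.
Qed.

Lemma supconv_ge_self z : cnorm z <= 4^-1 -> w z <= supconv z.
Proof.
by move=> zr; have := supconv_ge z zr; rewrite subrr pdist0 mulr0 subr0.
Qed.

Lemma supconv_periodic : periodic supconv.
Proof.
move=> z k l; congr sup; apply/eq_imagel => x _.
by rewrite addrAC pdist_lat.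
Qed.

Lemma supconv_lip z z' : `|supconv z - supconv z'| <= 2 * c * cnorm (z - z').
Proof.
have le u t : supconv u - supconv t <= 2 * c * cnorm (u - t).
  rewrite lerBlDr; apply: supconv_le => x xr.
  have := supconv_ge t xr; have := pdist_lip (t - x) (u - x).
  rewrite opprB addrA subrK cnormB => /(le_trans (ler_norm _)) h1.
  have := ler_wpM2l (ltW c0) h1; lra.
by rewrite ler_norml le andbT; have := le z' z; rewrite cnormB; lra.
Qed.

Lemma cont_supconv : cont supconv.
Proof.
move=> z e e0; exists (e / (2 * c)); split; first by rewrite divr_gt0 ?mulr_gt0.
move=> z' zz; apply: le_lt_trans (supconv_lip _ _) _.
by rewrite mulrC -ltr_pdivlMr ?mulr_gt0.
Qed.

(* A nearly optimal [x] is close to [a], since [w >= 0] and the penalty is steep. *)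
Lemma supconv_near a (e : R) : cnorm a <= 16^-1 -> 0 < e <= 1 ->
  exists2 x, cnorm x <= 8^-1 & supconv a - e < w x - c * pdist (a - x).
Proof.
move=> a16 /andP[e0 e1]; have [x xr xP] := supconv_approx a e0; exists x => //.
have a4 : cnorm a <= 4^-1 by lra.
have pd : pdist (a - x) < 32^-1.
  have h := supconv_ge_self a4; have wx := wW xr; have wa := w0 a.
  have : c * pdist (a - x) < W + 1 by lra.
  have := ler_wpM2r (pdist_ge0 (a - x)) cW; have := W0 => W00 h1 h2.
  rewrite ltNge; apply/negP => h3.
  have : (W + 1) * 32^-1 <= (W + 1) * pdist (a - x) by rewrite ler_wpM2l//; lra.
  lra.
have ax : cnorm (a - x) <= 2^-1.
  by apply: le_trans (cnormD _ _) _; rewrite cnormN; lra.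
have := cnorm_le_pdist ax; have := cnormD (x - a) a; rewrite subrK cnormB; lra.
Qed.

(** A near-maximiser [x] for [a] is carried along the circle by the translation [a - x], so the
    sub-mean value inequality of [w] at [x] becomes one for [supconv] at [a]. *)
Lemma supconv_avg (e : R) : 0 < e -> exists M0, forall M, (M0 <= M)%N -> (0 < M)%N ->
  forall a b, cnorm a <= 16^-1 -> cnorm b <= 8^-1 -> supconv a - e <= avg M supconv a b.
Proof.
move=> e0; pose e1 := Num.min 1 (e / 3).
have e10 : 0 < e1 by rewrite lt_min ltr01 divr_gt0.
have e11 : 0 < e1 <= 1 by rewrite e10 ge_min lexx.
have e13 : e1 <= e / 3 by rewrite ge_min lexx orbT.
clearbody e1; have d0 : 0 < e1 / (4 * c) by rewrite divr_gt0 ?mulr_gt0.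
have [M0 MP] := angle_small d0; exists M0 => M MM Mp a b a16 b8.
have [x x8 xP] := supconv_near a16 e11.
have cG : cont (fun y => supconv (y + (a - x)) + c * pdist (a - x)).
  apply: contD; last exact: cont_cst.
  move=> z e' e'0; have [d [dp dP]] := cont_supconv (z + (a - x)) e'0.
  exists d; split=> // y yz; apply: dP.
  by rewrite -[fun _ => _]/((y + (a - x)) - (z + (a - x))) opprD addrACA subrr addr0.
have wG t : w (circ x b t) <= supconv (circ x b t + (a - x)) + c * pdist (a - x).
  have xb : cnorm (circ x b t) <= 4^-1.
    by apply: le_trans (cnorm_circ _ _ _) _; lra.
  have := supconv_ge (circ x b t + (a - x)) xb; rewrite addrAC subrr add0r; lra.
have [M1 M1P] := sw cG wG e10.
(* The threshold [M1] depends on [a] and [b]. Passing to the multiple of [M] by [M'], and back by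
   the Lipschitz bound, gives a threshold uniform in both. *)
pose M' := maxn M1 1; have M'p : (0 < M')%N by exact: leq_maxr.
have MM'p : (0 < M * M')%N by rewrite muln_gt0 Mp.
have h1 := M1P (M * M')%N (leq_trans (leq_maxl M1 1) (leq_pmull _ Mp)) MM'p.
rewrite avgD avg_cst// avg_shift [x + (a - x)]addrC subrK in h1.
have h2 : `|avg (M * M') supconv a b - avg M supconv a b| <= e1.
  apply: avg_refine => // s t st; apply: le_trans (supconv_lip _ _) _.
  have := circ_lip a b s t => h3.
  have stM := le_trans st (MP M MM Mp).
  have : 2 * `|s - t| * cnorm b <= 2 * (e1 / (4 * c)) * 1.
    by apply: ler_pM; rewrite ?mulr_ge0 ?cnorm_ge0 ?ler_wpM2l//; lra.
  move=> h4; have := ler_wpM2l (ltW c0) (le_trans h3 h4).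
  have -> : c * (2 * (e1 / (4 * c)) * 1) = e1 / 2 by field; rewrite gt_eqF.
  lra.
move: h2; rewrite ler_norml => /andP[_ h2]; lra.
Qed.

Variables (kap tau q : R).
Hypothesis tau0 : 0 < tau.
Hypothesis q_near : forall z : E, peak z <= q \/ exists k l, cnorm (z + lat R k l) < 16^-1.
Hypothesis kapq : kap + tau * W <= (8 * pi)^-1 * (4 * n.+1%:R) * (1 - q).

(** By [kapq] the barrier wins away from the lattice. Near the origin, adding [Qim] leaves the
    maximum of [Qim + psib] and [kap + tau * supconv], where the information on [w] is visible. *)
Definition glued z : R := Num.max (psib z) (kap + tau * supconv z - Qper z).

Lemma glued_periodic : periodic glued.
Proof.
move=> z k l; rewrite /glued (trigonometric_periodic (@trigonometric_psib R n)).
by rewrite supconv_periodic Qper_periodic.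
Qed.

Lemma cont_glued : cont glued.
Proof.
apply: cont_max; first exact: trigonometric_cont (@trigonometric_psib R n).
apply: contD; last by apply: contN; exact: cont_Qper.
by apply: contD; [exact: cont_cst|apply: contZ; exact: cont_supconv].
Qed.

Lemma avg_periodic M (G : E -> R) a b k l : periodic G -> avg M G (a + lat R k l) b = avg M G a b.
Proof. by move=> pG; rewrite -avg_shift; congr (_ * _); apply: eq_bigr => j _; rewrite pG. Qed.

(** At each point the branch attaining the maximum is averaged. Where the barrier loses, the point
    is close to the lattice, [Qper] may be replaced by [Qim], and the average of [- Qim] loses
    exactly [pi * sqn b]. *)
Lemma quasi_smv_glued : quasi_smv glued.
Proof.
exists (8^-1) => // e e0; have et : 0 < e / tau by rewrite divr_gt0.
have [M0 MP] := supconv_avg et; exists (maxn M0 3) => M MM Mp a b b8.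
have M3 : (2 < M)%N by apply: leq_trans MM; exact: leq_maxr.
have [le1|lt1] := leP (kap + tau * supconv a - Qper a) (psib a).
  have -> : glued a = psib a by apply/max_idPl.
  have := psib_avg a (ltnW M3) b8.
  have : avg M (@psib R n) a b <= avg M glued a b.
    by apply: avg_le => k _; rewrite le_max lexx.
  lra.
have [k [l near]] : exists k l, cnorm (a + lat R k l) < 16^-1.
  have [far|//] := q_near a; exfalso; move: lt1; rewrite ltNge psib_peak => /negP; apply.
  have h1 : tau * supconv a <= tau * W by rewrite ler_wpM2l ?(ltW tau0)// supconv_leW.
  have h2 := Qper_ge0 a.
  have h3 : (8 * pi)^-1 * (4 * n.+1%:R) * (1 - q) <= (8 * pi)^-1 * (4 * n.+1%:R) * (1 - peak a) :> R.
    by rewrite ler_wpM2l ?mulr_ge0 ?invr_ge0 ?mulr_ge0 ?pi_ge0//; lra.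
  apply: le_trans h3; apply: le_trans kapq.
  by rewrite -addrA lerD2l; apply: le_trans h1; rewrite gerBl.
rewrite -(glued_periodic a k l) -(avg_periodic M a b k l glued_periodic).
have ga : glued (a + lat R k l) = kap + tau * supconv (a + lat R k l) - Qim (a + lat R k l).
  rewrite glued_periodic /glued (elimT max_idPr) ?(ltW lt1)//.
  rewrite supconv_periodic -(Qper_periodic a k l) Qper_small//; lra.
set a' := a + lat R k l in near ga *; rewrite ga.
have h1 := MP M (leq_trans (leq_maxl _ _) MM) Mp a' b (ltW near) b8.
have h2 : avg M (fun z => (kap + tau * supconv z) + (-1) * Qim z) a' b <= avg M glued a' b.
  apply: avg_le => j _; rewrite le_max mulN1r; apply/orP; right.
  rewrite Qper_small// (le_trans (cnorm_circ _ _ _))//; lra.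
move: h2; rewrite avgD avgD avg_cst// (avgZ M tau supconv) (avgZ M (-1) (@Qim R n)) avg_Qim// => h2.
have := ler_wpM2l (ltW tau0) h1; rewrite mulrBr [tau * (e / tau)]mulrC divfK ?gt_eqF//.
lra.
Qed.

Lemma glued_near_ge z : cnorm z <= 2^-1 -> kap + tau * supconv z <= Qim z + glued z.
Proof.
move=> z2; rewrite -lerBlDl /glued le_max Qper_small//; apply/orP; right.
by rewrite lexx.
Qed.

Lemma glued_near_le z t : cnorm z <= 2^-1 -> Qim z + psib z <= kap -> 0 <= t ->
  supconv z <= t -> Qim z + glued z <= kap + tau * t.
Proof.
move=> z2 zk t0 zt; rewrite -lerBrDl ge_max; apply/andP; split.
  by have := mulr_ge0 (ltW tau0) t0; lra.
rewrite Qper_small//; have := ler_wpM2l (ltW tau0) zt; lra.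
Qed.

End SupConvolution.

(** * Separation of a point from a sublevel set by polynomials *)

Section Separation.
Variables (R : realType) (n : nat).
Local Notation C := R[i].
Local Notation E := ('I_n -> C).
Implicit Types (x y z : E) (w : E -> R) (K : E -> Prop).

(** The glued weight is larger near [z0] than near [K], by a multiple of [w z0 - s]. A section
    peaking near [z0] is then exponentially small near [K], and a polynomial approximates it. The
    radius [r] is chosen before [w], so dilations reduce the general case to this one. *)
Lemma separate_small : exists2 r : R, 0 < r <= 32^-1 &
  forall w (W : R) K z0 (delta s : R),
  smv w -> (forall x, 0 <= w x) -> (forall x, cnorm x <= 4^-1 -> w x <= W) ->
  (forall k, K k -> cnorm k < r / 2) -> cnorm z0 < r / 2 -> 0 < delta -> 0 <= s -> s < w z0 ->
  (forall x k, K k -> cnorm (x - k) < delta -> w x <= s) ->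
  exists p (c : R), [/\ hpoly p, forall k, K k -> cabs (p k) <= c & c < cabs (p z0)].
Proof.
have d16 : 0 < 16^-1 :> R by rewrite invr_gt0.
have [q /andP[q0 q1] qP] := @peak_far R n _ d16.
pose c1 : R := (8 * pi)^-1 * (4 * n.+1%:R).
have c10 : 0 < c1 by rewrite !mulr_gt0 ?invr_gt0 ?mulr_gt0 ?pi_gt0.
pose kap := c1 * (1 - q) / 2.
have q10 : 0 < 1 - q by lra.
have kap0 : 0 < kap := divr_gt0 (mulr_gt0 c10 q10) (ltr0n _ 2).
have cQ : cont (fun z : E => Qim z + psib z).
  apply: contD; [exact: cont_Qim|exact: trigonometric_cont (@trigonometric_psib R n)].
have [r1 [r10 r1P]] := cQ 0 kap kap0.
have v0 : Qim (0 : E) + psib (0 : E) = 0.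
  rewrite psib_peak peak0 subrr mulr0 addr0 /Qim big1 ?mulr0// => i _.
  by rewrite /= expr0n.
exists (Num.min r1 32^-1); first by rewrite lt_min r10 invr_gt0 ltr0n /= ge_min lexx orbT.
set r := Num.min _ _.
have r32 : r <= 32^-1 by rewrite ge_min lexx orbT.
have r0 : 0 < r by rewrite lt_min r10 invr_gt0 ltr0n.
have rk z : cnorm z < r -> Qim z + psib z <= kap.
  move=> zr; have : cnorm (z - 0) < r1.
    by rewrite subr0; apply: lt_le_trans zr _; rewrite ge_min lexx.
  by move=> /r1P; rewrite v0 subr0 ltr_norml => /andP[_ /ltW].
move=> w W K z0 delta s sw w0 wW Kr zr0 delta0 s0 sz near.
have W0 : 0 <= W by apply: le_trans (w0 0) (wW _ _); rewrite cnorm0 invr_ge0.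
(* The first summand is the steepness that [supconv_near] requires. The second makes the penalty
   beyond distance [delta / 2] at least [W], so only points near [K] can contribute a positive
   value. *)
pose c := 32 * (W + 1) + 2 * W / delta.
have wd0 : 0 <= 2 * W / delta by rewrite divr_ge0 ?mulr_ge0 ?(ltW delta0).
have cW : 32 * (W + 1) <= c by rewrite lerDl.
have cd : W <= c * (delta / 2).
  apply: (@le_trans _ _ (2 * W / delta * (delta / 2))).
    by rewrite mulrA divfK ?gt_eqF//; lra.
  by rewrite ler_wpM2r ?divr_ge0 ?(ltW delta0)// lerDr; lra.
have c0 : 0 < c by lra.
(* The height [c1 * (1 - q)] of the barrier away from the lattice is shared: half goes to [kap], and
   [tau * W] fits into the other half. *)
clearbody c; pose tau := c1 * (1 - q) / (2 * (W + 1)).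
have W2 : 0 < 2 * (W + 1) by lra.
have tau0 : 0 < tau := divr_gt0 (mulr_gt0 c10 q10) W2.
have kapq : kap + tau * W <= c1 * (1 - q).
  have e1 : tau * (W + 1) = c1 * (1 - q) / 2 by rewrite /tau; field; rewrite gt_eqF//; lra.
  by rewrite /kap; lra.
clearbody tau.
have gl := quasi_smv_glued sw w0 wW cW tau0 qP kapq.
have cg := cont_glued w0 wW cW kap tau.
have pg := @glued_periodic R n w c kap tau.
pose gap := w z0 - s; have gap0 : 0 < gap by rewrite subr_gt0.
have e0 : 0 < tau * gap / 8 := divr_gt0 (mulr_gt0 tau0 gap0) (ltr0n _ 8).
have [t [tP [eta eta0 etaP]]] := trigonometric_approx cg pg gl e0.
(* The peak is only found at some [z] within [d] of [z0], so everything is translated by [z - z0].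
   The three bounds keep the translate of [K] within [delta], inside the ball of radius [r], and the
   change of [supconv] below [gap / 4]. *)
pose d := Num.min (delta / 2) (Num.min (r / 2) (gap / (8 * c))).
have d0 : 0 < d by rewrite !lt_min !divr_gt0 ?mulr_gt0.
have d1 : d <= delta / 2 by rewrite ge_min lexx.
have d2 : d <= r / 2 by rewrite !ge_min lexx orbT.
have d3 : 2 * c * d <= gap / 4.
  have : d <= gap / (8 * c) by rewrite !ge_min lexx !orbT.
  by rewrite ler_pdivlMr ?mulr_gt0//; lra.
clearbody d; have [a [N0 [a0 NP]]] := peak_section z0 eta0 d0 etaP.
(* Of the difference [tau * gap], a quarter is lost by moving from [z0] to [z], and two eighths by
   approximating the glued function at [x] and at [z]. *)
pose mu := tau * gap / 2; have mu0 : 0 < mu := divr_gt0 (mulr_gt0 tau0 gap0) (ltr0n _ 2).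
have ex1 : 0 <= expR (- mu) < 1 by rewrite expR_ge0 expR_lt1 oppr_lt0.
have a16 : 0 < (16 * a)^-1 by rewrite invr_gt0 mulr_gt0.
have [N1 N1P] := eventually_expr_le ex1 a16.
pose N := maxn N0 (maxn N1 1).
have Np : (0 < N)%N by apply: leq_trans (leq_maxr N1 1) (leq_maxr _ _).
have [z [f [zz0 ef fz fP]]] := NP N (leq_maxl _ _) Np.
have Nmu : a * expR (- (N%:R * mu)) <= 16^-1.
  have h := N1P N (leq_trans (leq_maxl _ _) (leq_maxr _ _)).
  rewrite -mulrN expRM_natl; have := ler_wpM2l (ltW a0) h.
  by rewrite invfM [16^-1 * _]mulrC mulrA mulfV ?gt_eqF// mul1r.
have zr : cnorm z < r.
  by have := cnormD (z - z0) z0; rewrite subrK; lra.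
have small k : K k -> cabs (f (k + (z - z0))) <= cabs (f z) / 4.
  move=> Kk; set x := k + (z - z0).
  have xr : cnorm x < r by have := cnormD k (z - z0); have := Kr k Kk; rewrite -/x; lra.
  have xs : supconv w c x <= s.
    apply: supconv_le => y y4.
    have [pd|pd] := ltP (pdist (x - y)) (delta / 2).
      have xy : cnorm (x - y) < delta / 2.
        apply: le_lt_trans (cnorm_le_pdist _) pd.
        by apply: le_trans (cnormD _ _) _; rewrite cnormN; lra.
      have wy : w y <= s.
        apply: (near y k Kk); apply: le_lt_trans (cnorm_dist _ x _) _.
        have -> : x - k = z - z0 by rewrite /x addrAC subrr add0r.
        by rewrite cnormB; lra.
      by apply: le_trans wy; rewrite gerBl mulr_ge0 ?pdist_ge0 ?(ltW c0).
    have := ler_wpM2l (ltW c0) pd; have := wW y y4; lra.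
  have x2 : cnorm x <= 2^-1 by lra.
  have z2 : cnorm z <= 2^-1 by lra.
  have up := glued_near_le tau0 x2 (rk x xr) s0 xs.
  have dn := @glued_near_ge R n w c kap tau z z2.
  have fz1 := supconv_lip w0 wW cW z0 z.
  have z04 : cnorm z0 <= 4^-1 by lra.
  have fz2 := supconv_ge_self w0 wW cW z04.
  have fz3 : w z0 - gap / 4 <= supconv w c z.
    have : 2 * c * cnorm (z0 - z) <= 2 * c * d.
      by rewrite ler_wpM2l ?mulr_ge0 ?(ltW c0)// cnormB ltW.
    move: fz1; rewrite ler_norml => /andP[_ fz1]; lra.
  have fz4 := ler_wpM2l (ltW tau0) fz3.
  have t1 := tP x; have t2 := tP z.
  have dPhi : Phi t x - Phi t z <= - mu.
    move: t1 t2; rewrite !ler_norml => /andP[_ t1] /andP[t2 _].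
    rewrite /Phi /mu; have gE : gap = w z0 - s by [].
    have e1 : tau * (w z0 - gap / 4) = tau * s + tau * gap * (3 / 4) by rewrite gE; field.
    rewrite e1 in fz4; lra.
  have := fP x => h.
  have e2 : expR (N%:R * (Phi t x - Phi t z)) <= expR (- (N%:R * mu)).
    by rewrite ler_expR -mulrN ler_wpM2l.
  have h2 : cabs (f x) ^+ 2 <= (cabs (f z) / 4) ^+ 2.
    apply: le_trans h _; rewrite expr_div_n mulrC ler_wpM2l ?sqr_ge0//.
    have <- : (16^-1 : R) = (4 ^+ 2)^-1 by congr _^-1; rewrite -natrX.
    by apply: le_trans Nmu; rewrite ler_wpM2l ?(ltW a0).
  by rewrite -(@ler_pXn2r _ 2) ?nnegrE ?cabs_ge0 ?divr_ge0 ?cabs_ge0.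
have f8 : 0 < cabs (f z) / 8 by rewrite divr_gt0.
have eF : entire (fun y => f (y + (z - z0))).
  by apply: entire_ext (entire_affine 1 (z - z0) ef) _ => y; rewrite cscale1.
have [p [hp pP]] := eF 1 _ f8.
(* Relative to [cabs (f z)], the polynomial is at most 1/4 + 1/8 on [K] and at least 1 - 1/8 at
   [z0]. *)
exists p, (cabs (f z) * (3 / 8)); split=> // [k Kk|].
  have k1 : cnorm k <= 1 by have := Kr k Kk; lra.
  have := pP k k1; have := small k Kk.
  have := cabsD (p k - f (k + (z - z0))) (f (k + (z - z0))); rewrite subrK cabsB; lra.
have z1 : cnorm z0 <= 1 by lra.
have := pP z0 z1; rewrite [z0 + _]addrC subrK.
have := cabsD (f z - p z0) (p z0); rewrite subrK; lra.
Qed.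

Lemma cscale_sub (c : C) x y : cscale c (x - y) = cscale c x - cscale c y.
Proof. by apply/funext => i; rewrite /cscale mulrBr. Qed.

Lemma cont_cscale (G : E -> R) (c : C) : cont G -> cont (fun z => G (cscale c z)).
Proof.
move=> cG z e e0; have [d [d0 dP]] := cG (cscale c z) e e0.
have c1 : 0 < cabs c + 1 by have := cabs_ge0 c; lra.
exists (d / (cabs c + 1)); split; first exact: divr_gt0.
move=> x xz; apply: dP; rewrite -[fun _ => _]/(cscale c x - cscale c z) -cscale_sub cnormZ.
apply: (@le_lt_trans _ _ ((cabs c + 1) * cnorm (x - z))).
  by rewrite ler_wpM2r ?cnorm_ge0//; lra.
by rewrite mulrC -ltr_pdivlMr.
Qed.

Lemma smv_cscale w (c : C) : c != 0 -> smv w -> smv (fun z => w (cscale c z)).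
Proof.
move=> c0 sw a b G cG wG e e0.
have ck z : cscale c^-1 (cscale c z) = z by rewrite cscaleA mulVf// cscale1.
have circE t : cscale c (circ a b t) = circ (cscale c a) (cscale c b) t.
  by rewrite /circ cscaleDr !cscaleA mulrC.
have wG' t : w (circ (cscale c a) (cscale c b) t) <=
    G (cscale c^-1 (circ (cscale c a) (cscale c b) t)).
  by rewrite -circE ck.
have [M0 MP] := sw _ _ _ (cont_cscale c^-1 cG) wG' e e0; exists M0 => M MM Mp.
have := MP M MM Mp; congr (_ <= _ * _); apply: eq_bigr => k _.
by rewrite -circE ck.
Qed.

Lemma separation w K z0 (rho delta s : R) :
  smv w -> (forall x, 0 <= w x) ->
  (forall r, exists M, forall x, cnorm x <= r -> w x <= M) ->
  (forall k, K k -> cnorm k <= rho) -> 0 < delta -> 0 <= s -> s < w z0 ->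
  (forall x k, K k -> cnorm (x - k) < delta -> w x <= s) ->
  exists p (c : R), [/\ hpoly p, forall k, K k -> cabs (p k) <= c & c < cabs (p z0)].
Proof.
move=> sw w0 wb Kr delta0 s0 sz near; have [r /andP[r0 _] rP] := separate_small.
pose rho' := `|rho| + cnorm z0 + 1.
have rho0 : 0 < rho' by have := normr_ge0 rho; have := cnorm_ge0 z0; rewrite /rho'; lra.
pose sig := r / (2 * rho'); have sig0 : 0 < sig by rewrite divr_gt0 ?mulr_gt0.
have sigr x : cnorm x < rho' -> cnorm (cscale sig%:C%C x) < r / 2.
  move=> xr; rewrite cnormZ cabs_real gtr0_norm//.
  have -> : r / 2 = sig * rho' by rewrite /sig; field; rewrite gt_eqF.
  by rewrite ltr_pM2l.
have sN : (sig%:C%C : C) != 0 by rewrite -cabs_eq0 cabs_real gtr0_norm// gt_eqF.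
have ks x : cscale (sig%:C%C)^-1 (cscale sig%:C%C x) = x by rewrite cscaleA mulVf// cscale1.
have sk x : cscale sig%:C%C (cscale (sig%:C%C)^-1 x) = x by rewrite cscaleA mulfV// cscale1.
have [W WP] := wb (4^-1 / sig).
pose K' x := K (cscale (sig%:C%C)^-1 x).
have [] := rP (fun z => w (cscale (sig%:C%C)^-1 z)) W K' (cscale sig%:C%C z0) (sig * delta) s.
- by apply: smv_cscale => //; rewrite invr_eq0.
- by move=> x; exact: w0.
- move=> x x4; apply: WP; rewrite cnormZ cabsV cabs_real gtr0_norm// mulrC.
  by rewrite ler_pM2r ?invr_gt0.
- move=> k /Kr kr; rewrite -(sk k); apply: sigr; apply: le_lt_trans kr _.
  have := ler_norm rho; have := cnorm_ge0 z0; rewrite /rho'; lra.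
- by apply: sigr; have := normr_ge0 rho; rewrite /rho'; lra.
- exact: mulr_gt0.
- by [].
- by rewrite ks.
- move=> x k Kk xk; apply: (near _ _ Kk); rewrite -cscale_sub cnormZ cabsV cabs_real gtr0_norm//.
  by rewrite mulrC ltr_pdivrMr// mulrC.
move=> p [c [hp pK pz]]; exists (fun y => p (cscale sig%:C%C y + 0)), c; split.
- exact: hpoly_affine.
- by move=> k Kk; rewrite addr0; apply: pK; rewrite /K' ks.
- by rewrite addr0.
Qed.

End Separation.

(** * Polynomial envelopes *)

Section WeightedComponents.
Variables (R : realType) (n : nat) (lam : 'I_n -> R).
Hypothesis lam_gt0 : forall i, 0 < lam i.
Local Notation C := R[i].
Local Notation E := ('I_n -> C).
Implicit Types (z : E) (al be : 'I_n -> nat) (t : C).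

Lemma cexpmE (d : R) t : cexpm d t = cexp (- (d%:C%C * t)).
Proof.
rewrite /cexp /cexpm /cis cReN cImN cReM cImM /= !mul0r subr0 addr0 cosN sinN.
by apply: cplx_eqP; rewrite ?(cReM, cImM) /=; ring.
Qed.

Lemma cexpm_add (d e : R) t : cexpm (d + e) t = cexpm d t * cexpm e t.
Proof. by rewrite !cexpmE -cexpD -opprD -mulrDl rmorphD. Qed.

Lemma cexpm0 t : cexpm (0 : R) t = 1.
Proof. by rewrite cexpmE mul0r oppr0 cexp0. Qed.

Lemma cexpm_imag (d s : R) : cexpm d (Complex 0 s) = cis (- (d * s)).
Proof. by rewrite /cexpm /cis mulr0 oppr0 expR0 !mul1r cosN sinN. Qed.

Lemma geometric_sum_bound (th : R) : cis th != 1 -> exists B : R, forall L,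
  cabs (\sum_(j < L) cis (th * j%:R)) <= B.
Proof.
move=> th1; exists (2 / cabs (1 - cis th)) => L.
have d0 : 0 < cabs (1 - cis th) by rewrite cabs_gt0 subr_eq0 eq_sym.
rewrite ler_pdivlMr// -cabsM mulrC.
have -> : (1 - cis th) * \sum_(j < L) cis (th * j%:R) = 1 - cis th ^+ L.
  have e (j : 'I_L) : true -> cis (th * j%:R) = cis th ^+ j by rewrite cisX mulr_natr.
  by rewrite (eq_bigr _ e) -[RHS]opprB subrX1 -mulNr opprB.
by apply: le_trans (cabsD _ _) _; rewrite cabs1 cabsN cisX cabs_cis.
Qed.

(** The sampling step [h] is so small that no nonzero frequency becomes a multiple of a full turn.
    Each such frequency then contributes a geometric sum bounded independently of the number of
    samples. *)
Lemma frequency_sum_bound (I : Type) (r : seq I) (a : I -> C) (th : I -> R) (h : R) :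
  0 < h -> (\sum_(x <- r) `|th x|) * h < 2 * pi -> exists D : R, forall L,
    cabs (\sum_(j < L) \sum_(x <- r) a x * cis (th x * (h * j%:R)) -
      L%:R * \sum_(x <- r | th x == 0) a x) <= D.
Proof.
move=> h0; elim: r => [|x r IH] hs.
  exists 0 => L; rewrite big1 ?big_nil ?mulr0 ?subr0 ?cabs0// => j _.
  by rewrite big_nil.
rewrite big_cons mulrDl in hs.
have s0 : 0 <= (\sum_(y <- r) `|th y|) * h.
  by rewrite mulr_ge0 ?(ltW h0)//; apply: sumr_ge0.
have x0 : 0 <= `|th x| * h by rewrite mulr_ge0 ?(ltW h0).
have hr : (\sum_(y <- r) `|th y|) * h < 2 * pi by apply: le_lt_trans hs; rewrite lerDr.
have [D DP] := IH hr.
have split L : \sum_(j < L) \sum_(y <- x :: r) a y * cis (th y * (h * j%:R)) =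
    a x * \sum_(j < L) cis (th x * h * j%:R) +
    \sum_(j < L) \sum_(y <- r) a y * cis (th y * (h * j%:R)).
  rewrite mulr_sumr -big_split /=; apply: eq_bigr => j _.
  by rewrite big_cons mulrA.
have [th0|th0] := eqVneq (th x) 0.
  exists D => L; rewrite split big_cons th0 eqxx.
  have -> : \sum_(j < L) cis (0 * h * j%:R) = L%:R :> C.
    rewrite (eq_bigr (fun=> 1)) ?sumr_const ?card_ord// => j _.
    by rewrite !mul0r cis0.
  by rewrite mulrDr opprD addrACA [a x * _]mulrC subrr add0r.
have cN : cis (th x * h) != 1.
  have c1 : cos (th x * h) != 1.
    have -> : cos (th x * h) = cos (`|th x| * h).
      by case: (ger0P (th x)) => // _; rewrite mulNr cosN.
    apply: cos_neq1; rewrite mulr_gt0 ?normr_gt0//=.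
    by apply: le_lt_trans hs; rewrite lerDl.
  by apply: contra c1 => /eqP /(congr1 (@complex.Re R)) /= ->.
have [B BP] := geometric_sum_bound cN.
exists (cabs (a x) * B + D) => L; rewrite split big_cons (negbTE th0) -addrA.
apply: le_trans (cabsD _ _) _; apply: lerD => //.
by rewrite cabsM ler_wpM2l ?cabs_ge0.
Qed.

(** A Bohr mean computed by sampling: after division by the number of samples, only the terms of
    frequency 0 remain in the limit. *)
Lemma zero_frequency (I : Type) (r : seq I) (a : I -> C) (th : I -> R) (c : R) :
  (forall s, cabs (\sum_(x <- r) a x * cis (th x * s)) <= c) ->
  cabs (\sum_(x <- r | th x == 0) a x) <= c.
Proof.
move=> bd; pose S := \sum_(x <- r) `|th x|.
have S0 : 0 <= S by apply: sumr_ge0.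
pose h : R := pi / (1 + S); have h0 : 0 < h by rewrite divr_gt0 ?pi_gt0//; lra.
have Sh : S * h < 2 * pi.
  rewrite /h mulrA ltr_pdivrMr; last lra.
  by have := @pi_gt0 R => p0; have := mulr_ge0 S0 (ltW p0); lra.
have [D DP] := frequency_sum_bound a h0 Sh.
have c0 : 0 <= c := le_trans (cabs_ge0 _) (bd 0).
apply/ler_addgt0Pr => e e0.
pose L := (Num.truncn (`|D| / e)).+1; have L0 : (0 : R) < L%:R by rewrite ltr0n.
have DL : D <= e * L%:R.
  apply: le_trans (ler_norm _) _; rewrite mulrC -ler_pdivrMr//.
  by apply/ltW/truncnS_gt.
set A := \sum_(x <- r | _) _ in DP *.
have h1 := DP L; set T := \sum_(j < L) _ in h1.
have hT : cabs T <= c * L%:R.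
  apply: le_trans (cabs_sum _ _ _) _; apply: (@le_trans _ _ (\sum_(j < L) c)).
    by apply: ler_sum => j _; exact: bd.
  by rewrite sumr_const card_ord -[_ *+ L]mulr_natr.
have : cabs (L%:R * A) <= (c + e) * L%:R.
  have -> : L%:R * A = T - (T - L%:R * A) by ring.
  by apply: le_trans (cabsD _ _) _; rewrite cabsN; lra.
by rewrite cabsM cabs_nat mulrC ler_pM2r.
Qed.

Definition mono al z : C := \prod_i z i ^+ al i.
Definition wt al : R := \sum_i lam i * (al i)%:R.

Lemma wt_ge0 al : 0 <= wt al.
Proof. by apply: sumr_ge0 => i _; rewrite mulr_ge0// ltW. Qed.

Lemma cexpm_wt al t : \prod_i cexpm (lam i) t ^+ al i = cexpm (wt al) t.
Proof.
rewrite /wt; elim/big_rec2: _ => [|i x y _ ->]; first by rewrite cexpm0.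
rewrite cexpm_add; congr (_ * _).
elim: (al i) => [|k IH]; first by rewrite expr0 mulr0 cexpm0.
by rewrite exprS IH -cexpm_add -[k.+1%:R]nat1r mulrDr mulr1.
Qed.

Lemma mono_PhiX al z t : mono al (PhiX lam z t) = cexpm (wt al) t * mono al z.
Proof.
rewrite -cexpm_wt /mono -big_split; apply: eq_bigr => i _ /=.
by rewrite /PhiX exprMn mulrC.
Qed.

Definition pexp := seq (C * ('I_n -> nat)).
Implicit Type s : pexp.

Definition peval s z : C := \sum_(x <- s) x.1 * mono x.2 z.

Lemma hpoly_mono al : hpoly (mono al).
Proof.
by apply: hpoly_prod => i; apply: (@hpolyX _ _ (fun z : E => z i)); exact: hpoly_coord.
Qed.

Lemma hpoly_peval s : hpoly (peval s).
Proof. by apply: hpoly_sum => x; apply: hpolyZ; exact: hpoly_mono. Qed.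

Lemma hpoly_expansion (p : E -> C) : hpoly p -> exists s, p =1 peval s.
Proof.
elim=> [c|i|p1 p2 _ [s1 h1] _ [s2 h2]|p1 p2 _ [s1 h1] _ [s2 h2]].
- exists [:: (c, fun=> 0%N)] => z; rewrite /peval big_seq1 /mono big1 ?mulr1// => i _ /=.
- exists [:: (1, fun j => (j == i) : nat)] => z; rewrite /peval big_seq1 mul1r /mono (bigD1 i)//=.
  by rewrite eqxx big1 ?mulr1// => j /negbTE ->; rewrite expr0.
- by exists (s1 ++ s2) => z; rewrite /peval big_cat h1 h2.
exists [seq (x.1 * y.1, fun i => (x.2 i + y.2 i)%N) | x <- s1, y <- s2] => z.
rewrite h1 h2 /peval big_allpairs_dep mulr_suml; apply: eq_bigr => x _.
rewrite mulr_sumr; apply: eq_bigr => y _ /=.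
have -> : mono (fun i => (x.2 i + y.2 i)%N) z = mono x.2 z * mono y.2 z.
  by rewrite /mono -big_split; apply: eq_bigr => i _; rewrite /= exprD.
have ac (u v x' y' : C) : u * v * (x' * y') = u * x' * (v * y') by ring.
by rewrite ac.
Qed.

Definition comp s (d : R) : pexp := [seq x <- s | wt x.2 == d].

Lemma comp_PhiX s d z t : peval (comp s d) (PhiX lam z t) = cexpm d t * peval (comp s d) z.
Proof.
rewrite /peval /comp !big_filter mulr_sumr; apply: eq_bigr => x /eqP xd.
by rewrite mono_PhiX xd mulrCA.
Qed.

(** A Cauchy estimate: along imaginary times, a factor of modulus 1 turns the component of weight
    [d] into the zero-frequency part of an exponential sum. *)
Lemma comp_bound s d z (c : R) :
  (forall th, cabs (peval s (PhiX lam z (Complex 0 th))) <= c) ->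
  cabs (peval (comp s d) z) <= c.
Proof.
move=> bd; rewrite /peval /comp big_filter.
have := @zero_frequency _ s (fun x => x.1 * mono x.2 z) (fun x => d - wt x.2) c.
have -> : \sum_(x <- s | d - wt x.2 == 0) x.1 * mono x.2 z =
    \sum_(x <- s | wt x.2 == d) x.1 * mono x.2 z.
  by apply: eq_bigl => x; rewrite subr_eq0 eq_sym.
apply=> th; have := bd th; rewrite -[cabs (peval _ _)]mul1r -(cabs_cis (d * th)) -cabsM.
congr (cabs _ <= _); rewrite /peval mulr_sumr; apply: eq_bigr => x _.
rewrite mono_PhiX cexpm_imag mulrBl cisD.
have ac (u v x' y : C) : u * (v * (x' * y)) = v * y * (u * x') by ring.
exact: ac.
Qed.

Lemma sum_comp s z : peval s z = \sum_(d <- undup [seq wt x.2 | x <- s]) peval (comp s d) z.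
Proof.
rewrite /peval /comp; under [RHS]eq_bigr do rewrite big_filter.
under [RHS]eq_bigr do rewrite big_mkcond.
rewrite exchange_big /= big_seq [RHS]big_seq; apply: eq_bigr => x xs.
rewrite (bigD1_seq (wt x.2)) ?undup_uniq ?mem_undup//=; last first.
  by apply/mapP; exists x.
by rewrite eqxx big1 ?addr0// => d; rewrite eq_sym => /negbTE ->.
Qed.

Lemma lam_lower : exists2 l : R, 0 < l & forall i, l <= lam i.
Proof.
exists ((1 + \sum_i (lam i)^-1)^-1).
  by rewrite invr_gt0 ltr_pwDl// sumr_ge0// => i _; rewrite invr_ge0 ltW.
move=> i; rewrite -[lam i]invrK lef_pV2 ?posrE ?invr_gt0//; last first.
  by rewrite ltr_pwDl// sumr_ge0// => j _; rewrite invr_ge0 ltW.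
rewrite (bigD1 i)//= addrCA lerDl addr_ge0// sumr_ge0// => j _.
by rewrite invr_ge0 ltW.
Qed.

Lemma conjc_cexpm (d : R) t : conjc (cexpm d t) = cexpm d (conjc t).
Proof.
by apply: cplx_eqP; rewrite /cexpm; case: t => x y /=; rewrite ?mulrN ?cosN ?sinN ?mulrN ?opprK.
Qed.

(* Letting Re t tend to infinity kills the antiholomorphic monomials of a
   polynomial of bidegree (d, 0). *)
Lemma quasi_hom_expansion (q : E -> C) (d : R) : quasi_hom lam q d 0 ->
  exists s, q =1 peval (comp s d).
Proof.
move=> [[s sE] hom]; have [l l0 lP] := lam_lower.
pose good (x : C * ('I_n -> nat) * ('I_n -> nat)) := wt x.1.2 - wt x.2 == d.
exists [seq x.1 | x <- s & wt x.2 == 0] => z.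
rewrite /peval /comp big_filter big_map big_filter_cond.
pose m (x : C * ('I_n -> nat) * ('I_n -> nat)) : C :=
  x.1.1 * (mono x.1.2 z * conjc (mono x.2 z)).
have mE x : x.1.1 * \prod_(i < n) (z i ^+ x.1.2 i * conjc (z i) ^+ x.2 i) = m x.
  rewrite /m big_split; congr (_ * (_ * _)); rewrite /mono rmorph_prod.
  by apply: eq_bigr => i _; rewrite rmorphXn.
(* At real part [T], the imaginary part of the time is used to select the terms whose holomorphic
   weight minus antiholomorphic weight is [d]; they carry a damping governed by the antiholomorphic
   weight. *)
have step (T : R) : 0 < T ->
    q z = \sum_(x <- s | good x) m x * (expR (- (2 * wt x.2 * T)))%:C%C.
  move=> T0; apply/eqP; rewrite -subr_eq0 -cabs_eq0 eq_le cabs_ge0 andbT cabsB.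
  (* The index [None] carries [- q z] at frequency 0. The whole sum is then identically 0, and so is
     its zero-frequency part. *)
  pose a (x : option (C * ('I_n -> nat) * ('I_n -> nat))) : C :=
    if x is Some x then m x * (expR ((d - wt x.1.2 - wt x.2) * T))%:C%C else - q z.
  pose th (x : option (C * ('I_n -> nat) * ('I_n -> nat))) : R :=
    if x is Some x then d - wt x.1.2 + wt x.2 else 0.
  have := @zero_frequency _ (None :: map Some s) a th 0.
  rewrite big_cons eqxx big_map.
  have -> : \sum_(x <- s | th (Some x) == 0) a (Some x) =
      \sum_(x <- s | good x) m x * (expR (- (2 * wt x.2 * T)))%:C%C.
    apply: eq_big => [x|x /eqP xg].
      by rewrite /good /th -[RHS]subr_eq0 -[LHS]oppr_eq0; congr (_ == _); ring.
    rewrite /a; congr (_ * (expR _)%:C%C).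
    by have -> : d = wt x.1.2 - wt x.2; [rewrite /th in xg; lra|ring].
  rewrite addrC; apply=> sg; rewrite big_cons big_map mul0r cis0 mulr1.
  have := hom (Complex T sg) z T0; rewrite cexpm0 mulr1 => hq.
  suff -> : \sum_(x <- s) a (Some x) * cis (th (Some x) * sg) = q z by rewrite addNr cabs0.
  have ce : cexp (d%:C%C * Complex T sg) * cexpm d (Complex T sg) = 1.
    by rewrite cexpmE -cexpD subrr cexp0.
  rewrite -[q z]mul1r -ce -mulrA -hq sE mulr_sumr; apply: eq_bigr => x _.
  have -> : \prod_(i < n) (PhiX lam z (Complex T sg) i ^+ x.1.2 i *
      conjc (PhiX lam z (Complex T sg) i) ^+ x.2 i) =
      cexpm (wt x.1.2) (Complex T sg) * mono x.1.2 z *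
      (cexpm (wt x.2) (Complex T (- sg)) * conjc (mono x.2 z)).
    rewrite big_split; congr (_ * _); first by rewrite -mono_PhiX.
    have <- : conjc (cexpm (wt x.2) (Complex T sg)) = cexpm (wt x.2) (Complex T (- sg)).
      exact: conjc_cexpm.
    transitivity (conjc (mono x.2 (PhiX lam z (Complex T sg)))).
      by rewrite /mono rmorph_prod; apply: eq_bigr => i _; rewrite rmorphXn.
    by rewrite mono_PhiX rmorphM.
  rewrite /a /m.
  have e : cis (th (Some x) * sg) * (expR ((d - wt x.1.2 - wt x.2) * T))%:C%C =
      cexp (d%:C%C * Complex T sg) * cexpm (wt x.1.2) (Complex T sg) *
      cexpm (wt x.2) (Complex T (- sg)).
    rewrite !cexpmE -!cexpD /cexp mulrC; congr (_%:C%C * cis _).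
      by congr expR; rewrite !(cReD, cReN, cReM) /=; ring.
    by rewrite !(cImD, cImN, cImM) /=; ring.
  have ac (x1 x2 x3 x4 x5 y1 y2 y3 y4 y5 : C) : x4 * x5 = y1 * y2 * y3 ->
    x1 * (x2 * x3) * x5 * x4 = y1 * (x1 * (y2 * x2 * (y3 * x3))).
    by move=> e'; rewrite -mulrA [x5 * x4]mulrC e'; ring.
  exact: ac e.
(* The terms without antiholomorphic factor, the only ones not damped as [T] grows. *)
pose A := \sum_(x <- s | good x && (wt x.2 == 0)) m x.
have AE : A = \sum_(x <- s | (wt x.2 == 0) && (wt x.1.2 == d)) x.1.1 * mono x.1.2 z.
  apply: eq_big => [x|x /andP[_ /eqP x0]].
    by rewrite andbC /good; case: eqP => //= ->; rewrite subr0.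
  rewrite /m; congr (_ * _); rewrite -[RHS]mulr1; congr (_ * _).
  rewrite /mono big1 ?conjc1// => i _.
  suff -> : x.2 i = 0%N by rewrite expr0.
  apply/eqP; rewrite -(@pnatr_eq0 R); move/eqP: x0; rewrite psumr_eq0 => [/allP|j _].
    move=> /(_ i (mem_index_enum _)); rewrite mulf_eq0 (gt_eqF (lam_gt0 i)) => //.
  by rewrite mulr_ge0 // ltW.
rewrite -AE; apply/eqP; rewrite -subr_eq0 -cabs_eq0 eq_le cabs_ge0 andbT.
apply/ler_addgt0Pr => e e0; rewrite add0r.
pose D := \sum_(x <- s) cabs (m x); have D0 : 0 <= D by apply: sumr_ge0 => x _; exact: cabs_ge0.
have eD : 0 < e / (D + 1) by rewrite divr_gt0//; lra.
have [K KP] := half_pow_small eD; pose T : R := K.+1%:R / (2 * l).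
have T0 : 0 < T by rewrite divr_gt0 ?mulr_gt0.
have small : expR (- (2 * l * T)) <= e / (D + 1).
  apply: le_trans (KP K.+1 (leqnSn _)); apply: expRN_le_half.
  by rewrite /T mulrC divfK// gt_eqF ?mulr_gt0.
rewrite (step T T0) (bigID (fun x => wt x.2 == 0)) /=.
have -> : \sum_(x <- s | good x && (wt x.2 == 0)) m x * (expR (- (2 * wt x.2 * T)))%:C%C = A.
  by apply: eq_bigr => x /andP[_ /eqP ->]; rewrite mulr0 mul0r oppr0 expR0 mulr1.
rewrite addrAC subrr add0r; apply: le_trans (cabs_sum _ _ _) _.
apply: (@le_trans _ _ (D * (e / (D + 1)))); last first.
  by rewrite mulrCA ler_piMr ?(ltW e0)// ler_pdivrMr; lra.
rewrite /D mulr_suml big_mkcond; apply: ler_sum => x _.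
case: ifP => [/andP[_ x0]|_]; last by rewrite mulr_ge0 ?cabs_ge0 ?(ltW eD).
rewrite cabsM ler_wpM2l ?cabs_ge0// cabs_real ger0_norm ?expR_ge0//.
apply: le_trans small; rewrite ler_expR lerN2 ler_wpM2r ?(ltW T0)// ler_wpM2l//.
have [i xi] : exists i, x.2 i != 0%N.
  apply: contrapT => no; move/eqP: x0; apply; rewrite /wt big1// => i _.
  have [->|xi] := eqVneq (x.2 i) 0%N; first by rewrite mulr0.
  by exfalso; apply: no; exists i.
apply: le_trans (lP i) _; rewrite /wt (bigD1 i)//=.
apply: (@le_trans _ _ (lam i * (x.2 i)%:R)).
  by rewrite ler_peMr ?(ltW (lam_gt0 i))// ler1n lt0n.
by rewrite lerDl sumr_ge0// => j _; rewrite mulr_ge0// ltW.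
Qed.

End WeightedComponents.

(** * The envelope of quasi-homogeneous polynomials *)

Section PolynomialEnvelope.
Variables (R : realType) (n : nat) (lam : 'I_n -> R) (rho : nat -> R).
Hypothesis n_gt0 : (0 < n)%N.
Hypothesis lam_gt0 : forall i, 0 < lam i.
Hypothesis hrho : rho_enum lam rho.
Local Notation C := R[i].
Local Notation E := ('I_n -> C).
Implicit Types (z : E) (t : C) (q : E -> C).

Lemma powR_sum (a : R) (al : 'I_n -> nat) : 0 < a ->
  powR a (wt lam al) = \prod_i powR a (lam i) ^+ al i.
Proof.
move=> a0; rewrite /wt; elim/big_rec2: _ => [|i y x _ <-]; first by rewrite powRr0.
by rewrite powRD ?(gt_eqF a0) ?implybT// powRrM powR_mulrn ?powR_ge0.
Qed.

Lemma geometric_le (a : R) (M : nat) : 0 <= a < 1 -> \sum_(k < M) a ^+ k <= (1 - a)^-1.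
Proof.
move=> /andP[a0 a1]; have d : 0 < 1 - a by rewrite subr_gt0.
rewrite -[leRHS]mulr1 ler_pdivlMl//.
have -> : (1 - a) * \sum_(k < M) a ^+ k = 1 - a ^+ M.
  by rewrite -[RHS]opprB subrX1 -mulNr opprB.
by rewrite gerBl exprn_ge0.
Qed.

Lemma powR_lt1 (a l : R) : 0 < a < 1 -> 0 < l -> 0 <= powR a l < 1.
Proof.
move=> /andP[a0 a1] l0; rewrite powR_ge0; have := gt0_ltr_powR l0 _ _ a1.
by rewrite powR1 /= !nnegrE ler01 (ltW a0); apply.
Qed.

(* Distinct weights have distinct exponents, so a sum over weights is dominated
   by a product of geometric series. *)
Lemma sum_weights (a : R) : 0 < a < 1 -> exists B : R, forall s : pexp R n,
  \sum_(d <- undup [seq wt lam x.2 | x <- s]) powR a d <= B.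
Proof.
move=> a01; have a0 : 0 < a by case/andP: a01.
exists (\prod_i (1 - powR a (lam i))^-1) => s.
pose M := (\sum_(x <- s) \sum_i x.2 i)%N.
pose T := {ffun 'I_n -> 'I_M.+1}.
pose w (al : T) : R := wt lam (fun i => al i).
pose phi (d : R) : T := odflt [ffun=> ord0] [pick al | w al == d].
have phiP d : d \in undup [seq wt lam x.2 | x <- s] -> w (phi d) = d.
  rewrite mem_undup => /mapP[x xs dE]; rewrite /phi; case: pickP => [al /eqP //|/= no].
  have xM i : (x.2 i < M.+1)%N.
    rewrite ltnS /M (big_rem x xs) /=; apply: leq_trans (leq_addr _ _).
    by rewrite (bigD1 i)//= leq_addr.
  have := no [ffun i => Ordinal (xM i)]; rewrite /w dE => /eqP; case.
  by congr wt; apply/funext => i; rewrite ffunE.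
have u : uniq (map phi (undup [seq wt lam x.2 | x <- s])).
  rewrite map_inj_in_uniq ?undup_uniq// => d e dW eW h.
  by rewrite -(phiP d dW) -(phiP e eW) h.
rewrite big_seq (eq_bigr (fun d => powR a (w (phi d)))) => [|d dW]; last by rewrite phiP.
rewrite -big_seq -(big_map phi xpredT (fun al => powR a (w al))) big_uniq//=.
apply: (@le_trans _ _ (\sum_(al : T) powR a (w al))).
  by rewrite [leRHS](bigID (mem (map phi (undup [seq wt lam x.2 | x <- s]))))/= lerDl sumr_ge0// => al _; exact: powR_ge0.
rewrite (eq_bigr (fun al : T => \prod_i powR a (lam i) ^+ al i)) => [|al _]; last exact: powR_sum.
rewrite -(bigA_distr_bigA (fun i (k : 'I_M.+1) => powR a (lam i) ^+ k)).
apply: ler_prod => i _; rewrite sumr_ge0 => [|k _]; last by rewrite exprn_ge0 ?powR_ge0.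
by apply: geometric_le; exact: powR_lt1.
Qed.

Definition admissible (v : E -> R) (k : nat) q :=
  quasi_hom lam q (rho k) 0 /\ forall x, powR (cabs (q x)) (rho k)^-1 <= v x.

Definition vset (v : E -> R) z : set R :=
  [set x : R | exists (k : nat) (q : E -> C),
     [/\ quasi_hom lam q (rho k) 0,
         forall w, powR (cabs (q w)) (rho k)^-1 <= v w &
         x = powR (cabs (q z)) (rho k)^-1]].

Definition env (v : E -> R) z : R := sup (vset v z).

Lemma rho_wt (al : 'I_n -> nat) : exists k, rho k = wt lam al.
Proof. by apply/(hrho.2 (wt lam al)); exists al. Qed.

Lemma rho_ge0 k : 0 <= rho k.
Proof.
have [al ->] : exists al : 'I_n -> nat, rho k = wt lam al.
  by apply/(hrho.2 (rho k)); exists k.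
exact: wt_ge0.
Qed.

Lemma powR_cexpm (d : R) t (y : C) : 0 < d ->
  powR (cabs (cexpm d t * y)) d^-1 = expR (- complex.Re t) * powR (cabs y) d^-1.
Proof.
move=> d0; rewrite cabsM cabs_cexpm powRM ?expR_ge0 ?cabs_ge0//; congr (_ * _).
by rewrite /powR gt_eqF ?expR_gt0// expRK; congr expR; field; rewrite gt_eqF.
Qed.

Variable v : E -> R.
Hypothesis v_ge0 : forall x, 0 <= v x.
Hypothesis v0 : v 0 = 0.

(** Degree 0 is ruled out by the conventions for inverse and power: [0^-1] is 0 and [powR _ 0] is 1
    even at base 0, which exceeds [v 0 = 0]. *)
Lemma admissible_rho k q : admissible v k q -> 0 < rho k.
Proof.
move=> [_ h]; rewrite lt_def rho_ge0 andbT; apply/negP => /eqP r0.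
by have := h 0; rewrite r0 invr0 powRr0 v0 ler10.
Qed.

Lemma admissible_hpoly k q : admissible v k q -> hpoly q.
Proof.
move=> [hq _]; have [s sE] := quasi_hom_expansion lam_gt0 hq.
by apply: hpoly_ext (hpoly_peval _) _ => z; rewrite sE.
Qed.

Lemma admissible_PhiX k q z t : admissible v k q ->
  q (PhiX lam z t) = cexpm (rho k) t * q z.
Proof.
move=> [hq _]; have [s sE] := quasi_hom_expansion lam_gt0 hq.
by rewrite !sE comp_PhiX.
Qed.

(** Since [n] is positive, the exponent with all entries 1 has positive weight, and at a positive
    degree the zero polynomial is a competitor; hence the suprema are over nonempty sets. *)
Lemma admissible_zero : exists k, admissible v k (fun=> 0).
Proof.
have [k kE] := rho_wt (fun=> 1%N); exists k.
have k0 : 0 < rho k.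
  rewrite kE /wt (bigD1 (Ordinal n_gt0))//= ltr_pwDl ?mulr_gt0 ?ltr01// sumr_ge0// => i _.
  by rewrite mulr_ge0 ?ler0n ?ltW.
split; last by move=> x; rewrite cabs0 powR0 ?invr_eq0 ?gt_eqF.
split; last by move=> t z _; rewrite mulr0.
by exists [::] => z; rewrite big_nil.
Qed.

Lemma vset_neq0 z : vset v z !=set0.
Proof.
have [k [h1 h2]] := admissible_zero.
by exists (powR (cabs (0 : C)) (rho k)^-1); exists k, (fun=> 0); split.
Qed.

Lemma vset_ub z : ubound (vset v z) (v z).
Proof. by move=> _ [k [q [_ h ->]]]. Qed.

Lemma env_ge k q z : admissible v k q -> powR (cabs (q z)) (rho k)^-1 <= env v z.
Proof.
move=> [h1 h2]; apply: ub_le_sup; first by exists (v z); exact: vset_ub.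
by exists k, q; split.
Qed.

Lemma env_le z : env v z <= v z.
Proof. by apply: ge_sup; [exact: vset_neq0|exact: vset_ub]. Qed.

Lemma env_ge0 z : 0 <= env v z.
Proof.
have [k hk] := admissible_zero; apply: le_trans (env_ge z hk); exact: powR_ge0.
Qed.

Lemma env_approx z (e : R) : 0 < e ->
  exists k q, admissible v k q /\ env v z - e < powR (cabs (q z)) (rho k)^-1.
Proof.
move=> e0; have hs : has_sup (vset v z).
  by split; [exact: vset_neq0|exists (v z); exact: vset_ub].
by have [_ [k [q [h1 h2 ->]]] h] := sup_adherent e0 hs; exists k, q.
Qed.

Lemma env_smv : smv (env v).
Proof.
apply: (@smv_sup R n (nat * (E -> C))%type (fun kq => admissible v kq.1 kq.2)
  (fun kq z => powR (cabs (kq.2 z)) (rho kq.1)^-1)).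
- move=> [k q] /= hk; apply: hpoly_powR_smv; last exact: admissible_hpoly hk.
  by rewrite invr_gt0; exact: admissible_rho hk.
- by move=> [k q] hk z; exact: env_ge.
- by move=> z e e0; have [k [q [hk h]]] := env_approx z e0; exists (k, q).
Qed.

Lemma env_PhiX z t : env v (PhiX lam z t) = expR (- complex.Re t) * env v z.
Proof.
have le z' t' : expR (- complex.Re t') * env v z' <= env v (PhiX lam z' t').
  apply/ler_addgt0Pr => e e0.
  have e1 : 0 < e / expR (- complex.Re t') by rewrite divr_gt0 ?expR_gt0.
  have [k [q [hk h]]] := env_approx z' e1.
  have := env_ge (PhiX lam z' t') hk.
  rewrite (admissible_PhiX z' t' hk) powR_cexpm ?(admissible_rho hk)// => h2.
  have := ler_wpM2l (expR_ge0 (- complex.Re t')) (ltW h).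
  rewrite mulrBr [_ * (e / _)]mulrC divfK ?gt_eqF ?expR_gt0//; lra.
apply/eqP; rewrite eq_le le andbT.
have := le (PhiX lam z t) (- t).
have -> : PhiX lam (PhiX lam z t) (- t) = z.
  apply/funext => i; rewrite /PhiX -mulrA !cexpmE -cexpD mulrN opprK addrC subrr.
  by rewrite cexp0 mulr1.
rewrite cReN opprK expRN => h.
by rewrite mulrC ler_pdivlMr ?expR_gt0// mulrC.
Qed.

(** The competitors for [v] and for [env v] coincide: each competitor for [v] is bounded by the
    envelope, and the envelope is bounded by [v]. *)
Lemma env_idem z : env v z = env (env v) z.
Proof.
congr sup; apply/seteqP; split=> [x [k [q [h1 h2 ->]]]|x [k [q [h1 h2 ->]]]]; exists k, q; split=> // w.
  by apply: env_ge; split.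
by apply: le_trans (h2 w) (env_le w).
Qed.

Hypothesis v_PhiX : forall z t, v (PhiX lam z t) = expR (- complex.Re t) * v z.

Lemma component_bound (r : R) s d z :
  (forall x, v x <= r -> cabs (peval s x) <= 1) ->
  forall t : R, expR (- t) * v z <= r ->
  cabs (peval (comp lam s d) z) <= expR (d * t).
Proof.
move=> bd t tr.
have h : cabs (peval (comp lam s d) (PhiX lam z t%:C%C)) <= 1.
  by apply: comp_bound => th; apply: bd; rewrite !v_PhiX /= oppr0 expR0 mul1r.
by move: h; rewrite comp_PhiX cabsM cabs_cexpm /= expRN mulrC ler_pdivrMr ?expR_gt0// mul1r.
Qed.

Lemma env_lower (w : E -> R) (r delta s rad : R) z0 :
  smv w -> (forall x, 0 <= w x) ->
  (forall r', exists M, forall x, cnorm x <= r' -> w x <= M) ->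
  0 < r -> (forall x, v x <= r -> cnorm x <= rad) -> 0 < delta -> s < w z0 ->
  (forall x k, v k <= r -> cnorm (x - k) < delta -> w x <= s) ->
  r <= env v z0.
Proof.
move=> sw w0 wb r0 Kr d0 sz near.
have K0 : v 0 <= r by rewrite v0 ltW.
have s0 : 0 <= s by apply: le_trans (w0 0) (near 0 0 K0 _); rewrite subrr cnorm0.
have [p [c [hp pK pz]]] := separation (K := fun k => v k <= r) sw w0 wb Kr d0 s0 sz near.
rewrite leNgt; apply/negP => elt.
have cp0 : 0 <= c by apply: le_trans (cabs_ge0 (p 0)) (pK 0 K0).
pose c' := (c + cabs (p z0)) / 2; have c'0 : 0 < c' by rewrite /c'; lra.
have cc' : c <= c' by rewrite /c'; lra.
have c'z : c' < cabs (p z0) by rewrite /c'; lra.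
clearbody c'; pose P x := c'^-1%:C%C * p x.
have hP : hpoly P by exact: hpolyZ.
have cP x : cabs (P x) = cabs (p x) / c'.
  by rewrite cabsM cabs_real ger0_norm ?invr_ge0 ?(ltW c'0)// mulrC.
have PK x : v x <= r -> cabs (P x) <= 1.
  by move=> xr; rewrite cP ler_pdivrMr// mul1r; apply: le_trans (pK x xr) cc'.
have Pz : 1 < cabs (P z0) by rewrite cP ltr_pdivlMr// mul1r.
have vz : 0 < v z0.
  rewrite lt_def v_ge0 andbT; apply/negP => /eqP h; have := PK z0.
  by rewrite h (ltW r0) leNgt Pz => /(_ isT).
(* An upper bound below 1 for [env v z0 / r], kept positive by the comparison with 1/2. *)
pose a := Num.max (env v z0 / r) 2^-1.
have a01 : 0 < a < 1.
  rewrite lt_max invr_gt0 ltr0n orbT /= gt_max ltr_pdivrMr// mul1r elt /=.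
  by rewrite invf_lt1// ltr1n.
have a0 : 0 < a by case/andP: a01.
have ea : env v z0 <= a * r by rewrite -ler_pdivrMr// le_max lexx.
clearbody a; have [B BP] := sum_weights a01.
(* Each component of weight [d] of the [N]-th power is at most [powR a d] at [z0]. Their sum is
   bounded by [B] independently of [N], which is impossible since [cabs (P z0)] exceeds 1. *)
have main N : cabs (P z0) ^+ N <= B.
  have [s1 sE] := hpoly_expansion (hpolyX N hP).
  have bd x : v x <= r -> cabs (peval s1 x) <= 1.
    by move=> xr; rewrite -sE cabsX exprn_ile1 ?cabs_ge0// PK.
  have cb d z (t : R) : expR (- t) * v z <= r ->
      cabs (peval (comp lam s1 d) z) <= expR (d * t) by exact: component_bound.
  have pos d x : 0 < v x -> cabs (peval (comp lam s1 d) x) <= powR (v x / r) d.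
    move=> vx; have vr : 0 < v x / r by rewrite divr_gt0.
    rewrite /powR gt_eqF//; apply: cb; rewrite expRN lnK ?posrE// invf_div divfK ?gt_eqF//.
  rewrite -cabsX sE (sum_comp lam); apply: le_trans (cabs_sum _ _ _) _.
  apply: le_trans (BP s1); rewrite big_seq [leRHS]big_seq; apply: ler_sum => d dW.
  have [x xs dE] : exists2 x, x \in s1 & d = wt lam x.2.
    by move: dW; rewrite mem_undup => /mapP.
  have [k kE] := rho_wt x.2; rewrite -dE in kE.
  (* The constant component is not admissible; the bound 1 for it is immediate. *)
  have [d00|d00] := eqVneq d 0.
    by have := pos d z0 vz; rewrite d00 !powRr0.
  have dp : 0 < d by rewrite lt_def d00 dE wt_ge0.
  (* By homogeneity the bound 1 on the sublevel set spreads to [powR (v x / r) d], so the factor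
     [powR r d] makes the component admissible. *)
  pose q x := (powR r d)%:C%C * peval (comp lam s1 d) x.
  have cq x' : cabs (q x') = powR r d * cabs (peval (comp lam s1 d) x').
    by rewrite cabsM cabs_real ger0_norm ?powR_ge0.
  have adm : admissible v k q.
    rewrite /admissible kE; split.
      split.
        exists [seq ((powR r d)%:C%C * y.1, y.2, fun=> 0%N) | y <- comp lam s1 d] => z.
        rewrite /q /peval mulr_sumr big_map; apply: eq_bigr => y _ /=.
        rewrite mulrA; congr (_ * _); apply: eq_bigr => i _.
        by rewrite expr0 mulr1.
      by move=> t z _; rewrite /q comp_PhiX cexpm0 mulr1 mulrCA.
    move=> y; have [vy|vy] := eqVneq (v y) 0; last first.
      have vp : 0 < v y by rewrite lt_def vy v_ge0.
      apply: (@le_trans _ _ (powR (powR (v y) d) d^-1)); last first.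
        by rewrite -powRrM mulfV// powRr1// ltW.
      apply: ge0_ler_powR; rewrite ?nnegrE ?invr_ge0 ?(ltW dp) ?cabs_ge0 ?powR_ge0//.
      rewrite cq; apply: (@le_trans _ _ (powR r d * powR (v y / r) d)).
        by rewrite ler_wpM2l ?powR_ge0// pos.
      by rewrite -powRM ?(ltW r0) ?divr_ge0 ?(ltW r0) ?(ltW vp)// mulrC divfK ?gt_eqF.
    suff h : cabs (peval (comp lam s1 d) y) = 0.
      by rewrite cq h mulr0 powR0 ?vy// invr_eq0.
    (* Where [v] vanishes, [cb] holds for every real time; letting it tend to minus infinity kills
       the component. *)
    apply/eqP; rewrite eq_le cabs_ge0 andbT; apply/ler_addgt0Pr => e e0; rewrite add0r.
    have [K KP] := half_pow_small e0; have := cb d y (- (K%:R / d)).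
    rewrite vy mulr0 mulrN mulrCA mulfV// mulr1 => /(_ (ltW r0)) h.
    by apply: le_trans h _; apply: le_trans (KP K (leqnn _)); exact: expRN_le_half.
  have := env_ge z0 adm; rewrite kE cq => h.
  have h2 := le_trans h ea.
  have h3 : powR r d * cabs (peval (comp lam s1 d) z0) <= powR (a * r) d.
    have X0 : 0 <= powR r d * cabs (peval (comp lam s1 d) z0) by rewrite mulr_ge0 ?powR_ge0 ?cabs_ge0.
    have := ge0_ler_powR (ltW dp) _ _ h2; rewrite !nnegrE powR_ge0 mulr_ge0 ?(ltW a0) ?(ltW r0)//.
    by rewrite -powRrM mulVf// powRr1// => /(_ isT isT).
  move: h3; rewrite powRM ?(ltW a0) ?(ltW r0)// [powR a d * _]mulrC ler_pM2l// powR_gt0//.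
have i01 : 0 <= (cabs (P z0))^-1 < 1.
  by rewrite invr_ge0 cabs_ge0 /= invf_lt1// (lt_trans _ Pz).
have B1 : 1 <= B by have := main 0%N; rewrite expr0.
have B2 : 0 < (2 * B)^-1 by rewrite invr_gt0; lra.
have [N NP] := eventually_expr_le i01 B2; have := NP N (leqnn _); have := main N.
have Pp : 0 < cabs (P z0) ^+ N by rewrite exprn_gt0 ?(lt_trans _ Pz).
rewrite exprVn => h1; rewrite lef_pV2 ?posrE//; last lra.
lra.
Qed.

End PolynomialEnvelope.

(** * Homogeneous sup-convolution of [u] *)

Section Regularization.
Variables (R : realType) (n : nat) (lam : 'I_n -> R).
Hypothesis lam_gt0 : forall i, 0 < lam i.
Local Notation C := R[i].
Local Notation E := ('I_n -> C).
Implicit Types (z y : E) (t : C).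

Definition gauge z : R := \sum_i powR (cabs (z i)) (lam i)^-1.

Lemma gauge_ge0 z : 0 <= gauge z.
Proof. by apply: sumr_ge0 => i _; exact: powR_ge0. Qed.

Lemma gauge0 : gauge 0 = 0.
Proof.
rewrite /gauge big1// => i _; rewrite -[(0 : E) i]/(0 : C) cabs0 powR0//.
by rewrite invr_eq0 gt_eqF.
Qed.

Lemma gauge_PhiX z t : gauge (PhiX lam z t) = expR (- complex.Re t) * gauge z.
Proof.
rewrite /gauge mulr_sumr; apply: eq_bigr => i _.
by rewrite /PhiX mulrC powR_cexpm.
Qed.

Lemma cont_gauge : cont gauge.
Proof.
apply: cont_sum => i; apply: cont_powR.
- by rewrite invr_gt0.
- by move=> z; exact: cabs_ge0.
- by apply: cont_cabs; exact: ccont_coord.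
Qed.

Lemma coord_le_gauge z (r : R) i : gauge z <= r -> cabs (z i) <= powR r (lam i).
Proof.
move=> zr; have h : powR (cabs (z i)) (lam i)^-1 <= r.
  apply: le_trans zr; rewrite /gauge (bigD1 i)//= lerDl sumr_ge0// => j _.
  exact: powR_ge0.
have r0 : 0 <= r := le_trans (powR_ge0 _ _) h.
have := ge0_ler_powR (ltW (lam_gt0 i)) _ _ h; rewrite !nnegrE powR_ge0 r0.
by rewrite -powRrM mulVf ?gt_eqF// powRr1 ?cabs_ge0// => /(_ isT isT).
Qed.

Lemma gauge_bounded (r : R) : exists rad : R, forall z, gauge z <= r -> cnorm z <= rad.
Proof.
exists (\sum_i powR r (lam i)) => z zr; apply: ler_sum => i _.
exact: coord_le_gauge.
Qed.

Lemma gauge_small (d : R) : 0 < d -> exists2 c, 0 < c & forall z, gauge z <= c -> cnorm z < d.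
Proof.
move=> d0; have D0 : 0 < d / n.+1%:R by rewrite divr_gt0.
have [c c0 cP] := @lam_lower R n (fun i => powR (d / n.+1%:R) (lam i)^-1) (fun i => powR_gt0 _ D0).
exists c => // z zc; apply: (@le_lt_trans _ _ (n%:R * (d / n.+1%:R))).
  apply: cnorm_le_const => i; apply: le_trans (coord_le_gauge i zc) _.
  apply: (@le_trans _ _ (powR (powR (d / n.+1%:R) (lam i)^-1) (lam i))).
    by apply: ge0_ler_powR; rewrite ?nnegrE ?powR_ge0 ?(ltW (lam_gt0 i)) ?(ltW c0).
  by rewrite -powRrM mulVf ?gt_eqF// powRr1// ltW.
by rewrite mulrCA -[ltRHS]mulr1 ltr_pM2l// ltr_pdivrMr// mul1r ltr_nat.
Qed.

Lemma gauge_eq0 z : gauge z = 0 -> z = 0.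
Proof.
move=> z0; apply/funext => i; apply/eqP; rewrite -[_ i]/(z i) -cabs_eq0 eq_le cabs_ge0 andbT.
have := @coord_le_gauge z 0 i; rewrite z0 powR0 ?gt_eqF//; exact.
Qed.

(** The exponents may exceed 1, so the triangle inequality holds only up to a constant: the modulus
    of a sum is at most twice the larger modulus. *)
Lemma gauge_quasi_add : exists2 Q : R, 0 <= Q & forall z y, gauge (z + y) <= Q * (gauge z + gauge y).
Proof.
pose two i : R := powR 2 (lam i)^-1.
have t0 i : 0 <= two i by exact: powR_ge0.
exists (\sum_i two i) => [|z y]; first by apply: sumr_ge0.
rewrite /gauge -big_split mulr_sumr; apply: ler_sum => i _ /=.
rewrite -[(z + y) i]/(z i + y i).
set a := cabs (z i); set b := cabs (y i).
have [a0 b0] : 0 <= a /\ 0 <= b by split; exact: cabs_ge0.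
apply: (@le_trans _ _ (two i * (powR a (lam i)^-1 + powR b (lam i)^-1))); last first.
  rewrite ler_wpM2r ?addr_ge0 ?powR_ge0// (bigD1 i)//= lerDl.
  by apply: sumr_ge0.
have mono (m : R) : 0 <= m -> cabs (z i + y i) <= 2 * m ->
    powR (cabs (z i + y i)) (lam i)^-1 <= two i * powR m (lam i)^-1.
  move=> m0 h; rewrite /two -powRM//.
  by apply: ge0_ler_powR; rewrite ?nnegrE ?cabs_ge0 ?invr_ge0 ?mulr_ge0 ?(ltW (lam_gt0 i)).
have tri : cabs (z i + y i) <= a + b := cabsD _ _.
have [ab|ba] := leP a b.
  apply: le_trans (mono b b0 _) _; first lra.
  by rewrite ler_wpM2l// lerDr powR_ge0.
apply: le_trans (mono a a0 _) _; first lra.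
by rewrite ler_wpM2l// lerDl powR_ge0.
Qed.

Variable u : E -> R.
Hypothesis u_usc : usc u.
Hypothesis u_ge0 : forall x, 0 <= u x.
Hypothesis u_PhiX : forall z t, u (PhiX lam z t) = expR (- complex.Re t) * u z.

Lemma homogeneous0 (f : E -> R) :
  (forall z t, f (PhiX lam z t) = expR (- complex.Re t) * f z) -> f 0 = 0.
Proof.
move=> fh; have := fh 0 1; have -> : PhiX lam (0 : E) 1 = 0.
  by apply/funext => i; rewrite /PhiX mul0r.
rewrite /= => h; apply/eqP; have : (1 - expR (- 1)) * f 0 = 0 by rewrite mulrBl mul1r -h subrr.
move/eqP; rewrite mulf_eq0 subr_eq0 => /orP[|//].
by rewrite eq_sym lt_eqF// expR_lt1 oppr_lt0.
Qed.

(** Upper semicontinuity bounds [u] on the bounded set where the gauge is at most 1; the time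
    [ln (gauge z)] brings any [z] with positive gauge to gauge 1. *)
Lemma u_le_gauge : exists2 A : R, 0 <= A & forall z, u z <= A * gauge z.
Proof.
have [rad radP] := gauge_bounded 1; have [A A0 AP] := usc_bounded rad u_usc.
exists A => // z; have [z0|z0] := eqVneq (gauge z) 0.
  by rewrite z0 mulr0 (gauge_eq0 z0) (homogeneous0 u_PhiX).
have zp : 0 < gauge z by rewrite lt_def z0 gauge_ge0.
pose t : C := (ln (gauge z))%:C%C.
have et : expR (- complex.Re t) = (gauge z)^-1 by rewrite expRN lnK.
have := AP (PhiX lam z t); rewrite u_PhiX et => h.
rewrite -ler_pdivrMr// mulrC; apply: h; apply: radP.
by rewrite gauge_PhiX et mulVf.
Qed.

Section Level.
Variables (A Q m : R).
Hypothesis A_ge0 : 0 <= A.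
Hypothesis uA : forall z, u z <= A * gauge z.
Hypothesis Q_ge0 : 0 <= Q.
Hypothesis gQ : forall z y, gauge (z + y) <= Q * (gauge z + gauge y).
Hypothesis m_large : A * Q + 1 <= m.

Let m0 : 0 < m. Proof. by apply: lt_le_trans m_large; rewrite ltr_wpDl ?mulr_ge0. Qed.

Let vals z : set R := [set u x - m * gauge (x - z) | x in setT].

Definition reg z : R := sup (vals z).

(** Because [m] is at least [A * Q + 1], the penalty beats the growth of [u] with one copy of the
    gauge to spare. The supremum is therefore finite and near-maximisers stay in a bounded set. *)
Lemma penalized_le z y : u y - m * gauge (y - z) <= A * Q * gauge z - gauge (y - z).
Proof.
have h1 := uA y; have := gQ (y - z) z; rewrite subrK => h2.
have h3 := ler_wpM2l A_ge0 h2; have := ler_wpM2r (gauge_ge0 (y - z)) m_large.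
rewrite mulrDl mul1r; lra.
Qed.

Let vals_ub z : ubound (vals z) (A * Q * gauge z).
Proof.
move=> _ [y _ <-]; apply: le_trans (penalized_le z y) _.
by rewrite gerBl gauge_ge0.
Qed.

Let vals_neq0 z : vals z !=set0. Proof. by exists (u z - m * gauge (z - z)), z. Qed.

Lemma reg_ge z y : u y - m * gauge (y - z) <= reg z.
Proof.
by apply: ub_le_sup; [exists (A * Q * gauge z); exact: vals_ub|exists y].
Qed.

Lemma reg_ge_self z : u z <= reg z.
Proof. by have := reg_ge z z; rewrite subrr gauge0 mulr0 subr0. Qed.

Lemma reg_le z (s : R) : (forall y, u y - m * gauge (y - z) <= s) -> reg z <= s.
Proof. by move=> h; apply: ge_sup => // _ [y _ <-]. Qed.

Lemma reg_approx z (e : R) : 0 < e -> exists2 y, reg z - e < u y - m * gauge (y - z) &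
  gauge (y - z) <= A * Q * gauge z + e.
Proof.
move=> e0; have hs : has_sup (vals z) by split => //; exists (A * Q * gauge z); exact: vals_ub.
have [_ [y _ <-]] := sup_adherent e0 hs; rewrite -/(reg z) => h; exists y => //.
have := penalized_le z y; have := reg_ge_self z; have := u_ge0 z; lra.
Qed.

Lemma reg_PhiX z t : reg (PhiX lam z t) = expR (- complex.Re t) * reg z.
Proof.
have K z' t' : PhiX lam (PhiX lam z' t') (- t') = z'.
  apply/funext => i; rewrite /PhiX -mulrA !cexpmE -cexpD mulrN opprK addrC subrr.
  by rewrite cexp0 mulr1.
have PB y' z' t' : PhiX lam y' t' - PhiX lam z' t' = PhiX lam (y' - z') t'.
  by apply/funext => i; rewrite -[LHS]/(PhiX lam y' t' i - PhiX lam z' t' i) /PhiX -mulrBl.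
have le z' t' : reg (PhiX lam z' t') <= expR (- complex.Re t') * reg z'.
  apply: reg_le => y; have -> : y = PhiX lam (PhiX lam y (- t')) t'.
    by have := K y (- t'); rewrite opprK.
  rewrite PB gauge_PhiX u_PhiX mulrCA -mulrBr ler_wpM2l ?expR_ge0//.
  exact: reg_ge.
apply/eqP; rewrite eq_le le /=; have := le (PhiX lam z t) (- t).
rewrite K cReN opprK => h.
by rewrite expRN ler_pdivrMl ?expR_gt0.
Qed.

(** Near-maximisers [y] keep [y - z1] in one fixed ball, where the gauge is uniformly continuous;
    the same [y] is then tested at the neighbouring point. *)
Lemma cont_reg : cont reg.
Proof.
move=> z e e0; have [G G0 GP] := cont_bounded (cnorm z + 1) cont_gauge.
have [rad radP] := gauge_bounded (A * Q * G + 1).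
have em : 0 < e / 3 / m by rewrite !divr_gt0.
have [d d0 dP] := cont_unif rad cont_gauge em.
exists (Num.min 1 d); split; first by rewrite lt_min ltr01.
pose e1 := Num.min 1 (e / 3); have e10 : 0 < e1 by rewrite lt_min ltr01 divr_gt0.
have e11 : e1 <= 1 by rewrite ge_min lexx.
have e13 : e1 <= e / 3 by rewrite ge_min lexx orbT.
clearbody e1.
have one z1 z2 : cnorm z1 <= cnorm z + 1 -> cnorm (z1 - z2) < d -> reg z1 - reg z2 < e.
  move=> z1r z12; have [y h1 h2] := reg_approx z1 e10.
  have yr : cnorm (y - z1) <= rad.
    apply: radP; apply: le_trans h2 _; apply: lerD => //.
    rewrite ler_wpM2l ?mulr_ge0//; apply: le_trans (ler_norm _) (GP _ z1r).
  have yd : cnorm ((y - z2) - (y - z1)) < d by rewrite opprB addrC -addrA [_ + (y - z2)]addrA addNr add0r.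
  have := dP _ _ yr yd; rewrite ltr_norml => /andP[_ h3].
  have h4 := reg_ge z2 y.
  have : m * (gauge (y - z2) - gauge (y - z1)) < e / 3.
    by rewrite mulrC -ltr_pdivlMr.
  lra.
move=> w; rewrite -[fun _ => _]/(w - z) lt_min => /andP[w1 wd].
rewrite ltr_norml; apply/andP; split.
  rewrite ltrNl opprB; apply: one; first by rewrite lerDl.
  by rewrite cnormB.
apply: one => //; have := cnormD (w - z) z; rewrite subrK; lra.
Qed.

Definition majorant z : R := reg z + gauge z / m.

Lemma majorant_ge0 z : 0 <= majorant z.
Proof.
rewrite addr_ge0 ?divr_ge0 ?gauge_ge0 ?(ltW m0)//.
exact: le_trans (u_ge0 z) (reg_ge_self z).
Qed.

Lemma majorant_ge z : u z <= majorant z.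
Proof.
apply: le_trans (reg_ge_self z) _.
by rewrite lerDl divr_ge0 ?gauge_ge0 ?(ltW m0).
Qed.

Lemma majorant_PhiX z t : majorant (PhiX lam z t) = expR (- complex.Re t) * majorant z.
Proof. by rewrite /majorant reg_PhiX gauge_PhiX mulrDr mulrA. Qed.

Lemma cont_majorant : cont majorant.
Proof.
apply: contD; first exact: cont_reg.
under [X in cont X]eq_fun do rewrite mulrC.
by apply: contZ; exact: cont_gauge.
Qed.

Lemma majorant_bounded (r : R) : exists rad : R, forall z, majorant z <= r -> cnorm z <= rad.
Proof.
have [rad radP] := gauge_bounded (r * m); exists rad => z zr; apply: radP.
rewrite -ler_pdivrMr//; apply: le_trans zr; rewrite lerDr.
exact: le_trans (u_ge0 z) (reg_ge_self z).
Qed.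

End Level.

(** Points [y] with [gauge (y - z)] at most [c] are controlled by upper semicontinuity at [z]. For
    the others the penalty outgrows [A * Q * (gauge z + gauge (y - z))], which dominates [u y]. *)
Lemma majorant_cvg (A Q e : R) z : 0 <= A -> (forall z, u z <= A * gauge z) -> 0 <= Q ->
  (forall z y, gauge (z + y) <= Q * (gauge z + gauge y)) -> 0 < e ->
  exists m1 : R, forall m, m1 <= m -> majorant m z <= u z + e.
Proof.
move=> A0 uA Q0 gQ e0; have e2 : 0 < e / 2 by rewrite divr_gt0.
have [d [d0 dP]] := u_usc z e2; have [c c0 cP] := gauge_small d0.
have g0 := gauge_ge0 z.
pose b := A * Q * gauge z; have b0 : 0 <= b by rewrite !mulr_ge0.
exists (A * Q + 1 + b / c + gauge z / (e / 2)) => m mm.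
have AQ : 0 <= A * Q by rewrite mulr_ge0.
have bc : 0 <= b / c by rewrite divr_ge0 ?(ltW c0).
have ge : 0 <= gauge z / (e / 2) by rewrite divr_ge0 ?(ltW e2).
have m1 : A * Q + 1 <= m by lra.
have m0 : 0 < m by lra.
have h1 : gauge z / m <= e / 2.
  by rewrite ler_pdivrMr// mulrC -ler_pdivrMr//; lra.
suff h2 : reg m z <= u z + e / 2 by rewrite /majorant; lra.
apply: reg_le => y; have [yc|yc] := leP (gauge (y - z)) c.
  have := dP y (cP _ yc); have := mulr_ge0 (ltW m0) (gauge_ge0 (y - z)); lra.
have h3 := uA y; have := gQ (y - z) z; rewrite subrK => h4.
have h5 := ler_wpM2l A0 h4.
have h6 : b <= (m - A * Q) * gauge (y - z).
  apply: (@le_trans _ _ (b / c * gauge (y - z))).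
    by rewrite -mulrA ler_peMr// mulrC ler_pdivlMr// mul1r ltW.
  by rewrite ler_wpM2r ?gauge_ge0//; lra.
have := u_ge0 z; rewrite /b in h6; lra.
Qed.

End Regularization.

(** * Comparison and continuity of the envelope *)

Section ContinuousEnvelope.
Variables (R : realType) (n : nat) (lam : 'I_n -> R) (rho : nat -> R).
Hypothesis n_gt0 : (0 < n)%N.
Hypothesis lam_gt0 : forall i, 0 < lam i.
Hypothesis hrho : rho_enum lam rho.
Local Notation C := R[i].
Local Notation E := ('I_n -> C).
Variables (v : E -> R).
Hypothesis v_ge0 : forall x, 0 <= v x.
Hypothesis v_PhiX : forall z t, v (PhiX lam z t) = expR (- complex.Re t) * v z.
Hypothesis v_cont : cont v.
Hypothesis v_bounded : forall r : R, exists rad : R, forall z, v z <= r -> cnorm z <= rad.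

Let v0 : v 0 = 0 := homogeneous0 v_PhiX.

Lemma sublevel_margin (r e : R) : 0 < e -> exists2 d, 0 < d & forall x k, v k <= r ->
  cnorm (x - k) < d -> v x <= r + e.
Proof.
move=> e0; have [rad radP] := v_bounded r; have [d d0 dP] := cont_unif rad v_cont e0.
exists d => // x k kr xk; have := dP k x (radP k kr) xk; rewrite ltr_norml => /andP[_ h]; lra.
Qed.

(** If [u z] exceeded the envelope, a level [r] between the two would contradict [env_lower]: near
    the sublevel set of [r], [u] is bounded by [v], hence by a number below [u z]. *)
Lemma env_ge_smv (u : E -> R) z : smv u -> usc u -> (forall x, 0 <= u x) ->
  (forall x, u x <= v x) -> u z <= env lam rho v z.
Proof.
move=> su cu u0 uv; rewrite leNgt; apply/negP => lt.
pose r := (env lam rho v z + u z) / 2.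
have e0 := env_ge0 n_gt0 lam_gt0 hrho v_ge0 z.
have r0 : 0 < r by rewrite /r; lra.
have er : env lam rho v z < r by rewrite /r; lra.
have ru : r < u z by rewrite /r; lra.
clearbody r; have ee : 0 < (u z - r) / 2 by lra.
have [d d0 dP] := sublevel_margin r ee; have [rad radP] := v_bounded r.
have ub r' : exists M, forall x, cnorm x <= r' -> u x <= M.
  by have [M _ MP] := usc_bounded r' cu; exists M.
have sz : r + (u z - r) / 2 < u z by lra.
have := env_lower lam_gt0 hrho v_ge0 v0 v_PhiX su u0 ub r0 radP d0 sz.
move=> h; have : r <= env lam rho v z.
  by apply: h => x k kr xk; apply: le_trans (uv x) (dP x k kr xk).
lra.
Qed.

(** From below, a single competitor that is nearly optimal at [z] suffices. From above, [env_lower]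
    is applied to the translate of the envelope by [h]: a large value at [z + h] would force the
    value at [z] up to [r], which lies above it. *)
Lemma cont_env : cont (env lam rho v).
Proof.
set W := env lam rho v; move=> z e e0; have e4 : 0 < e / 4 by rewrite divr_gt0.
have W0 x : 0 <= W x := env_ge0 n_gt0 lam_gt0 hrho v_ge0 x.
have Wv x : W x <= v x := env_le n_gt0 lam_gt0 hrho v_ge0 x.
pose r := W z + e / 2; have r0 : 0 < r by have := W0 z; rewrite /r; lra.
have [d d0 dP] := sublevel_margin r e4; have [rad radP] := v_bounded r.
have d2 : 0 < d / 2 by rewrite divr_gt0.
have up h : cnorm h < d / 2 -> W (z + h) <= W z + e / 2 + e / 4.
  move=> hd; rewrite leNgt; apply/negP => lt.
  have sw : smv (fun x => W (x + h)).
    have sW : smv W by move=> a b G; exact: (env_smv n_gt0 lam_gt0 hrho v_ge0 v0).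
    exact: (@smv_translate R n W h sW).
  have wb r' : exists M, forall x, cnorm x <= r' -> W (x + h) <= M.
    have [M _ MP] := cont_bounded (r' + cnorm h) v_cont; exists M => x xr.
    apply: le_trans (Wv _) _; apply: le_trans (ler_norm _) (MP _ _).
    by apply: le_trans (cnormD _ _) _; rewrite lerD2r.
  have := env_lower lam_gt0 hrho v_ge0 v0 v_PhiX sw (fun x => W0 (x + h)) wb r0 radP d2 lt.
  move=> hh; have : r <= W z.
    apply: hh => x k kr xk; apply: le_trans (Wv _) _; rewrite -/r.
    apply: (dP _ k kr); rewrite addrAC; apply: le_lt_trans (cnormD _ _) _; lra.
  by rewrite /r; lra.
have e2 : 0 < e / 2 by rewrite divr_gt0.
have [k [q [hk hq]]] := env_approx n_gt0 lam_gt0 hrho v_ge0 z e2.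
have rk := admissible_rho lam_gt0 hrho v0 hk.
have cq : cont (fun x => powR (cabs (q x)) (rho k)^-1).
  apply: cont_powR; [by rewrite invr_gt0|by move=> x; exact: cabs_ge0|].
  by apply: cont_cabs; apply: hpoly_ccont; exact: (admissible_hpoly lam_gt0 hk).
have [d' [d'0 dP']] := cq z _ e2.
exists (Num.min (d / 2) d'); split; first by rewrite lt_min d2.
move=> w; rewrite -[fun _ => _]/(w - z) lt_min => /andP[w1 w2].
have h1 := up (w - z) w1; rewrite addrC subrK in h1.
have h2 := env_ge w hk; have := dP' w w2; rewrite ltr_norml => /andP[h3 _].
rewrite -/W in hq h2; rewrite ltr_norml; apply/andP; split; lra.
Qed.

End ContinuousEnvelope.

Theorem mainTheorem8 (R : realType) (n : nat) (lam : 'I_n -> R)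
  (rho : nat -> R)
  (hn : (0 < n)%N)
  (hlam1 : forall i : 'I_n, nat_of_ord i = 0%N -> lam i = 1)
  (hlam : forall i : 'I_n, 0 < lam i)
  (hrho : rho_enum lam rho)
  (u : ('I_n -> R[i]) -> R) (hu : inH lam u) :
  exists us : nat -> ('I_n -> R[i]) -> R,
    [/\ forall m, inH lam (us m),
        forall m, cont (us m),
        forall z, (fun m => us m z) @ \oo --> u z &
        forall m z, us m z =
          sup [set x : R | exists (k : nat) (q : ('I_n -> R[i]) -> R[i]),
                 [/\ quasi_hom lam q (rho k) 0,
                     forall w, powR (cabs (q w)) (rho k)^-1 <= us m w &
                     x = powR (cabs (q z)) (rho k)^-1]]].
Proof.
case: hu => psu [z1 [z2 z12]] u0 uPhi; have su := psh_smv u0 psu; have [cu _] := psu.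
have [A A0 uA] := u_le_gauge hlam cu uPhi; have [Q Q0 gQ] := gauge_quasi_add hlam.
(* [A * Q + 1] is the least penalty for which the regularisation is known to be finite. *)
pose M (m : nat) : R := A * Q + 1 + m%:R; pose v m := majorant lam u (M m).
have Mm m : A * Q + 1 <= M m by rewrite lerDl.
have v_ge0 m : forall x, 0 <= v m x by move=> x; exact: (majorant_ge0 hlam u0 A0 uA Q0 gQ (Mm m)).
have v_ge m : forall x, u x <= v m x by move=> x; exact: (majorant_ge hlam A0 uA Q0 gQ (Mm m)).
have v_PhiX m : forall z t, v m (PhiX lam z t) = expR (- complex.Re t) * v m z.
  by move=> z t; exact: (majorant_PhiX hlam uPhi A0 uA gQ (Mm m)).
have v_cont m : cont (v m) by exact: (cont_majorant hlam u0 A0 uA Q0 gQ (Mm m)).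
have v_bd m : forall r : R, exists rad : R, forall z, v m z <= r -> cnorm z <= rad.
  exact: (majorant_bounded hlam u0 A0 uA Q0 gQ (Mm m)).
have v0 m : v m 0 = 0 by exact: homogeneous0 (v_PhiX m).
have le_env m z : u z <= env lam rho (v m) z by exact: env_ge_smv.
have env_cont m : cont (env lam rho (v m)) by exact: cont_env.
exists (fun m => env lam rho (v m)); split=> [m||z|m z].
- split.
  + by apply: cont_smv_psh => //; exact: env_smv.
  (* The envelope vanishes at the origin with [v m], and it is positive wherever [u] is; a
     nonconstant [u] is positive somewhere. *)
  + have [z3 z30] : exists z, 0 < u z.
      apply: contrapT => no; apply: z12.
      have uz z : u z = 0.
        apply/eqP; rewrite eq_le u0 andbT leNgt; apply/negP => uz.
        by apply: no; exists z.
      by rewrite !uz.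
    exists z3, 0 => e; have := le_env m z3; rewrite e.
    have := env_le hn hlam hrho (v_ge0 m) 0; rewrite v0; lra.
  + exact: env_ge0.
  + by move=> z t; exact: env_PhiX.
- by move=> m; exact: env_cont.
- apply/cvgrPdist_le => e e0; have [m1 m1P] := majorant_cvg hlam cu u0 z A0 uA Q0 gQ e0.
  exists (Num.truncn m1).+1 => // m /= mm.
  have m1m : m1 <= M m.
    have AQ : 0 <= A * Q by rewrite mulr_ge0.
    have : m1 < m%:R by apply: lt_le_trans (truncnS_gt _) _; rewrite ler_nat.
    by rewrite /M; lra.
  have := env_le hn hlam hrho (v_ge0 m) z; have := le_env m z.
  have := m1P _ m1m; rewrite -/(v m) => h1 h2 h3.
  by rewrite ler_norml; apply/andP; split; lra.
- exact: env_idem.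
Qed.
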